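(* Let $\mathbb{H}^n$ be the Heisenberg group with homogeneous dimension $Q=2n+2$. For every $p\ge1$ there exists a constant $C$ such that for every $u\in W^{1,Q,p}(\mathbb{H}^n)$ with $\|\nabla_{\mathbb{H}^n}u\|_Q\le1$ we have $$\int_{\mathbb{H}^n}\frac{\exp_{\lceil p\frac{Q-1}Q-1\rceil}\Big[\frac1A|u|^{\frac Q{Q-1}}\Big]}{1+|u|^{\frac p{Q-1}}}\,dx\le C\|u\|_p^p,$$ where $$A=\frac1Q\Big(\int_\Sigma|z^*|^Qdx^*\Big)^{-\frac1{Q-1}}=\frac1Q\left(\frac{\Gamma(\frac Q2)\Gamma(n)}{2\pi^{n+1/2}\Gamma(\frac{Q-1}2)}\right)^{\frac1{Q-1}},$$ and the exponential constant $A^{-1}$ is sharp, i.e. it cannot be replaced by any larger number.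
   Context: $\mathbb{H}^n=\mathbb{C}^n\times\mathbb{R}$ with elements $x=(z,t)$, $z=(x_j+iy_j)_{j=1}^n$, group law $(z,t)(z',t')=(z+z',\,t+t'+2\,\mathrm{Im}\,z\cdot\overline{z'})$, Haar measure $dx=dz\,dt$, dilations $(z,t)\mapsto(\lambda z,\lambda^2t)$, and homogeneous norm $|(z,t)|=(|z|^4+t^2)^{1/4}$. $X_j=\partial_{x_j}+2y_j\partial_t$, $Y_j=\partial_{y_j}-2x_j\partial_t$ ($j=1,\dots,n$), and $\nabla_{\mathbb{H}^n}=(X_1,Y_1,\dots,X_n,Y_n)$ is the horizontal gradient; $|\nabla_{\mathbb{H}^n}u|$ is its Euclidean norm in $\mathbb{R}^{2n}$ and $\|\nabla_{\mathbb{H}^n}u\|_Q$ the $L^Q$ norm of $|\nabla_{\mathbb{H}^n}u|$. $\Sigma=\{|x|=1\}$ is the unit sphere, with points $x^*=(z^*,t^* )$, and $dx^*$ is the measure on $\Sigma$ with $\int_{\mathbb{H}^n}h\,dx=\int_0^\infty\int_\Sigma h(rx^* )\,r^{Q-1}dx^*dr$, where $rx^*$ is the dilate of $x^*$. $W^{1,q,p}(\mathbb{H}^n)=\{u\in L^p(\mathbb{H}^n):|\nabla_{\mathbb{H}^n}u|\in L^q(\mathbb{H}^n)\}$. $\exp_N(t)=e^t-\sum_{j=0}^N\frac{t^j}{j!}$ for an integer $N\ge0$. *)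

(* Defs.v *)
From HB Require Import structures.
From mathcomp Require Import all_boot all_order all_algebra.
From mathcomp Require Import all_classical all_reals all_analysis.
From mathcomp Require Import measurable_realfun.
Set Implicit Arguments.
Unset Strict Implicit.
Unset Printing Implicit Defensive.
Import Order.TTheory GRing.Theory Num.Theory.
Import numFieldNormedType.Exports.
Local Open Scope classical_set_scope.
Local Open Scope ring_scope.

(* The sigma-algebra generated by the coordinates, as on [n.-tuple T]; for
   T = R it is the Borel sigma-algebra of 'rV[R]_n. *)
Section measurable_row_vector.
Context {d : measure_display} {T : measurableType d}.
Variable n : nat.

Let coors : 'I_n -> 'rV[T]_n -> T := fun i v => v ord0 i.

Let row_set0 : g_sigma_preimage coors set0.
Proof. exact: sigma_algebra0. Qed.

Let row_setC A : g_sigma_preimage coors A -> g_sigma_preimage coors (~` A).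
Proof. exact: sigma_algebraC. Qed.

Let row_bigcup (F : (set 'rV[T]_n)^nat) :
  (forall i, g_sigma_preimage coors (F i)) ->
  g_sigma_preimage coors (\bigcup_i (F i)).
Proof. exact: sigma_algebra_bigcup. Qed.

HB.instance Definition _ := @isMeasurable.Build (measure_tuple_display d)
  'rV[T]_n (g_sigma_preimage coors) row_set0 row_setC row_bigcup.

End measurable_row_vector.


Section product_sigma_finite.
Local Open Scope ereal_scope.
Context d1 d2 (T1 : measurableType d1) (T2 : measurableType d2) (R : realType).
Variable m1 : {sigma_finite_measure set T1 -> \bar R}.
Variable m2 : {sigma_finite_measure set T2 -> \bar R}.

(* For [m1 \x m2] itself the library infers the sigma-finite structure only
   when [m1] and [m2] are subprobabilities. *)
Definition product_sigma_finite : set (T1 * T2) -> \bar R := m1 \x m2.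

HB.instance Definition _ := Measure.copy product_sigma_finite (m1 \x m2).

Let product_sigma_finiteT : sigma_finite setT product_sigma_finite.
Proof.
have /sigma_finiteP[F [TF ndF Foo]] := sigma_finiteT m1.
have /sigma_finiteP[G [TG ndG Goo]] := sigma_finiteT m2.
exists (fun n => F n `*` G n).
  rewrite -setXTT TF TG predeqE => -[x y]; split.
    move=> [/= [n _ Fnx] [k _ Gky]]; exists (maxn n k) => //; split.
    - by move: x Fnx; exact/subsetPset/ndF/leq_maxl.
    - by move: y Gky; exact/subsetPset/ndG/leq_maxr.
  by move=> [n _ []/= ? ?]; split; exists n.
move=> k; have [? ?] := Foo k; have [? ?] := Goo k.
split; first exact: measurableX.
rewrite /product_sigma_finite product_measure1E// lte_mul_pinfty//.
by rewrite ge0_fin_numE.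
Qed.

HB.instance Definition _ := Measure_isSigmaFinite.Build _ _ _
  product_sigma_finite product_sigma_finiteT.

End product_sigma_finite.

Section lebesgue_row_vector.
Context {R : realType}.

(* [lebesgue_measure] lives on [measurableTypeR R], an alias of [R] with the
   same measurable sets but another display; [lebesgue_line] is the same set
   function as a measure on [R]. *)
Definition lebesgue_line : set R -> \bar R := @lebesgue_measure R.

HB.instance Definition _ := isMeasure.Build _ R _ lebesgue_line
  (measure0 (@lebesgue_measure R)) (measure_ge0 (@lebesgue_measure R))
  (@measure_semi_sigma_additive _ _ _ (@lebesgue_measure R)).

HB.instance Definition _ := Measure_isSigmaFinite.Build _ R _ lebesgue_line
  (sigma_finiteT (@lebesgue_measure R)).

Lemma measurable_coord n (i : 'I_n) :
  measurable_fun [set: 'rV[R]_n] (fun v : 'rV[R]_n => v ord0 i).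
Proof.
move=> _ Y mY; rewrite setTI; apply: sub_sigma_algebra => /=.
rewrite -bigcup_seq/=; exists i => /=; first by rewrite mem_index_enum.
by exists Y => //; rewrite setTI.
Qed.

Lemma measurable_fun_row d (T : measurableType d) n (f : T -> 'rV[R]_n) :
  (forall i, measurable_fun [set: T] (fun x => f x ord0 i)) ->
  measurable_fun [set: T] f.
Proof.
move=> mf.
suff sub : g_sigma_preimage (fun i x => f x ord0 i) `<=` measurable.
  move=> _ A mA; apply: sub.
  rewrite (g_sigma_preimage_comp (fun i (v : 'rV[R]_n) => v ord0 i) f).
  by exists A.
apply: smallest_sub; first exact: sigma_algebra_measurable.
case: n => [|n] in f mf *; first by rewrite big_ord0.
rewrite -bigcup_mkord_ord; apply: bigcup_sub => i Ii.
by move=> A [B mB <-]; exact: mf.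
Qed.

Definition row_cons n (v : R * 'rV[R]_n) : 'rV[R]_n.+1 :=
  row_mx (const_mx v.1 : 'rV_1) v.2.

Lemma measurable_row_cons n : measurable_fun setT (@row_cons n).
Proof.
apply: measurable_fun_row => i.
rewrite /row_cons; under eq_fun => x do rewrite mxE.
case: (@fintype.split 1 n i) => j; first by under eq_fun do rewrite mxE; exact: measurable_fst.
exact: measurableT_comp (@measurable_coord n j) measurable_snd.
Qed.

Definition row_uncons n (v : 'rV[R]_n.+1) : R * 'rV[R]_n :=
  (v ord0 ord0, @rsubmx R 1 1 n v).

Lemma measurable_row_uncons n : measurable_fun setT (@row_uncons n).
Proof.
apply: measurable_fun_pair; first exact: (@measurable_coord _ _).
apply: measurable_fun_row => i.
by under eq_fun do rewrite mxE; exact: (@measurable_coord _ _).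
Qed.

Lemma row_consK n : cancel (@row_cons n) (@row_uncons n).
Proof.
case=> a v; rewrite /row_cons /row_uncons/= row_mxKr; congr pair.
rewrite mxE; case: splitP => j; last by case: j => k klt /= eq0.
by rewrite mxE.
Qed.

Section pushforward_row_cons.
Variables (n : nat) (m : {sigma_finite_measure set 'rV[R]_n -> \bar R}).

Definition lebesgue_row_cons : set 'rV[R]_n.+1 -> \bar R :=
  pushforward (product_sigma_finite lebesgue_line m) (@row_cons n).

Let mf := @measurable_row_cons n.

Let lebesgue_row_cons0 : lebesgue_row_cons set0 = 0%E.
Proof. exact: measure0. Qed.

Let lebesgue_row_cons_ge0 A : (0 <= lebesgue_row_cons A)%E.
Proof. exact: measure_ge0. Qed.

Let lebesgue_row_cons_sigma_additive : semi_sigma_additive lebesgue_row_cons.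
Proof. exact: measure_semi_sigma_additive. Qed.

HB.instance Definition _ := isMeasure.Build _ _ _ lebesgue_row_cons
  lebesgue_row_cons0 lebesgue_row_cons_ge0 lebesgue_row_cons_sigma_additive.

Let lebesgue_row_cons_sigma_finite : sigma_finite setT lebesgue_row_cons.
Proof.
have [F TF Foo] := sigma_finiteT (product_sigma_finite lebesgue_line m).
exists (fun k => @row_uncons n @^-1` F k).
  by rewrite -preimage_bigcup -TF preimage_setT.
move=> k; have [mF Fkoo] := Foo k; split.
  by rewrite -[X in measurable X]setTI; exact: measurable_row_uncons.
rewrite /lebesgue_row_cons /pushforward -comp_preimage.
by rewrite (_ : _ \o _ = id) ?preimage_id//; apply/funext => v; exact: row_consK.
Qed.

HB.instance Definition _ := Measure_isSigmaFinite.Build _ _ _ lebesgue_row_cons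
  lebesgue_row_cons_sigma_finite.

End pushforward_row_cons.

(* Lebesgue measure on R^n, as the product of Lebesgue measure in the first
   coordinate and Lebesgue measure on R^(n-1). *)
Fixpoint lebesgue_row n : {sigma_finite_measure set 'rV[R]_n -> \bar R} :=
  match n with
  | 0 => \d_(0 : 'rV[R]_0)
  | k.+1 => lebesgue_row_cons (lebesgue_row k)
  end.

End lebesgue_row_vector.

(* C^n, with z = x + iy stored as the pair (x, y). *)
Notation Cn R n := ('rV[R]_n * 'rV[R]_n)%type.

(* The underlying space C^n x R of the Heisenberg group; ((x, y), t) is the
   point (z, t). The group law enters below only through the left-invariant
   fields X_j and Y_j. *)
Notation heis R n := ('rV[R]_n * 'rV[R]_n * R)%type.

Section heisenberg.
Context {R : realType} {n : nat}.
Implicit Types (p : heis R n) (u phi : heis R n -> R).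

Definition haar : set (heis R n) -> \bar R :=
  product_sigma_finite
    (product_sigma_finite (@lebesgue_row R n) (@lebesgue_row R n))
    (@lebesgue_line R).

HB.instance Definition _ := SigmaFiniteMeasure.on haar.

Definition enorm (z : Cn R n) : R :=
  Num.sqrt (\sum_(j < n) (z.1 ord0 j ^+ 2 + z.2 ord0 j ^+ 2)).

Definition hnorm p : R := (enorm p.1 ^+ 4 + p.2 ^+ 2) `^ (4^-1).

Definition hdil (r : R) p : heis R n := (r *: p.1, r ^+ 2 * p.2).

Definition unit_sphere : set (heis R n) := [set p | hnorm p = 1].

Definition dx (j : 'I_n) : heis R n := ((delta_mx ord0 j, 0), 0).
Definition dy (j : 'I_n) : heis R n := ((0, delta_mx ord0 j), 0).
Definition dt : heis R n := ((0, 0), 1).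

Definition Xfield (j : 'I_n) phi p : R :=
  'D_(dx j) phi p + 2 * p.1.2 ord0 j * 'D_dt phi p.
Definition Yfield (j : 'I_n) phi p : R :=
  'D_(dy j) phi p - 2 * p.1.1 ord0 j * 'D_dt phi p.

(* Class C^k: all iterated directional derivatives of order at most k exist
   and are continuous. *)
Fixpoint Ck (k : nat) phi : Prop :=
  if k is l.+1 then
    continuous phi /\
    forall v, (forall p, derivable phi p v) /\ Ck l ('D_v phi)
  else continuous phi.

Definition test_function phi : Prop :=
  (forall k, Ck k phi) /\ compact (closure [set p | phi p != 0]).

Definition loc_integrable u : Prop :=
  measurable_fun [set: heis R n] u /\
  forall K : set (heis R n), compact K -> haar.-integrable K (EFin \o u).

(* [G] is the distributional horizontal gradient of [u]: the components of
   [(G p).1] are the X_j u and those of [(G p).2] the Y_j u. The formal adjoint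
   of X_j (Y_j) is - X_j (- Y_j) because their coefficients are constant along
   their own directions. *)
Definition weak_hgrad u (G : heis R n -> Cn R n) : Prop :=
  loc_integrable u /\
  forall j : 'I_n,
    [/\ loc_integrable (fun p => (G p).1 ord0 j),
        loc_integrable (fun p => (G p).2 ord0 j),
        forall phi, test_function phi ->
          \int[haar]_p (u p * Xfield j phi p) =
          - \int[haar]_p ((G p).1 ord0 j * phi p) &
        forall phi, test_function phi ->
          \int[haar]_p (u p * Yfield j phi p) =
          - \int[haar]_p ((G p).2 ord0 j * phi p)].

(* The space W^{1,a,b}: u in L^b with horizontal gradient in L^a. *)
Definition sobolev (a b : R) u : Prop :=
  u \in Lfun haar b%:E /\
  exists2 G, weak_hgrad u G & (fun p => enorm (G p)) \in Lfun haar a%:E.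

Definition hdim : nat := (2 * n + 2)%N.
Local Notation Q := (hdim%:R : R).

(* The measure dx^* on the unit sphere, as a measure on the whole space of which
   only the restriction to [unit_sphere] matters; that restriction is determined
   by the polar formula. *)
Definition sphere_measure (sigma : {measure set (heis R n) -> \bar R}) : Prop :=
  forall h : heis R n -> \bar R,
    measurable_fun [set: heis R n] h -> (forall p, 0 <= h p)%E ->
    (\int[haar]_p h p =
     \int[lebesgue_measure]_(r in `]0%R, +oo[)
       \int[sigma]_(p in unit_sphere) (h (hdil r p) * (r ^+ hdim.-1)%:E))%E.

Definition A_const (sigma : {measure set (heis R n) -> \bar R}) : R :=
  Q^-1 * (\int[sigma]_(p in unit_sphere) enorm p.1 ^+ hdim) `^ (- (Q - 1)^-1).

Definition exp_tail (N : nat) (s : R) : R :=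
  expR s - \sum_(j < N.+1) s ^+ j / j`!%:R.

Definition exact_growth_inequality (a p C : R) : Prop :=
  forall (u : heis R n -> R) (G : heis R n -> Cn R n),
    sobolev Q p u -> weak_hgrad u G ->
    ('N[haar]_(Q%:E)[EFin \o (fun x => enorm (G x))] <= 1)%E ->
    (\int[haar]_x
       (exp_tail `|Num.ceil (p * ((Q - 1) / Q) - 1)|
          (a * `|u x| `^ (Q / (Q - 1)))
        / (1 + `|u x| `^ (p / (Q - 1))))%:E
     <= C%:E * 'N[haar]_(p%:E)[EFin \o u] `^ p)%E.

End heisenberg.

Definition Gamma_fun {R : realType} (s : R) : R :=
  \int[lebesgue_measure]_(t in `]0, +oo[) (t `^ (s - 1) * expR (- t)).

(* Main.v *)
Require Import Defs.
From HB Require Import structures.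
From mathcomp Require Import all_boot all_order all_algebra.
From mathcomp Require Import all_classical all_reals all_analysis.
From mathcomp Require Import measurable_realfun ring lra zify.
Set Implicit Arguments.
Unset Strict Implicit.
Unset Printing Implicit Defensive.
Import Order.TTheory GRing.Theory Num.Theory.
Import numFieldNormedType.Exports.
Local Open Scope classical_set_scope.
Local Open Scope ring_scope.

(** Through almost every point (z0, t0) of the unit sphere passes the
    horizontal spiral of the points (r e^{- i tau log r} z0, r^2 t0), with
    tau = t0/|z0|^2 and speed 1/|z0|. Integrating the gradient of u along its left
    translates with the weight |z0|^Q, and straightening the spirals by a measure
    preserving twist, bounds u by convolution of |grad u| on a layer
    {s < |u| < t} with the kernel |z|^(Q-1) / N^(2Q-2). Hoelder's inequality turns
    this into the isocapacitary inequality
    (t - s)^q <= e^(1/(Q-1)) (A ln (m(s) / m(t)) + C), where q = Q/(Q-1), m is the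
    distribution function of |u| and e the energy of the layer. Along the
    levels t_j = (A j)^(1/q) it shows that only O(k+1) of the numbers
    e^j t_j^(-p/(Q-1)) m(t_j) can exceed e^(-k) ||u||_p^p, so that their sum is at
    most C ||u||_p^p. This is proved for mollifications of u, which have an upper
    gradient along the spirals, and passes to the limit by Fatou's lemma.
    Sharpness is tested on multiples of ln (1 + e^(-s) / (eps + s)), s = N^4. *)

(** Rearranging u would give no control of the horizontal gradient, so the distribution function is
    studied directly, through the energy needed to cross a layer. The sharp constant survives
    because one number c, the integral of |z0|^Q over the sphere, arises twice: as the total weight
    of the spirals, and as the coefficient of the logarithm when the kernel to the power q, which is
    |z|^Q / N^(2Q), is integrated over an annulus. This gives c^(1-q) = c^(-1/(Q-1)), and the radii
    m(s)^(1/Q), m(t)^(1/Q) of the annulus contribute 1/Q. To get there, the pointwise bound is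
    averaged over the set above t, which smooths the kernel at the inner radius; all other
    contributions enter the additive C only. The denominator comes from comparing t_j with t_j/(2j):
    Chebyshev's inequality at the lower level costs its power -p, and since j is of order t_j^q this
    is of order t_j^(p/(Q-1)). Few terms are large because a large one leaves energy O((k+1)/j)
    above t_j, too little to climb to a distant level whose term is large too. *)

Section nonnegative_integral.
Local Open Scope ereal_scope.
Context d (T : measurableType d) (R : realType).
Variable m : {measure set T -> \bar R}.
Implicit Types f g h : T -> \bar R.

Lemma int_le f g : (forall x, 0 <= f x) -> measurable_fun setT f ->
  measurable_fun setT g -> (forall x, f x <= g x) ->
  \int[m]_x f x <= \int[m]_x g x.
Proof.
by move=> f0 mf mg fg; apply: ge0_le_integral => // x _; exact: le_trans (fg x).
Qed.

Lemma intD f g : (forall x, 0 <= f x) -> measurable_fun setT f ->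
  (forall x, 0 <= g x) -> measurable_fun setT g ->
  \int[m]_x (f x + g x) = \int[m]_x f x + \int[m]_x g x.
Proof. by move=> f0 mf g0 mg; apply: ge0_integralD. Qed.

Lemma intZ (k : R) f : (0 <= k)%R -> (forall x, 0 <= f x) ->
  measurable_fun setT f -> \int[m]_x (k%:E * f x) = k%:E * \int[m]_x f x.
Proof. by move=> k0 f0 mf; apply: ge0_integralZl_EFin. Qed.

Lemma intZr (k : R) f : (0 <= k)%R -> (forall x, 0 <= f x) ->
  measurable_fun setT f -> \int[m]_x (f x * k%:E) = \int[m]_x f x * k%:E.
Proof.
move=> k0 f0 mf; rewrite muleC -intZ//.
by apply: eq_integral => x _; rewrite muleC.
Qed.

Lemma int_ge0 f : (forall x, 0 <= f x) -> 0 <= \int[m]_x f x.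
Proof. by move=> f0; apply: integral_ge0. Qed.

Lemma int_setE (D : set T) f :
  \int[m]_(x in D) f x = \int[m]_x (f x * (\1_D x)%:E).
Proof.
rewrite integral_mkcond; apply: eq_integral => x _.
by rewrite patchE indicE; case: (x \in D); rewrite ?mule1 ?mule0.
Qed.

Lemma eq_int f g : (forall x, f x = g x) -> \int[m]_x f x = \int[m]_x g x.
Proof. by move=> fg; apply: eq_integral => x _. Qed.

Lemma int_indic (D : set T) : measurable D -> \int[m]_x (\1_D x)%:E = m D.
Proof. by move=> mD; rewrite integral_indic// setIT. Qed.

End nonnegative_integral.

Section tonelli.
Local Open Scope ereal_scope.
Context d1 d2 (T1 : measurableType d1) (T2 : measurableType d2) (R : realType).
Variable m1 : {sigma_finite_measure set T1 -> \bar R}.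
Variable m2 : {sigma_finite_measure set T2 -> \bar R}.
Variable f : T1 * T2 -> \bar R.
Hypothesis mf : measurable_fun setT f.
Hypothesis f0 : forall x, 0 <= f x.

Lemma tonelli1 : \int[product_sigma_finite m1 m2]_z f z =
  \int[m1]_x \int[m2]_y f (x, y).
Proof. exact: fubini_tonelli1. Qed.

Lemma tonelli2 : \int[product_sigma_finite m1 m2]_z f z =
  \int[m2]_y \int[m1]_x f (x, y).
Proof. exact: fubini_tonelli2. Qed.

Lemma tonelli : \int[m1]_x \int[m2]_y f (x, y) =
  \int[m2]_y \int[m1]_x f (x, y).
Proof. exact: fubini_tonelli. Qed.

Lemma measurable_int2 : measurable_fun setT (fun x => \int[m2]_y f (x, y)).
Proof. exact: measurable_fun_fubini_tonelli_F. Qed.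

Lemma measurable_int1 : measurable_fun setT (fun y => \int[m1]_x f (x, y)).
Proof. exact: measurable_fun_fubini_tonelli_G. Qed.

End tonelli.

(** * Maps that multiply a measure by a constant *)

Section scales.
Local Open Scope ereal_scope.

(** Change of variables tested on nonnegative functions instead of sets, the form in which it
    composes and passes under Tonelli's theorem. The factor [k] is an inverse Jacobian; [k = 1] says
    that the measure is preserved. *)
Definition scales d (T : measurableType d) (R : realType)
    (m : {measure set T -> \bar R}) (phi : T -> T) (k : R) :=
  measurable_fun setT phi /\
  forall h, measurable_fun setT h -> (forall x, 0 <= h x) ->
    \int[m]_x h (phi x) = k%:E * \int[m]_x h x.

Lemma scales_comp d (T : measurableType d) (R : realType)
    (m : {measure set T -> \bar R}) phi psi (k l : R) :
  scales m phi k -> scales m psi l -> scales m (phi \o psi) (l * k)%R.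
Proof.
move=> [mp hp] [mq hq]; split; first exact: measurableT_comp.
move=> h mh h0; rewrite /= (hq (fun x => h (phi x)))//.
  by rewrite hp// muleA EFinM.
exact: (measurableT_comp mh mp).
Qed.

Lemma eq_scales d (T : measurableType d) (R : realType)
    (m : {measure set T -> \bar R}) phi psi (k l : R) :
  phi =1 psi -> k = l -> scales m phi k -> scales m psi l.
Proof. by move=> /funext -> ->. Qed.

(** By Tonelli's theorem the fibre map may depend on the base point as long as its factor [k2] does
    not. Shears, Heisenberg translations and dilations all have this form. *)
Lemma scales_skew d1 d2 (T1 : measurableType d1) (T2 : measurableType d2)
    (R : realType) (m1 : {sigma_finite_measure set T1 -> \bar R})
    (m2 : {sigma_finite_measure set T2 -> \bar R})
    (f : T1 -> T1) (g : T1 -> T2 -> T2) (k1 k2 : R) :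
  (0 <= k2)%R -> scales m1 f k1 -> (forall x, scales m2 (g x) k2) ->
  measurable_fun setT (fun p => g p.1 p.2) ->
  scales (product_sigma_finite m1 m2) (fun p => (f p.1, g p.1 p.2)) (k1 * k2)%R.
Proof.
move=> k20 [mf hf] hg mg.
have mphi : measurable_fun setT (fun p : T1 * T2 => (f p.1, g p.1 p.2)).
  apply: measurable_fun_pair => //.
  by apply: measurableT_comp.
split=> // h mh h0.
have mhx x : measurable_fun setT (fun y => h (x, y)) by exact: measurableT_comp.
rewrite tonelli1//; last exact: (measurableT_comp mh mphi).
rewrite /=.
have -> : \int[m1]_x \int[m2]_y h (f x, g x y) =
    \int[m1]_x (k2%:E * \int[m2]_y h (f x, y)).
  apply: eq_integral => x _; have [_ /(_ (fun y => h (f x, y)))] := hg x.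
  exact.
have mH := measurable_int2 m2 mh h0.
rewrite intZ//; [|by move=> x; exact: int_ge0|exact: (measurableT_comp mH mf)].
rewrite (hf (fun x => \int[m2]_y h (x, y)))//; last by move=> x; exact: int_ge0.
by rewrite muleA -EFinM mulrC tonelli1.
Qed.

Lemma scales_swap d1 d2 (T1 : measurableType d1) (T2 : measurableType d2)
    (R : realType) (m1 : {sigma_finite_measure set T1 -> \bar R})
    (m2 : {sigma_finite_measure set T2 -> \bar R}) phi (k : R) :
  scales (product_sigma_finite m1 m2) phi k ->
  scales (product_sigma_finite m2 m1) (fun p => let q := phi (p.2, p.1) in (q.2, q.1)) k.
Proof.
move=> [mphi hphi]; have ms e1 e2 (S1 : measurableType e1) (S2 : measurableType e2) :
    measurable_fun setT (fun p : S1 * S2 => (p.2, p.1)).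
  exact: measurable_fun_pair.
have mpsi : measurable_fun setT (fun p : T2 * T1 => let q := phi (p.2, p.1) in (q.2, q.1)).
  exact: (measurableT_comp (ms _ _ _ _) (measurableT_comp mphi (ms _ _ _ _))).
split=> // h mh h0.
rewrite tonelli2//; last exact: (measurableT_comp mh mpsi).
rewrite [in RHS]tonelli2//.
rewrite -(@tonelli1 _ _ _ _ _ m1 m2 (fun p => h (p.2, p.1)))//; last first.
  exact: (measurableT_comp mh (ms _ _ _ _)).
rewrite -(@tonelli1 _ _ _ _ _ m1 m2 (fun p => h ((phi p).2, (phi p).1)))//; last first.
  exact: (measurableT_comp mh (measurableT_comp (ms _ _ _ _) mphi)).
apply: (hphi (fun p => h (p.2, p.1))) => //.
exact: (measurableT_comp mh (ms _ _ _ _)).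
Qed.

End scales.

Section line.
Local Open Scope ereal_scope.
Context (R : realType).

(** The identity is measurable between the two copies of the line, and pushing the measure forward
    along it changes neither integral. This makes the fundamental theorem and the Gaussian integral
    available for [lebesgue_line]. *)
Lemma ge0_integral_line (D : set R) (f : R -> \bar R) :
  measurable D -> measurable_fun D f -> (forall x, D x -> 0 <= f x) ->
  \int[lebesgue_measure]_(x in D) f x = \int[lebesgue_line]_(x in D) f x.
Proof.
move=> mD mf f0; have mid : measurable_fun setT (idfun : measurableTypeR R -> R).
  by move=> _ A mA; rewrite setTI preimage_id.
have /= <- := @ge0_integral_pushforward _ _ _ _ _ _ mid lebesgue_measure D f mD mf _; last first.
  by move=> x /set_mem; exact: f0.
by apply: eq_measure_integral => A mA _.
Qed.

(** The pushforward by [phi], divided by [k], agrees with Lebesgue measure on half-open intervals,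
    hence everywhere by uniqueness. *)
Lemma scales_line_measure (phi : R -> R) (k : R) : (0 < k)%R ->
  measurable_fun setT phi ->
  (forall x y, lebesgue_measure (phi @^-1` `]x, y]%classic) = k%:E * (@lebesgue_measure R) `]x, y]%classic) ->
  scales (@lebesgue_line R) phi k.
Proof.
move=> k0 mphi phiE; split=> // h mh h0.
have mphi' : measurable_fun setT (phi : R -> measurableTypeR R) by exact: mphi.
have ki : (0 <= k^-1)%R by rewrite invr_ge0 ltW.
pose nu := mscale (NngNum ki) (@measure_function_pushforward__canonical__measure_function_Measure _ _ _ _ R (@lebesgue_line R) _ mphi').
have nuE A : measurable A -> (@lebesgue_measure R) A = nu A.
  apply: lebesgue_measure_unique => _ [[x y]] _ <-.
  transitivity ((k^-1)%:E * lebesgue_measure (phi @^-1` `]x, y]%classic)); last by [].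
  by rewrite phiE muleA -EFinM mulVf ?mul1e// gt_eqF.
have H0 : \int[lebesgue_line]_x h (phi x) = \int[pushforward lebesgue_line (phi : R -> measurableTypeR R)]_y h y.
  by rewrite ge0_integral_pushforward.
rewrite H0 -[LHS]mul1e -(@mulfV _ k) ?gt_eqF// EFinM -muleA; congr (_ * _).
rewrite -[RHS]ge0_integral_line//.
rewrite [RHS](eq_measure_integral nu) => [|A mA _]; last exact: nuE.
by rewrite ge0_integral_mscale.
Qed.

Lemma scales_line_pos (a b : R) : (0 < a)%R ->
  scales (@lebesgue_line R) (fun x => a * x + b)%R a^-1.
Proof.
move=> a0; apply: scales_line_measure; first by rewrite invr_gt0.
  by apply: measurable_funD => //; apply: measurable_funM.
move=> x y; have -> : (fun x => a * x + b)%R @^-1` `]x, y] = `]((x - b) / a)%R, ((y - b) / a)%R]%classic.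
  by apply/seteqP; split=> z /=; rewrite !in_itv/= ltr_pdivrMr// ler_pdivlMr// ltrBlDr lerBrDr mulrC.
rewrite !lebesgue_measure_itv/= !lte_fin ltr_pM2r ?invr_gt0// ltrD2r.
case: ifPn => _; last by rewrite mule0.
by rewrite -!EFinB -EFinM; congr (_%:E); lra.
Qed.

Lemma scales_line_opp : scales (@lebesgue_line R) (@GRing.opp R) 1.
Proof.
apply: scales_line_measure => // x y; rewrite opp_preimage_itvbndbnd/= !lebesgue_measure_itv/= mul1e.
by rewrite !lte_fin ltrN2 opprK addrC.
Qed.

Lemma scales_line (a b : R) : a != 0%R ->
  scales (@lebesgue_line R) (fun x => a * x + b)%R `|a|^-1.
Proof.
case: ltgtP => // a0 _; last by rewrite gtr0_norm//; exact: scales_line_pos.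
have na0 : (0 < - a)%R by rewrite oppr_gt0.
apply: (eq_scales _ _ (scales_comp (scales_line_pos b na0) scales_line_opp)).
  by move=> x /=; rewrite mulrNN.
by rewrite mul1r ltr0_norm.
Qed.

End line.

Section rows.
Local Open Scope ereal_scope.
Context (R : realType).

Lemma measurable_row_axpy n (a : R) (w : 'rV[R]_n) :
  measurable_fun setT (fun v : 'rV[R]_n => a *: v + w)%R.
Proof.
apply: measurable_fun_row => i; under eq_fun do rewrite !mxE.
by apply: measurable_funD => //; apply: measurable_funM => //; exact: measurable_coord.
Qed.

Lemma integral_rowS n (h : 'rV[R]_n.+1 -> \bar R) :
  measurable_fun setT h -> (forall v, 0 <= h v) ->
  \int[lebesgue_row n.+1]_v h v =
  \int[product_sigma_finite lebesgue_line (lebesgue_row n)]_v h (row_cons v).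
Proof.
move=> mh h0.
rewrite [LHS](@ge0_integral_pushforward _ _ _ _ _ _ (@measurable_row_cons R n))//.
Qed.

Lemma scales_row n (a : R) (w : 'rV[R]_n) : a != 0%R ->
  scales (lebesgue_row n) (fun v => a *: v + w)%R (`|a| ^- n)%R.
Proof.
move=> a0; elim: n => [|n IH] in w *.
  split; first exact: measurable_row_axpy.
  move=> h mh h0; rewrite expr0 invr1 mul1e; apply: eq_integral => v _.
  by congr h; rewrite [LHS]thinmx0 [RHS]thinmx0.
split; first exact: measurable_row_axpy.
move=> h mh h0; rewrite !integral_rowS//; last first.
  exact: (measurableT_comp mh (measurable_row_axpy _ _)).
pose g (_ : R) v := (a *: v + (row_uncons w).2)%R.
have := @scales_skew _ _ _ _ _ lebesgue_line (lebesgue_row n)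
   (fun x => a * x + w ord0 ord0)%R g `|a|^-1 (`|a| ^- n).
case.
- by rewrite invr_ge0 exprn_ge0.
- exact: scales_line.
- by move=> x; exact: IH.
- exact: (measurableT_comp (measurable_row_axpy _ _) measurable_snd).
move=> _ /(_ (h \o @row_cons R n)) /= H.
rewrite exprS invfM -H//; last exact: (measurableT_comp mh (@measurable_row_cons _ _)).
apply: eq_integral => -[t v] _ /=; congr h.
apply/rowP => i; rewrite /row_cons !mxE/=.
case: splitP => j ij; rewrite !mxE/=; congr (_ + w _ _)%R; apply/val_inj => /=.
  by rewrite ij ord1.
by rewrite ij.
Qed.

End rows.

(** * The group, measurability, and the invariances of the Haar measure *)

Section heisenberg_group.
Context (R : realType) (n : nat).
Local Notation C := (Cn R n).
Local Notation H := (heis R n).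
Implicit Types (z w : C) (p q : H).

Definition sqn z : R := \sum_(j < n) (z.1 ord0 j ^+ 2 + z.2 ord0 j ^+ 2).

(** This is $\mathrm{Im}\,z\cdot\overline{w}$, the symplectic form of the group law. *)
Definition omega z w : R :=
  \sum_(j < n) (z.2 ord0 j * w.1 ord0 j - z.1 ord0 j * w.2 ord0 j).

(** The fourth power of the homogeneous norm: a polynomial, hence smooth at the origin and free of
    roots. *)
Definition hN4 p : R := sqn p.1 ^+ 2 + p.2 ^+ 2.

Definition hmul p q : H := (p.1 + q.1, p.2 + q.2 + 2 * omega p.1 q.1).

(** Multiplication of every coordinate by c - is; for the cosine and sine of an angle it turns z by
    the opposite angle. *)
Definition crot (c s : R) z : C := (c *: z.1 + s *: z.2, c *: z.2 - s *: z.1).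

Lemma sqn_ge0 z : 0 <= sqn z.
Proof. by apply: sumr_ge0 => j _; rewrite addr_ge0// sqr_ge0. Qed.

Lemma hN4_ge0 p : 0 <= hN4 p.
Proof. by rewrite addr_ge0// sqr_ge0. Qed.

Lemma sqn_le_hN4 p : sqn p.1 ^+ 2 <= hN4 p.
Proof. by rewrite lerDl sqr_ge0. Qed.

Lemma enorm_ge0 z : 0 <= enorm z.
Proof. exact: sqrtr_ge0. Qed.

Lemma enorm_sqr z : enorm z ^+ 2 = sqn z.
Proof. by rewrite sqr_sqrtr// sqn_ge0. Qed.

Lemma enorm_exp4 z : enorm z ^+ 4 = sqn z ^+ 2.
Proof. by rewrite -enorm_sqr -exprM. Qed.

Lemma hnormE p : hnorm p = hN4 p `^ 4^-1.
Proof. by rewrite /hnorm enorm_exp4. Qed.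

Lemma sqnZ (a : R) z : sqn (a *: z) = a ^+ 2 * sqn z.
Proof.
by rewrite mulr_sumr; apply: eq_bigr => j _; rewrite !mxE !exprMn mulrDr.
Qed.

Lemma sqnN z : sqn (- z) = sqn z.
Proof. by apply: eq_bigr => j _; rewrite !mxE !sqrrN. Qed.

Lemma sqn0 : sqn 0 = 0.
Proof. by apply: big1 => j _; rewrite !mxE expr0n addr0. Qed.

Lemma hN4N p : hN4 (- p) = hN4 p.
Proof. by rewrite /hN4 sqnN sqrrN. Qed.

Lemma hN4_hdil (r : R) p : hN4 (hdil r p) = r ^+ 4 * hN4 p.
Proof. by rewrite /hN4 /hdil/= sqnZ; ring. Qed.

Lemma sqn_crot (c s : R) z : c ^+ 2 + s ^+ 2 = 1 -> sqn (crot c s z) = sqn z.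
Proof.
move=> cs; apply: eq_bigr => j _; rewrite !mxE.
rewrite -[RHS]mul1r -cs; ring.
Qed.

Lemma omegaDl z z' w : omega (z + z') w = omega z w + omega z' w.
Proof. by rewrite -big_split/=; apply: eq_bigr => j _; rewrite !mxE; ring. Qed.

Lemma omegaDr z w w' : omega z (w + w') = omega z w + omega z w'.
Proof. by rewrite -big_split/=; apply: eq_bigr => j _; rewrite !mxE; ring. Qed.

Lemma omegaZl a z w : omega (a *: z) w = a * omega z w.
Proof. by rewrite mulr_sumr; apply: eq_bigr => j _; rewrite !mxE; ring. Qed.

Lemma omegaZr a z w : omega z (a *: w) = a * omega z w.
Proof. by rewrite mulr_sumr; apply: eq_bigr => j _; rewrite !mxE; ring. Qed.

Lemma omegaNl z w : omega (- z) w = - omega z w.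
Proof. by rewrite -scaleN1r omegaZl mulN1r. Qed.

Lemma omegaNr z w : omega z (- w) = - omega z w.
Proof. by rewrite -scaleN1r omegaZr mulN1r. Qed.

Lemma omegaC z w : omega z w = - omega w z.
Proof. by rewrite -sumrN; apply: eq_bigr => j _; ring. Qed.

Lemma omegaxx z : omega z z = 0.
Proof. by apply: big1 => j _; ring. Qed.

Lemma hmulA p q r : hmul p (hmul q r) = hmul (hmul p q) r.
Proof.
rewrite /hmul/= addrA; congr pair; rewrite omegaDl omegaDr; ring.
Qed.

Lemma hmulp0 p : hmul p 0 = p.
Proof.
rewrite /hmul /= !addr0; case: p => z t /=.
by rewrite (_ : omega z 0 = 0) ?mulr0 ?addr0// -(scale0r z) omegaZr mul0r.
Qed.

Lemma hmul0p p : hmul 0 p = p.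
Proof.
rewrite /hmul /= !add0r; case: p => z t /=.
by rewrite (_ : omega 0 z = 0) ?mulr0 ?addr0// -(scale0r z) omegaZl mul0r.
Qed.

(** The form [omega] is alternating, so the additive opposite is also the group inverse; [- p]
    denotes it throughout. *)
Lemma hmulVp p : hmul (- p) p = 0.
Proof. by rewrite /hmul/= omegaNl omegaxx oppr0 mulr0 addr0 !addNr. Qed.

Lemma hmulK p q : hmul (- p) (hmul p q) = q.
Proof. by rewrite hmulA hmulVp hmul0p. Qed.

Lemma hmulVKr p q : hmul (hmul q (- p)) p = q.
Proof. by rewrite -hmulA hmulVp hmulp0. Qed.

Lemma hinvM p q : - hmul p q = hmul (- q) (- p).
Proof.
transitivity ((- (p.1 + q.1), - (p.2 + q.2 + 2 * omega p.1 q.1)) : H) => //.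
rewrite /hmul/= omegaNl omegaNr opprK (omegaC q.1) opprD addrC; congr pair; ring.
Qed.

End heisenberg_group.

Section measurability.
Context (R : realType) (n : nat).
Local Notation C := (Cn R n).
Local Notation H := (heis R n).
Context d (T : measurableType d).

Lemma measurable_fun_coord (f : T -> 'rV[R]_n) j :
  measurable_fun setT f -> measurable_fun setT (fun x => f x ord0 j).
Proof. by move=> mf; exact: (measurableT_comp (@measurable_coord R n j) mf). Qed.

Lemma measurable_fun_rowD (f g : T -> 'rV[R]_n) : measurable_fun setT f ->
  measurable_fun setT g -> measurable_fun setT (fun x => f x + g x).
Proof.
move=> mf mg; apply: measurable_fun_row => i; under eq_fun do rewrite mxE.
by apply: measurable_funD; exact: measurable_fun_coord.
Qed.

Lemma measurable_fun_rowZ (a : T -> R) (f : T -> 'rV[R]_n) :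
  measurable_fun setT a -> measurable_fun setT f ->
  measurable_fun setT (fun x => a x *: f x).
Proof.
move=> ma mf; apply: measurable_fun_row => i; under eq_fun do rewrite mxE.
by apply: measurable_funM => //; exact: measurable_fun_coord.
Qed.

Lemma measurable_fun_rowN (f : T -> 'rV[R]_n) :
  measurable_fun setT f -> measurable_fun setT (fun x => - f x).
Proof.
move=> mf; apply: measurable_fun_row => i; under eq_fun do rewrite mxE.
by apply: measurableT_comp => //; exact: measurable_fun_coord.
Qed.

Lemma measurable_fun_fst d1 d2 (T1 : measurableType d1) (T2 : measurableType d2)
  (f : T -> T1 * T2) : measurable_fun setT f -> measurable_fun setT (fun x => (f x).1).
Proof. by move=> mf; exact: (measurableT_comp measurable_fst mf). Qed.

Lemma measurable_fun_snd d1 d2 (T1 : measurableType d1) (T2 : measurableType d2)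
  (f : T -> T1 * T2) : measurable_fun setT f -> measurable_fun setT (fun x => (f x).2).
Proof. by move=> mf; exact: (measurableT_comp measurable_snd mf). Qed.

Lemma measurable_fun_CD (f g : T -> C) : measurable_fun setT f ->
  measurable_fun setT g -> measurable_fun setT (fun x => f x + g x).
Proof.
by move=> mf mg; apply: measurable_fun_pair; apply: measurable_fun_rowD;
  (apply: measurable_fun_fst || apply: measurable_fun_snd).
Qed.

Lemma measurable_fun_CN (f : T -> C) :
  measurable_fun setT f -> measurable_fun setT (fun x => - f x).
Proof.
by move=> mf; apply: measurable_fun_pair; apply: measurable_fun_rowN;
  (apply: measurable_fun_fst || apply: measurable_fun_snd).
Qed.

Lemma measurable_fun_CZ (a : T -> R) (f : T -> C) : measurable_fun setT a ->
  measurable_fun setT f -> measurable_fun setT (fun x => a x *: f x).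
Proof.
by move=> ma mf; apply: measurable_fun_pair; apply: measurable_fun_rowZ => //;
  (apply: measurable_fun_fst || apply: measurable_fun_snd).
Qed.

Lemma measurable_fun_sqn (f : T -> C) :
  measurable_fun setT f -> measurable_fun setT (fun x => sqn (f x)).
Proof.
move=> mf; apply: measurable_sum => j.
by apply: measurable_funD; apply: measurable_funX; apply: measurable_fun_coord;
  (apply: measurable_fun_fst || apply: measurable_fun_snd).
Qed.

Lemma measurable_fun_enorm (f : T -> C) :
  measurable_fun setT f -> measurable_fun setT (fun x => enorm (f x)).
Proof.
move=> mf; apply: (measurableT_comp (continuous_measurable_fun (@sqrt_continuous R))).
exact: measurable_fun_sqn.
Qed.

Lemma measurable_fun_omega (f g : T -> C) : measurable_fun setT f ->
  measurable_fun setT g -> measurable_fun setT (fun x => omega (f x) (g x)).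
Proof.
move=> mf mg; apply: measurable_sum => j.
by apply: measurable_funB; apply: measurable_funM; apply: measurable_fun_coord;
  (apply: measurable_fun_fst || apply: measurable_fun_snd).
Qed.

Lemma measurable_fun_hN4 (f : T -> H) :
  measurable_fun setT f -> measurable_fun setT (fun x => hN4 (f x)).
Proof.
move=> mf; apply: measurable_funD; apply: measurable_funX.
  by apply: measurable_fun_sqn; exact: measurable_fun_fst.
exact: measurable_fun_snd.
Qed.

Lemma measurable_fun_hmul (f g : T -> H) : measurable_fun setT f ->
  measurable_fun setT g -> measurable_fun setT (fun x => hmul (f x) (g x)).
Proof.
move=> mf mg; have mf1 := measurable_fun_fst mf; have mg1 := measurable_fun_fst mg.
apply: measurable_fun_pair; first exact: measurable_fun_CD.
apply: measurable_funD.
  by apply: measurable_funD; exact: measurable_fun_snd.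
by apply: measurable_funM => //; exact: measurable_fun_omega.
Qed.

Lemma measurable_fun_hN (f : T -> H) :
  measurable_fun setT f -> measurable_fun setT (fun x => - f x).
Proof.
move=> mf; apply: measurable_fun_pair.
  by apply: measurable_fun_CN; exact: measurable_fun_fst.
by apply: measurableT_comp => //; exact: measurable_fun_snd.
Qed.

Lemma measurable_fun_crot (a b : T -> R) (f : T -> C) : measurable_fun setT a ->
  measurable_fun setT b -> measurable_fun setT f ->
  measurable_fun setT (fun x => crot (a x) (b x) (f x)).
Proof.
move=> ma mb mf; have m1 := measurable_fun_fst mf; have m2 := measurable_fun_snd mf.
apply: measurable_fun_pair; apply: measurable_fun_rowD; first exact: measurable_fun_rowZ.
- exact: measurable_fun_rowZ.
- exact: measurable_fun_rowZ.
- by apply: measurable_fun_rowN; exact: measurable_fun_rowZ.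
Qed.

Lemma measurable_fun_hdil (r : T -> R) (f : T -> H) : measurable_fun setT r ->
  measurable_fun setT f -> measurable_fun setT (fun x => hdil (r x) (f x)).
Proof.
move=> mr mf; apply: measurable_fun_pair.
  by apply: measurable_fun_CZ => //; exact: measurable_fun_fst.
by apply: measurable_funM; [exact: measurable_funX|exact: measurable_fun_snd].
Qed.

End measurability.

Section haar_invariance.
Context (R : realType) (n : nat).
Local Notation C := (Cn R n).
Local Notation H := (heis R n).
Local Notation row := (@lebesgue_row R n).

Definition lebesgue_C : {sigma_finite_measure set C -> \bar R} :=
  product_sigma_finite (@lebesgue_row R n) (@lebesgue_row R n).

Lemma scales_C (a : R) (w : C) : a != 0 ->
  scales lebesgue_C (fun z => a *: z + w) (`|a| ^- n.*2).
Proof.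
move=> a0; have an0 : 0 <= `|a| ^- n by rewrite invr_ge0 exprn_ge0.
have h := @scales_skew _ _ _ _ _ row row _ (fun _ y => a *: y + w.2) _ _ an0
  (scales_row w.1 a0) (fun _ => scales_row w.2 a0) _.
apply: (eq_scales _ _ (h _)) => //.
- by rewrite -invfM -exprD addnn.
- exact: (measurableT_comp (measurable_row_axpy _ _) measurable_snd).
Qed.

Lemma scales_rowD (w : 'rV[R]_n) : scales row (fun y => y + w) 1.
Proof.
apply: (eq_scales _ _ (scales_row w (oner_neq0 R))).
  by move=> y; rewrite scale1r.
by rewrite normr1 expr1n invr1.
Qed.

Lemma scales_shear2 (a : R) : scales lebesgue_C (fun z => (z.1, z.2 + a *: z.1)) 1.
Proof.
have sid : scales row id 1.
  by split=> [|h mh h0]; [exact: measurable_id|rewrite mul1e].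
have h := @scales_skew _ _ _ _ _ row row _ (fun x y => y + a *: x) _ _ ler01
  sid (fun x => scales_rowD (a *: x)) _.
apply: (eq_scales _ _ (h _)) => //; first by rewrite mulr1.
by apply: measurable_fun_rowD => //; apply: measurable_fun_rowZ.
Qed.

Lemma scales_shear1 (a : R) : scales lebesgue_C (fun z => (z.1 + a *: z.2, z.2)) 1.
Proof. exact: (scales_swap (scales_shear2 a)). Qed.

(* Three shears make every rotation but the half-turn, which is the square of a
   quarter-turn. *)
Lemma scales_crot (c s : R) : c ^+ 2 + s ^+ 2 = 1 -> scales lebesgue_C (crot c s) 1.
Proof.
have gen a b : a ^+ 2 + b ^+ 2 = 1 -> a != -1 -> scales lebesgue_C (crot a b) 1.
  move=> ab a1; have a10 : 1 + a != 0 by rewrite addrC -[1]opprK subr_eq0.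
  (* The tangent of half the angle; it exists because the half-turn is excluded. *)
  pose k := b / (1 + a).
  have h := scales_comp (scales_shear1 k) (scales_comp (scales_shear2 (- b)) (scales_shear1 k)).
  apply: (eq_scales _ _ h); last by rewrite !mulr1.
  have k2 : k * (1 + a) = b by rewrite /k divfK.
  have k1 : 1 - k * b = a.
    apply: (mulIf a10); rewrite mulrBl mulrAC k2 mul1r -expr2.
    by rewrite (_ : b ^+ 2 = 1 - a ^+ 2); [ring|rewrite -ab; ring].
  move=> z; rewrite /crot /=; congr pair; apply/rowP => i; rewrite !mxE.
    transitivity ((1 - k * b) * z.1 ord0 i + k * (1 + (1 - k * b)) * z.2 ord0 i); first ring.
    by rewrite k1 k2.
  transitivity ((1 - k * b) * z.2 ord0 i - b * z.1 ord0 i); first ring.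
  by rewrite k1.
move=> cs; have [c1|c1] := eqVneq c (-1); last exact: gen.
have s0 : s = 0.
  have : s ^+ 2 = 0 by move: cs; rewrite c1 sqrrN expr1n; lra.
  by move/eqP; rewrite sqrf_eq0 => /eqP.
have q : scales lebesgue_C (crot 0 1) 1.
  by apply: gen; [rewrite expr0n expr1n add0r|rewrite eq_sym oppr_eq0 oner_eq0].
apply: (eq_scales _ _ (scales_comp q q)); last by rewrite mulr1.
move=> z; rewrite /crot c1 s0/=; congr pair; apply/rowP => i; rewrite !mxE; ring.
Qed.

Lemma scales_haar (f : C -> C) (g : C -> R -> R) : scales lebesgue_C f 1 ->
  (forall z, scales lebesgue_line (g z) 1) ->
  measurable_fun setT (fun p : H => g p.1 p.2) ->
  scales haar (fun p : H => (f p.1, g p.1 p.2)) 1.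
Proof.
move=> hf hg mg; have h := scales_skew ler01 hf hg mg.
by apply: (eq_scales _ _ h) => //; rewrite mulr1.
Qed.

Lemma scales_translate (a : R) : scales lebesgue_line (fun t => t + a) 1.
Proof.
apply: (eq_scales _ _ (scales_line a (oner_neq0 R))); last by rewrite normr1 invr1.
by move=> x; rewrite mul1r.
Qed.

Lemma scales_CD (w : C) : scales lebesgue_C (fun z => z + w) 1.
Proof.
apply: (eq_scales _ _ (scales_C w (oner_neq0 R))); last by rewrite normr1 expr1n invr1.
by move=> z; rewrite scale1r.
Qed.

(** A left translation moves z by a constant and t by an amount that depends on z alone, so it is a
    skew product of translations. *)
Lemma scales_hmull (p : H) : scales haar (hmul p) 1.
Proof.
have h := @scales_haar (fun z => z + p.1) (fun z t => t + (p.2 + 2 * omega p.1 z)) (scales_CD _)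
  (fun z => scales_translate _) _.
apply: (eq_scales _ _ (h _)) => //.
  by move=> q; rewrite /hmul addrC; congr pair; ring.
apply: measurable_funD => //; apply: measurable_funD => //; apply: measurable_funM => //.
by apply: measurable_fun_omega => //; exact: measurable_fst.
Qed.

Lemma scales_hN : scales haar (fun q : H => - q) 1.
Proof.
have hC : scales lebesgue_C (fun z => - z) 1.
  have N1 : (-1 : R) != 0 by rewrite oppr_eq0 oner_eq0.
  apply: (eq_scales _ _ (scales_C 0 N1)); last by rewrite normrN1 expr1n invr1.
  by move=> z; rewrite scaleN1r addr0.
apply: (@scales_haar (fun z => - z) (fun z t => - t) hC).
  by move=> _; exact: scales_line_opp.
by apply: measurableT_comp => //; exact: measurable_snd.
Qed.

Lemma scales_haar_crot (c s : R) : c ^+ 2 + s ^+ 2 = 1 ->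
  scales haar (fun q : H => (crot c s q.1, q.2)) 1.
Proof.
move=> cs; apply: (@scales_haar (crot c s) (fun z t => t)) => //; first exact: scales_crot.
  by move=> z; split=> [|h mh h0]; [exact: measurable_id|rewrite mul1e].
exact: measurable_snd.
Qed.

(** Additive translations are not group translations but preserve the measure too; they serve the
    integration by parts along a constant direction. *)
Lemma scales_hshift (p : H) : scales haar (fun q : H => q + p) 1.
Proof.
apply: (@scales_haar (fun z => z + p.1) (fun z t => t + p.2)) => //; first exact: scales_CD.
  by move=> z; exact: scales_translate.
by apply: measurable_funD => //; exact: measurable_snd.
Qed.

End haar_invariance.

(** Indicators of decidable conditions as real factors, so that they multiply integrands and are
    evaluated by a case analysis on the order. *)
Definition indb {R : realType} (b : bool) : R := (nat_of_bool b)%:R.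

Lemma indb_ge0 (R : realType) b : 0 <= indb b :> R.
Proof. by case: b. Qed.

#[global] Hint Extern 0 (is_true (0 <= indb _)) => exact: indb_ge0 : core.

Lemma indbE (R : realType) : ((indb true = 1 :> R) * (indb false = 0 :> R))%type.
Proof. by []. Qed.

(** * Calculus along lines and the layer-cake formula *)

Section directional_derivative.
Context (R : realType) (V : normedModType R).
Implicit Types (f g : V -> R) (x v : V).

Lemma dv_eq f x v (a b : R) : is_derive x v f a -> a = b -> is_derive x v f b.
Proof. by move=> h <-. Qed.

Lemma dv_fun f g x v (a : R) : is_derive x v f a -> f =1 g -> is_derive x v g a.
Proof. by move=> h /funext <-. Qed.

Lemma dvD f g x v (a b : R) : is_derive x v f a -> is_derive x v g b ->
  is_derive x v (fun y => f y + g y) (a + b).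
Proof. by move=> hf hg; exact: is_deriveD. Qed.

Lemma dvB f g x v (a b : R) : is_derive x v f a -> is_derive x v g b ->
  is_derive x v (fun y => f y - g y) (a - b).
Proof. by move=> hf hg; exact: is_deriveB. Qed.

Lemma dvN f x v (a : R) : is_derive x v f a -> is_derive x v (fun y => - f y) (- a).
Proof. by move=> hf; exact: is_deriveN. Qed.

Lemma dvM f g x v (a b : R) : is_derive x v f a -> is_derive x v g b ->
  is_derive x v (fun y => f y * g y) (f x * b + g x * a).
Proof. by move=> hf hg; exact: is_deriveM. Qed.

Lemma dv_cst (c : R) x v : is_derive x v (fun _ => c) 0.
Proof. exact: is_derive_cst. Qed.

Lemma dvZ f x v (c a : R) : is_derive x v f a -> is_derive x v (fun y => c * f y) (c * a).
Proof.
by move=> hf; apply: (dv_eq (dvM (dv_cst c x v) hf)); rewrite mulr0 addr0.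
Qed.

Lemma dvX f n x v (a : R) : is_derive x v f a ->
  is_derive x v (fun y => f y ^+ n.+1) (n.+1%:R * f x ^+ n * a).
Proof.
move=> hf; elim: n => [|n IH].
  by apply: (dv_eq (dv_fun hf _)) => [y|]; rewrite ?expr1// expr0 mulr1 mul1r.
apply: (dv_eq (dv_fun (dvM hf IH) _)) => [y|]; first by rewrite [RHS]exprS.
by rewrite exprS -[n.+2%:R]natr1; ring.
Qed.

Lemma dv_sum n (f : 'I_n -> V -> R) x v (a : 'I_n -> R) :
  (forall i, is_derive x v (f i) (a i)) ->
  is_derive x v (fun y => \sum_i f i y) (\sum_i a i).
Proof.
move=> h; have H := @is_derive_sum _ _ _ n f x v a h.
by apply: (dv_fun H) => y; rewrite fct_sumE.
Qed.

Lemma dv_line f x v (a t : R) : is_derive (t *: v + x) v f a <->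
  is_derive (t : R^o) 1 (fun s : R^o => f (s *: v + x)) a.
Proof.
have E (h : R) : f (h *: v + (t *: v + x)) = f ((h *: 1%R + t) *: v + x).
  by rewrite addrA -scalerDl /GRing.scale/= mulr1.
split=> -[dd de].
  have E' : (fun h : R => h^-1 *: (f ((h *: 1%R + t) *: v + x) - f (t *: v + x))) =
     (fun h : R => h^-1 *: (f (h *: v + (t *: v + x)) - f (t *: v + x))).
    by apply/funext => h; rewrite E.
  split; first by rewrite /derivable /comp/= /shift/= E'.
  by rewrite -de /derive /comp/= /shift/= E'.
have E' : (fun h : R => h^-1 *: (f (h *: v + (t *: v + x)) - f (t *: v + x))) =
  (fun h : R => h^-1 *: (f ((h *: 1%R + t) *: v + x) - f (t *: v + x))).
  by apply/funext => h; rewrite E.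
split; first by rewrite /derivable /comp/= /shift/= E'.
by rewrite -de /derive /comp/= /shift/= E'.
Qed.

Lemma dv_line0 f x v (a : R) : is_derive x v f a <->
  is_derive (0 : R^o) 1 (fun s : R^o => f (s *: v + x)) a.
Proof. by rewrite -dv_line scale0r add0r. Qed.

(** Only the restriction of [f] to the line through [x] matters, so the chain rule in one variable
    suffices and no differentiability of [f] as a map on [V] is asked. *)
Lemma dv_comp f (g : R -> R) x v (a b : R) : is_derive x v f a ->
  is_derive (f x : R^o) 1 g b -> is_derive x v (fun y => g (f y)) (b * a).
Proof.
move=> /dv_line0 hf hg; apply/dv_line0.
have hg' : is_derive (f (0 *: v + x) : R^o) 1 g b by rewrite scale0r add0r.
by have h := is_derive1_comp hg' hf; exact: h.
Qed.

End directional_derivative.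

Section line_derivative.
Context (R : realType).
Implicit Types (f g : R -> R) (x : R).

Lemma dv_id x : is_derive x 1 (fun y : R => y) 1.
Proof. exact: is_derive_id. Qed.

Lemma dv_pow n x : is_derive x 1 (fun y : R => y ^+ n.+1) (n.+1%:R * x ^+ n).
Proof. by apply: (dv_eq (dvX n (dv_id x))); rewrite mulr1. Qed.

Lemma dv_expR f x (a : R) : is_derive x 1 f a ->
  is_derive x 1 (fun y => expR (f y)) (expR (f x) * a).
Proof. by move=> hf; exact: (dv_comp hf (is_derive_expR (f x))). Qed.

Lemma dv_continuous f x (a : R) : is_derive x 1 f a -> {for x, continuous f}.
Proof. by move=> [h _]; apply: differentiable_continuous; exact/derivable1_diffP. Qed.

End line_derivative.

Section fundamental_theorem.
Context (R : realType).
Local Notation mu := (@lebesgue_measure R).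
Local Notation lam := (@lebesgue_line R).

Lemma FTC2_lebesgue (F f : R -> R) (a b : R) : a <= b ->
  (forall x, a <= x <= b -> is_derive x 1 F (f x)) ->
  (forall x, a <= x <= b -> {for x, continuous f}) ->
  (\int[mu]_(x in `[a, b]) (f x)%:E = (F b - F a)%:E)%E.
Proof.
rewrite le_eqVlt => /predU1P[<- _ _|ab dF cf].
  by rewrite set_itv1 integral_set1 subrr.
rewrite EFinB; apply: continuous_FTC2 => //.
- apply: continuous_in_subspaceT => x; rewrite inE/= in_itv/=; exact: cf.
- split.
  + move=> x; rewrite in_itv/= => /andP[ax xb].
    by have [] := dF x _; rewrite ?(ltW ax) ?(ltW xb).
  + by apply: cvg_at_right_filter; apply: (dv_continuous (dF a _)); rewrite lexx ltW.
  + by apply: cvg_at_left_filter; apply: (dv_continuous (dF b _)); rewrite lexx ltW.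
- move=> x; rewrite in_itv/= => /andP[ax xb].
  by rewrite derive1E; have [] := dF x _; rewrite ?(ltW ax) ?(ltW xb).
Qed.

Lemma measurable_continuous_in (f : R -> R) (D : interval R) :
  {within [set` D], continuous f} -> measurable_fun [set` D] f.
Proof. by move=> cf; exact: subspace_continuous_measurable_fun. Qed.

Lemma FTC2_line (F f : R -> R) (a b : R) : a <= b ->
  (forall x, a <= x <= b -> is_derive x 1 F (f x)) ->
  (forall x, a <= x <= b -> {for x, continuous f}) ->
  (forall x, a <= x <= b -> 0 <= f x) ->
  (\int[lam]_(x in `[a, b]) (f x)%:E = (F b - F a)%:E)%E.
Proof.
move=> ab dF cf f0; rewrite -(FTC2_lebesgue ab dF cf) ge0_integral_line//.
  apply/measurable_EFinP; apply: measurable_continuous_in.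
  by apply: continuous_in_subspaceT => x; rewrite inE/= in_itv/=; exact: cf.
Qed.

Lemma FTC2y_line (F f : R -> R) (a l : R) :
  (forall x, a <= x -> is_derive x 1 F (f x)) ->
  (forall x, a <= x -> {for x, continuous f}) ->
  (forall x, a <= x -> 0 <= f x) -> F x @[x --> +oo] --> l ->
  (\int[lam]_(x in `[a, +oo[) (f x)%:E = (l - F a)%:E)%E.
Proof.
move=> dF cf f0 Fl; rewrite -ge0_integral_line//; first last.
- by move=> x /=; rewrite in_itv/= andbT lee_fin; exact: f0.
- apply/measurable_EFinP; apply: measurable_continuous_in.
  by apply: continuous_in_subspaceT => x; rewrite inE/= in_itv/= andbT; exact: cf.
rewrite EFinB; apply: ge0_continuous_FTC2y => //.
- by apply: continuous_in_subspaceT => x; rewrite inE/= in_itv/= andbT; exact: cf.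
- by move=> x ax; have [] := dF x (ltW ax).
- by apply: cvg_at_right_filter; exact: (dv_continuous (dF a (lexx _))).
- move=> x; rewrite in_itv/= andbT => ax.
  by rewrite derive1E; have [] := dF x (ltW ax).
Qed.

Lemma int_itv_oc_line (a : R) (b : itv_bound R) (f : R -> R) :
  (forall x, 0 <= f x) -> measurable_fun setT f ->
  (\int[lam]_(x in [set` Interval (BRight a) b]) (f x)%:E =
   \int[lam]_(x in [set` Interval (BLeft a) b]) (f x)%:E)%E.
Proof.
move=> f0 mf; have mf' D : measurable_fun D (EFin \o f).
  by apply/measurable_EFinP; exact: measurable_funTS.
rewrite -!ge0_integral_line; first by rewrite integral_itv_obnd_cbnd//; exact: mf'.
all: by [exact: measurable_itv|exact: mf'|move=> x _; rewrite lee_fin].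
Qed.

Lemma measurable_fun_ltR d (T : measurableType d) (f g : T -> R) :
  measurable_fun setT f -> measurable_fun setT g ->
  measurable_fun setT (fun x => indb (f x < g x) : R).
Proof.
move=> mf mg; have mb := measurable_fun_ltr mf mg.
rewrite (_ : (fun _ => _) = \1_[set x | f x < g x]); last first.
  by apply/funext => x; rewrite indicE; congr ((nat_of_bool _)%:R); apply/idP/idP; rewrite inE.
apply: measurable_indic; rewrite -[X in measurable X]setTI.
exact: (mb measurableT [set true]).
Qed.

Lemma measurable_fun_leR d (T : measurableType d) (f g : T -> R) :
  measurable_fun setT f -> measurable_fun setT g ->
  measurable_fun setT (fun x => indb (f x <= g x) : R).
Proof.
move=> mf mg; rewrite (_ : (fun _ => _) = (fun x => 1 - indb (g x < f x))).
  by apply: measurable_funB => //; exact: measurable_fun_ltR.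
by apply/funext => x; case: leP => _; rewrite ?subr0 ?subrr.
Qed.

Lemma int_gt_line (a : R) (f : R -> R) :
  (\int[lam]_(x in `]a, +oo[) (f x)%:E = \int[lam]_x (indb (a < x)%R * f x)%:E)%E.
Proof.
rewrite int_setE; apply: eq_int => x; rewrite -EFinM mulrC indicE /indb.
by congr ((_ * _)%:E); congr ((nat_of_bool _)%:R); apply/idP/idP; rewrite inE/= in_itv/= andbT.
Qed.

Lemma tail_line (F f : R -> R) (a l : R) : measurable_fun setT f ->
  (forall x, a <= x -> is_derive x 1 F (f x)) ->
  (forall x, a <= x -> {for x, continuous f}) ->
  (forall x, a <= x -> 0 <= f x) -> F x @[x --> +oo] --> l ->
  (\int[lam]_x (indb (a < x)%R * f x)%:E = (l - F a)%:E)%E.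
Proof.
move=> mf dF cf f0 Fl; rewrite -int_gt_line -(FTC2y_line dF cf f0 Fl).
have mf' D : measurable_fun D (EFin \o f).
  by apply/measurable_EFinP; exact: measurable_funTS.
rewrite -!ge0_integral_line//.
- by rewrite integral_itv_obnd_cbnd.
- by move=> x /=; rewrite in_itv/= andbT lee_fin; exact: f0.
- by move=> x /=; rewrite in_itv/= andbT lee_fin => /ltW; exact: f0.
Qed.

End fundamental_theorem.

Section layer_cake.
Context (R : realType) d (T : measurableType d).
Variable m : {sigma_finite_measure set T -> \bar R}.
Local Notation lam := (@lebesgue_line R).

(** The weighted layer-cake formula: G(phi) is the integral of g beyond phi, and the order of
    integration is exchanged. It reduces integrals of exponentials to moments of sublevel sets. *)
Lemma tonelli_tail (phi W : T -> R) (g G : R -> R) :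
  measurable_fun setT phi -> measurable_fun setT W -> measurable_fun setT g ->
  (forall x, 0 <= W x) -> (forall w, 0 <= w -> 0 <= g w) -> (forall x, 0 <= phi x) ->
  (forall a : R, (0 <= a)%R -> \int[lam]_w (indb (a < w)%R * g w)%:E = (G a)%:E)%E ->
  (\int[m]_x (W x * G (phi x))%:E =
   \int[lam]_w ((indb (0 < w)%R * g w)%:E * \int[m]_x (W x * indb (phi x < w)%R)%:E))%E.
Proof.
move=> mphi mW mg W0 g0 phi0 gG; pose k w := indb (0 < w) * g w.
have mk : measurable_fun setT k by apply: measurable_funM => //; exact: measurable_fun_ltR.
have k0 w : 0 <= k w.
  by rewrite /k /indb; case: ltP => [/ltW/g0|_]; rewrite ?mul0r ?mul1r.
have phk a w : 0 <= a -> indb (a < w) * g w = indb (a < w) * k w.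
  by move=> a0; rewrite /k /indb; case: ltP => [aw|_]; rewrite ?mul0r// (le_lt_trans a0 aw) !mul1r.
pose F (p : T * R) := (W p.1 * indb (phi p.1 < p.2) * k p.2)%:E.
have mF : measurable_fun setT F.
  apply/measurable_EFinP; apply: measurable_funM; last exact: (measurableT_comp mk measurable_snd).
  apply: measurable_funM; first exact: (measurableT_comp mW measurable_fst).
  by apply: measurable_fun_ltR; [exact: (measurableT_comp mphi measurable_fst)|exact: measurable_snd].
have F0 p : (0 <= F p)%E by rewrite lee_fin; apply: mulr_ge0; [apply: mulr_ge0|exact: k0].
transitivity (\int[m]_x \int[lam]_w F (x, w))%E.
  apply: eq_int => x; rewrite EFinM -gG// -intZ//.
  - by apply: eq_int => w; rewrite -EFinM phk// mulrA.
  - by move=> w; rewrite lee_fin phk// mulr_ge0.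
  - by apply/measurable_EFinP; apply: measurable_funM => //; exact: measurable_fun_ltR.
rewrite tonelli//; apply: eq_int => w; rewrite -intZ//.
- by apply: eq_int => x; rewrite /F /= -EFinM mulrC.
- exact: k0.
- by move=> x; rewrite lee_fin mulr_ge0.
- by apply/measurable_EFinP; apply: measurable_funM => //; exact: measurable_fun_ltR.
Qed.

End layer_cake.

(** * The measure of the unit sphere *)

Section exponential_moments.
Context (R : realType).
Local Notation lam := (@lebesgue_line R).

Lemma cvg_expRN_pow k : expR (- (x : R) ^+ k.+1) @[x --> +oo] --> (0 : R).
Proof.
apply: (@squeeze_cvgr _ _ _ _ (fun=> 0) (fun x : R => expR (- x))).
- near=> x; rewrite expR_ge0/= ler_expR lerN2 exprS ler_peMr//.
  by rewrite exprn_ege1.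
- exact: cvg_cst.
- exact: cvgr_expR.
Unshelve. all: by end_near. Qed.

Lemma continuous_cpow (c : R) k x : {for x, continuous (fun r : R => c * r ^+ k)}.
Proof. by apply: continuousM; [exact: cst_continuous|exact: exprn_continuous]. Qed.

Lemma continuous_expRN_pow k x : {for x, continuous (fun r : R => expR (- r ^+ k.+1))}.
Proof. exact: (dv_continuous (dv_expR (dvN (dv_pow k x)))). Qed.

Lemma measurable_expRN_pow k : measurable_fun setT (fun r : R => expR (- r ^+ k)).
Proof. by apply: measurableT_comp => //; apply: measurableT_comp => //; exact: measurable_funX. Qed.

Lemma tail_expR_pow k (a : R) : 0 <= a ->
  (\int[lam]_w (indb (a < w)%R * (k.+1%:R * w ^+ k * expR (- w ^+ k.+1)))%:E =
   (expR (- a ^+ k.+1))%:E)%E.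
Proof.
move=> a0; apply: (etrans (@tail_line R (fun w => - expR (- w ^+ k.+1))
  (fun w => k.+1%:R * w ^+ k * expR (- w ^+ k.+1)) a 0 _ _ _ _ _)); last by rewrite sub0r opprK.
- apply: measurable_funM; last exact: measurable_expRN_pow.
  by apply: measurable_funM => //; exact: measurable_funX.
- by move=> x _; apply: (dv_eq (dvN (dv_expR (dvN (dv_pow k x))))); ring.
- move=> x _; apply: continuousM; [exact: continuous_cpow|exact: continuous_expRN_pow].
- by move=> x ax; rewrite !mulr_ge0 ?expR_ge0// exprn_ge0// (le_trans a0).
- by rewrite -oppr0; apply: cvgN; exact: cvg_expRN_pow.
Qed.

(** This is $\Gamma(\frac{m+1}{k+1})/(k+1)$; for odd k it plays the role of a Gaussian moment. *)
Definition exp_moment k m : \bar R :=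
  (\int[lam]_r (indb (0 < r)%R * (r ^+ m * expR (- r ^+ k.+1)))%:E)%E.

Lemma measurable_exp_moment k m :
  measurable_fun setT (fun r : R => r ^+ m * expR (- r ^+ k.+1)).
Proof.
by apply: measurable_funM; [exact: measurable_funX|exact: measurable_expRN_pow].
Qed.

Lemma exp_momentZ k m (c : R) : 0 <= c ->
  (\int[lam]_r (indb (0 < r)%R * (c * r ^+ m * expR (- r ^+ k.+1)))%:E =
   c%:E * exp_moment k m)%E.
Proof.
move=> c0; rewrite -intZ//.
- by apply: eq_int => r; rewrite -EFinM; congr (_%:E); ring.
- move=> r; rewrite lee_fin /indb; case: ltP => [r0|_]; rewrite ?mul0r// mul1r.
  by rewrite mulr_ge0 ?expR_ge0// exprn_ge0// ltW.
- apply/measurable_EFinP; apply: measurable_funM; first exact: measurable_fun_ltR.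
  exact: measurable_exp_moment.
Qed.

(** The absolute value is there because [tonelli_tail] wants a layer function that is nonnegative on
    the whole line. *)
Lemma int_pow_line m (w : R) : 0 <= w ->
  (\int[lam]_r (indb (0 < r)%R * (m.+1%:R * r ^+ m) * indb (`|r| < w)%R)%:E = (w ^+ m.+1)%:E)%E.
Proof.
move=> w0; have cf := @continuous_cpow m.+1%:R m.
have := @FTC2_line R (fun r => r ^+ m.+1) (fun r => m.+1%:R * r ^+ m) 0 w w0
  (fun x _ => dv_pow m x) (fun x _ => cf x) _.
rewrite expr0n subr0 => <- //; last by move=> x /andP[x0 _]; rewrite mulr_ge0// exprn_ge0.
have mf : measurable_fun [set: R] (EFin \o (fun r => m.+1%:R * r ^+ m)).
  by apply/measurable_EFinP; apply: measurable_funM => //; exact: measurable_funX.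
rewrite -!ge0_integral_line.
- rewrite [RHS]integral_itv_bndoo; last exact: (measurable_funS measurableT).
  rewrite [RHS]integral_mkcond; apply: eq_integral => r _; rewrite patchE.
  rewrite mem_setE in_itv/=; case: (ltP 0 r) => r0; last by rewrite indbE !mul0r.
  by rewrite gtr0_norm// indbE mul1r; case: ltP; rewrite indbE ?mulr1 ?mulr0.
- exact: measurable_itv.
- exact: (measurable_funS measurableT).
- by move=> x /=; rewrite in_itv/= lee_fin => /andP[x0 _]; rewrite mulr_ge0// exprn_ge0.
- exact: measurableT.
- apply/measurable_EFinP; apply: measurable_funM; last exact: measurable_fun_ltR.
  apply: measurable_funM; first exact: measurable_fun_ltR.
  exact/measurable_EFinP.
- move=> x _; rewrite lee_fin; case: (ltP 0 x) => r0; rewrite indbE ?mul0r// mul1r.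
  by rewrite !mulr_ge0// exprn_ge0// ltW.
Qed.

(* Integration by parts, as Tonelli's theorem applied to
   [e^{-r^(k+1)} = \int_r^oo (k+1) w^k e^{-w^(k+1)} dw]. *)
Lemma exp_moment_rec k m :
  (m.+1%:R%:E * exp_moment k m = k.+1%:R%:E * exp_moment k (m + k.+1))%E.
Proof.
have mabs : measurable_fun [set: R] (fun r : R => `|r|) by exact: measurableT_comp.
rewrite -!exp_momentZ//.
have := @tonelli_tail R _ R lam (fun r => `|r|) (fun r => indb (0 < r) * (m.+1%:R * r ^+ m))
  (fun w => k.+1%:R * w ^+ k * expR (- w ^+ k.+1)) (fun a => expR (- a ^+ k.+1)) mabs.
move=> H; transitivity (\int[lam]_r (indb (0 < r) * (m.+1%:R * r ^+ m) * expR (- `|r| ^+ k.+1))%:E)%E.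
  apply: eq_int => r; case: (ltP 0 r) => r0; rewrite indbE ?mul0r// !mul1r.
  by rewrite gtr0_norm.
rewrite H.
- apply: eq_int => w; case: (ltP 0 w) => w0; rewrite !indbE; last by rewrite !mul0r mul0e.
  rewrite int_pow_line ?ltW// -EFinM !mul1r; set E := expR _; congr (_%:E).
  by rewrite exprD !exprS; ring.
- apply: measurable_funM; first exact: measurable_fun_ltR.
  by apply: measurable_funM => //; exact: measurable_funX.
- apply: measurable_funM; last exact: measurable_expRN_pow.
  by apply: measurable_funM => //; exact: measurable_funX.
- move=> r; case: (ltP 0 r) => r0; rewrite indbE ?mul0r// mul1r.
  by rewrite mulr_ge0// exprn_ge0// ltW.
- by move=> w w0; rewrite !mulr_ge0 ?exprn_ge0 ?expR_ge0.
- by [].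
- by move=> a a0; exact: tail_expR_pow.
Qed.

Lemma exp_moment_base k : (k.+1%:R%:E * exp_moment k k = 1)%E.
Proof. by rewrite -exp_momentZ// tail_expR_pow// expr0n oppr0 expR0. Qed.

Lemma exp_moment_fact j : exp_moment 0 j = j`!%:R%:E.
Proof.
elim: j => [|j IH]; first by rewrite -(exp_moment_base 0) mul1e.
by have := exp_moment_rec 0 j; rewrite IH mul1e addn1 => <-; rewrite -EFinM -natrM factS.
Qed.

Lemma exp_moment3 j : exp_moment 3 (4 * j + 3) = (j`!%:R / 4)%:E.
Proof.
have div4 (x y : \bar R) : (4%:R%:E * x = 4%:R%:E * y -> x = y)%E.
  by move=> h; rewrite -[x]mul1e -[y]mul1e -(@mulVf _ (4%:R : R))// EFinM -!muleA h.
elim: j => [|j IH].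
  by apply: div4; rewrite exp_moment_base -EFinM mul1r mulfV.
apply: div4; rewrite (_ : (4 * j.+1 + 3 = (4 * j + 3) + 4)%N); last by rewrite mulnS -addnA addnC.
rewrite -exp_moment_rec IH -!EFinM; congr (_%:E).
rewrite factS natrM (_ : (4 * j + 3).+1 = 4 * j.+1)%N; last by rewrite mulnS -addnS addnC.
by rewrite natrM; field.
Qed.

Lemma exp_moment_gauss : exp_moment 1 0 = (Num.sqrt pi / 2)%:E.
Proof.
have <- := @integral0y_gauss R; rewrite /exp_moment -int_gt_line.
have mg := @measurable_exp_moment 1 0.
rewrite int_itv_oc_line//; last by move=> r; rewrite mul1r expR_ge0.
rewrite -ge0_integral_line//.
- by apply: eq_integral => r _; rewrite mul1r.
- by apply/measurable_EFinP; exact: measurable_funTS.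
- by move=> r _; rewrite lee_fin mul1r expR_ge0.
Qed.

Lemma exp_moment1 j : exists2 g : R, 0 < g & exp_moment 1 j.*2 = g%:E.
Proof.
elim: j => [|j [g g0 IH]].
  by exists (Num.sqrt pi / 2); [rewrite divr_gt0// sqrtr_gt0 pi_gt0|exact: exp_moment_gauss].
exists ((j.*2.+1)%:R / 2 * g); first by rewrite mulr_gt0// divr_gt0.
have := exp_moment_rec 1 j.*2; rewrite IH -EFinM addn2 -doubleS => h.
by rewrite -[LHS]mul1e -(@mulVf _ (2%:R : R))// EFinM -muleA -h -EFinM; congr (_%:E); field.
Qed.

(** The substitution v = r^(k+1). As [f] is continuous on the open half-line only, it is made on the
    intervals [1/(m+1), m+1] and carried to the limit by monotone convergence. *)
Lemma integral_pow_substitution k (f : R -> R) : measurable_fun setT f ->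
  (forall x, 0 < x -> {for x, continuous f}) -> (forall x, 0 < x -> 0 <= f x) ->
  (\int[lam]_(r in `]0%R, +oo[) (f (r ^+ k.+1) * (k.+1%:R * r ^+ k))%:E =
   \int[lam]_(v in `]0%R, +oo[) (f v)%:E)%E.
Proof.
move=> mf cf f0; pose a m : R := m.+1%:R^-1; pose b m : R := m.+1%:R.
have a0 m : 0 < a m by rewrite invr_gt0.
have b1 m : 1 <= b m by rewrite ler1n.
have a1 m : a m <= 1 by rewrite invf_le1// ler1n.
have aS i j : (i <= j)%N -> a j <= a i by move=> ij; rewrite lef_pV2 ?posrE// ler_nat.
have bS i j : (i <= j)%N -> b i <= b j by move=> ij; rewrite ler_nat.
have b0 m : 0 <= b m by [].
pose A m := `[a m, b m]%classic; pose B m := `[a m ^+ k.+1, b m ^+ k.+1]%classic.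
have ndA : nondecreasing_seq A.
  move=> i j ij; apply/subsetPset => x; rewrite /A /= !in_itv/= => /andP[h1 h2].
  by rewrite (le_trans (aS _ _ ij))// (le_trans h2 (bS _ _ ij)).
have ndB : nondecreasing_seq B.
  move=> i j ij; apply/subsetPset => x; rewrite /B /= !in_itv/= => /andP[h1 h2].
  rewrite (le_trans _ h1) ?(le_trans h2)//.
    by rewrite lerXn2r ?nnegrE//; exact: bS.
  by apply: lerXn2r; [rewrite nnegrE ltW|rewrite nnegrE ltW|exact: aS].
have ex x : 0 < x -> exists m, a m <= x <= b m.
  move=> x0; have xi : 0 <= x + x^-1 by apply: addr_ge0; rewrite ?invr_ge0; exact: ltW.
  (* A single bound for x + 1/x settles both endpoints. *)
  exists (Num.bound (x + x^-1)); have /ltW h := archi_boundP xi.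
  have hb : x + x^-1 <= b (Num.bound (x + x^-1)) by rewrite (le_trans h)// ler_nat.
  apply/andP; split; last by rewrite (le_trans _ hb)// lerDl invr_ge0 ltW.
  rewrite -[leRHS]invrK lef_pV2 ?posrE ?invr_gt0// (le_trans _ hb)// lerDr; exact: ltW.
have UA : \bigcup_m A m = `]0, +oo[%classic.
  apply/seteqP; split => x; rewrite /A /=.
    by move=> [m _] /=; rewrite !in_itv/= andbT => /andP[h _]; exact: lt_le_trans h.
  by rewrite in_itv/= andbT => /ex[m h]; exists m => //=; rewrite in_itv.
have UB : \bigcup_m B m = `]0, +oo[%classic.
  apply/seteqP; split => x; rewrite /B /=.
    move=> [m _] /=; rewrite !in_itv/= andbT => /andP[h _].
    by apply: lt_le_trans h; rewrite exprn_gt0.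
  rewrite in_itv/= andbT => /ex[m /andP[h1 h2]]; exists m => //=; rewrite in_itv/=.
  rewrite (le_trans _ h1) ?(le_trans h2)//; first by rewrite exprS ler_peMr// exprn_ege1.
  rewrite exprS; apply: ler_piMr; first exact: ltW.
  by apply: exprn_ile1 => //; exact: ltW.
have subA m x : A m x -> 0 < x by rewrite /A /= in_itv/= => /andP[+ _]; exact: lt_le_trans.
have subB m x : B m x -> 0 < x.
  by rewrite /B /= in_itv/= => /andP[+ _]; apply: lt_le_trans; rewrite exprn_gt0.
have mk : measurable_fun setT (fun r : R => f (r ^+ k.+1) * (k.+1%:R * r ^+ k)).
  apply: measurable_funM; first by apply: measurableT_comp => //; exact: measurable_funX.
  by apply: measurable_funM => //; exact: measurable_funX.
have k0 x : 0 < x -> 0 <= f (x ^+ k.+1) * (k.+1%:R * x ^+ k).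
  by move=> x0; rewrite !mulr_ge0 ?f0 ?exprn_gt0// exprn_ge0// ltW.
have mE (g : R -> R) (D : set R) : measurable_fun setT g -> measurable_fun D (EFin \o g).
  by move=> mg; apply/measurable_EFinP; exact: measurable_funTS.
have cA := @ge0_nondecreasing_set_cvg_integral _ R R A _ lam ndA
  (fun i => measurable_itv _) (fun i => mE _ (A i) mk) (fun i x h => k0 x (subA i x h)).
have cB := @ge0_nondecreasing_set_cvg_integral _ R R B _ lam ndB
  (fun i => measurable_itv _) (fun i => mE _ (B i) mf) (fun i x h => f0 x (subB i x h)).
rewrite UA in cA; rewrite UB in cB.
suff E : (fun i => \int[lam]_(x in A i) (f (x ^+ k.+1) * (k.+1%:R * x ^+ k))%:E)%E =
    (fun i => \int[lam]_(x in B i) (f x)%:E)%E.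
  by apply: (cvg_unique _ cA); rewrite // E.
apply/funext => m; rewrite -!ge0_integral_line; first last.
- by move=> x h; rewrite lee_fin; apply: k0; exact: (subA m).
- exact: mE.
- exact: measurable_itv.
- by move=> x h; rewrite lee_fin; apply: f0; exact: (subB m).
- exact: mE.
- exact: measurable_itv.
pose F (r : R) := r ^+ k.+1.
have F' : (derive1 F) = (fun r => k.+1%:R * r ^+ k).
  by apply/funext => r; rewrite derive1E; have [] := dv_pow k r.
have cF' x : {for x, continuous (derive1 F)} by rewrite F'; exact: continuous_cpow.
have ab : a m <= b m by exact: le_trans (a1 m) (b1 m).
have := @integration_by_substitution_increasing R F f (a m) (b m) ab.
rewrite F' => -> //.
- by move=> x y; rewrite !in_itv/= => /andP[h _] _ xy; rewrite /F ltrXn2r ?nnegrE ?(le_trans (ltW (a0 m)))// (le_trans h)// ltW.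
- by move=> x _; rewrite -F'; exact: cF'.
- by apply/cvg_ex; eexists; apply: cvg_at_right_filter; rewrite -F'; exact: cF'.
- by apply/cvg_ex; eexists; apply: cvg_at_left_filter; rewrite -F'; exact: cF'.
- split.
  + by move=> x _; have [] := dv_pow k x.
  + by apply: cvg_at_right_filter; exact: (dv_continuous (dv_pow k _)).
  + by apply: cvg_at_left_filter; exact: (dv_continuous (dv_pow k _)).
- apply: continuous_in_subspaceT => x; rewrite inE => h; apply: cf; exact: (subB m).
Qed.

Lemma Gamma_line (s : R) :
  Gamma_fun s = fine (\int[lam]_(t in `]0%R, +oo[) (t `^ (s - 1) * expR (- t))%:E)%E.
Proof.
rewrite /Gamma_fun /Rintegral ge0_integral_line//; last first.
  by move=> x _; rewrite lee_fin mulr_ge0 ?powR_ge0 ?expR_ge0.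
apply/measurable_EFinP; apply: measurable_funTS; apply: measurable_funM.
  exact: measurable_powR.
by apply: measurableT_comp => //; exact: oppr_measurable.
Qed.

Lemma Gamma_nat j : Gamma_fun j.+1%:R = j`!%:R :> R.
Proof.
rewrite Gamma_line int_gt_line; transitivity (fine (exp_moment 0 j)); last by rewrite exp_moment_fact.
congr fine; apply: eq_int => r; case: (ltP 0 r) => r0; rewrite indbE ?mul0r// !mul1r.
by rewrite -natr1 addrK powR_mulrn ?ltW// expr1.
Qed.

(** The substitution v = r^2. The Gaussian moment [g] is left unevaluated, since the integral over
    the sphere produces the same one. *)
Lemma Gamma_half j (g : R) : exp_moment 1 j.+1.*2 = g%:E ->
  Gamma_fun (j.+1%:R + 2^-1) = 2 * g.
Proof.
move=> hg; rewrite Gamma_line.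
pose f (v : R) := v `^ (j.+1%:R + 2^-1 - 1) * expR (- v).
have mf : measurable_fun setT f.
  by apply: measurable_funM; [exact: measurable_powR|apply: measurableT_comp => //; exact: oppr_measurable].
rewrite -(@integral_pow_substitution 1 f mf).
- rewrite int_gt_line; transitivity (fine (2%:E * exp_moment 1 j.+1.*2)%E); last by rewrite hg.
  congr fine; rewrite -exp_momentZ//; apply: eq_int => r; case: (ltP 0 r) => r0; rewrite indbE ?mul0r// !mul1r.
  rewrite /f expr1 (_ : (r ^+ 2) `^ _ = r ^+ j.*2.+1).
    by congr (_%:E); rewrite doubleS [in RHS]exprS; set E := expR _; ring.
  rewrite -powR_mulrn ?ltW// -powRrM -powR_mulrn ?ltW//; congr (_ `^ _).
  by rewrite -natr1 -[j.*2.+1%:R]natr1 -muln2 natrM; field.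
- move=> x x0; apply: (@continuousM _ _ (fun v => v `^ _) (fun v => expR (- v))).
    by apply: dv_continuous; exact: is_derive1_powR.
  exact: (dv_continuous (dv_expR (dvN (dv_id x)))).
- by move=> x x0; rewrite mulr_ge0 ?powR_ge0 ?expR_ge0.
Qed.


Lemma int_pow_ab m (a b : R) : 0 <= a -> a <= b ->
  (\int[lam]_w (indb (a < w)%R * (indb (w < b)%R * (m.+1%:R * w ^+ m)))%:E =
   (b ^+ m.+1 - a ^+ m.+1)%:E)%E.
Proof.
move=> a0 ab; have cf := @continuous_cpow m.+1%:R m.
rewrite -(@FTC2_line R (fun r => r ^+ m.+1) (fun r => m.+1%:R * r ^+ m) a b ab
  (fun x _ => dv_pow m x) (fun x _ => cf x)) //; last first.
  by move=> x /andP[x0 _]; rewrite mulr_ge0// exprn_ge0// (le_trans a0).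
have mf : measurable_fun [set: R] (EFin \o (fun r => m.+1%:R * r ^+ m)).
  by apply/measurable_EFinP; apply: measurable_funM => //; exact: measurable_funX.
rewrite -!ge0_integral_line.
- rewrite [RHS]integral_itv_bndoo; last exact: (measurable_funS measurableT).
  rewrite [RHS]integral_mkcond; apply: eq_integral => r _; rewrite patchE.
  rewrite mem_setE in_itv/=; case: (ltP a r) => r0; last by rewrite indbE !mul0r.
  by rewrite indbE mul1r; case: ltP; rewrite indbE ?mul1r ?mul0r.
- exact: measurable_itv.
- exact: (measurable_funS measurableT).
- by move=> x /=; rewrite in_itv/= lee_fin => /andP[x0 _]; rewrite mulr_ge0// exprn_ge0// (le_trans a0).
- exact: measurableT.
- apply/measurable_EFinP; apply: measurable_funM; first exact: measurable_fun_ltR.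
  apply: measurable_funM; first exact: measurable_fun_ltR.
  exact/measurable_EFinP.
- move=> x _; rewrite lee_fin; case: (ltP a x) => r0; rewrite indbE ?mul0r// mul1r.
  by rewrite !mulr_ge0// exprn_ge0// (le_trans a0)// ltW.
Qed.

End exponential_moments.

Section gaussian_moments.
Context (R : realType).
Local Notation lam := (@lebesgue_line R).

Definition rsq n (v : 'rV[R]_n) : R := \sum_(j < n) v ord0 j ^+ 2.

Lemma measurable_rsq n : measurable_fun setT (@rsq n).
Proof. by apply: measurable_sum => j; apply: measurable_funX; exact: measurable_coord. Qed.

Lemma measurable_expN d (T : measurableType d) (f : T -> R) :
  measurable_fun setT f -> measurable_fun setT (fun x => expR (- f x)).
Proof.
by move=> mf; apply: measurableT_comp => //; apply: measurableT_comp => //; exact: oppr_measurable.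
Qed.

Lemma rsq_cons n (t : R) (v : 'rV[R]_n) : rsq (row_cons (t, v)) = t ^+ 2 + rsq v.
Proof.
rewrite /rsq big_ord_recl; congr (_ ^+ 2 + _).
  by rewrite /row_cons mxE; case: splitP => j; rewrite ?mxE//; case: j.
apply: eq_bigr => j _; rewrite /row_cons mxE; case: splitP => [[[]]|k]//= e.
by congr (v _ _ ^+ 2); apply/val_inj; case: e.
Qed.

Lemma int_gauss_line : (\int[lam]_t (expR (- t ^+ 2))%:E = (Num.sqrt pi)%:E)%E.
Proof.
have <- := @integralT_gauss R; rewrite -ge0_integral_line//.
- by apply/measurable_EFinP; exact: measurable_expRN_pow.
Qed.

Lemma int_gauss_row n :
  (\int[@lebesgue_row R n]_v (expR (- rsq v))%:E = (Num.sqrt pi ^+ n)%:E)%E.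
Proof.
elim: n => [|n IH].
  rewrite (_ : (\int[_]_v _)%E = (\int[\d_(0%R : 'rV[R]_0)]_v (expR (- rsq v))%:E)%E)//.
  rewrite integral_dirac//; last by apply/measurable_EFinP; apply: measurable_expN; exact: measurable_rsq.
  by rewrite diracT mul1e /rsq big_ord0 oppr0 expR0.
have m0 : measurable_fun setT (fun v : 'rV[R]_n.+1 => (expR (- rsq v))%:E).
  by apply/measurable_EFinP; apply: measurable_expN; exact: measurable_rsq.
have m1 : measurable_fun setT (fun v : 'rV[R]_n => (expR (- rsq v))%:E).
  by apply/measurable_EFinP; apply: measurable_expN; exact: measurable_rsq.
rewrite integral_rowS//.
rewrite tonelli1; last 2 first.
- exact: (measurableT_comp m0 (@measurable_row_cons _ _)).
- by move=> v; rewrite lee_fin expR_ge0.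
under eq_integral => t _.
  under eq_integral => v _ do rewrite rsq_cons opprD expRD EFinM.
  rewrite intZ ?expR_ge0//.
  rewrite IH; over.
rewrite intZr ?exprn_ge0 ?sqrtr_ge0//.
- by rewrite int_gauss_line -EFinM exprS.
- by apply/measurable_EFinP; exact: measurable_expRN_pow.
Qed.

Context (n : nat).
Local Notation C := (Cn R n).
Local Notation H := (heis R n).
Local Notation muC := (@lebesgue_C R n).

Lemma sqn_rsq (z : C) : sqn z = rsq z.1 + rsq z.2.
Proof. exact: big_split. Qed.

Lemma int_gauss_C : (\int[muC]_z (expR (- sqn z))%:E = (pi ^+ n)%:E)%E.
Proof.
have m1 : measurable_fun setT (fun v : 'rV[R]_n => (expR (- rsq v))%:E).
  by apply/measurable_EFinP; apply: measurable_expN; exact: measurable_rsq.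
rewrite tonelli1; last 2 first.
- by apply/measurable_EFinP; apply: measurable_expN; exact: measurable_fun_sqn.
- by move=> v; rewrite lee_fin expR_ge0.
under eq_integral => x _.
  under eq_integral => y _ do rewrite sqn_rsq/= opprD expRD EFinM.
  rewrite intZ ?expR_ge0//.
  rewrite int_gauss_row; over.
rewrite intZr ?exprn_ge0 ?sqrtr_ge0//.
by rewrite int_gauss_row -EFinM -exprMn -expr2 sqr_sqrtr// pi_ge0.
Qed.

Definition sqn_moment k (w : R) : \bar R :=
  (\int[muC]_z (sqn z ^+ k * indb (sqn z < w)%R)%:E)%E.

Lemma measurable_sqn_moment k (w : R) :
  measurable_fun setT (fun z : C => sqn z ^+ k * indb (sqn z < w)).
Proof.
apply: measurable_funM; first by apply: measurable_funX; exact: measurable_fun_sqn.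
by apply: measurable_fun_ltR => //; exact: measurable_fun_sqn.
Qed.

(** Dilation of C^n by the square root of w, whose Jacobian is w^n. *)
Lemma sqn_moment_scale k (w : R) : 0 < w ->
  sqn_moment k w = ((w ^+ (k + n))%:E * sqn_moment k 1)%E.
Proof.
move=> w0; have s0 : 0 < Num.sqrt w by rewrite sqrtr_gt0.
have [_ h] := scales_C (0 : C) (lt0r_neq0 s0).
have g0 (z : C) : (0 <= (sqn z ^+ k * indb (sqn z < w))%:E)%E.
  by rewrite lee_fin mulr_ge0// exprn_ge0// sqn_ge0.
have mg : measurable_fun setT (fun z : C => (sqn z ^+ k * indb (sqn z < w))%:E).
  by apply/measurable_EFinP; exact: measurable_sqn_moment.
have := h _ mg g0; rewrite -/(sqn_moment k w).
rewrite (_ : (\int[muC]_x _)%E = ((w ^+ k)%:E * sqn_moment k 1)%E); last first.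
  rewrite -intZ ?exprn_ge0 ?ltW//.
  - apply: eq_int => z; rewrite addr0 sqnZ sqr_sqrtr ?ltW// -EFinM exprMn mulrA.
    by have -> : (w * sqn z < w) = (sqn z < 1) by rewrite -[X in _ < X]mulr1 ltr_pM2l.
  - by move=> z; rewrite lee_fin mulr_ge0// exprn_ge0// sqn_ge0.
  - by apply/measurable_EFinP; exact: measurable_sqn_moment.
rewrite gtr0_norm// -mul2n exprM sqr_sqrtr ?ltW// => E.
rewrite exprD mulrC EFinM -muleA E muleA -EFinM mulfV ?mul1e// expf_neq0// gt_eqF//.
Qed.

Lemma sqn_moment_fin k : sqn_moment k 1 \is a fin_num.
Proof.
rewrite ge0_fin_numE; last first.
  by apply: int_ge0 => z; rewrite lee_fin mulr_ge0// exprn_ge0// sqn_ge0.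
apply: (@le_lt_trans _ _ (\int[muC]_z ((expR 1)%:E * (expR (- sqn z))%:E))%E).
  apply: int_le.
  - by move=> z; rewrite lee_fin mulr_ge0// exprn_ge0// sqn_ge0.
  - by apply/measurable_EFinP; exact: measurable_sqn_moment.
  - apply/measurable_EFinP; apply: measurable_funM => //.
    by apply: measurable_expN; exact: measurable_fun_sqn.
  - move=> z; rewrite -EFinM lee_fin -expRD.
    case: (ltP (sqn z) 1) => z1; rewrite indbE ?mulr0 ?expR_ge0// mulr1.
    rewrite (@le_trans _ _ 1)//; first by apply: exprn_ile1; [exact: sqn_ge0|exact: ltW].
    by rewrite -[leLHS]expR0 ler_expR subr_ge0 ltW.
rewrite intZ ?expR_ge0//.
- by rewrite int_gauss_C -EFinM ltry.
- by apply/measurable_EFinP; apply: measurable_expN; exact: measurable_fun_sqn.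
Qed.

(** By layers over the balls |z|^2 < w, whose moments are powers of w by homogeneity, the integral
    is reduced to one moment of the unit ball. *)
Lemma int_sqn_exp k m :
  (\int[muC]_z (sqn z ^+ m * expR (- sqn z ^+ k.+1))%:E =
   k.+1%:R%:E * sqn_moment m 1 * exp_moment R k (k + (m + n)))%E.
Proof.
have mW : measurable_fun setT (fun z : C => sqn z ^+ m).
  by apply: measurable_funX; exact: measurable_fun_sqn.
rewrite (@tonelli_tail R _ _ muC (@sqn R n) (fun z => sqn z ^+ m)
  (fun w => k.+1%:R * w ^+ k * expR (- w ^+ k.+1)) (fun a => expR (- a ^+ k.+1))); first last.
- by move=> a a0; exact: tail_expR_pow.
- by move=> z; exact: sqn_ge0.
- by move=> w w0; rewrite !mulr_ge0 ?exprn_ge0 ?expR_ge0.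
- by move=> z; rewrite exprn_ge0// sqn_ge0.
- apply: measurable_funM; last exact: measurable_expRN_pow.
  by apply: measurable_funM => //; exact: measurable_funX.
- exact: mW.
- exact: measurable_fun_sqn.
have s0 : (0 <= sqn_moment m 1)%E.
  by apply: int_ge0 => z; rewrite lee_fin mulr_ge0// exprn_ge0// sqn_ge0.
have /fineK <- := sqn_moment_fin m; set s := fine _.
have s0' : 0 <= s by exact: fine_ge0.
transitivity (\int[lam]_w (indb (0 < w)%R * (k.+1%:R * s * w ^+ (k + (m + n)) * expR (- w ^+ k.+1)))%:E)%E.
  apply: eq_int => w; case: (ltP 0 w) => w0; rewrite indbE ?mul0r ?mul0e// !mul1r.
  rewrite -/(sqn_moment m w) sqn_moment_scale// -(fineK (sqn_moment_fin m)) -/s -!EFinM; congr (_%:E).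
  by rewrite [in RHS]exprD; set E := expR _; ring.
by rewrite exp_momentZ ?mulr_ge0// EFinM.
Qed.

(** The volume of the unit ball, read off from the Gaussian integral: $\pi^n$ is this volume times
    $n!$. *)
Lemma sqn_moment0 : sqn_moment 0 1 = (pi ^+ n / n`!%:R)%:E.
Proof.
have := int_sqn_exp 0 0; rewrite add0n mul1e exp_moment_fact.
under eq_integral => z _ do rewrite expr0 mul1r expr1.
rewrite int_gauss_C -(fineK (sqn_moment_fin 0)) -EFinM => -[->].
by rewrite mulfK// pnatr_eq0 -lt0n fact_gt0.
Qed.

(** Integrate 1 - |z|^(2m+2) over the unit ball by layers: the weight is (m+1) w^m for w < 1, and
    the volumes of the smaller balls are known multiples of that of the unit ball. *)
Lemma sqn_momentS m : ((m.+1 + n)%:R%:E * sqn_moment m.+1 1 = n%:R%:E * sqn_moment 0 1)%E.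
Proof.
set G := fun a : R => indb (a < 1) * (1 - a ^+ m.+1).
have mg : measurable_fun [set: R] (fun w : R => indb (w < 1) * (m.+1%:R * w ^+ m)).
  by apply: measurable_funM; [exact: measurable_fun_ltR|apply: measurable_funM => //; exact: measurable_funX].
have Ga a : 0 <= a -> (\int[lam]_w (indb (a < w)%R * (indb (w < 1)%R * (m.+1%:R * w ^+ m)))%:E = (G a)%:E)%E.
  move=> a0; rewrite /G; have [a1|a1] := ltP a 1.
    by rewrite int_pow_ab ?(ltW a1)// expr1n indbE mul1r.
  rewrite indbE mul0r integral0_eq// => w _; case: (ltP a w) => aw; rewrite indbE ?mul0r//.
  by rewrite mul1r ltNge (le_trans a1 (ltW aw))/= indbE mul0r.
have := @tonelli_tail R _ _ muC (@sqn R n) (fun=> 1) _ G (@measurable_fun_sqn R n _ _ id (@measurable_id _ _ setT))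
  (@measurable_cst _ _ _ _ _ _) mg (fun=> ler01) _ (@sqn_ge0 R n) Ga.
have g0 w : 0 <= w -> 0 <= indb (w < 1) * (m.+1%:R * w ^+ m) :> R by move=> w0; rewrite !mulr_ge0// exprn_ge0.
move=> /(_ g0).
under eq_integral => z _ do rewrite mul1r.
have /fineK E0 := sqn_moment_fin 0; have /fineK Em := sqn_moment_fin m.+1.
set s0 := fine _ in E0; set s := fine _ in Em.
have s0' : 0 <= s0 by apply: fine_ge0; apply: int_ge0 => z; rewrite lee_fin mulr_ge0// exprn_ge0// sqn_ge0.
rewrite [X in _ = X -> _](_ : _ = (s0 * m.+1%:R / (m + n).+1%:R)%:E); last first.
  transitivity (\int[lam]_w ((s0 * m.+1%:R / (m + n).+1%:R)%:E * (indb (0 < w)%R * (indb (w < 1)%R * ((m + n).+1%:R * w ^+ (m + n))))%:E))%E.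
    apply: eq_int => w; case: (ltP 0 w) => w0; rewrite indbE ?mul0r ?mul0e ?mule0// !mul1r.
    rewrite (_ : (\int[muC]_x _)%E = sqn_moment 0 w); last by apply: eq_int => z; rewrite expr0.
    rewrite sqn_moment_scale// -E0 -!EFinM add0n exprD; congr (_%:E); field.
    by rewrite -natrD nat1r pnatr_eq0.
  rewrite intZ.
  - by rewrite int_pow_ab// expr1n expr0n subr0 mule1.
  - by rewrite divr_ge0// mulr_ge0.
  - move=> w; rewrite lee_fin; case: (ltP 0 w) => w0; rewrite indbE ?mul0r// mul1r.
    by rewrite !mulr_ge0// exprn_ge0// ltW.
  - apply/measurable_EFinP; apply: measurable_funM; first exact: measurable_fun_ltR.
    by apply: measurable_funM; [exact: measurable_fun_ltR|apply: measurable_funM => //; exact: measurable_funX].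
move=> H; have : (sqn_moment 0 1 = (s0 * m.+1%:R / (m + n).+1%:R)%:E + sqn_moment m.+1 1)%E.
  rewrite -H -intD.
  - apply: eq_int => z; rewrite -EFinD; congr (_%:E); rewrite /G expr0; ring.
  - move=> z; rewrite lee_fin /G; have [z1|z1] := ltP; rewrite indbE ?mul0r// mul1r subr_ge0.
    by apply: exprn_ile1; [exact: sqn_ge0|exact: ltW].
  - apply/measurable_EFinP; rewrite /G; apply: measurable_funM.
      by apply: measurable_fun_ltR => //; exact: measurable_fun_sqn.
    by apply: measurable_funB => //; apply: measurable_funX; exact: measurable_fun_sqn.
  - by move=> z; rewrite lee_fin mulr_ge0// exprn_ge0// sqn_ge0.
  - by apply/measurable_EFinP; exact: measurable_sqn_moment.
rewrite -E0 -Em -EFinD -!EFinM => -[E]; congr (_%:E).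
have -> : s = s0 - s0 * m.+1%:R / (m + n).+1%:R by rewrite {1}E; ring.
rewrite addSn -[(m + n).+1%:R]natr1 -[m.+1%:R]natr1 natrD; field.
by rewrite -natrD natr1 pnatr_eq0.
Qed.

Lemma int_sqnS_exp (hn : (0 < n)%N) (g : R) : exp_moment R 1 n.*2 = g%:E ->
  (\int[muC]_z (sqn z ^+ n.+1 * expR (- sqn z ^+ 2))%:E = (pi ^+ n / n.-1`!%:R * g)%:E)%E.
Proof.
move=> hg; rewrite int_sqn_exp.
have := exp_moment_rec R 1 n.*2; rewrite hg -EFinM => E.
rewrite (_ : (1 + (n.+1 + n) = n.*2 + 2)%N); last by rewrite -addnn !addSn add0n addn2.
rewrite -muleA muleCA -E.
have := sqn_momentS n; rewrite sqn_moment0.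
have /fineK <- := sqn_moment_fin n.+1; rewrite -!EFinM => -[E2]; congr (_%:E).
have -> : fine (sqn_moment n.+1 1) = n%:R * (pi ^+ n / n`!%:R) / (n.+1 + n)%:R.
  by rewrite -E2 mulrC mulKf// pnatr_eq0 addSn.
have -> : n`! = (n * n.-1`!)%N by rewrite -{1}(prednK hn) factS prednK.
rewrite natrM addSn addnn.
have n0 : n%:R != 0 :> R by rewrite pnatr_eq0 -lt0n.
have f0 : (n.-1)`!%:R != 0 :> R by rewrite pnatr_eq0 -lt0n fact_gt0.
have d0 : n.*2.+1%:R != 0 :> R by rewrite pnatr_eq0.
move: n0 f0 d0; move: (n%:R : R) ((n.-1)`!%:R : R) (n.*2.+1%:R : R) (pi ^+ n : R) => a b c d a0 b0 c0.
by field; rewrite a0 b0 c0.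
Qed.

End gaussian_moments.

Section sphere_constants.
Context (R : realType) (n : nat).
Local Notation C := (Cn R n).
Local Notation H := (heis R n).
Local Notation Q := (@hdim n).
Local Notation muC := (@lebesgue_C R n).
Local Notation lam := (@lebesgue_line R).
Local Notation mu := (@haar R n).

Lemma int_haar_prod (f : C -> R) (g : R -> R) :
  measurable_fun setT f -> measurable_fun setT g ->
  (forall z, 0 <= f z) -> (forall t, 0 <= g t) ->
  (\int[lam]_t (g t)%:E \is a fin_num)%E ->
  (\int[mu]_p (f p.1 * g p.2)%:E = \int[muC]_z (f z)%:E * \int[lam]_t (g t)%:E)%E.
Proof.
move=> mf mg f0 g0 /fineK gE.
have mF : measurable_fun setT (fun p : H => (f p.1 * g p.2)%:E).
  apply/measurable_EFinP; apply: measurable_funM.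
    exact: (measurableT_comp mf measurable_fst).
  exact: (measurableT_comp mg measurable_snd).
have F0 (p : H) : (0 <= (f p.1 * g p.2)%:E)%E by rewrite lee_fin mulr_ge0.
have := tonelli1 muC lam mF F0; rewrite [X in X = _ -> _](_ : _ = \int[mu]_p (f p.1 * g p.2)%:E)%E// => ->.
have ge0 : 0 <= fine (\int[lam]_t (g t)%:E)%E by apply: fine_ge0; apply: int_ge0 => t; rewrite lee_fin.
rewrite -gE -intZr//; last exact/measurable_EFinP.
apply: eq_int => z; rewrite gE -intZ//; exact/measurable_EFinP.
Qed.

Lemma hdim_double : (Q = n.+1.*2)%N.
Proof. by rewrite /hdim mul2n addn2 doubleS. Qed.

Lemma enorm_hdim (z : C) : enorm z ^+ Q = sqn z ^+ n.+1.
Proof. by rewrite hdim_double -mul2n exprM enorm_sqr. Qed.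

Lemma measurable_hnorm : measurable_fun setT (@hnorm R n).
Proof.
rewrite (_ : @hnorm R n = fun p => hN4 p `^ 4^-1); last by apply/funext => p; rewrite hnormE.
apply: (measurableT_comp (measurable_powR _)); exact: measurable_fun_hN4.
Qed.

Lemma measurable_unit_sphere : measurable (@unit_sphere R n).
Proof.
rewrite (_ : unit_sphere = setT `&` @hnorm R n @^-1` [set 1]); last by rewrite setTI.
exact: measurable_hnorm.
Qed.

Lemma hN4_unit (p : H) : unit_sphere p -> hN4 p = 1.
Proof.
rewrite /unit_sphere/= hnormE => h.
have : (hN4 p `^ 4^-1) `^ 4 = 1 by rewrite h powR1.
by rewrite -powRrM mulVf// powRr1// hN4_ge0.
Qed.

Lemma sqn_unit (p : H) : unit_sphere p -> sqn p.1 <= 1.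
Proof.
move=> /hN4_unit h; have := sqn_le_hN4 p; rewrite h => h2.
by rewrite -(@ler_pXn2r _ 2)// ?nnegrE ?sqn_ge0// expr1n.
Qed.

Lemma enorm_unit (p : H) : unit_sphere p -> enorm p.1 <= 1.
Proof. by move=> /sqn_unit h; rewrite -(@ler_pXn2r _ 2)// ?nnegrE ?enorm_ge0// enorm_sqr expr1n. Qed.

Variable sigma : {measure set H -> \bar R}.
Hypothesis hsigma : sphere_measure sigma.
Local Notation Sg := (@unit_sphere R n).

Definition csphere_e : \bar R := (\int[sigma]_(p in Sg) (enorm p.1 ^+ Q)%:E)%E.

Lemma int_pos_line (f : R -> \bar R) : measurable_fun setT f ->
  (forall x, (0 < x)%R -> 0 <= f x)%E ->
  (\int[@lebesgue_measure R]_(r in `]0%R, +oo[) f r = \int[lam]_r ((indb (0 < r)%R)%:E * f r))%E.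
Proof.
move=> mf f0; rewrite ge0_integral_line//; [|exact: measurable_funTS|]; last first.
  by move=> x /=; rewrite in_itv/= andbT; exact: f0.
rewrite int_setE; apply: eq_int => x; rewrite muleC indicE; congr (_ * _)%E.
by congr ((nat_of_bool _)%:R%:E); apply/idP/idP; rewrite inE/= in_itv/= andbT.
Qed.

Lemma sphere_int_ge0 (f : H -> \bar R) : (forall p, 0 <= f p)%E ->
  (0 <= \int[sigma]_(p in Sg) f p)%E.
Proof. by move=> f0; apply: integral_ge0. Qed.

(** On a homogeneous factor times a function of the norm, the polar formula separates the sphere
    from the radius. *)
Lemma polar_product (f : H -> R) (g : R -> R) (k : nat) :
  measurable_fun setT f -> measurable_fun setT g ->
  (forall p, 0 <= f p) -> (forall r, 0 <= g r) ->
  (forall r p, 0 < r -> f (hdil r p) = r ^+ k * f p) ->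
  (\int[mu]_p (f p * g (hN4 p))%:E =
   \int[lam]_r ((indb (0 < r)%R * (r ^+ (k + Q.-1) * g (r ^+ 4)))%:E *
     \int[sigma]_(p in Sg) (f p)%:E))%E.
Proof.
move=> mf mg f0 g0 fh; rewrite (hsigma (h := fun p => (f p * g (hN4 p))%:E)); first last.
- by move=> p; rewrite lee_fin mulr_ge0.
- apply/measurable_EFinP; apply: measurable_funM => //.
  by apply: (measurableT_comp mg); exact: measurable_fun_hN4.
have E r : 0 < r -> (\int[sigma]_(p in Sg) ((f (hdil r p) * g (hN4 (hdil r p)))%:E * (r ^+ Q.-1)%:E) =
    (r ^+ (k + Q.-1) * g (r ^+ 4))%:E * \int[sigma]_(p in Sg) (f p)%:E)%E.
  move=> r0; rewrite -ge0_integralZl_EFin.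
  - apply: eq_integral => p /set_mem hp; rewrite -!EFinM fh// hN4_hdil (hN4_unit hp) mulr1 exprD.
    by congr (_%:E); ring.
  - exact: measurable_unit_sphere.
  - by move=> p _; rewrite lee_fin.
  - by apply/measurable_EFinP; exact: measurable_funTS.
  - by rewrite mulr_ge0// exprn_ge0// ltW.
have S0 : (0 <= \int[sigma]_(p in Sg) (f p)%:E)%E by apply: sphere_int_ge0 => p; rewrite lee_fin.
transitivity (\int[@lebesgue_measure R]_(r in `]0%R, +oo[)
    ((r ^+ (k + Q.-1) * g (r ^+ 4))%:E * \int[sigma]_(p in Sg) (f p)%:E))%E.
  by apply: eq_integral => r; rewrite inE/= in_itv/= andbT => /E.
rewrite int_pos_line.
- by apply: eq_int => r; rewrite muleA -EFinM.
- apply: emeasurable_funM => //; apply/measurable_EFinP; apply: measurable_funM; first exact: measurable_funX.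
  by apply: (measurableT_comp mg); exact: measurable_funX.
- by move=> r r0; rewrite mule_ge0// lee_fin mulr_ge0// exprn_ge0// ltW.
Qed.

Lemma polar_product' (f : H -> R) (g : R -> R) (k : nat) :
  measurable_fun setT f -> measurable_fun setT g ->
  (forall p, 0 <= f p) -> (forall r, 0 <= g r) ->
  (forall r p, 0 < r -> f (hdil r p) = r ^+ k * f p) ->
  (\int[mu]_p (f p * g (hN4 p))%:E =
   (\int[lam]_r (indb (0 < r)%R * (r ^+ (k + Q.-1) * g (r ^+ 4)))%:E) *
     \int[sigma]_(p in Sg) (f p)%:E)%E.
Proof.
move=> mf mg f0 g0 fh; rewrite (polar_product mf mg f0 g0 fh) ge0_integralZr//.
- apply/measurable_EFinP; apply: measurable_funM; first exact: measurable_fun_ltR.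
  apply: measurable_funM; first exact: measurable_funX.
  by apply: (measurableT_comp mg); exact: measurable_funX.
- move=> r _; rewrite lee_fin; case: (ltP 0 r) => r0; rewrite indbE ?mul0r// mul1r.
  by rewrite mulr_ge0// exprn_ge0// ltW.
- by apply: sphere_int_ge0 => p; rewrite lee_fin.
Qed.

Lemma measurable_expRN : measurable_fun setT (fun r : R => expR (- r)).
Proof. by apply: measurable_expN. Qed.

Lemma muleI_fin (a b : R) (x : \bar R) : 0 < a -> (a%:E * x = b%:E)%E -> x = (b / a)%:E.
Proof.
move=> a0 h; rewrite -[LHS]mul1e -(@mulVf _ a) ?gt_eqF// EFinM -muleA h -EFinM.
by rewrite mulrC.
Qed.

Lemma enorm_hdil (r : R) (p : H) : 0 < r -> enorm (hdil r p).1 = r * enorm p.1.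
Proof.
move=> r0; apply/eqP; rewrite -(@eqrXn2 _ 2)// ?enorm_ge0 ?mulr_ge0 ?enorm_ge0 ?ltW//.
by rewrite exprMn !enorm_sqr /hdil/= sqnZ.
Qed.

(** The polar formula is tested on |z|^Q exp(-N^4). As N^4 = |z|^4 + t^2, the integral over the
    group is a product of two known integrals, and on the other side the radial factor is n!/4. *)
Lemma csphere_formula (hn : (0 < n)%N) :
  csphere_e = (2 * pi `^ (n%:R + 1 / 2) * Gamma_fun ((Q%:R - 1) / 2)
    / (Gamma_fun (Q%:R / 2) * Gamma_fun n%:R))%:E /\
  0 < 2 * pi `^ (n%:R + 1 / 2) * Gamma_fun ((Q%:R - 1) / 2)
    / (Gamma_fun (Q%:R / 2) * Gamma_fun n%:R) :> R.
Proof.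
have [g g0 gE] := exp_moment1 R n.
have G1 : Gamma_fun (Q%:R / 2) = n`!%:R :> R.
  rewrite (_ : Q%:R / 2 = n.+1%:R) ?Gamma_nat//.
  by rewrite hdim_double -muln2 natrM mulfK.
have G2 : Gamma_fun n%:R = n.-1`!%:R :> R by rewrite -{1}(prednK hn) Gamma_nat.
have G3 : Gamma_fun ((Q%:R - 1) / 2) = 2 * g :> R.
  rewrite (_ : (Q%:R - 1) / 2 = n.-1.+1%:R + 2^-1); first by apply: Gamma_half; rewrite prednK.
  by rewrite prednK// hdim_double -muln2 natrM -natr1; field.
rewrite G1 G2 G3.
have pi1 : pi `^ (n%:R + 1 / 2) = pi ^+ n * Num.sqrt pi :> R.
  rewrite powRD; last by rewrite (gt_eqF (pi_gt0 R)) implybT.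
  by rewrite powR_mulrn ?pi_ge0// div1r powR12_sqrt// pi_ge0.
have f1 : 0 < n`!%:R :> R by rewrite ltr0n fact_gt0.
have f2 : 0 < n.-1`!%:R :> R by rewrite ltr0n fact_gt0.
have pg := pi_gt0 R; have sp : 0 < Num.sqrt (pi : R) by rewrite sqrtr_gt0.
split; last by rewrite pi1 divr_gt0 ?mulr_gt0// exprn_gt0.
have me : measurable_fun setT (fun p : H => enorm p.1 ^+ Q).
  by apply: measurable_funX; apply: measurable_fun_enorm; exact: measurable_fst.
have := @polar_product' (fun p => enorm p.1 ^+ Q) (fun r => expR (- r)) Q me measurable_expRN.
rewrite -/csphere_e (_ : (Q + Q.-1 = 4 * n + 3)%N); last first.
  by rewrite hdim_double doubleS /= -addnn; ring.
rewrite -/(exp_moment R 3 _) exp_moment3 => h.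
have {h} h : (\int[mu]_p (enorm p.1 ^+ Q * expR (- hN4 p))%:E = (n`!%:R / 4)%:E * csphere_e)%E.
  apply: h => [p|r|r p r0].
  - by rewrite exprn_ge0// enorm_ge0.
  - exact: expR_ge0.
  - by rewrite enorm_hdil// exprMn.
have := muleI_fin _ (esym (etrans _ h)) => /(_ (pi ^+ n / (n.-1)`!%:R * g * Num.sqrt pi)) ->.
- by congr (_%:E); rewrite pi1; field; rewrite !gt_eqF.
- by rewrite divr_gt0.
- rewrite [RHS](_ : _ = \int[mu]_p (sqn p.1 ^+ n.+1 * expR (- sqn p.1 ^+ 2) * expR (- p.2 ^+ 2))%:E)%E; last first.
    by apply: eq_int => p; rewrite enorm_hdim /hN4 opprD expRD mulrA.
  rewrite (@int_haar_prod (fun z => sqn z ^+ n.+1 * expR (- sqn z ^+ 2)) (fun t => expR (- t ^+ 2))).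
  + by rewrite (int_sqnS_exp hn gE) int_gauss_line -EFinM.
  + apply: measurable_funM; first by apply: measurable_funX; exact: measurable_fun_sqn.
    by apply: measurable_expN; apply: measurable_funX; exact: measurable_fun_sqn.
  + by apply: measurable_expN; exact: measurable_funX.
  + by move=> z; rewrite mulr_ge0 ?expR_ge0// exprn_ge0// sqn_ge0.
  + by move=> t; exact: expR_ge0.
  + by rewrite int_gauss_line.
Qed.

Definition csphere : R := (\int[sigma]_(p in Sg) (enorm p.1 ^+ Q))%R.

Lemma csphereE (hn : (0 < n)%N) : csphere_e = csphere%:E.
Proof. by rewrite /csphere /Rintegral -/csphere_e; have [-> _] := csphere_formula hn. Qed.

Lemma csphere_gt0 (hn : (0 < n)%N) : 0 < csphere.
Proof. by rewrite /csphere /Rintegral -/csphere_e; have [-> /=] := csphere_formula hn. Qed.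

Lemma A_const_csphere : A_const sigma = Q%:R^-1 * csphere `^ (- (Q%:R - 1)^-1).
Proof. by []. Qed.

Lemma powRN_inv (x s : R) : 0 <= x -> x `^ (- s) = x^-1 `^ s.
Proof. by move=> x0; rewrite -(powR_inv1 x0) -powRrM mulN1r. Qed.

Lemma A_const_Gamma (hn : (0 < n)%N) :
  A_const sigma = Q%:R^-1 * (Gamma_fun (Q%:R / 2) * Gamma_fun n%:R
     / (2 * pi `^ (n%:R + 1 / 2) * Gamma_fun ((Q%:R - 1) / 2))) `^ (Q%:R - 1)^-1.
Proof.
rewrite A_const_csphere /csphere /Rintegral -/csphere_e; have [-> /= c0] := csphere_formula hn.
move: c0; move: (2 * _ * _) (Gamma_fun _ * Gamma_fun _) ((Q%:R - 1)^-1) (Q%:R^-1) => x y s r c0.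
by rewrite (powRN_inv _ (ltW c0)) invf_div.
Qed.

Lemma haar_ball_fin : (\int[mu]_p (indb (hN4 p < 1)%R)%:E < +oo)%E.
Proof.
apply: (@le_lt_trans _ _ (\int[mu]_p ((expR 2 * expR (- sqn p.1)) * expR (- p.2 ^+ 2))%:E)%E).
  apply: int_le.
  - by move=> p; rewrite lee_fin.
  - by apply/measurable_EFinP; apply: measurable_fun_ltR => //; exact: measurable_fun_hN4.
  - apply/measurable_EFinP; apply: measurable_funM.
      by apply: measurable_funM => //; apply: measurable_expN; apply: measurable_fun_sqn; exact: measurable_fst.
    by apply: measurable_expN; apply: measurable_funX; exact: measurable_snd.
  - move=> p; rewrite lee_fin; case: (ltP (hN4 p) 1) => h; rewrite indbE; last by rewrite !mulr_ge0 ?expR_ge0.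
    rewrite -!expRD -[leLHS]expR0 ler_expR.
    have h1 : sqn p.1 ^+ 2 < 1 by apply: le_lt_trans h; exact: sqn_le_hN4.
    have h2 : p.2 ^+ 2 < 1 by apply: le_lt_trans h; rewrite lerDr sqr_ge0.
    by have := sqn_ge0 p.1; nra.
rewrite (@int_haar_prod (fun z => expR 2 * expR (- sqn z)) (fun t => expR (- t ^+ 2))).
- rewrite int_gauss_line; under eq_integral => z _ do rewrite EFinM.
  rewrite intZ ?expR_ge0//; first by rewrite int_gauss_C -!EFinM ltry.
  by apply/measurable_EFinP; apply: measurable_expN; exact: measurable_fun_sqn.
- by apply: measurable_funM => //; apply: measurable_expN; exact: measurable_fun_sqn.
- by apply: measurable_expN; exact: measurable_funX.
- by move=> z; rewrite mulr_ge0 ?expR_ge0.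
- by move=> t; exact: expR_ge0.
- by rewrite int_gauss_line.
Qed.

(** The polar formula for the indicator of the unit ball. All that is known of [sigma] is that
    formula, so its finiteness on the sphere has to come from the volume of the ball. *)
Lemma haar_ball_sphere :
  (\int[mu]_p (indb (hN4 p < 1)%R)%:E * (Q%:R)%:E = sigma Sg)%E.
Proof.
have := @polar_product' (fun=> 1) (fun r => indb (r < 1)) 0 (@measurable_cst _ _ _ _ _ _) _ (fun=> ler01) (fun=> indb_ge0 _ _).
under [X in (_ -> _ -> X = _) -> _]eq_integral => p _ do rewrite mul1r.
have Q0 : (0 < Q)%N by rewrite hdim_double.
have -> : (\int[lam]_r (indb (0 < r) * (r ^+ (0 + Q.-1) * indb (r ^+ 4 < 1)))%:E = (Q%:R^-1)%:E)%E.
  transitivity (\int[lam]_r ((Q%:R^-1)%:E * (indb (0 < r) * (Q.-1.+1%:R * r ^+ Q.-1) * indb (`|r| < 1))%:E))%E.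
    apply: eq_int => r; case: (ltP 0 r) => r0; rewrite indbE ?mul0r ?mule0// !mul1r add0n prednK//.
    rewrite -EFinM gtr0_norm// -{1}(@expr1n _ 4) ltr_pXn2r ?nnegrE ?ltW//.
    by rewrite !mulrA mulVf ?mul1r// pnatr_eq0 -lt0n.
  rewrite intZ ?invr_ge0//.
  - by rewrite int_pow_line// expr1n mule1.
  - by move=> r; rewrite lee_fin; case: (ltP 0 r) => r0; rewrite indbE ?mul0r// mul1r !mulr_ge0// exprn_ge0// ltW.
  - apply/measurable_EFinP; apply: measurable_funM; last by apply: measurable_fun_ltR => //; exact: measurableT_comp.
    apply: measurable_funM; first exact: measurable_fun_ltR.
    by apply: measurable_funM => //; exact: measurable_funX.
rewrite integral_cst ?mul1e; last exact: measurable_unit_sphere.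
move=> -> //.
- by rewrite muleAC -EFinM mulVf ?mul1e// pnatr_eq0 -lt0n.
- exact: measurable_fun_ltR.
- by move=> r p r0; rewrite mulr1 expr0.
Qed.

Lemma sphere_fin : (sigma Sg < +oo)%E.
Proof.
rewrite -haar_ball_sphere; have := haar_ball_fin.
have : (0 <= \int[mu]_p (indb (hN4 p < 1)%R)%:E)%E by apply: int_ge0 => p; rewrite lee_fin.
by case: (\int[mu]_p _)%E => // r _ _; rewrite -EFinM ltry.
Qed.

End sphere_constants.

(** * Horizontal spirals *)

Section restriction.
Local Open Scope ereal_scope.
Context d (T : measurableType d) (R : realType).
Variable m : {measure set T -> \bar R}.

(** The measure is the sum of its restrictions to [D] and to the complement, and each of these is
    carried by its own set. *)
Lemma integral_mrestr (D : set T) (mD : measurable D) (f : T -> \bar R) :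
  measurable_fun setT f -> (forall x, 0 <= f x) ->
  \int[mrestr m mD]_x f x = \int[m]_(x in D) f x.
Proof.
move=> mf f0; have mDC : measurable (~` D) by exact: measurableC.
have mE A : measurable A -> m A = measure_add (mrestr m mD) (mrestr m mDC) A.
  move=> mA; rewrite measure_addE.
  transitivity (m ((A `&` D) `|` (A `&` ~` D))); first by rewrite -setIUr setUv setIT.
  apply: measureU; [exact: measurableI|exact: measurableI|].
  by rewrite setIACA setICr setI0.
rewrite [RHS](eq_measure_integral (measure_add (mrestr m mD) (mrestr m mDC))) => [|A mA _]; last exact: mE.
rewrite ge0_integral_measure_add//; last exact: measurable_funTS.
rewrite [X in _ = _ + X](_ : _ = 0) ?adde0; last first.
  rewrite (@ge0_negligible_integral _ _ _ _ D D)//.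
  - by rewrite setDv integral_set0.
  - exact: measurable_funTS.
  - by transitivity (m (D `&` ~` D)) => //; rewrite setICr measure0.
rewrite (@ge0_negligible_integral _ _ _ _ setT (~` D))//.
- by rewrite setTD setCK.
- by transitivity (m (~` D `&` D)) => //; rewrite setICl measure0.
Qed.

End restriction.

Section sphere_fubini.
Context (R : realType) (n : nat).
Local Notation H := (heis R n).
Local Notation Q := (@hdim n).
Local Notation lam := (@lebesgue_line R).
Local Notation mu := (@haar R n).
Local Notation Sg := (@unit_sphere R n).
Variable sigma : {measure set H -> \bar R}.
Hypothesis hsigma : sphere_measure sigma.

(** Nothing is known of [sigma] off the sphere; the restriction to the sphere is a finite measure,
    to which Tonelli's theorem applies. *)
Let sph := mrestr sigma (@measurable_unit_sphere R n).

Let sph_fin : fin_num_fun sph.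
Proof.
move=> A mA; rewrite ge0_fin_numE//; apply: le_lt_trans (sphere_fin hsigma).
rewrite /sph /mrestr; apply: le_measure; rewrite ?inE.
- by apply: measurableI => //; exact: measurable_unit_sphere.
- exact: measurable_unit_sphere.
- exact: subIsetr.
Qed.

HB.instance Definition _ := Measure.on sph.
HB.instance Definition _ := Measure_isFinite.Build _ _ _ sph sph_fin.

Lemma sphere_tonelli (F : H * R -> \bar R) : measurable_fun setT F ->
  (forall x, 0 <= F x)%E ->
  (\int[sigma]_(p in Sg) \int[lam]_r F (p, r) =
   \int[lam]_r \int[sigma]_(p in Sg) F (p, r))%E.
Proof.
move=> mF F0; have E := @fubini_tonelli _ _ _ _ R sph lam F mF F0.
have E1 : (\int[sph]_p \int[lam]_r F (p, r) = \int[sigma]_(p in Sg) \int[lam]_r F (p, r))%E.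
  apply: integral_mrestr; last by move=> p; apply: int_ge0.
  exact: (measurable_int2 lam mF F0).
rewrite -E1 E; apply: eq_int => r; apply: integral_mrestr => //.
exact: (measurableT_comp mF).
Qed.

(** The radius becomes the inner variable because a spiral is followed with its point on the sphere
    fixed. *)
Lemma polar_swap (h : H -> \bar R) : measurable_fun setT h -> (forall p, 0 <= h p)%E ->
  (\int[mu]_p h p =
   \int[sigma]_(p in Sg) \int[lam]_r ((indb (0 < r)%R * r ^+ Q.-1)%:E * h (hdil r p)))%E.
Proof.
move=> mh h0.
have mF : measurable_fun setT (fun x : H * R => ((indb (0 < x.2)%R * x.2 ^+ Q.-1)%:E * h (hdil x.2 x.1))%E).
  apply: emeasurable_funM.
    apply/measurable_EFinP; apply: measurable_funM; first exact: measurable_fun_ltR.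
    by apply: measurable_funX; exact: measurable_snd.
  by apply: (measurableT_comp mh); apply: measurable_fun_hdil; [exact: measurable_snd|exact: measurable_fst].
have F0 (x : H * R) : (0 <= (indb (0 < x.2)%R * x.2 ^+ Q.-1)%:E * h (hdil x.2 x.1))%E.
  rewrite mule_ge0// lee_fin; case: (ltP 0 x.2) => r0; rewrite indbE ?mul0r// mul1r.
  by rewrite exprn_ge0// ltW.
rewrite (sphere_tonelli mF F0) (hsigma mh h0)/=.
have mh' r : measurable_fun setT (fun p => h (hdil r p)).
  by apply: (measurableT_comp mh); exact: measurable_fun_hdil.
pose G r := (\int[sigma]_(p in Sg) ((indb (0 < r)%R * r ^+ Q.-1)%:E * h (hdil r p)))%E.
have mG : measurable_fun setT G.
  rewrite (_ : G = fun r => \int[sph]_p ((indb (0 < r)%R * r ^+ Q.-1)%:E * h (hdil r p)))%E.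
    exact: (measurable_int1 sph mF F0).
  apply/funext => r; apply/esym/integral_mrestr; last by move=> p; exact: (F0 (p, r)).
  exact: (measurableT_comp mF (measurable_fun_pair (@measurable_id _ _ setT) (@measurable_cst _ _ _ _ _ r))).
have G0 r : (0 <= G r)%E by apply: sphere_int_ge0 => p; exact: (F0 (p, r)).
transitivity (\int[@lebesgue_measure R]_(r in `]0%R, +oo[) G r)%E.
  apply: eq_integral => r; rewrite inE/= in_itv/= andbT => r0; apply: eq_integral => p _.
  by rewrite r0 indbE mul1r muleC.
rewrite int_pos_line//; apply: eq_int => r; rewrite -/(G r); case: (ltP 0 r) => r0; rewrite indbE ?mul1e//.
rewrite mul0e /G integral0_eq// => p _; by rewrite ltNge r0 indbE mul0r mul0e.
Qed.

End sphere_fubini.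

Section periodic.
Context (R : realType).
Local Notation lam := (@lebesgue_line R).

Lemma measurable_fun_inv_ge0 d (T : measurableType d) (f : T -> R) :
  (forall x, 0 <= f x) -> measurable_fun setT f ->
  measurable_fun setT (fun x => (f x)^-1).
Proof.
move=> f0 mf; rewrite (_ : (fun _ => _) = (fun x => f x `^ (-1))).
  exact: (measurableT_comp (measurable_powR _) mf).
by apply/funext => x; rewrite powR_inv1.
Qed.

Variables (P : R) (F : R -> \bar R).
Hypotheses (P0 : 0 < P) (mF : measurable_fun setT F) (F0 : forall x, (0 <= F x)%E).
Hypothesis FP : forall x, F (x + P) = F x.

Let FPn (k : nat) x : F (x + k%:R * P) = F x.
Proof.
elim: k x => [|k IH] x; first by rewrite mul0r addr0.
by rewrite -natr1 mulrDl mul1r addrA FP IH.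
Qed.

Let FPz (k : int) x : F (x + k%:~R * P) = F x.
Proof.
case: k => k; first exact: FPn.
by rewrite NegzE mulrNz mulNr -[in RHS](subrK (k.+1%:R * P) x) FPn.
Qed.

Let mind (a b : R) (G : R -> \bar R) : measurable_fun setT G ->
  measurable_fun setT (fun x => ((indb (a <= x)%R * indb (x < b)%R)%:E * G x)%E).
Proof.
move=> mG; apply: emeasurable_funM => //; apply/measurable_EFinP.
by apply: measurable_funM; [exact: measurable_fun_leR|exact: measurable_fun_ltR].
Qed.

Let ind0 (a b : R) (G : R -> \bar R) x : (forall x, 0 <= G x)%E ->
  (0 <= (indb (a <= x)%R * indb (x < b)%R)%:E * G x)%E.
Proof. by move=> G0; rewrite mule_ge0// lee_fin mulr_ge0. Qed.

(** After reduction of the shift modulo [P], the part of the window that sticks out of [0, P) on the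
    right is moved back to the left end by one period. *)
Lemma integral_period (a : R) :
  (\int[lam]_x ((indb (0 <= x)%R * indb (x < P)%R)%:E * F (x + a)) =
   \int[lam]_x ((indb (0 <= x)%R * indb (x < P)%R)%:E * F x))%E.
Proof.
pose b := a - (Num.floor (a / P))%:~R * P.
have /andP[b0 bP] : 0 <= b < P.
  have /andP[h1 h2] := floor_itv (a / P); rewrite /b subr_ge0 ltrBlDl.
  rewrite -ler_pdivlMr// h1/= -[X in _ + X]mul1r -mulrDl -ltr_pdivrMr//.
  by move: h2; rewrite intrD.
transitivity (\int[lam]_x ((indb (0 <= x)%R * indb (x < P)%R)%:E * F (x + b)))%E.
  apply: eq_int => x; congr (_ * _)%E.
  by rewrite -(FPz (Num.floor (a / P)) (x + b)) /b addrA subrK.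
have mFa (c : R) : measurable_fun setT (fun x : R => F (x + c)).
  by apply: (measurableT_comp mF); exact: measurable_funD.
have [_ Tb] := scales_translate b; have [_ TP] := scales_translate P.
pose I (u v : R) := (\int[lam]_x ((indb (u <= x)%R * indb (x < v)%R)%:E * F x))%E.
have split3 u v w : u <= v -> v <= w -> (I u w = I u v + I v w)%E.
  move=> uv vw; rewrite /I -intD//; [|by move=> x; exact: ind0|exact: mind|by move=> x; exact: ind0|exact: mind].
  apply: eq_int => x; rewrite -ge0_muleDl ?lee_fin ?mulr_ge0// -EFinD; congr (_%:E * _)%E.
  rewrite /indb; case: (leP u x) => ux; case: (ltP x v) => xv.
  - by rewrite (lt_le_trans xv vw) mul0r addr0.
  - by rewrite mulr0 add0r.
  - by rewrite !mul0r addr0.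
  - by have := le_lt_trans xv ux; rewrite ltNge uv.
transitivity (I b (b + P)).
  have := Tb (fun x => ((indb (b <= x)%R * indb (x < b + P)%R)%:E * F x)%E) (mind _ _ mF) (fun x => ind0 _ _ _ F0).
  rewrite mul1e /I => <-; apply: eq_int => x.
  by rewrite lerDr [_ + P]addrC ltrD2r.
have E : I P (b + P) = I 0 b.
  have := TP (fun x => ((indb (P <= x)%R * indb (x < b + P)%R)%:E * F x)%E) (mind _ _ mF) (fun x => ind0 _ _ _ F0).
  rewrite mul1e /I => <-; apply: eq_int => x.
  by rewrite lerDr ltrD2r FP.
have h1 : P <= b + P by rewrite lerDr.
by rewrite (split3 b P (b + P) (ltW bP) h1) E addeC -(split3 0 b P b0 (ltW bP)).
Qed.

End periodic.

Section crossing.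
Context (R : realType).

Lemma near_gt (f : R -> R) (x s : R) : {for x, continuous f} -> s < f x ->
  exists2 e, 0 < e & forall y, `|x - y| < e -> s < f y.
Proof.
move=> cf h; have h' : nbhs x [set y | s < f y] by exact: (cvgr_gt (f x) cf _ h).
case/nbhs_ballP: h' => e /= e0 he.
by exists e => // y hy; exact: he.
Qed.

Lemma near_lt (f : R -> R) (x s : R) : {for x, continuous f} -> f x < s ->
  exists2 e, 0 < e & forall y, `|x - y| < e -> f y < s.
Proof.
move=> cf h; have h' : nbhs x [set y | f y < s] by exact: (cvgr_lt (f x) cf _ h).
case/nbhs_ballP: h' => e /= e0 he.
by exists e => // y hy; exact: he.
Qed.

(** The time is the infimum of the times at which f is at most s; continuity excludes any value
    there other than s. *)
Lemma first_time (f : R -> R) (a b s : R) : a <= b ->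
  (forall r, a <= r <= b -> {for r, continuous f}) -> s < f a -> f b <= s ->
  exists c, [/\ a < c <= b, f c = s & forall r, a <= r < c -> s < f r].
Proof.
move=> ab cf fa fb; pose A := [set r | a <= r <= b /\ f r <= s].
have Ab : A b by split=> //; rewrite ab lexx.
have hA : has_inf A by split; [exists b|exists a => r [/andP[]]].
have ac : a <= inf A by apply: lb_le_inf; [exists b|move=> r [/andP[]]].
have cb : inf A <= b by apply: ge_inf => //; case: hA.
have cfc : {for inf A, continuous f} by apply: cf; rewrite ac cb.
have fc : f (inf A) <= s.
  rewrite leNgt; apply/negP => h.
  have [e e0 he] := near_gt cfc h.
  have [r [rab rs] re] := inf_adherent e0 hA.
  have rc : inf A <= r by apply: ge_inf; [case: hA|split].
  by have := he r; rewrite distrC ger0_norm ?subr_ge0// ltrBlDl => /(_ re); rewrite /= ltNge rs.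
have lt r : a <= r < inf A -> s < f r.
  move=> /andP[ar rc]; rewrite ltNge; apply/negP => h.
  have : inf A <= r by apply: ge_inf; [case: hA|split=> //; rewrite ar (le_trans (ltW rc))].
  by rewrite leNgt rc.
have ac' : a < inf A by rewrite lt_neqAle ac andbT; apply/eqP => h; move: fa; rewrite h ltNge fc.
exists (inf A); split => //; first by rewrite ac'.
apply/eqP; rewrite eq_le fc/= leNgt; apply/negP => h.
have [e e0 he] := near_lt cfc h.
pose r := Num.max a (inf A - e / 2).
have rA : r < inf A by rewrite /r gt_max ac' ltrBlDr ltrDl divr_gt0.
have ar : a <= r by rewrite /r le_max lexx.
have := lt r; rewrite ar rA => /(_ isT); rewrite ltNge => /negP; apply; apply: ltW; apply: he.
rewrite gtr0_norm ?subr_gt0// ltrBlDl -ltrBlDr; apply: (@lt_le_trans _ _ (inf A - e / 2)).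
  by rewrite ltrD2l ltrN2 ltr_pdivrMr// mulr_natr mulr2n ltrDl.
by rewrite /r le_max lexx orbT.
Qed.

(** After the first arrival at s, reversing time and sign turns [first_time] into the last passage
    at t before it. In between f stays in the open layer, so the gradient restricted to the layer
    accounts for the whole descent. *)
Lemma crossing (f : R -> R) (a b s t : R) : a <= b -> s < t ->
  (forall r, a <= r <= b -> {for r, continuous f}) -> t <= f a -> f b <= s ->
  exists c d, [/\ a <= c, c < d, d <= b, f c = t & f d = s /\ forall r, c < r < d -> s < f r < t].
Proof.
move=> ab st cf fa fb.
have [d [/andP[ad db] fd hd]] := first_time ab cf (lt_le_trans st fa) fb.
have cg r : - d <= r <= - a -> {for r, continuous (fun r => - f (- r))}.
  move=> /andP[h1 h2]; apply: continuousN; apply: continuous_comp; first exact: opp_continuous.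
  by apply: cf; rewrite lerNr h2/= (le_trans _ db)// lerNl.
have h1 : - d <= - a by rewrite lerN2 ltW.
have h2 : - t < - f (- - d) by rewrite opprK fd ltrN2.
have h3 : - f (- - a) <= - t by rewrite opprK lerN2.
have [c [/andP[dc ca] fc hc]] := first_time h1 cg h2 h3.
exists (- c), d; split => //; first by rewrite lerNr.
- by rewrite ltrNl.
- by apply: oppr_inj.
- split=> // r /andP[cr rd]; rewrite hd ?rd ?andbT/=; last first.
    by rewrite ltW// (le_lt_trans _ cr)// lerNr.
  by rewrite -ltrN2 -[r]opprK hc// lerN2 (ltW rd)/= ltrNl.
Qed.

End crossing.

Section twist.
Context (R : realType) (n : nat).
Local Notation C := (Cn R n).
Local Notation H := (heis R n).
Local Notation Q := (@hdim n).
Local Notation lam := (@lebesgue_line R).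
Local Notation mu := (@haar R n).
Local Notation Sg := (@unit_sphere R n).

Lemma hnorm_ge0 (p : H) : 0 <= hnorm p.
Proof. exact: powR_ge0. Qed.

Lemma hnorm_exp4 (p : H) : hnorm p ^+ 4 = hN4 p.
Proof. by rewrite hnormE -powR_mulrn ?powR_ge0// -powRrM mulVf// powRr1// hN4_ge0. Qed.

Lemma hnorm_hdil (r : R) (p : H) : 0 < r -> hnorm (hdil r p) = r * hnorm p.
Proof.
move=> r0; apply/eqP; rewrite -(@eqrXn2 _ 4)// ?hnorm_ge0 ?mulr_ge0 ?hnorm_ge0 ?ltW//.
by rewrite exprMn !hnorm_exp4 hN4_hdil.
Qed.

Lemma hnormN (p : H) : hnorm (- p) = hnorm p.
Proof. by rewrite !hnormE hN4N. Qed.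

Lemma enorm_le_hnorm (p : H) : enorm p.1 <= hnorm p.
Proof.
rewrite -(@ler_pXn2r _ 4)// ?nnegrE ?enorm_ge0 ?hnorm_ge0// hnorm_exp4 enorm_exp4.
exact: sqn_le_hN4.
Qed.

(** On a dilation orbit t/|z|^2 is constant and ln N grows like ln r, so rotating by this angle
    bends the orbit into a spiral. Where z = 0 the inverse is 0 and the angle vanishes. *)
Definition twist_angle (p : H) : R := p.2 * (sqn p.1)^-1 * ln (hnorm p).

Definition twist (p : H) : H := (crot (cos (twist_angle p)) (sin (twist_angle p)) p.1, p.2).

Definition spiral (p : H) (r : R) : H := twist (hdil r p).

Definition hrot (a : R) (p : H) : H := (crot (cos a) (sin a) p.1, p.2).

Lemma measurable_twist_angle : measurable_fun setT twist_angle.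
Proof.
apply: measurable_funM; last first.
  by apply: (measurableT_comp (@measurable_ln R)); exact: measurable_hnorm.
apply: measurable_funM; first exact: measurable_snd.
by apply: measurable_fun_inv_ge0 => [p|]; [exact: sqn_ge0|apply: measurable_fun_sqn; exact: measurable_fst].
Qed.

Lemma measurable_cosR : measurable_fun setT (@cos R).
Proof. exact: continuous_measurable_fun (@continuous_cos R). Qed.

Lemma measurable_sinR : measurable_fun setT (@sin R).
Proof. exact: continuous_measurable_fun (@continuous_sin R). Qed.

Lemma measurable_fun_hrot d (T : measurableType d) (a : T -> R) (f : T -> H) :
  measurable_fun setT a -> measurable_fun setT f ->
  measurable_fun setT (fun x => hrot (a x) (f x)).
Proof.
move=> ma mf; apply: measurable_fun_pair; last exact: measurable_fun_snd.
apply: measurable_fun_crot; last exact: measurable_fun_fst.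
  exact: (measurableT_comp measurable_cosR ma).
exact: (measurableT_comp measurable_sinR ma).
Qed.

Lemma measurable_twist : measurable_fun setT twist.
Proof. by apply: measurable_fun_hrot => //; exact: measurable_twist_angle. Qed.

Lemma sqn_hrot a (p : H) : sqn (hrot a p).1 = sqn p.1.
Proof. by rewrite sqn_crot// cos2Dsin2. Qed.

Lemma hnorm_hrot a (p : H) : hnorm (hrot a p) = hnorm p.
Proof. by rewrite !hnormE /hN4 sqn_hrot. Qed.

Lemma enorm_hrot a (p : H) : enorm (hrot a p).1 = enorm p.1.
Proof. by rewrite /enorm -/(sqn _) -/(sqn p.1) sqn_hrot. Qed.

Lemma hrotD a b (p : H) : hrot a (hrot b p) = hrot (a + b) p.
Proof.
rewrite /hrot /crot cosD sinD /=; congr (_, _, _); apply/rowP => i; rewrite !mxE; ring.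
Qed.

Lemma twist_angle_hrot a (p : H) : twist_angle (hrot a p) = twist_angle p.
Proof. by rewrite /twist_angle sqn_hrot hnorm_hrot. Qed.

Lemma twist_hrot a (p : H) : twist (hrot a p) = hrot (a + twist_angle p) p.
Proof.
rewrite /twist -/(hrot (twist_angle (hrot a p)) (hrot a p)) hrotD addrC.
by rewrite twist_angle_hrot.
Qed.

Lemma hrot2pi a (p : H) : hrot (a + pi *+ 2) p = hrot a p.
Proof. by rewrite /hrot cosD2pi sinD2pi. Qed.

(* [twist] is not a single rotation, but averaging over all rotations turns the
   point-dependent angle into a translation of a periodic integrand. *)
Lemma scales_twist : scales mu twist 1.
Proof.
split; first exact: measurable_twist.
move=> h mh h0; rewrite mul1e.
pose w (a : R) := indb (0 <= a) * indb (a < pi *+ 2) : R.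
have mw : measurable_fun setT w.
  by apply: measurable_funM; [exact: measurable_fun_leR|exact: measurable_fun_ltR].
have w0 a : 0 <= w a by rewrite mulr_ge0.
have p2 : 0 < (pi : R) *+ 2 by rewrite pmulrn_lgt0// pi_gt0.
have W : (\int[lam]_a (w a)%:E = (pi *+ 2 : R)%:E)%E.
  rewrite (_ : (\int[lam]_a _)%E = \int[lam]_a (\1_(`[0%R, pi *+ 2[%classic : set R) a)%:E)%E.
    rewrite int_indic//; have := @lebesgue_measure_itv R (`[0%R, pi *+ 2[)%R.
    by rewrite /= lte_fin p2 sube0 => <-.
  apply: eq_int => a; rewrite indicE mem_setE in_itv/= /w /indb.
  by case: (0 <= a); rewrite ?mul1r ?mul0r.
have rotE (g : H -> \bar R) : measurable_fun setT g -> (forall p, 0 <= g p)%E ->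
    (\int[mu]_p \int[lam]_a ((w a)%:E * g (hrot a p)) = (pi *+ 2 : R)%:E * \int[mu]_p g p)%E.
  move=> mg g0.
  have mG : measurable_fun setT (fun x : H * R => ((w x.2)%:E * g (hrot x.2 x.1))%E).
    apply: emeasurable_funM; first by apply/measurable_EFinP; exact: (measurableT_comp mw measurable_snd).
    by apply: (measurableT_comp mg); apply: measurable_fun_hrot; [exact: measurable_snd|exact: measurable_fst].
  have G0 (x : H * R) : (0 <= (w x.2)%:E * g (hrot x.2 x.1))%E by rewrite mule_ge0 ?lee_fin ?w0.
  rewrite (tonelli mu lam mG G0).
  have I0 : (0 <= \int[mu]_p g p)%E by exact: int_ge0.
  transitivity (\int[lam]_a ((w a)%:E * \int[mu]_p g p))%E.
    apply: eq_int => a; rewrite /= intZ//.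
      have [_ ha] := scales_haar_crot n (cos2Dsin2 a).
      by congr (_ * _)%E; have := ha g mg g0; rewrite mul1e.
    by apply: (measurableT_comp mg); exact: measurable_fun_hrot.
  rewrite ge0_integralZr ?W//; first exact/measurable_EFinP.
  by move=> a _; rewrite lee_fin w0.
have cancel (x y : \bar R) : ((pi *+ 2 : R)%:E * x = (pi *+ 2 : R)%:E * y -> x = y)%E.
  by move=> e; rewrite -[x]mul1e -[y]mul1e -(@mulVf _ (pi *+ 2 : R)) ?gt_eqF// EFinM -!muleA e.
apply: cancel; rewrite -(rotE h mh h0) -(rotE (h \o twist)); last 2 first.
- exact: (measurableT_comp mh measurable_twist).
- by move=> p; exact: h0.
apply: eq_int => p; rewrite /=.
under eq_integral => a _ do rewrite twist_hrot.
apply: (@integral_period R (pi *+ 2) (fun a => h (hrot a p)) p2) => //.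
- by apply: (measurableT_comp mh); exact: measurable_fun_hrot.
- by move=> a; rewrite hrot2pi.
Qed.

Lemma twistE (p : H) : twist p = hrot (twist_angle p) p. Proof. by []. Qed.

Definition hker (p : H) : R := enorm p.1 ^+ Q.-1 / hnorm p ^+ (Q.-1 + Q.-1).

Lemma hker_ge0 p : 0 <= hker p.
Proof. by rewrite divr_ge0// exprn_ge0// ?enorm_ge0 ?hnorm_ge0. Qed.

Lemma hker_twist p : hker (twist p) = hker p.
Proof. by rewrite twistE /hker enorm_hrot hnorm_hrot. Qed.

Lemma hkerN p : hker (- p) = hker p.
Proof. by rewrite /hker hnormN /enorm -!/(sqn _) sqnN. Qed.

Lemma measurable_hker : measurable_fun setT hker.
Proof.
apply: measurable_funM; first by apply: measurable_funX; apply: measurable_fun_enorm; exact: measurable_fst.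
apply: measurable_fun_inv_ge0 => [p|]; first by rewrite exprn_ge0// hnorm_ge0.
by apply: measurable_funX; exact: measurable_hnorm.
Qed.

Lemma measurable_fun_spiral d (T : measurableType d) (f : T -> H) (r : T -> R) :
  measurable_fun setT f -> measurable_fun setT r ->
  measurable_fun setT (fun x => spiral (f x) (r x)).
Proof. by move=> mf mr; apply: (measurableT_comp measurable_twist); exact: measurable_fun_hdil. Qed.

Variable sigma : {measure set H -> \bar R}.
Hypothesis hsigma : sphere_measure sigma.

(** Since r^(Q-1) (r|z0|)^(Q-1) / r^(2Q-2) = |z0|^(Q-1), the kernel just cancels the volume factor
    of polar coordinates. The twist preserves both the measure and the kernel, so rays may be
    replaced by spirals. *)
Lemma int_spiral (h : H -> R) : measurable_fun setT h -> (forall p, 0 <= h p) ->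
  (\int[sigma]_(p in Sg) \int[lam]_r (indb (0 < r)%R * (enorm p.1 ^+ Q.-1 * h (spiral p r)))%:E =
   \int[mu]_p (h p * hker p)%:E)%E.
Proof.
move=> mh h0; have mF : measurable_fun setT (fun p => (h p * hker p)%:E).
  by apply/measurable_EFinP; apply: measurable_funM => //; exact: measurable_hker.
have F0 p : (0 <= (h p * hker p)%:E)%E by rewrite lee_fin mulr_ge0// hker_ge0.
have [mT /(_ _ mF F0)] := scales_twist; rewrite mul1e => <-.
rewrite (polar_swap hsigma); last 2 first.
- exact: (measurableT_comp mF mT).
- by move=> p; exact: F0.
apply: eq_integral => p /set_mem hp; apply: eq_int => r; rewrite -EFinM; congr (_%:E).
case: (ltP 0 r) => r0; rewrite indbE ?mul0r// !mul1r hker_twist /hker enorm_hdil// hnorm_hdil//.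
have -> : hnorm p = 1 by [].
rewrite mulr1 exprMn exprD -/(spiral p r); have : r ^+ Q.-1 != 0 by rewrite expf_neq0// gt_eqF.
by move: (r ^+ Q.-1) (h _) (enorm _ ^+ _) => a b c a0; field.
Qed.

End twist.

Section upper_gradient.
Context (R : realType) (n : nat).
Local Notation H := (heis R n).
Local Notation Q := (@hdim n).
Local Notation lam := (@lebesgue_line R).
Local Notation mu := (@haar R n).
Local Notation Sg := (@unit_sphere R n).

(* Upper gradients along left translates of the spirals only; these have speed
   [1 / |z*|] at the point [p = (z*, t* )] of the sphere. *)
Record upper_gradient (u D : H -> R) : Prop := {
  ug_measurable : measurable_fun setT u;
  ug_gradient_measurable : measurable_fun setT D;
  ug_ge0 : forall p, 0 <= D p;
  ug_continuous : forall x p r, unit_sphere p -> 0 < sqn p.1 -> 0 < r ->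
    {for r, continuous (fun r : R => u (hmul x (spiral p r)))};
  ug_continuous0 : forall x p, unit_sphere p -> 0 < sqn p.1 ->
    u (hmul x (spiral p r)) @[r --> 0^'+] --> u x;
  ug_le : forall x p a b, unit_sphere p -> 0 < sqn p.1 -> 0 < a -> a <= b ->
    (`|u (hmul x (spiral p b)) - u (hmul x (spiral p a))|%:E <=
     \int[lam]_(r in `[a, b]) (D (hmul x (spiral p r)) / enorm p.1)%:E)%E }.

(** The term with [d] deals with spirals that never leave {|u| > s}: along these its integral is
    infinite. In the end [d] tends to 0. *)
Definition layer (u D : H -> R) (s t d : R) (y : H) : R :=
  indb (s < `|u y|) * indb (`|u y| < t) * D y + d * indb (s < `|u y|).

Section layer.
Variables (u D : H -> R).
Hypothesis hu : upper_gradient u D.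

Lemma layer_ge0 s t d y : 0 <= d -> 0 <= layer u D s t d y.
Proof. by move=> d0; rewrite addr_ge0// !mulr_ge0// (ug_ge0 hu). Qed.

Lemma measurable_layer s t d : measurable_fun setT (layer u D s t d).
Proof.
have mu' : measurable_fun setT (fun y => `|u y|) by apply: measurableT_comp => //; exact: ug_measurable hu.
apply: measurable_funD.
  apply: measurable_funM; last exact: ug_gradient_measurable hu.
  by apply: measurable_funM; exact: measurable_fun_ltR.
by apply: measurable_funM => //; exact: measurable_fun_ltR.
Qed.

(** A spiral that comes down to s crosses the whole layer, and the gradient over the crossing
    accounts for t - s; the factor |z0| undoes the speed. *)
Lemma layer_line x p s t d : unit_sphere p -> 0 < sqn p.1 -> 0 <= s -> s < t -> 0 < d ->
  t <= `|u x| ->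
  (((t - s) * enorm p.1)%:E <=
   \int[lam]_r (indb (0 < r)%R * layer u D s t d (hmul x (spiral p r)))%:E)%E.
Proof.
move=> hp p0 s0 st d0 tx; set f := fun r => `|u (hmul x (spiral p r))|.
have mg : measurable_fun setT (fun r => hmul x (spiral p r)).
  by apply: measurable_fun_hmul => //; exact: measurable_fun_spiral.
have mL := measurableT_comp (measurable_layer s t d) mg.
have mI : measurable_fun setT (fun r : R => (indb (0 < r)%R * layer u D s t d (hmul x (spiral p r)))%:E).
  by apply/measurable_EFinP; apply: measurable_funM => //; exact: measurable_fun_ltR.
have L0 y : 0 <= layer u D s t d y by rewrite layer_ge0// ltW.
have I0 r : (0 <= (indb (0 < r)%R * layer u D s t d (hmul x (spiral p r)))%:E)%E.
  by rewrite lee_fin mulr_ge0.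
have m1 : enorm p.1 <= 1 by exact: enorm_unit.
have m0 : 0 < enorm p.1 by rewrite sqrtr_gt0.
have [[r1 [r10 fr1]]|nr] := pselect (exists r1, 0 < r1 /\ f r1 <= s); last first.
  have fs r : 0 < r -> s < f r by move=> r0; rewrite ltNge; apply/negP => h; apply: nr; exists r.
  rewrite (@le_trans _ _ (\int[lam]_r (d%:E * (indb (0 < r)%R)%:E))%E)//; last first.
    apply: int_le => //.
    - by move=> r; rewrite lee_fin mulr_ge0// ltW.
    - by apply/measurable_EFinP; apply: measurable_funM => //; exact: measurable_fun_ltR.
    - move=> r; rewrite lee_fin; case: (ltP 0 r) => r0; rewrite !indbE ?mulr0 ?mul0r// mul1r.
      by rewrite /layer (fs r r0) indbE lerDr !mulr_ge0// (ug_ge0 hu).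
  have Ioo : (\int[lam]_r (indb (0 < r)%R)%:E)%E = +oo%E.
    transitivity (\int[lam]_r (\1_(`]0%R, +oo[%classic : set R) r)%:E)%E.
      by apply: eq_int => r; rewrite indicE mem_setE in_itv/= andbT.
    rewrite int_indic//; transitivity ((@lebesgue_measure R) `]0%R, +oo[%classic) => //.
    by rewrite lebesgue_measure_itv/= ltry addye.
  rewrite intZ ?(ltW d0)//; first by rewrite Ioo gt0_muley ?lte_fin// leey.
    by move=> r; rewrite lee_fin.
  by apply/measurable_EFinP; exact: measurable_fun_ltR.
(* Continuity and the gradient bound are given for r > 0 only; as r tends to 0 the values of |u| are
   merely known to exceed t - e. *)
apply/lee_addgt0Pr => e e0.
have [te|te] := leP (t - e) s.
  rewrite (@le_trans _ _ e%:E)//; last by rewrite leeDr//; exact: int_ge0.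
  by rewrite lee_fin; nra.
have cf r : 0 < r -> {for r, continuous f}.
  by move=> r0; apply: (cvg_norm (ug_continuous hu hp p0 r0)).
have [r0 [r00 r01 fr0]] : exists r0, [/\ 0 < r0, r0 <= r1 & t - e <= f r0].
  have h' : (0:R)^'+ [set r | t - e < f r].
    apply: (cvgr_gt `|u x| (cvg_norm (ug_continuous0 hu hp p0))).
    by rewrite (lt_le_trans _ tx)// ltrBlDr ltrDl.
  have {h'} h' : nbhs (0:R) [set r | 0 < r -> t - e < f r] by exact: h'.
  have [a /= a0 ha] : nbhs_ball (0:R) [set r | 0 < r -> t - e < f r] by exact/nbhs_ballP.
  exists (Num.min (a / 2) r1); split.
  - by rewrite lt_min r10 divr_gt0.
  - by rewrite ge_min lexx orbT.
  - apply/ltW/ha; last by rewrite lt_min r10 divr_gt0.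
    rewrite /ball/= sub0r normrN gtr0_norm ?lt_min ?r10 ?divr_gt0//.
    by rewrite gt_min ltr_pdivrMr// mulr_natr mulr2n ltrDl a0.
have cf' r : r0 <= r <= r1 -> {for r, continuous f} by move=> /andP[h _]; apply: cf; exact: lt_le_trans h.
have [c [c' [rc cc' c'r fc [fc' hf]]]] := crossing r01 te cf' fr0 fr1.
have c0 : 0 < c by exact: lt_le_trans rc.
have h1 := ug_le hu x hp p0 c0 (ltW cc').
have mD : measurable_fun setT (fun r => D (hmul x (spiral p r))).
  exact: (measurableT_comp (ug_gradient_measurable hu) mg).
have h2 : ((t - e - s)%:E <= \int[lam]_(r in `[c, c']) (D (hmul x (spiral p r)) / enorm p.1)%:E)%E.
  apply: le_trans h1; rewrite lee_fin -fc -fc' distrC; apply: le_trans (ler_norm _) _.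
  exact: ler_dist_dist.
have h3 : (\int[lam]_(r in `[c, c']) (D (hmul x (spiral p r)) / enorm p.1)%:E * (enorm p.1)%:E <=
    \int[lam]_r (indb (0 < r)%R * layer u D s t d (hmul x (spiral p r)))%:E)%E.
  have mDm : measurable_fun setT (fun r => (D (hmul x (spiral p r)) / enorm p.1)%:E).
    by apply/measurable_EFinP; apply: measurable_funM.
  have Dm0 r : (0 <= (D (hmul x (spiral p r)) / enorm p.1)%:E)%E.
    by rewrite lee_fin divr_ge0 ?(ug_ge0 hu)// ltW.
  rewrite -ge0_integral_line//; last exact: measurable_funTS.
  rewrite integral_itv_bndoo; last exact: measurable_funTS.
  rewrite ge0_integral_line//; last exact: measurable_funTS.
  rewrite int_setE -intZr ?(ltW m0)//; last 2 first.
  - by move=> r; rewrite mule_ge0.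
  - by apply: emeasurable_funM => //; apply/measurable_EFinP; exact: measurable_indic.
  apply: int_le => //.
  - by move=> r; rewrite !mule_ge0// lee_fin ltW.
  - apply: emeasurable_funM => //; apply: emeasurable_funM => //.
    by apply/measurable_EFinP; exact: measurable_indic.
  - move=> r; rewrite -!EFinM lee_fin indicE mem_setE in_itv/=.
    have [/andP[cr rc']|_] := boolP (c < r < c'); last by rewrite mulr0 mul0r mulr_ge0.
    rewrite mulr1 divfK ?gt_eqF// (lt_trans c0 cr) indbE mul1r /layer.
    have /andP[h' h] := hf r (introT andP (conj cr rc')).
    rewrite h' (lt_trans h) ?ltrBlDr ?ltrDl// indbE !mul1r mulr1 lerDl; exact: ltW.
rewrite (@le_trans _ _ ((t - e - s)%:E * (enorm p.1)%:E + e%:E)%E)//.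
  rewrite -EFinM -EFinD lee_fin; nra.
by rewrite leeD2r// (le_trans _ h3)// lee_wpmul2r// lee_fin ltW.
Qed.

Variable sigma : {measure set H -> \bar R}.
Hypothesis hsigma : sphere_measure sigma.
Hypothesis n0 : (0 < n)%N.

(** The bound along single spirals is integrated over the sphere with the weight |z0|^(Q-1). On the
    left this leaves |z0|^Q, whose integral is [csphere sigma]; on the right [int_spiral] produces
    the kernel. *)
Lemma pointwise_layer x s t d : 0 <= s -> s < t -> 0 < d -> t <= `|u x| ->
  ((csphere sigma * (t - s))%:E <=
   \int[mu]_y (layer u D s t d (hmul x y) * hker y)%:E)%E.
Proof.
move=> s0 st d0 tx.
have mL : measurable_fun setT (fun y => layer u D s t d (hmul x y)).
  by apply: (measurableT_comp (measurable_layer s t d)); exact: measurable_fun_hmul.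
have L0 y : 0 <= layer u D s t d (hmul x y) by rewrite layer_ge0// ltW.
rewrite -(int_spiral hsigma mL L0) EFinM -(csphereE hsigma n0) /csphere_e.
have ts0 : 0 <= t - s by rewrite subr_ge0 ltW.
have me k : measurable_fun setT (fun p : H => enorm p.1 ^+ k).
  by apply: measurable_funX; apply: measurable_fun_enorm; exact: measurable_fst.
have mS := @measurable_unit_sphere R n.
rewrite -ge0_integralZr//; last 2 first.
- by apply/measurable_EFinP; exact: measurable_funTS.
- by move=> p _; rewrite lee_fin exprn_ge0// enorm_ge0.
have mF : measurable_fun setT (fun q : H * R =>
    (indb (0 < q.2)%R * (enorm q.1.1 ^+ Q.-1 * layer u D s t d (hmul x (spiral q.1 q.2))))%:E).
  apply/measurable_EFinP; apply: measurable_funM; first exact: measurable_fun_ltR.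
  apply: measurable_funM; first exact: (measurableT_comp (me _) measurable_fst).
  by apply: (measurableT_comp mL); apply: measurable_fun_spiral.
have F0 (q : H * R) : (0 <= (indb (0 < q.2)%R * (enorm q.1.1 ^+ Q.-1 * layer u D s t d (hmul x (spiral q.1 q.2))))%:E)%E.
  by rewrite lee_fin !mulr_ge0// exprn_ge0// enorm_ge0.
apply: ge0_le_integral => //.
- by move=> p _; rewrite -EFinM lee_fin mulr_ge0// exprn_ge0// enorm_ge0.
- by apply/measurable_EFinP; apply: measurable_funTS; apply: measurable_funM.
- by apply: measurable_funTS; exact: (measurable_int2 lam mF F0).
(* No bound along spirals is available at points with z0 = 0, but there the weight |z0|^Q
   vanishes. *)
move=> p hp; have [p0|p0] := ltP 0 (sqn p.1); last first.
  have -> : enorm p.1 = 0 by rewrite /enorm ler0_sqrtr.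
  rewrite (_ : 0 ^+ Q = 0) ?mul0e; last by rewrite hdim_double doubleS expr0n.
  by apply: int_ge0 => r; rewrite lee_fin !mulr_ge0// exprn_ge0.
have -> : (\int[lam]_r (indb (0 < r)%R * (enorm p.1 ^+ Q.-1 * layer u D s t d (hmul x (spiral p r))))%:E =
  (enorm p.1 ^+ Q.-1)%:E * \int[lam]_r (indb (0 < r)%R * layer u D s t d (hmul x (spiral p r)))%:E)%E.
  rewrite -intZ.
  - by apply: eq_int => r; rewrite -EFinM mulrCA.
  - by rewrite exprn_ge0// enorm_ge0.
  - by move=> r; rewrite lee_fin mulr_ge0.
  - apply/measurable_EFinP; apply: measurable_funM; first exact: measurable_fun_ltR.
    by apply: (measurableT_comp mL); exact: measurable_fun_spiral.
have -> : ((enorm p.1 ^+ Q)%:E * (t - s)%:E = (enorm p.1 ^+ Q.-1)%:E * ((t - s) * enorm p.1)%:E)%E.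
  have -> : enorm p.1 ^+ Q = enorm p.1 ^+ Q.-1 * enorm p.1 by rewrite -exprSr hdim_double.
  by rewrite -!EFinM; congr (_%:E); move: (_ ^+ _) => X; ring.
by rewrite lee_wpmul2l ?lee_fin ?exprn_ge0 ?enorm_ge0//; exact: layer_line.
Qed.

End layer.
End upper_gradient.

(** * Convexity inequalities and integrals of the kernel *)

Section convexity.
Context (R : realType).
Implicit Types x y m p q : R.

(** The graph of y^p lies above its tangent at m; this is Young's inequality for the pair m^(p-1),
    y. *)
Lemma powR_tangent p y m : 1 <= p -> 0 <= y -> 0 <= m ->
  p * m `^ (p - 1) * y <= y `^ p + (p - 1) * m `^ p.
Proof.
move=> p1 y0 m0; have [<-|pn1] := eqVneq 1 p.
  by rewrite subrr mul0r addr0 powRr0 !mul1r powRr1.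
have {}p1 : 1 < p by rewrite lt_neqAle pn1.
have p0 : 0 < p by rewrite (lt_trans _ p1).
have q0 : 0 < p - 1 by rewrite subr_gt0.
have := @conjugate_powR R (m `^ (p - 1)) y (p / (p - 1)) p (powR_ge0 _ _) y0 (divr_gt0 p0 q0) p0.
rewrite invf_div -powRrM (_ : (p - 1) * (p / (p - 1)) = p); last by field; rewrite gt_eqF.
have pq : (p - 1) / p + p^-1 = 1 by field; rewrite gt_eqF.
move=> /(_ pq).
move: (m `^ (p - 1)) (m `^ p) (y `^ p) => a b c h.
have -> : c + (p - 1) * b = p * (b / (p / (p - 1)) + c / p) by field; rewrite !gt_eqF.
by rewrite -mulrA ler_pM2l// invf_div.
Qed.

(** The tangent at x + y, evaluated at x. *)
Lemma powRD_le p x y : 1 <= p -> 0 <= x -> 0 <= y ->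
  (x + y) `^ p <= x `^ p + p * y * (x + y) `^ (p - 1).
Proof.
move=> p1 x0 y0; have xy := addr_ge0 x0 y0.
have [s0|s0] := eqVneq (x + y) 0.
  rewrite s0 powR0 ?gt_eqF ?(lt_le_trans _ p1)//.
  by rewrite addr_ge0 ?powR_ge0// !mulr_ge0 ?powR_ge0// (le_trans _ p1).
have := powR_tangent p1 x0 xy.
have -> : (x + y) `^ p = (x + y) `^ (p - 1) * (x + y).
  by rewrite -{3}(powRr1 xy) -powRD ?subrK// s0 implybT.
by move: (_ `^ (p - 1)) (x `^ p) => a b h; lra.
Qed.

End convexity.

Section integral_inequalities.
Context (R : realType) d (T : measurableType d).
Variable m : {measure set T -> \bar R}.
Implicit Types f g phi : T -> R.

Lemma measurable_fun_powR f (p : R) : measurable_fun setT f ->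
  measurable_fun setT (fun x => f x `^ p).
Proof. by move=> mf; exact: (measurableT_comp (measurable_powR p) mf). Qed.

(** The tangent inequality at the mean [a], integrated against the probability density [phi]. *)
Lemma jensen_powR phi f (p a : R) : 1 <= p ->
  measurable_fun setT phi -> measurable_fun setT f ->
  (forall x, 0 <= phi x) -> (forall x, 0 <= f x) ->
  (\int[m]_x (phi x)%:E = 1)%E -> (\int[m]_x (phi x * f x)%:E = a%:E)%E ->
  ((a `^ p)%:E <= \int[m]_x (phi x * f x `^ p)%:E)%E.
Proof.
move=> p1 mphi mf phi0 f0 I1 Ia; have p0 : 0 <= p by exact: le_trans p1.
have a0 : 0 <= a by rewrite -lee_fin -Ia; apply: int_ge0 => x; rewrite lee_fin mulr_ge0.
have mfp := measurable_fun_powR p mf.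
have mpf : measurable_fun setT (fun x => phi x * f x) by exact: measurable_funM.
have mpp : measurable_fun setT (fun x => phi x * f x `^ p) by exact: measurable_funM.
have key : (\int[m]_x ((p * a `^ (p - 1))%:E * (phi x * f x)%:E) <=
    \int[m]_x ((phi x * f x `^ p)%:E + ((p - 1) * a `^ p)%:E * (phi x)%:E))%E.
  apply: int_le.
  - by move=> x; rewrite -EFinM lee_fin !mulr_ge0// powR_ge0.
  - by apply/measurable_EFinP; apply: measurable_funM.
  - apply/measurable_EFinP; apply: measurable_funD => //; exact: measurable_funM.
  - move=> x; rewrite -!EFinM -EFinD lee_fin.
    have := powR_tangent p1 (f0 x) a0; move: (phi0 x); move: (phi x) (a `^ (p - 1)) (a `^ p) (f x `^ p) (f x) => z b c e y z0 h.
    have := ler_wpM2l z0 h; lra.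
have pa0 : 0 <= p * a `^ (p - 1) by rewrite mulr_ge0 ?powR_ge0.
have pc0 : 0 <= (p - 1) * a `^ p by rewrite mulr_ge0 ?powR_ge0// subr_ge0.
move: key; rewrite intZ//; [|by move=> x; rewrite lee_fin mulr_ge0|exact/measurable_EFinP].
rewrite intD; last 4 first.
- by move=> x; rewrite lee_fin mulr_ge0// powR_ge0.
- exact/measurable_EFinP.
- by move=> x; rewrite -EFinM lee_fin mulr_ge0.
- by apply/measurable_EFinP; exact: measurable_funM.
rewrite intZ//; [|exact/measurable_EFinP].
rewrite I1 Ia mule1 -EFinM.
have -> : p * a `^ (p - 1) * a = a `^ p + (p - 1) * a `^ p.
  have [->|an0] := eqVneq a 0; first by rewrite mulr0 powR0 ?mulr0 ?addr0// gt_eqF// (lt_le_trans _ p1).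
  have -> : a `^ p = a `^ (p - 1) * a by rewrite -{3}(powRr1 a0) -powRD ?subrK// an0 implybT.
  by ring.
by rewrite EFinD leeD2rE.
Qed.

Lemma hoelder_powR f g (p q a b : R) : 0 < p -> 0 < q -> p^-1 + q^-1 = 1 ->
  measurable_fun setT f -> measurable_fun setT g ->
  (forall x, 0 <= f x) -> (forall x, 0 <= g x) -> 0 <= a -> 0 <= b ->
  (\int[m]_x (f x `^ p)%:E <= a%:E)%E -> (\int[m]_x (g x `^ q)%:E <= b%:E)%E ->
  (\int[m]_x (f x * g x)%:E <= (a `^ p^-1 * b `^ q^-1)%:E)%E.
Proof.
move=> p0 q0 pq mf mg f0 g0 a0 b0 Ia Ib.
have := hoelder m mf mg p0 q0 pq; rewrite Lnorm1.
under eq_integral => x _ do rewrite /= ger0_norm ?mulr_ge0//.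
move=> h; apply: (le_trans h); rewrite EFinM; apply: lee_pmul => //.
- exact: Lnorm_ge0.
- exact: Lnorm_ge0.
- rewrite unlock -poweR_EFin; apply: gt0_ler_poweR.
  + by rewrite invr_ge0 ltW.
  + by rewrite in_itv/= leey andbT; apply: integral_ge0 => x _; rewrite lee_fin powR_ge0.
  + by rewrite in_itv/= leey andbT lee_fin.
  + by under eq_integral => x _ do rewrite /= ger0_norm//.
- rewrite unlock -poweR_EFin; apply: gt0_ler_poweR.
  + by rewrite invr_ge0 ltW.
  + by rewrite in_itv/= leey andbT; apply: integral_ge0 => x _; rewrite lee_fin powR_ge0.
  + by rewrite in_itv/= leey andbT lee_fin.
  + by under eq_integral => x _ do rewrite /= ger0_norm//.
Qed.

End integral_inequalities.

Section kernel.
Context (R : realType) (n : nat).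
Local Notation H := (heis R n).
Local Notation Q := (@hdim n).
Local Notation lam := (@lebesgue_line R).
Local Notation mu := (@haar R n).
Local Notation Sg := (@unit_sphere R n).
Variable sigma : {measure set H -> \bar R}.
Hypothesis hsigma : sphere_measure sigma.

Lemma polar_radial (k : nat) (G : R -> R) : measurable_fun setT G -> (forall r, 0 <= G r) ->
  (\int[mu]_p (enorm p.1 ^+ k * G (hnorm p))%:E =
   (\int[lam]_r (indb (0 < r)%R * (r ^+ (k + Q.-1) * G r))%:E) *
     \int[sigma]_(p in Sg) (enorm p.1 ^+ k)%:E)%E.
Proof.
move=> mG G0; pose g v := G (v `^ 4^-1).
have me : measurable_fun setT (fun p : H => enorm p.1 ^+ k).
  by apply: measurable_funX; apply: measurable_fun_enorm; exact: measurable_fst.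
under eq_integral => p _ do rewrite hnormE -/(g _).
rewrite (polar_product' hsigma (k := k) me (g := g)) //.
- congr (_ * _)%E; apply: eq_int => r; case: (ltP 0 r) => r0; rewrite indbE ?mul0r//.
  have -> : g (r ^+ 4) = G r; last by [].
  by rewrite /g -(powR_mulrn 4 (ltW r0)) -powRrM mulfV// powRr1// ltW.
- exact: (measurableT_comp mG (measurable_powR _)).
- by move=> p; rewrite exprn_ge0// enorm_ge0.
- by move=> r; exact: G0.
- by move=> r p r0; rewrite enorm_hdil// exprMn.
Qed.

Definition hball_ind (r : R) (p : H) : R := indb (hnorm p < r).

Lemma measurable_hball_ind r : measurable_fun setT (hball_ind r).
Proof. by apply: measurable_fun_ltR => //; exact: measurable_hnorm. Qed.

Definition sphere_mass : R := fine (sigma Sg).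

Lemma sphere_massE : sigma Sg = sphere_mass%:E.
Proof. by rewrite fineK// ge0_fin_numE// (sphere_fin hsigma). Qed.

Lemma hdim_gt1 : (1 < Q)%N. Proof. by rewrite hdim_double doubleS. Qed.

(** The kernel is homogeneous of degree 1 - Q, so its radial integral in polar coordinates is r, and
    on the sphere |z0| is at most 1. *)
Lemma int_hker_ball r : 0 <= r ->
  (\int[mu]_p (hball_ind r p * hker p)%:E <= (sphere_mass * r)%:E)%E.
Proof.
move=> r0; pose G s := indb (s < r) * (s `^ (- (Q.-1 + Q.-1)%:R)) : R.
have mG : measurable_fun setT G.
  by apply: measurable_funM; [exact: measurable_fun_ltR|exact: measurable_powR].
have G0 s : 0 <= G s by rewrite mulr_ge0 ?powR_ge0.
have -> : (\int[mu]_p (hball_ind r p * hker p)%:E = \int[mu]_p (enorm p.1 ^+ Q.-1 * G (hnorm p))%:E)%E.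
  by apply: eq_int => p; congr (_%:E); rewrite /hker /G powRN powR_mulrn ?hnorm_ge0// mulrCA.
rewrite (polar_radial Q.-1 mG G0).
have -> : (\int[lam]_s (indb (0 < s)%R * (s ^+ (Q.-1 + Q.-1) * G s))%:E = r%:E)%E.
  have := int_pow_line 0 r0; rewrite expr1 => <-; apply: eq_int => s; congr (_%:E).
  case: (ltP 0 s) => s0; rewrite indbE ?mul0r// !mul1r /G gtr0_norm// powRN powR_mulrn ?ltW//.
  by rewrite mulrCA mulfV ?mulr1// expf_neq0// gt_eqF.
rewrite mulrC EFinM; apply: lee_wpmul2l; first by rewrite lee_fin.
rewrite -sphere_massE -[leRHS]mul1e -integral_cst; last exact: measurable_unit_sphere.
apply: ge0_le_integral => //.
- exact: measurable_unit_sphere.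
- by move=> p _; rewrite lee_fin exprn_ge0// enorm_ge0.
- apply: measurable_funTS; apply/measurable_EFinP; apply: measurable_funX; apply: measurable_fun_enorm; exact: measurable_fst.
- by move=> p /enorm_unit h; rewrite lee_fin; apply: exprn_ile1 => //; exact: enorm_ge0.
Qed.

Lemma hker_le (p : H) : hker p <= hnorm p ^- Q.-1.
Proof.
rewrite /hker exprD invfM mulrA ler_piMl ?invr_ge0 ?exprn_ge0 ?hnorm_ge0//.
have [h|h] := ltP 0 (hnorm p).
  by rewrite ler_pdivrMr ?exprn_gt0// mul1r lerXn2r ?nnegrE ?enorm_ge0 ?hnorm_ge0// enorm_le_hnorm.
have -> : enorm p.1 = 0 by apply/eqP; rewrite eq_le enorm_ge0 (le_trans (enorm_le_hnorm p)).
by rewrite expr0n -subn1 subn_eq0 leqNgt hdim_gt1 mul0r.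
Qed.

Definition qexp : R := Q%:R / (Q%:R - 1).

Lemma Q1_gt0 : 0 < Q%:R - 1 :> R.
Proof. by rewrite subr_gt0 ltr1n hdim_gt1. Qed.

Lemma predQ : Q.-1%:R = Q%:R - 1 :> R.
Proof. by rewrite -subn1 natrB// ltnW// hdim_gt1. Qed.

Lemma powR_qexp (x : R) (k : nat) : 0 <= x -> (x ^+ (k * Q.-1)) `^ qexp = x ^+ (k * Q).
Proof.
move=> x0; rewrite -!powR_mulrn// -powRrM !natrM predQ /qexp; congr (_ `^ _).
by field; rewrite gt_eqF// Q1_gt0.
Qed.

Lemma hker_powR (p : H) : hker p `^ qexp = enorm p.1 ^+ Q * hnorm p ^- (2 * Q).
Proof.
rewrite /hker powRM ?exprn_ge0 ?enorm_ge0 ?invr_ge0 ?exprn_ge0 ?hnorm_ge0//.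
have := powR_qexp 1 (enorm_ge0 p.1); rewrite !mul1n => ->; congr (_ * _).
have h0 := hnorm_ge0 p; rewrite addnn -mul2n -exprVn -exprVn; apply: powR_qexp.
by rewrite invr_ge0.
Qed.

(** To the power [qexp] the kernel is |z|^Q / N^(2Q), of the borderline degree -Q: the radial
    integral is that of 1/r. This is where the sharp coefficient of the logarithm arises. *)
Lemma int_hker_powR (n0 : (0 < n)%N) (r s : R) : 0 < r -> r <= s ->
  (\int[mu]_p (indb (r <= hnorm p)%R * indb (hnorm p < s)%R * hker p `^ qexp)%:E =
   (csphere sigma * (ln s - ln r))%:E)%E.
Proof.
move=> r0 rs; pose G x := indb (r <= x) * indb (x < s) * x `^ (- (2 * Q)%:R) : R.
have mG : measurable_fun setT G.
  apply: measurable_funM; last exact: measurable_powR.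
  by apply: measurable_funM; [exact: measurable_fun_leR|exact: measurable_fun_ltR].
have G0 x : 0 <= G x by rewrite !mulr_ge0 ?powR_ge0.
have -> : (\int[mu]_p (indb (r <= hnorm p)%R * indb (hnorm p < s)%R * hker p `^ qexp)%:E =
    \int[mu]_p (enorm p.1 ^+ Q * G (hnorm p))%:E)%E.
  apply: eq_int => p; congr (_%:E); rewrite hker_powR /G powRN powR_mulrn ?hnorm_ge0//.
  by rewrite mulrCA.
rewrite (polar_radial Q mG G0) -/(csphere_e sigma) (csphereE hsigma n0) mulrC EFinM; congr (_ * _)%E.
transitivity (\int[lam]_(x in `[r, s]) (x^-1)%:E)%E; last first.
  apply: (@FTC2_line R (@ln R) (fun x => x^-1) r s rs).
  - by move=> x /andP[h _]; apply: is_derive1_ln; exact: lt_le_trans h.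
  - by move=> x /andP[h _]; apply: inv_continuous; rewrite gt_eqF// (lt_le_trans r0).
  - by move=> x /andP[h _]; rewrite invr_ge0 (le_trans (ltW r0)).
rewrite -[RHS]ge0_integral_line//; first last.
- by move=> x /=; rewrite in_itv/= lee_fin invr_ge0 => /andP[h _]; rewrite (le_trans (ltW r0)).
- apply/measurable_EFinP; apply: measurable_continuous_in; apply: continuous_in_subspaceT => x.
  rewrite inE/= in_itv/= => /andP[h _]; apply: inv_continuous; rewrite gt_eqF// (lt_le_trans r0)//.
rewrite -[RHS]integral_itv_bndo_bndc; last first.
  apply/measurable_EFinP; apply: measurable_continuous_in; apply: continuous_in_subspaceT => x.
  rewrite inE/= in_itv/= => /andP[h _]; apply: inv_continuous; rewrite gt_eqF// (lt_le_trans r0)//.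
rewrite -[LHS]ge0_integral_line//; first last.
- move=> x _; rewrite lee_fin; case: (ltP 0 x) => x0; rewrite indbE ?mul0r// mul1r mulr_ge0//.
  by rewrite exprn_ge0// ltW.
- apply/measurable_EFinP; apply: measurable_funM; first exact: measurable_fun_ltR.
  by apply: measurable_funM => //; exact: measurable_funX.
rewrite [RHS]integral_mkcond; apply: eq_integral => x _; rewrite patchE mem_setE in_itv/= /G.
have [rx|xr] := leP r x; last by rewrite indbE !mul0r !mulr0.
have x0 : 0 < x by exact: lt_le_trans rx.
rewrite x0 !indbE !mul1r /=; case: ifPn => xs; last by rewrite mul0r mulr0.
rewrite indbE mul1r powRN powR_mulrn ?ltW//; congr (_%:E).
rewrite (_ : (2 * Q = (Q + Q.-1).+1)%N); last by rewrite -addnS prednK ?(ltnW hdim_gt1)// addnn mul2n.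
by rewrite exprS invfM mulrCA mulfV ?mulr1// expf_neq0// gt_eqF.
Qed.

End kernel.

(** * The isocapacitary inequality *)

Lemma eqW d (T : porderType d) (x y : T) : x = y -> (x <= y)%O.
Proof. by move=> ->. Qed.

Section averages.
Context (R : realType) (n : nat).
Local Notation H := (heis R n).
Local Notation mu := (@haar R n).
Variable phi : H -> R.
Hypotheses (mphi : measurable_fun setT phi) (phi0 : forall x, 0 <= phi x).
Hypothesis phi1 : (\int[mu]_x (phi x)%:E = 1)%E.

(** The group convolution of [phi] with [k], for a probability density [phi]: first the normalised
    indicator of a superlevel set, later a normalised bump. *)
Definition havg (k : H -> R) (y : H) : \bar R :=
  (\int[mu]_x (phi x * k (hmul (- x) y))%:E)%E.

Let mk2 (k : H -> R) : measurable_fun setT k ->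
  measurable_fun setT (fun p : H * H => k (hmul (- p.1) p.2)).
Proof.
move=> mk; apply: (measurableT_comp mk); apply: measurable_fun_hmul; last exact: measurable_snd.
by apply: measurable_fun_hN; exact: measurable_fst.
Qed.

Lemma measurable_havg (k : H -> R) : measurable_fun setT k -> (forall x, 0 <= k x) ->
  measurable_fun setT (havg k).
Proof.
move=> mk k0; apply: (@measurable_int1 _ _ _ _ _ mu (fun p : H * H => (phi p.1 * k (hmul (- p.1) p.2))%:E)).
  apply/measurable_EFinP; apply: measurable_funM; last exact: mk2.
  exact: (measurableT_comp mphi measurable_fst).
by move=> p; rewrite lee_fin mulr_ge0.
Qed.

Lemma havg_ge0 (k : H -> R) y : (forall x, 0 <= k x) -> (0 <= havg k y)%E.
Proof. by move=> k0; apply: int_ge0 => x; rewrite lee_fin mulr_ge0. Qed.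

Lemma int_havg (W k : H -> R) : measurable_fun setT W -> measurable_fun setT k ->
  (forall x, 0 <= W x) -> (forall x, 0 <= k x) ->
  (\int[mu]_y ((W y)%:E * havg k y) =
   \int[mu]_x ((phi x)%:E * \int[mu]_y (W y * k (hmul (- x) y))%:E))%E.
Proof.
move=> mW mk W0 k0; pose F (p : H * H) := (phi p.1 * (W p.2 * k (hmul (- p.1) p.2)))%:E.
have mF : measurable_fun setT F.
  apply/measurable_EFinP; apply: measurable_funM; first exact: (measurableT_comp mphi measurable_fst).
  by apply: measurable_funM; [exact: (measurableT_comp mW measurable_snd)|exact: mk2].
have F0 p : (0 <= F p)%E by rewrite lee_fin !mulr_ge0.
have mkx (x : H) : measurable_fun setT (fun y : H => k (hmul (- x) y)).
  by apply: (measurableT_comp mk); exact: measurable_fun_hmul.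
have mky (y : H) : measurable_fun setT (fun x : H => k (hmul (- x) y)).
  by apply: (measurableT_comp mk); apply: measurable_fun_hmul => //; exact: measurable_fun_hN.
transitivity (\int[mu]_y \int[mu]_x F (x, y))%E.
  apply: eq_int => y; rewrite -intZ//.
  - by apply: eq_int => x; rewrite -EFinM mulrCA.
  - by move=> x; rewrite lee_fin mulr_ge0.
  - by apply/measurable_EFinP; exact: measurable_funM.
rewrite -(tonelli mu mu mF F0); apply: eq_int => x; rewrite -intZ//.
- by move=> y; rewrite lee_fin mulr_ge0.
- by apply/measurable_EFinP; exact: measurable_funM.
Qed.

Lemma int_hmull (k : H -> R) x : measurable_fun setT k -> (forall x, 0 <= k x) ->
  (\int[mu]_y (k (hmul x y))%:E = \int[mu]_y (k y)%:E)%E.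
Proof.
move=> mk k0; have [_ h] := scales_hmull x.
by have := h (fun y => (k y)%:E); rewrite mul1e; apply => //; exact/measurable_EFinP.
Qed.

Lemma int_phiM (a : R) : 0 <= a -> (\int[mu]_x ((phi x)%:E * a%:E) = a%:E)%E.
Proof. by move=> a0; rewrite intZr// ?phi1 ?mul1e//; exact/measurable_EFinP. Qed.

(** A bound valid for the kernel centred at every point x passes to the average, because [phi] has
    mass 1. *)
Lemma int_havg_le (W k : H -> R) (a : R) : 0 <= a ->
  measurable_fun setT W -> measurable_fun setT k ->
  (forall x, 0 <= W x) -> (forall x, 0 <= k x) ->
  (forall x, \int[mu]_y (W y * k (hmul (- x) y))%:E <= a%:E)%E ->
  (\int[mu]_y ((W y)%:E * havg k y) <= a%:E)%E.
Proof.
move=> a0 mW mk W0 k0 h; rewrite int_havg// -[leRHS]int_phiM//; apply: int_le.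
- by move=> x; rewrite mule_ge0 ?lee_fin//; apply: int_ge0 => y; rewrite lee_fin mulr_ge0.
- apply: emeasurable_funM; first exact/measurable_EFinP.
  apply: (@measurable_int2 _ _ _ _ _ mu (fun p : H * H => (W p.2 * k (hmul (- p.1) p.2))%:E)).
    apply/measurable_EFinP; apply: measurable_funM; last exact: mk2.
    exact: (measurableT_comp mW measurable_snd).
  by move=> p; rewrite lee_fin mulr_ge0.
- by apply: emeasurable_funM => //; exact/measurable_EFinP.
- by move=> x; rewrite lee_wpmul2l ?lee_fin.
Qed.

Lemma havg_jensen (k : H -> R) y (q a : R) : 1 <= q -> measurable_fun setT k ->
  (forall x, 0 <= k x) -> havg k y = a%:E ->
  ((a `^ q)%:E <= havg (fun x => (k x `^ q)%R) y)%E.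
Proof.
move=> q1 mk k0 h; apply: jensen_powR => //.
by apply: (measurableT_comp mk); apply: measurable_fun_hmul => //; exact: measurable_fun_hN.
Qed.

Lemma havgD (k l : H -> R) y : measurable_fun setT k -> measurable_fun setT l ->
  (forall x, 0 <= k x) -> (forall x, 0 <= l x) ->
  (havg (fun x => (k x + l x)%R) y = havg k y + havg l y)%E.
Proof.
move=> mk ml k0 l0; rewrite -intD.
- by apply: eq_int => x; rewrite mulrDr EFinD.
- by move=> x; rewrite lee_fin mulr_ge0.
- apply/measurable_EFinP; apply: measurable_funM => //.
  by apply: (measurableT_comp mk); apply: measurable_fun_hmul => //; exact: measurable_fun_hN.
- by move=> x; rewrite lee_fin mulr_ge0.
- apply/measurable_EFinP; apply: measurable_funM => //.
  by apply: (measurableT_comp ml); apply: measurable_fun_hmul => //; exact: measurable_fun_hN.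
Qed.

End averages.

Section isocapacity.
Context (R : realType) (n : nat).
Local Notation H := (heis R n).
Local Notation Q := (@hdim n).
Local Notation mu := (@haar R n).
Local Notation q := (qexp R n).
Variable sigma : {measure set H -> \bar R}.
Hypothesis hsigma : sphere_measure sigma.
Hypothesis n0 : (0 < n)%N.
Local Notation S := (sphere_mass sigma).
Local Notation c := (csphere sigma).

Definition gexp : R := (Q%:R - 1)^-1.

(** Inside the parentheses, 1 comes from the kernel beyond the outer radius and the other summand
    from the kernel within the inner one; c^(-q) is left from dividing by the weight of the
    spirals. *)
Definition isoC : R := c `^ (- q) * (1 + q * S * (1 + S) `^ gexp).

Variables (u D : H -> R).
Hypothesis hu : upper_gradient u D.
Variables (s t mt ms e : R).
Hypotheses (s0 : 0 <= s) (st : s < t) (mt0 : 0 < mt) (e0 : 0 <= e).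
Hypothesis hmt : (\int[mu]_x (indb (t <= `|u x|)%R)%:E = mt%:E)%E.
Hypothesis hms : (\int[mu]_x (indb (s < `|u x|)%R)%:E = ms%:E)%E.
Hypothesis he : (\int[mu]_x ((indb (s < `|u x|)%R * indb (`|u x| < t)%R * D x) `^ Q%:R)%:E <= e%:E)%E.

Let phi (x : H) : R := indb (t <= `|u x|) / mt.

Let mabs : measurable_fun setT (fun x => `|u x|).
Proof. by apply: measurableT_comp => //; exact: ug_measurable hu. Qed.

Let mphi : measurable_fun setT phi.
Proof. by apply: measurable_funM => //; exact: measurable_fun_leR. Qed.

Let phi0 x : 0 <= phi x. Proof. by rewrite divr_ge0// ltW. Qed.

Let phi1 : (\int[mu]_x (phi x)%:E = 1)%E.
Proof.
under eq_integral => x _ do rewrite EFinM.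
rewrite intZr// ?invr_ge0 ?(ltW mt0)// ?hmt.
- by rewrite -EFinM mulfV// gt_eqF.
- by move=> x; rewrite lee_fin.
- by apply/measurable_EFinP; exact: measurable_fun_leR.
Qed.

(** The inner radius, and next the outer one: their Q-th powers are the measures of the superlevel
    sets at t and s. The annulus between them yields the logarithm. *)
Let rho : R := mt `^ Q%:R^-1.
Let Rad : R := ms `^ Q%:R^-1.

Let Q0 : 0 < Q%:R :> R. Proof. by rewrite ltr0n (ltn_trans _ (hdim_gt1 n)). Qed.

Let mts : mt <= ms.
Proof.
rewrite -lee_fin -hmt -hms; apply: int_le.
- by move=> x; rewrite lee_fin.
- by apply/measurable_EFinP; exact: measurable_fun_leR.
- by apply/measurable_EFinP; exact: measurable_fun_ltR.
- move=> x; rewrite lee_fin; case: (leP t `|u x|) => h; last by rewrite indbE.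
  by rewrite (lt_le_trans st h) indbE.
Qed.

Let ms0 : 0 < ms. Proof. exact: lt_le_trans mts. Qed.

Let rho0 : 0 < rho. Proof. exact: powR_gt0. Qed.
Let Rad0 : 0 < Rad. Proof. exact: powR_gt0. Qed.
Let rhoR : rho <= Rad.
Proof. by apply: ge0_ler_powR; rewrite ?invr_ge0 ?nnegrE ?(ltW Q0) ?(ltW mt0) ?(ltW ms0). Qed.

Let rhoQ : rho ^+ Q = mt.
Proof. by rewrite -powR_mulrn ?(ltW rho0)// -powRrM mulVf ?gt_eqF// powRr1// ltW. Qed.
Let RadQ : Rad ^+ Q = ms.
Proof. by rewrite -powR_mulrn ?(ltW Rad0)// -powRrM mulVf ?gt_eqF// powRr1// ltW. Qed.

Let S0 : 0 <= S. Proof. exact: fine_ge0. Qed.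

(** The singular part of the kernel is averaged in the integral norm, the remaining part pointwise.
    Averaging over a set of measure rho^Q thus bounds the averaged kernel by [M], although the
    kernel itself is unbounded. *)
Let k1 (x : H) : R := hball_ind rho x * hker x.
Let k2 (x : H) : R := indb (rho <= hnorm x) * hker x.

Let k12 x : hker x = k1 x + k2 x.
Proof. by rewrite /k1 /k2 /hball_ind; case: ltP => h; rewrite !indbE ?mul0r ?mul1r ?addr0 ?add0r. Qed.

Let mk1 : measurable_fun setT k1.
Proof. by apply: measurable_funM; [exact: measurable_hball_ind|exact: measurable_hker]. Qed.
Let mk2 : measurable_fun setT k2.
Proof.
apply: measurable_funM; last exact: measurable_hker.
by apply: measurable_fun_leR => //; exact: measurable_hnorm.
Qed.
Let k10 x : 0 <= k1 x. Proof. by rewrite mulr_ge0// hker_ge0. Qed.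
Let k20 x : 0 <= k2 x. Proof. by rewrite mulr_ge0// hker_ge0. Qed.

Let k2_le x : k2 x <= rho ^- Q.-1.
Proof.
rewrite /k2; case: (leP rho (hnorm x)) => h; rewrite indbE ?mul0r ?mul1r; last by rewrite invr_ge0 exprn_ge0// ltW.
apply: (le_trans (hker_le x)); rewrite lef_pV2 ?posrE ?exprn_gt0// ?(lt_le_trans rho0)//.
by rewrite lerXn2r ?nnegrE ?(ltW rho0) ?hnorm_ge0.
Qed.

Let M : R := (1 + S) * rho ^- Q.-1.

Let M0 : 0 <= M. Proof. by rewrite mulr_ge0 ?addr_ge0// invr_ge0 exprn_ge0// ltW. Qed.

Let avg2 y : (havg phi k2 y <= (rho ^- Q.-1)%:E)%E.
Proof.
rewrite -[leRHS](@int_phiM _ _ phi mphi phi0 phi1) ?invr_ge0 ?exprn_ge0 ?(ltW rho0)//.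
apply: int_le.
- by move=> x; rewrite lee_fin mulr_ge0.
- apply/measurable_EFinP; apply: measurable_funM => //.
  by apply: (measurableT_comp mk2); apply: measurable_fun_hmul => //; exact: measurable_fun_hN.
- by apply: emeasurable_funM => //; exact/measurable_EFinP.
- by move=> x; rewrite -EFinM lee_fin; apply: ler_wpM2l => //; exact: k2_le.
Qed.

Let avg1 y : (havg phi k1 y <= (S * rho ^- Q.-1)%:E)%E.
Proof.
apply: (@le_trans _ _ (\int[mu]_x (mt^-1%:E * (k1 (hmul (- y) x))%:E))%E).
  apply: int_le.
  - by move=> x; rewrite lee_fin mulr_ge0.
  - apply/measurable_EFinP; apply: measurable_funM => //.
    by apply: (measurableT_comp mk1); apply: measurable_fun_hmul => //; exact: measurable_fun_hN.
  - apply/measurable_EFinP; apply: measurable_funM => //.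
    by apply: (measurableT_comp mk1); exact: measurable_fun_hmul.
  - move=> x; rewrite -EFinM lee_fin.
    (* The kernel is invariant under inversion, so the integral in x becomes one over a left
       translate. *)
    have -> : k1 (hmul (- x) y) = k1 (hmul (- y) x).
      have <- : - hmul (- y) x = hmul (- x) y by rewrite hinvM opprK.
      by rewrite /k1 /hball_ind hnormN hkerN.
    apply: ler_wpM2r => //; rewrite /phi -[leRHS]mul1r ler_wpM2r ?invr_ge0 ?(ltW mt0)//.
    by case: (leP t `|u x|) => h; rewrite indbE ?ler01.
rewrite intZ ?invr_ge0 ?(ltW mt0)//.
- rewrite int_hmull//; apply: (@le_trans _ _ (mt^-1%:E * (S * rho)%:E)%E).
    by apply: lee_wpmul2l; [rewrite lee_fin invr_ge0 ltW|exact: (int_hker_ball hsigma (ltW rho0))].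
  rewrite -EFinM lee_fin -rhoQ.
  have -> : rho ^+ Q = rho * rho ^+ Q.-1 by rewrite -exprS prednK// (ltn_trans _ (hdim_gt1 n)).
  by rewrite invfM mulrC -!mulrA [X in _ * X]mulrA mulfV ?gt_eqF// mul1r.
- by move=> x; rewrite lee_fin.
- by apply/measurable_EFinP; apply: (measurableT_comp mk1); exact: measurable_fun_hmul.
Qed.

Let K y : R := fine (havg phi (@hker R n) y).
Let K1 y : R := fine (havg phi k1 y).
Let K2 y : R := fine (havg phi k2 y).

Let K1E y : havg phi k1 y = (K1 y)%:E.
Proof. by rewrite fineK// ge0_fin_numE ?havg_ge0// (le_lt_trans (avg1 y))// ltry. Qed.
Let K2E y : havg phi k2 y = (K2 y)%:E.
Proof. by rewrite fineK// ge0_fin_numE ?havg_ge0// (le_lt_trans (avg2 y))// ltry. Qed.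
Let KE y : havg phi (@hker R n) y = (K y)%:E /\ K y = K2 y + K1 y.
Proof.
have E : havg phi (@hker R n) y = (K1 y + K2 y)%:E.
  have := etrans (havgD mphi phi0 y mk1 mk2 k10 k20) (etrans (congr2 adde (K1E y) (K2E y)) (esym (EFinD (K1 y) (K2 y)))).
  by move=> <-; apply: eq_int => x; rewrite k12.
by split; [rewrite /K E|rewrite /K E; exact: addrC].
Qed.
Let K10 y : 0 <= K1 y. Proof. by apply: fine_ge0; exact: havg_ge0. Qed.
Let K20 y : 0 <= K2 y. Proof. by apply: fine_ge0; exact: havg_ge0. Qed.
Let K0 y : 0 <= K y. Proof. by rewrite (KE y).2; apply: addr_ge0; [exact: K20|exact: K10]. Qed.
Let KM y : K y <= M.
Proof.
rewrite (KE y).2 /M mulrDl mul1r; apply: lerD; rewrite -lee_fin; first by rewrite -K2E; exact: avg2.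
by rewrite -K1E; exact: avg1.
Qed.
Let mK : measurable_fun setT K.
Proof. by apply: measurableT_comp => //; apply: measurable_havg => //; [exact: measurable_hker|exact: hker_ge0]. Qed.
Let mK2 : measurable_fun setT K2.
Proof. by apply: measurableT_comp => //; exact: measurable_havg. Qed.
Let mK1 : measurable_fun setT K1.
Proof. by apply: measurableT_comp => //; exact: measurable_havg. Qed.

Let om (y : H) : R := indb (s < `|u y|).
Let mom : measurable_fun setT om. Proof. exact: measurable_fun_ltR. Qed.
Let om0 y : 0 <= om y. Proof. by []. Qed.

Let q1 : 1 <= q.
Proof. by rewrite /qexp ler_pdivlMr ?Q1_gt0// mul1r gerBl. Qed.
Let qg : q - 1 = gexp.
Proof. by rewrite /qexp /gexp; field; rewrite gt_eqF// Q1_gt0. Qed.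

Let lnR : R := ln Rad - ln rho.

(** Jensen's inequality moves the power q inside the average. For each centre the annulus
    contributes c ln (Rad / rho); beyond [Rad] the kernel to the power q is at most Rad^(-Q), which
    on a set of measure ms = Rad^Q adds at most 1. *)
Let intK2 : (\int[mu]_y (om y * K2 y `^ q)%:E <= (c * lnR + 1)%:E)%E.
Proof.
have mk2q : measurable_fun setT (fun x => k2 x `^ q) by exact: measurable_fun_powR.
have lnR0 : 0 <= lnR by rewrite /lnR subr_ge0 ler_ln ?posrE.
have c0 : 0 < c := csphere_gt0 hsigma n0.
apply: (@le_trans _ _ (\int[mu]_y ((om y)%:E * havg phi (fun x => (k2 x `^ q)%R) y))%E).
  apply: int_le.
  - by move=> y; rewrite lee_fin mulr_ge0// powR_ge0.
  - by apply/measurable_EFinP; exact: (measurable_funM mom (measurable_fun_powR q mK2)).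
  - apply: emeasurable_funM; first exact/measurable_EFinP.
    by apply: measurable_havg => // x; rewrite powR_ge0.
  - move=> y; rewrite EFinM; apply: lee_wpmul2l; first by rewrite lee_fin.
    by apply: havg_jensen => //; exact: K2E.
apply: int_havg_le => //; first by rewrite addr_ge0// mulr_ge0// ltW.
  by move=> x; rewrite powR_ge0.
move=> x; pose g (y : H) : R := indb (rho <= hnorm y) * indb (hnorm y < Rad) * hker y `^ q.
have mg : measurable_fun setT g.
  apply: measurable_funM; last by apply: measurable_fun_powR; exact: measurable_hker.
  by apply: measurable_funM; [apply: measurable_fun_leR|apply: measurable_fun_ltR] => //; exact: measurable_hnorm.
have g0 y : 0 <= g y by rewrite !mulr_ge0// powR_ge0.
have mgx : measurable_fun setT (fun y => g (hmul (- x) y)) by apply: (measurableT_comp mg); exact: measurable_fun_hmul.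
apply: (@le_trans _ _ (\int[mu]_y ((g (hmul (- x) y))%:E + (Rad ^- Q)%:E * (om y)%:E))%E).
  apply: int_le.
  - by move=> y; rewrite lee_fin mulr_ge0// powR_ge0.
  - apply/measurable_EFinP; apply: measurable_funM; first exact: mom.
    by apply: (measurableT_comp mk2q); exact: measurable_fun_hmul.
  - by apply: emeasurable_funD; [exact/measurable_EFinP|apply: emeasurable_funM => //; exact/measurable_EFinP].
  - move=> y; rewrite -EFinM -EFinD lee_fin; move: (hmul _ _) => w.
    have RQ0 : 0 <= Rad ^- Q by rewrite invr_ge0 exprn_ge0// ltW.
    rewrite /g /k2 /om; case: (ltP s `|u y|) => _; rewrite indbE ?mul0r; last first.
      by rewrite addr_ge0 ?mulr_ge0 ?powR_ge0.
    rewrite mul1r mulr1; case: (leP rho (hnorm w)) => h1; rewrite indbE ?mul0r; last first.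
      by rewrite powR0 ?add0r// gt_eqF// (lt_le_trans ltr01 q1).
    rewrite !mul1r; case: (ltP (hnorm w) Rad) => h2; rewrite indbE ?mul1r ?mul0r ?lerDl ?add0r//.
    apply: (@le_trans _ _ ((Rad ^- Q.-1) `^ q)).
      apply: ge0_ler_powR; rewrite ?nnegrE ?hker_ge0 ?(le_trans _ q1)// ?invr_ge0 ?exprn_ge0 ?(ltW Rad0)//.
      apply: (le_trans (hker_le w)); rewrite lef_pV2 ?posrE ?exprn_gt0// ?(lt_le_trans Rad0)//.
      by rewrite lerXn2r ?nnegrE ?(ltW Rad0) ?hnorm_ge0.
    have Ri : 0 <= Rad^-1 by rewrite invr_ge0 ltW.
    by have := powR_qexp n 1 Ri; rewrite !mul1n !exprVn => ->.
rewrite intD; last 4 first.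
- by move=> y; rewrite lee_fin.
- exact/measurable_EFinP.
- by move=> y; rewrite -EFinM lee_fin mulr_ge0// invr_ge0 exprn_ge0// ltW.
- by apply: emeasurable_funM => //; exact/measurable_EFinP.
rewrite int_hmull// (int_hker_powR hsigma n0 rho0 rhoR) intZ.
- by rewrite hms -EFinM RadQ mulVf ?gt_eqF.
- by rewrite invr_ge0 exprn_ge0// ltW.
- by move=> y; rewrite lee_fin.
- exact/measurable_EFinP.
Qed.

Let intK1 : (\int[mu]_y (K1 y)%:E <= (S * rho)%:E)%E.
Proof.
have -> : (\int[mu]_y (K1 y)%:E = \int[mu]_y (1%:E * havg phi k1 y))%E.
  by apply: eq_int => y; rewrite mul1e K1E.
apply: (@int_havg_le _ _ phi mphi phi0 phi1 (fun=> 1)) => //; first by rewrite mulr_ge0// ltW.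
move=> x; under eq_integral => y _ do rewrite mul1r.
by rewrite int_hmull//; exact: (int_hker_ball hsigma (ltW rho0)).
Qed.

Let B : R := c * lnR + 1 + q * S * (1 + S) `^ gexp.

Let mK2q : measurable_fun setT (fun y => om y * K2 y `^ q).
Proof. exact: (measurable_funM mom (measurable_fun_powR q mK2)). Qed.

(** Only the far part may carry the logarithm, with coefficient exactly c. The near part is
    linearised, (K2 + K1)^q <= K2^q + q K1 K^(q-1): here K^(q-1) is at most of order 1/rho and the
    integral of K1 at most of order rho, so the cost is a constant. *)
Let intK : (\int[mu]_y ((om y * K y) `^ q)%:E <= B%:E)%E.
Proof.
have Mg : M `^ gexp = (1 + S) `^ gexp / rho.
  rewrite /M powRM ?addr_ge0// ?invr_ge0 ?exprn_ge0 ?(ltW rho0)//; congr (_ * _).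
  rewrite -exprVn -powR_mulrn ?invr_ge0 ?(ltW rho0)// -powRrM predQ /gexp mulfV ?gt_eqF ?Q1_gt0//.
  by rewrite powRr1// invr_ge0 ltW.
have Mg0 : 0 <= q * M `^ gexp by rewrite mulr_ge0 ?powR_ge0// (le_trans _ q1).
apply: (@le_trans _ _ (\int[mu]_y ((om y * K2 y `^ q)%:E + (q * M `^ gexp)%:E * (K1 y)%:E))%E).
  apply: int_le.
  - by move=> y; rewrite lee_fin powR_ge0.
  - by apply/measurable_EFinP; apply: measurable_fun_powR; exact: measurable_funM.
  - apply/measurable_EFinP; apply: measurable_funD; last exact: measurable_funM.
    exact: mK2q.
  - move=> y; rewrite -EFinM -EFinD lee_fin /om; case: (ltP s `|u y|) => _; rewrite indbE ?mul0r; last first.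
      rewrite powR0 ?gt_eqF ?(lt_le_trans ltr01 q1)// add0r; apply: mulr_ge0 => //; exact: K10.
    rewrite !mul1r; have [_ ->] := KE y; apply: (le_trans (powRD_le q1 (K20 y) (K10 y))).
    rewrite lerD2l mulrAC ler_wpM2r// ler_wpM2l ?(le_trans _ q1)// qg.
    have [_ <-] := KE y; apply: ge0_ler_powR => //; rewrite ?nnegrE//.
    by rewrite invr_ge0 ltW// Q1_gt0.
rewrite intD; last 4 first.
- by move=> y; rewrite lee_fin mulr_ge0// powR_ge0.
- by apply/measurable_EFinP; exact: mK2q.
- by move=> y; rewrite -EFinM lee_fin mulr_ge0.
- by apply/measurable_EFinP; exact: measurable_funM.
rewrite (@intZ _ _ _ _ (q * M `^ gexp) (fun y => (K1 y)%:E)); [|exact: Mg0|by move=> y; rewrite lee_fin|by apply/measurable_EFinP; exact: mK1].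
rewrite /B EFinD; apply: leeD; first exact: intK2.
apply: (@le_trans _ _ ((q * M `^ gexp)%:E * (S * rho)%:E)%E); first by apply: lee_wpmul2l; [rewrite lee_fin|exact: intK1].
rewrite -EFinM lee_fin Mg; apply: eqW.
by have := lt0r_neq0 rho0; move: (_ `^ _) => z r0; field.
Qed.

Let mL d : measurable_fun setT (layer u D s t d). Proof. exact: measurable_layer. Qed.

(** The pointwise bound holds at every x with |u x| at least t; it is averaged over these x, each
    inner integral being shifted by a left translation. *)
Let avg_le d : 0 < d -> ((c * (t - s))%:E <= \int[mu]_y (layer u D s t d y * K y)%:E)%E.
Proof.
move=> d0; have L0 y : 0 <= layer u D s t d y by rewrite (layer_ge0 hu)// ltW.
have c0 : 0 < c := csphere_gt0 hsigma n0.
have -> : (\int[mu]_y (layer u D s t d y * K y)%:E =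
    \int[mu]_y ((layer u D s t d y)%:E * havg phi (@hker R n) y))%E.
  by apply: eq_int => y; have [-> _] := KE y; rewrite EFinM.
rewrite int_havg//; last 2 first.
- exact: measurable_hker.
- exact: hker_ge0.
have ct0 : 0 <= c * (t - s) by rewrite mulr_ge0 ?(ltW c0)// subr_ge0 ltW.
rewrite -[leLHS](@int_phiM _ _ phi mphi phi0 phi1)//; apply: int_le.
- by move=> x; rewrite -EFinM lee_fin mulr_ge0.
- by apply: emeasurable_funM => //; exact/measurable_EFinP.
- apply: emeasurable_funM; first exact/measurable_EFinP.
  apply: (@measurable_int2 _ _ _ _ _ mu (fun p : H * H => (layer u D s t d p.2 * hker (hmul (- p.1) p.2))%:E)).
    apply/measurable_EFinP; apply: measurable_funM.
      exact: (measurableT_comp (mL d) measurable_snd).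
    apply: (measurableT_comp (@measurable_hker R n)); apply: measurable_fun_hmul; last exact: measurable_snd.
    by apply: measurable_fun_hN; exact: measurable_fst.
  by move=> p; rewrite lee_fin mulr_ge0// hker_ge0.
- move=> x; rewrite {1 2}/phi; case: (leP t `|u x|) => tx; rewrite indbE; last by rewrite mul0r !mul0e.
  apply: lee_wpmul2l; first by rewrite lee_fin mul1r invr_ge0 ltW.
  apply: (le_trans (pointwise_layer hu hsigma n0 s0 st d0 tx)).
  rewrite -(@int_hmull _ _ (fun y => layer u D s t d y * hker (hmul (- x) y)) x).
  + by apply: eqW; apply: eq_int => y; rewrite hmulK.
  + apply: measurable_funM => //; apply: (measurableT_comp (@measurable_hker R n)).
    exact: measurable_fun_hmul.
  + by move=> y; rewrite mulr_ge0// hker_ge0.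
Qed.

Let f1 (y : H) : R := indb (s < `|u y|) * indb (`|u y| < t) * D y.

(** Hoelder's inequality between the energy of the layer and [intK], raised to the power q. Then
    c^(-q) c = c^(-1/(Q-1)) and ln (Rad / rho) = ln (ms / mt) / Q make up the constant A. *)
Lemma isocapacity : (t - s) `^ q <= e `^ gexp * (A_const sigma * ln (ms / mt) + isoC).
Proof.
have c0 : 0 < c := csphere_gt0 hsigma n0.
have f10 y : 0 <= f1 y by rewrite !mulr_ge0// (ug_ge0 hu).
have mf1 : measurable_fun setT f1.
  apply: measurable_funM; last exact: ug_gradient_measurable hu.
  by apply: measurable_funM; exact: measurable_fun_ltR.
have lnR0 : 0 <= lnR by rewrite /lnR subr_ge0 ler_ln ?posrE.
have q0 : 0 < q by rewrite (lt_le_trans _ q1).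
have B0 : 0 <= B.
  rewrite /B; apply: addr_ge0; first by apply: addr_ge0 => //; rewrite mulr_ge0// ltW.
  by rewrite mulr_ge0 ?powR_ge0// mulr_ge0// ltW.
have h1 : ((c * (t - s))%:E <= \int[mu]_y (f1 y * (om y * K y))%:E)%E.
  (* The averaged kernel is bounded and {|u| > s} has finite measure, so the auxiliary term of the
     layer vanishes with d. *)
  have key d : 0 < d -> ((c * (t - s))%:E <= \int[mu]_y (f1 y * (om y * K y))%:E + (d * (M * ms))%:E)%E.
    move=> d0; apply: (le_trans (avg_le d0)).
    have -> : ((d * (M * ms))%:E = \int[mu]_y ((d * M)%:E * (om y)%:E))%E.
      rewrite (@intZ _ _ _ _ (d * M) (fun y => (om y)%:E)); first by rewrite hms -EFinM mulrA.
      + by apply: mulr_ge0; [exact: ltW|exact: M0].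
      + by move=> y; rewrite lee_fin.
      + exact/measurable_EFinP.
    rewrite -intD; last 4 first.
    - by move=> y; rewrite lee_fin; apply: mulr_ge0 => //; apply: mulr_ge0; [exact: om0|exact: K0].
    - by apply/measurable_EFinP; exact: (measurable_funM mf1 (measurable_funM mom mK)).
    - by move=> y; rewrite -EFinM lee_fin; apply: mulr_ge0; [apply: mulr_ge0; [exact: ltW|exact: M0]|exact: om0].
    - by apply/measurable_EFinP; apply: measurable_funM; [exact: measurable_cst|exact: mom].
    apply: int_le.
    - by move=> y; rewrite lee_fin; apply: mulr_ge0; [rewrite (layer_ge0 hu)// ltW|exact: K0].
    - by apply/measurable_EFinP; exact: (measurable_funM (mL d) mK).
    - apply/measurable_EFinP; apply: measurable_funD.
        exact: (measurable_funM mf1 (measurable_funM mom mK)).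
      by apply: measurable_funM; [exact: measurable_cst|exact: mom].
    - move=> y; rewrite -EFinM -EFinD lee_fin /layer -/(f1 y) -/(om y) mulrDl; apply: lerD.
        by rewrite /f1 /om; case: (s < _); rewrite !indbE ?mul0r// !mul1r.
      by rewrite mulrAC; apply: ler_wpM2r; [exact: om0|apply: ler_wpM2l; [exact: ltW|exact: KM]].
  apply/lee_addgt0Pr => d d0; have Mms : 0 < M * ms + 1 by rewrite ltr_pwDr// mulr_ge0 ?M0// ltW.
  apply: (le_trans (key _ (divr_gt0 d0 Mms))); apply: leeD2l.
  by rewrite lee_fin mulrAC ler_pdivrMr// ler_wpM2l ?(ltW d0)// lerDl.
have Qq : Q%:R^-1 + q^-1 = 1 :> R.
  by rewrite /qexp invf_div; field; rewrite gt_eqF// Q0.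
have h2 := hoelder_powR Q0 q0 Qq mf1 (measurable_funM mom mK) f10 (fun y => mulr_ge0 (om0 y) (K0 y)) e0 B0 he intK.
have h3 : c * (t - s) <= e `^ Q%:R^-1 * B `^ q^-1 by rewrite -lee_fin (le_trans h1).
have ct0 : 0 <= c * (t - s) by rewrite mulr_ge0 ?(ltW c0)// subr_ge0 ltW.
have h4 : c `^ q * (t - s) `^ q <= e `^ gexp * B.
  rewrite -powRM ?(ltW c0) ?subr_ge0 ?(ltW st)//.
  apply: (le_trans (ge0_ler_powR (ltW q0) _ _ h3)); rewrite ?nnegrE ?mulr_ge0 ?powR_ge0 ?(ltW c0)// ?subr_ge0 ?(ltW st)//.
  rewrite powRM ?powR_ge0// -!powRrM mulVf ?gt_eqF// powRr1//.
  by rewrite (_ : Q%:R^-1 * q = gexp)// /qexp /gexp mulrA mulVf ?mul1r// gt_eqF.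
have cq0 : 0 < c `^ q by rewrite powR_gt0.
have h5 : (t - s) `^ q <= e `^ gexp * (c `^ (- q) * B).
  by rewrite mulrCA powRN ler_pdivlMl.
apply: (le_trans h5); apply: ler_wpM2l; first exact: powR_ge0.
rewrite /B /isoC A_const_csphere; apply: eqW.
have -> : c * lnR + 1 + q * S * (1 + S) `^ gexp = c * lnR + (1 + q * S * (1 + S) `^ gexp) by rewrite addrA.
rewrite mulrDr; congr (_ + _).
have -> : lnR = Q%:R^-1 * ln (ms / mt).
  by rewrite /lnR !ln_powR ln_div ?posrE// mulrBr.
have E : c `^ (- q) * c = c `^ (- (Q%:R - 1)^-1).
  rewrite -[X in _ * X = _](powRr1 (ltW c0)) -powRD ?(gt_eqF c0) ?implybT//.
  by congr (_ `^ _); have := qg; rewrite /gexp; move: (_^-1) => z; lra.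
by rewrite mulrA E mulrCA mulrA.
Qed.

End isocapacity.

(** * Counting the levels that carry a large term *)

Section counting.

(** Members beyond L lie within L of the least of them, all others are at most L: this makes two
    windows of L + 1 integers. *)
Lemma count_spread (P : pred nat) L J :
  (forall i j, P i -> P j -> (j < i)%N -> (j <= L)%N || (i - j <= L)%N) ->
  (count P (iota 0 J) <= 2 * L + 2)%N.
Proof.
move=> h; have [a ha] : exists a, forall j, P j -> (L < j)%N -> (a <= j <= a + L)%N.
  have [/asboolP ex|/asboolPn nex] := boolP `[< exists j, (L < j)%N && P j >]; last first.
    by exists 0%N => j pj Lj; exfalso; apply: nex; exists j; rewrite Lj.
  exists (ex_minn ex); case: ex_minnP => a /andP[La pa] amin j pj Lj.
  have aj := amin j; rewrite Lj pj in aj; rewrite aj//=.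
  have [ja|] := ltnP a j; last by move=> ja; rewrite (leq_trans ja)// leq_addr.
  have := h _ _ pj pa ja; rewrite leqNgt La/=; lia.
rewrite -size_filter.
apply: (@leq_trans (size (iota 0 L.+1 ++ iota a L.+1))); last by rewrite size_cat !size_iota; lia.
apply: uniq_leq_size; first by rewrite filter_uniq// iota_uniq.
move=> j; rewrite mem_filter mem_cat !mem_iota => /andP[pj _].
by have [Lj|jL] := ltnP L j; [have := ha j pj Lj; lia|lia].
Qed.

Variable R : realType.

Lemma expRN_nat_le (k : nat) : expR (- k%:R) <= 2^-1 ^+ k :> R.
Proof.
have -> : - k%:R = k%:R * (-1) :> R by rewrite mulrN1.
rewrite expRM_natl lerXn2r ?nnegrE ?expR_ge0//.
by rewrite expRN lef_pV2 ?posrE ?expR_gt0//; have := @expR_ge1Dx R 1; lra.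
Qed.

Lemma sum_geometric (K : nat) : \sum_(k < K) expR (- k%:R) * k.+1%:R <= 4 :> R.
Proof.
(* The exact value of the sum of (k+1) 2^(-k) over k < K. *)
apply: (@le_trans _ _ (4 - 2 * (K%:R + 2) * 2^-1 ^+ K)); last first.
  by rewrite gerBl !mulr_ge0 ?addr_ge0// exprn_ge0.
elim: K => [|K IH]; first by rewrite big_ord0 expr0 mulr1; lra.
have step (S x y k : R) : S <= 4 - 2 * (k + 2) * y -> x <= y -> 0 <= k ->
    S + x * (k + 1) <= 4 - 2 * (k + 1 + 2) * (2^-1 * y).
  move=> IH' xy k0; have : x * (k + 1) <= y * (k + 1) by rewrite ler_wpM2r//; lra.
  lra.
rewrite big_ord_recr/= exprS -(natr1 K); apply: step => //; exact: expRN_nat_le.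
Qed.

(** Each term is at most the sum of B e^(-k) over those k < K at which it is counted, plus B e^(-K).
    With K = J the remainders add up to B J e^(-J), at most B, which is the 1 in the bound. *)
Lemma sum_geometric_count (w : nat -> R) (B : R) (c J : nat) : 0 <= B ->
  (forall j, 0 <= w j <= B) ->
  (forall k, (count (fun j => (0 < w j)%R && (B * expR (- k.+1%:R) <= w j)%R) (iota 0 J) <= c * k.+1)%N) ->
  \sum_(j < J) w j <= B * (4 * c%:R + 1).
Proof.
move=> B0 w01 hc; pose P k j := (0 < w j) && (B * expR (- k.+1%:R) <= w j).
have wle K j : w j <= \sum_(k < K) B * expR (- k%:R) * (P k j)%:R + B * expR (- K%:R).
  elim: K => [|K IH]; first by rewrite big_ord0 add0r oppr0 expR0 mulr1; have /andP[] := w01 j.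
  rewrite big_ord_recr/=; have S0 : 0 <= \sum_(k < K) B * expR (- k%:R) * (P k j)%:R.
    by apply: sumr_ge0 => k _; rewrite !mulr_ge0// expR_ge0.
  have [p|np] := boolP (P K j).
    rewrite mulr1; apply: (le_trans IH); rewrite lerDl mulr_ge0// expR_ge0.
  rewrite mulr0 addr0; apply: (@le_trans _ _ (B * expR (- K.+1%:R))); last by rewrite lerDr.
  move: np; rewrite /P negb_and -leNgt -ltNge => /orP[h|/ltW//].
  by apply: (le_trans h); rewrite mulr_ge0// expR_ge0.
apply: (@le_trans _ _ (\sum_(j < J) (\sum_(k < J) B * expR (- k%:R) * (P k j)%:R + B * expR (- J%:R)))).
  by apply: ler_sum => j _; exact: wle.
rewrite big_split/= exchange_big/= mulrDr; apply: lerD.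
  apply: (@le_trans _ _ (\sum_(k < J) B * expR (- k%:R) * (c * k.+1)%:R)).
    apply: ler_sum => k _; rewrite -mulr_sumr ler_wpM2l ?mulr_ge0 ?expR_ge0// -natr_sum ler_nat.
    have E : iota 0 J = index_iota 0 J by rewrite /index_iota subn0.
    apply: leq_trans (hc k); rewrite -sum1_count E big_mkord.
    rewrite [leqRHS]big_mkcond/=.
    by apply: leq_sum => j _; rewrite /P; case: ifP.
  under eq_bigr => k _ do rewrite natrM -mulrA [X in _ * X]mulrCA.
  rewrite -mulr_sumr -mulr_sumr ler_wpM2l// mulrC ler_wpM2r// sum_geometric//.
rewrite sumr_const card_ord -(mulr_natr (B * expR (- J%:R)) J) -mulrA ler_wpM2l//.
apply: (@le_trans _ _ (expR (- J%:R) * expR J%:R)); last by rewrite -expRD addNr expR0.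
by rewrite ler_wpM2l ?expR_ge0//; apply: le_trans (expR_ge1Dx _); rewrite lerDr.
Qed.

End counting.

Section levels.
Variable R : realType.
Implicit Types (x y a b : R).

Lemma powR_bernoulli a y : 1 <= a -> 0 <= y -> 1 + a * (y - 1) <= y `^ a.
Proof.
move=> a1 y0; have := powR_tangent a1 y0 ler01; rewrite !powR1; lra.
Qed.

(** Bernoulli's inequality for the exponent 1/a at the point x^a. *)
Lemma powR_concave a x : 0 < a -> a <= 1 -> 0 <= x -> x `^ a <= 1 + a * (x - 1).
Proof.
move=> a0 a1 x0; have a1' : 1 <= a^-1 by rewrite invf_ge1.
have := powR_bernoulli a1' (powR_ge0 x a); rewrite -powRrM mulfV ?gt_eqF// powRr1//.
rewrite -(ler_pM2l a0) mulrDr mulrA mulfV ?gt_eqF// mul1r mulr1; lra.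
Qed.

Variables (A C1 g p : R).
Hypotheses (A0 : 0 < A) (C10 : 0 <= C1) (g0 : 0 < g) (g3 : g <= 3^-1) (p0 : 0 <= p).
Let q : R := 1 + g.

Definition lev (j : nat) : R := (A * j%:R) `^ q^-1.

Definition wlev (mu : R -> R) (j : nat) : R :=
  expR j%:R * lev j `^ (- (g * p)) * mu (lev j).

Let q0 : 0 < q. Proof. by rewrite /q ltr_pwDl// ltW. Qed.
Let q1 : 1 <= q. Proof. by rewrite /q lerDl ltW. Qed.

Lemma lev_gt0 j : (0 < j)%N -> 0 < lev j.
Proof. by move=> j0; rewrite powR_gt0// mulr_gt0// ltr0n. Qed.

Lemma lev_powR j : lev j `^ q = A * j%:R.
Proof. by rewrite /lev -powRrM mulVf ?gt_eqF// powRr1// mulr_ge0// ltW. Qed.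

Lemma lev_ln j : (0 < j)%N -> q * ln (lev j) = ln A + ln j%:R.
Proof.
by move=> j0; rewrite /lev ln_powR mulrA mulfV ?gt_eqF// mul1r lnM// posrE// ltr0n.
Qed.

Lemma lev_le i j : (i <= j)%N -> lev i <= lev j.
Proof.
move=> ij; apply: ge0_ler_powR; rewrite ?invr_ge0 ?(ltW q0) ?nnegrE ?mulr_ge0 ?(ltW A0)//.
by rewrite ler_wpM2l ?(ltW A0)// ler_nat.
Qed.

(** The three losses in [wlev_eta]: from Bernoulli's inequality, from Chebyshev's inequality at the
    lower level, and from the additive constant of the isocapacitary inequality. *)
Definition levC : R := q + p * `|ln (A / 2)| + C1 / A.

(** Twice the constant with which the proof of [wlev_spread] bounds (i - j) j / (k i), plus 1 for
    the case i - j < k. *)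
Definition levK : R := 2 * ((2 * q * (A + C1) / A) `^ g^-1 * (q / g)) + 1.

Section sequence.
(** Here [mu] models the distribution function and [eta t] the part above t of a total energy of at
    most 1. A layer that ends at t has at most 1 - eta t of it ([iso1]), a layer that starts at s at
    most eta s ([iso2]). *)
Variables (mu eta : R -> R) (M : R).
Hypothesis mu_mono : forall s t, 0 < s -> s <= t -> mu t <= mu s.
Hypothesis eta01 : forall t, 0 <= eta t <= 1.
Hypothesis cheb : forall s, 0 < s -> s `^ p * mu s <= M.
Hypothesis iso1 : forall s t, 0 < s -> s < t -> 0 < mu t ->
  (t - s) `^ q <= (1 - eta t) `^ g * (A * ln (mu s / mu t) + C1).
Hypothesis iso2 : forall s t, 0 < s -> s < t -> 0 < mu t ->
  (t - s) `^ q <= eta s `^ g * (A * ln (mu s / mu t) + C1).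

Lemma wlev_gt0 j : (0 < j)%N -> 0 < mu (lev j) -> 0 < wlev mu j.
Proof. by move=> j0 m0; rewrite /wlev !mulr_gt0 ?expR_gt0// powR_gt0 ?lev_gt0. Qed.

Lemma wlev_ln j : (0 < j)%N -> 0 < mu (lev j) ->
  ln (wlev mu j) = j%:R - g * p * ln (lev j) + ln (mu (lev j)).
Proof.
move=> j0 m0; have l0 := lev_gt0 j0.
rewrite /wlev !lnM ?posrE ?mulr_gt0 ?expR_gt0 ?(powR_gt0 _ l0)//.
by rewrite expRK ln_powR mulNr.
Qed.

(* The upper level [lev j] is compared with the level [lev j / (2 j)]. *)
Lemma wlev_eta j : (0 < j)%N -> 0 < mu (lev j) -> 0 < M ->
  g * j%:R * eta (lev j) - levC <= ln M - ln (wlev mu j).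
Proof.
move=> j0 m0 M0; have t0 := lev_gt0 j0; rewrite (wlev_ln j0 m0).
have J1 : 1 <= j%:R :> R by rewrite ler1n.
have J0 : 0 < j%:R :> R by rewrite ltr0n.
have lt := lev_ln j0; have tq := lev_powR j; have := eta01 (lev j).
set t := lev j in t0 lt m0 tq *; set J := (j%:R : R) in J1 J0 lt tq *; clearbody J.
move: (eta t) (iso1 (s := t / (2 * J)) (t := t)) => e iso /andP[e0 e1].
have s0 : 0 < t / (2 * J) by rewrite divr_gt0// mulr_gt0.
have st : t / (2 * J) < t.
  rewrite ltr_pdivrMr ?mulr_gt0// ltr_pMr//; lra.
have {}iso := iso s0 st m0.
have ms : 0 < mu (t / (2 * J)) by apply: (lt_le_trans m0); apply: mu_mono => //; exact: ltW.
have lnms : p * ln (t / (2 * J)) + ln (mu (t / (2 * J))) <= ln M.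
  rewrite -ln_powR -lnM ?posrE ?powR_gt0// ler_ln ?posrE ?mulr_gt0 ?powR_gt0//.
  exact: cheb.
(* By Bernoulli's inequality the lower level t/(2j) loses only the constant q/2 from the exponent
   j. *)
have low : A * (J - q / 2) <= (t - t / (2 * J)) `^ q.
  have -> : t - t / (2 * J) = t * (1 - (2 * J)^-1) by rewrite mulrBr mulr1.
  have J2 : (2 * J)^-1 <= 1 by rewrite invf_le1 ?mulr_gt0//; lra.
  rewrite powRM ?(ltW t0)// ?subr_ge0// tq -mulrA ler_pM2l//.
  apply: (@le_trans _ _ (J * (1 + q * ((1 - (2 * J)^-1) - 1)))); last first.
    by rewrite ler_pM2l//; apply: powR_bernoulli => //; rewrite subr_ge0.
  rewrite le_eqVlt; apply/orP; left; apply/eqP.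
  by move: (gt_eqF J0) => /negbT h; field.
(* Energy above t is missing from the layer below it, and the gain is linear in that energy; it
   becomes the term g j eta. *)
have conc : (1 - e) `^ g <= 1 - g * e.
  have := powR_concave g0 (le_trans g3 _) (_ : 0 <= 1 - e); rewrite subr_ge0 => /(_ _ e1).
  move=> h; apply: (le_trans (h _)); first by lra.
  by lra.
(* As t^q = A j, the lower level t/(2j) equals (A/2) t^(-g). Chebyshev's inequality there produces
   the power t^(gp), which the weight in [wlev] cancels. *)
have lns : ln (t / (2 * J)) = ln (A / 2) - g * ln t.
  have -> : ln (t / (2 * J)) = ln t - ln 2 - ln J.
    by rewrite ln_div ?posrE ?mulr_gt0// lnM ?posrE// opprD addrA.
  rewrite ln_div ?posrE//; move: lt; rewrite /q; lra.
rewrite ln_div ?posrE// in iso.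
move: (le_trans low iso) => {low iso} iso.
have pl : - (p * ln (A / 2)) <= p * `|ln (A / 2)|.
  by rewrite -mulrN ler_wpM2l// -normrN ler_norm.
rewrite lns in lnms; rewrite /levC.
move: (powR_ge0 (1 - e) g) iso conc lnms pl.
move: (mu (t / (2 * J))) ms => m1 ms.
move: (_ `^ g) (ln (mu t)) (ln m1) (ln M) (ln (A / 2)) (ln t) => z a b c l lnt.
move: (`|l|) => al z0 iso conc lnms pl.
have C1A : A * (C1 / A) = C1 by rewrite mulrCA mulfV ?mulr1// gt_eqF.
move: (C1 / A) C1A => D CA.
have iso' : J - q / 2 <= z * (b - a + D).
  have : A * (J - q / 2) <= A * (z * (b - a + D)) by rewrite -CA in iso; move: iso; congr (_ <= _); ring.
  by rewrite ler_pM2l.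
have JQ : 0 < J - q / 2.
  suff : forall x y : R, 1 <= x -> y <= 3^-1 -> 0 < x - (1 + y) / 2 by exact.
  by move=> x y x1 y1; lra.
have X0 : 0 <= b - a + D.
  rewrite leNgt; apply/negP => Xn; have : z * (b - a + D) <= 0 by rewrite mulr_ge0_le0// ltW.
  lra.
have iso2' : J - q / 2 <= (1 - g * e) * (b - a + D) by apply: (le_trans iso'); apply: ler_wpM2r.
have gE : 0 <= g * e by rewrite mulr_ge0// ltW.
have gE1 : g * e <= 3^-1 by apply: (le_trans _ g3); rewrite ler_piMr// ltW.
have X1 : b - a + D <= J + (c - (J - g * p * lnt + a) + p * al + D) by nra.
rewrite leNgt; apply/negP => lt2.
have X2 : b - a + D < J + g * e * J - q by rewrite -/q; lra.
have : (1 - g * e) * (b - a + D) <= (1 - g * e) * (J + g * e * J - q).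
  by apply: ler_wpM2l; [lra|exact: ltW].
have : 0 <= (g * e) ^+ 2 * J by rewrite mulr_ge0 ?sqr_ge0// ltW.
move: (g * e) gE gE1 iso2' => f f0 f1 h1 h2 h3.
have : 0 <= (3^-1 - f) * q by rewrite mulr_ge0 ?subr_ge0// ltW.
move: q0 => q0'; nra.
Qed.

Definition levB : R := M * expR levC.

Lemma levB_ln : 0 < M -> ln levB = ln M + levC.
Proof. by move=> M0; rewrite /levB lnM ?posrE ?expR_gt0// expRK. Qed.

Lemma wlev_le j : (0 < j)%N -> 0 < mu (lev j) -> 0 < M ->
  g * j%:R * eta (lev j) <= ln levB - ln (wlev mu j).
Proof.
move=> j0 m0 M0; have := wlev_eta j0 m0 M0; rewrite (levB_ln M0).
by move: (g * _) (levC) => a b; lra.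
Qed.

Lemma wlev_le_levB j : (0 < j)%N -> 0 <= mu (lev j) -> wlev mu j <= levB.
Proof.
move=> j0; rewrite le_eqVlt => /orP[/eqP m0|m0].
  rewrite /wlev -m0 mulr0 mulr_ge0 ?expR_ge0//.
  by apply: le_trans (cheb (lev_gt0 j0)); rewrite -m0 mulr0.
have M0 : 0 < M by apply: lt_le_trans (cheb (lev_gt0 j0)); apply: mulr_gt0 m0; exact: powR_gt0 (lev_gt0 j0).
have W0 := wlev_gt0 j0 m0.
rewrite -ler_ln ?posrE ?W0 ?(mulr_gt0 M0 (expR_gt0 _))// -subr_ge0.
apply: le_trans (wlev_le j0 m0 M0); rewrite !mulr_ge0 ?(ltW g0)//.
by have /andP[] := eta01 (lev j).
Qed.

(** A term of relative size e^(-k) leaves energy at most k/(g j) above t_j, and the logarithm of the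
    ratio of the measures is at most k + (i - j). Since t_i - t_j is at least t_i (i - j)/(q i),
    [iso2] bounds (i - j) j by a multiple of k i when i - j is at least k. *)
Lemma wlev_spread i j (k : R) : (0 < j)%N -> (j < i)%N -> 1 <= k -> 0 < M ->
  0 < mu (lev j) -> 0 < mu (lev i) ->
  levB * expR (- k) <= wlev mu j -> levB * expR (- k) <= wlev mu i ->
  j%:R <= levK * k \/ (i - j)%:R <= levK * k.
Proof.
move=> j0 ji k1 M0 mj mi wj wi; have i0 : (0 < i)%N := ltn_trans j0 ji.
have k0 : 0 < k by apply: lt_le_trans k1.
have B0 : 0 < levB by rewrite mulr_gt0 ?expR_gt0.
have lnw h : (0 < h)%N -> 0 < mu (lev h) -> levB * expR (- k) <= wlev mu h -> ln levB - k <= ln (wlev mu h).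
  move=> h0 mh; have W0 := wlev_gt0 h0 mh.
  rewrite -ler_ln ?posrE ?W0 ?(mulr_gt0 B0 (expR_gt0 _))//.
  by rewrite lnM ?posrE ?expR_gt0// expRK.
have {}wi := lnw _ i0 mi wi; have {}wj := lnw _ j0 mj wj.
have tj0 := lev_gt0 j0; have ti0 := lev_gt0 i0.
have tij : lev j <= lev i by apply: lev_le; exact: ltnW.
have J0 : 0 < j%:R :> R by rewrite ltr0n.
have I0 : 0 < i%:R :> R by rewrite ltr0n.
have ID : i%:R = j%:R + (i - j)%:R :> R by rewrite -natrD subnKC// ltnW.
have D1 : 1 <= (i - j)%:R :> R by rewrite ler1n subn_gt0.
set J := (j%:R : R) in J0 ID *; set I := (i%:R : R) in I0 ID; set D := ((i - j)%:R : R) in ID D1 *.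
have D0 : 0 < D by apply: lt_le_trans D1.
have etaj : eta (lev j) <= k / (g * J).
  rewrite ler_pdivlMr ?mulr_gt0// mulrC; have := wlev_le j0 mj M0; rewrite -/J; lra.
have Y0 : 0 <= D / (q * I).
  by rewrite divr_ge0 ?mulr_ge0 ?(ltW D0) ?(ltW q0) ?(ltW I0).
have low : A * I * (D / (q * I)) `^ q <= (lev i - lev j) `^ q.
  have JI : lev j <= lev i * (1 + q^-1 * (J / I - 1)).
    have -> : lev j = lev i * (J / I) `^ q^-1.
      rewrite /lev -powRM ?divr_ge0 ?mulr_ge0 ?(ltW A0)//; congr (_ `^ _).
      by rewrite -mulrA; congr (_ * _); rewrite mulrCA mulfV ?mulr1// gt_eqF.
    rewrite ler_wpM2l ?(ltW ti0)//; apply: powR_concave; rewrite ?invr_gt0 ?invf_le1// divr_ge0// ltW.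
  have : lev i * (D / (q * I)) <= lev i - lev j.
    suff E : lev i * (D / (q * I)) = lev i - lev i * (1 + q^-1 * (J / I - 1)) by rewrite E lerD2l lerN2.
    have -> : J = I - D by rewrite ID addrK.
    by field; rewrite !gt_eqF.
  move/(ge0_ler_powR (ltW q0)); rewrite ?nnegrE powRM ?(ltW ti0)//.
  rewrite lev_powR -/I => h; apply: h; rewrite ?subr_ge0//; first exact: mulr_ge0 (ltW ti0) Y0.
have up : (lev i - lev j) `^ q <= (k / (g * J)) `^ g * ((A + C1) * (k + D)).
  have [E|nE] := eqVneq (lev j) (lev i).
    rewrite E subrr powR0 ?gt_eqF// mulr_ge0 ?powR_ge0// mulr_ge0 ?addr_ge0// ltW//.
  have lt : lev j < lev i by rewrite lt_neqAle nE.
  have h := iso2 tj0 lt mi.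
  have X : ln (mu (lev j) / mu (lev i)) <= k + D.
    rewrite ln_div ?posrE//; have := wlev_ln j0 mj; have := wlev_ln i0 mi.
    have W0 := wlev_gt0 j0 mj.
    have := wlev_le_levB j0 (ltW mj); rewrite -ler_ln ?posrE//.
    have : g * p * ln (lev j) <= g * p * ln (lev i).
      by apply: ler_wpM2l; [rewrite mulr_ge0// ltW|rewrite ler_ln ?posrE].
    rewrite -/I -/J; move: (g * p * _) (g * p * _) => x y; lra.
  have X2 : A * ln (mu (lev j) / mu (lev i)) + C1 <= (A + C1) * (k + D).
    have : A * ln (mu (lev j) / mu (lev i)) <= A * (k + D) by rewrite ler_pM2l.
    have : C1 * 1 <= C1 * (k + D) by apply: ler_wpM2l => //; lra.
    lra.
  apply: (le_trans h); apply: (@le_trans _ _ (eta (lev j) `^ g * ((A + C1) * (k + D)))).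
    by rewrite ler_wpM2l// powR_ge0.
  rewrite ler_wpM2r ?mulr_ge0 ?addr_ge0 ?(ltW A0) ?(ltW k0) ?(ltW D0)//.
  have /andP[e0 _] := eta01 (lev j).
  apply: ge0_ler_powR => //; rewrite ?nnegrE ?(ltW g0)//.
  by rewrite divr_ge0 ?mulr_ge0 ?(ltW g0) ?(ltW k0) ?(ltW J0).
move: (le_trans low up) => {low up} main.
set c := 2 * q * (A + C1) / A; have c0 : 0 < c.
  by rewrite /c !mulr_gt0 ?invr_gt0// ltr_pwDl.
(* If i - j < k the second alternative already holds, as [levK] is at least 1. *)
have [kD|Dk] := leP k D; last first.
  right; apply: (le_trans (ltW Dk)); rewrite ler_peMl ?(ltW k0)//.
  by rewrite /levK lerDr !mulr_ge0 ?powR_ge0 ?(ltW q0) ?invr_ge0 ?(ltW g0).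
have {}Y0 : 0 < D / (q * I) by rewrite divr_gt0 ?mulr_gt0.
have m2 : (D / (q * I)) `^ g <= c * (k / (g * J)) `^ g.
  have E : A * I * (D / (q * I)) `^ q = (A / q * D) * (D / (q * I)) `^ g.
    have E0 x : 0 < x -> x `^ q = x * x `^ g.
      by move=> x0; rewrite /q powRD ?(gt_eqF x0) ?implybT// powRr1// ltW.
    rewrite E0// mulrA; congr (_ * _); field.
    by rewrite !gt_eqF.
  have E2 : (k / (g * J)) `^ g * ((A + C1) * (k + D)) <= (A / q * D) * (c * (k / (g * J)) `^ g).
    have -> : (A / q * D) * (c * (k / (g * J)) `^ g) = (k / (g * J)) `^ g * ((A + C1) * (2 * D)).
      by rewrite /c; field; rewrite !gt_eqF.
    rewrite ler_wpM2l ?powR_ge0// ler_wpM2l ?addr_ge0 ?(ltW A0)//; lra.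
  have := le_trans main E2; rewrite E ler_pM2l// mulr_gt0// divr_gt0//.
have m3 : D / (q * I) <= c `^ g^-1 * (k / (g * J)).
  have KJ : 0 <= k / (g * J) by rewrite divr_ge0 ?mulr_ge0 ?(ltW g0) ?(ltW k0) ?(ltW J0).
  have gi : 0 <= g^-1 by rewrite invr_ge0 ltW.
  have := ge0_ler_powR gi _ _ m2; rewrite !nnegrE powR_ge0 mulr_ge0 ?powR_ge0 ?(ltW c0)// => /(_ isT isT).
  by rewrite -powRrM mulfV ?(gt_eqF g0)// powRr1 ?(ltW Y0)// powRM ?powR_ge0 ?(ltW c0)// -powRrM mulfV ?(gt_eqF g0)// powRr1.
set c6 := c `^ g^-1 * (q / g).
have c60 : 0 <= c6 by rewrite mulr_ge0 ?powR_ge0// divr_ge0 ?(ltW q0) ?(ltW g0).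
have m4 : D * J <= c6 * k * I.
  have : D / (q * I) * (q * I * J) <= c `^ g^-1 * (k / (g * J)) * (q * I * J).
    by rewrite ler_wpM2r// !mulr_ge0 ?(ltW q0) ?(ltW I0) ?(ltW J0).
  rewrite (_ : D / _ * _ = D * J); last by field; rewrite !gt_eqF.
  suff -> : c `^ g^-1 * (k / (g * J)) * (q * I * J) = c6 * k * I by [].
  by rewrite /c6; field; rewrite !gt_eqF.
have KE : levK = 2 * c6 + 1 by [].
(* With i = j + (i - j), the product of j and i - j is at most c6 k times their sum, so one of them
   is at most 2 c6 k. *)
have [h|h1] := leP J (levK * k); [by left|right].
rewrite leNgt; apply/negP => h2; rewrite KE in h1 h2.
have k6 : 0 <= c6 * k by rewrite mulr_ge0// ltW.
rewrite ID in m4; nra.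
Qed.

(** The index starts at 1 because [lev 0] is 0. With an integer N above [levK], the spread N (k + 1)
    gives at most (2N + 2)(k + 1) terms of relative size e^(-k-1). *)
Lemma sum_wlev J : (forall t, 0 <= mu t) ->
  \sum_(j < J) wlev mu j.+1 <= levB * (4 * (2 * (Num.truncn levK).+1 + 2)%:R + 1).
Proof.
move=> mu0; have M0 : 0 <= M by apply: le_trans (cheb ltr01); rewrite mulr_ge0 ?powR_ge0.
have B0 : 0 <= levB by rewrite mulr_ge0// expR_ge0.
apply: (@sum_geometric_count _ (fun j => wlev mu j.+1)) => // [j|k].
  by rewrite wlev_le_levB// andbT !mulr_ge0 ?expR_ge0 ?powR_ge0.
set N := (Num.truncn levK).+1; set P := (X in count X).
have K0 : 0 <= levK.
  by rewrite addr_ge0// !mulr_ge0 ?powR_ge0// ?invr_ge0 ltW.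
have spread i j : P i -> P j -> (j < i)%N -> (j <= N * k.+1)%N || (i - j <= N * k.+1)%N.
  rewrite /P => /andP[pi wi] /andP[pj wj] ji.
  have M0' : 0 < M.
    rewrite lt_neqAle M0 andbT; apply: contraTneq pj => M00.
    by rewrite -leNgt; apply: le_trans (wlev_le_levB _ _) _; rewrite // /levB -M00 mul0r.
  have mup h : 0 < wlev mu h.+1 -> 0 < mu (lev h.+1).
    by rewrite /wlev pmulr_rgt0// mulr_gt0 ?expR_gt0// powR_gt0// lev_gt0.
  have NK (h : nat) : h%:R <= levK * k.+1%:R -> (h <= N * k.+1)%N.
    move=> h1; rewrite -(ler_nat R) natrM; apply: (le_trans h1).
    by rewrite ler_wpM2r//; apply: ltW; exact: truncnS_gt.
  have := fun h => @wlev_spread i.+1 j.+1 k.+1%:R isT ji h M0' (mup _ pj) (mup _ pi) wj wi.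
  rewrite ler1n => /(_ isT)[h|h].
    by rewrite (leq_trans (leqnSn _) (NK _ h)).
  by rewrite subSS in h; rewrite (NK _ h) orbT.
apply: (leq_trans (count_spread J spread)).
nia.
Qed.

End sequence.
End levels.

(** * The inequality for functions with an upper gradient *)

Section exp_tail.
Variable R : realType.
Implicit Types (x : R) (N : nat).

Lemma exp_sum_le x m : 0 <= x -> \sum_(j < m) x ^+ j / j`!%:R <= expR x.
Proof.
move=> x0; have := @nondecreasing_cvgn_le _ (series (exp_coeff x)) _ (is_cvg_series_exp_coeff x) m.
rewrite /series/= big_mkord; apply => i j ij.
rewrite /series/= [leRHS](big_cat_nat (n := i))//= lerDl; apply: sumr_ge0 => k _; exact: exp_coeff_ge0.
Qed.

Lemma exp_tail_ge0 N x : 0 <= x -> 0 <= exp_tail N x.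
Proof. by move=> x0; rewrite subr_ge0 exp_sum_le. Qed.

Lemma exp_tail_le_expR N x : 0 <= x -> exp_tail N x <= expR x.
Proof.
by move=> x0; rewrite gerBl; apply: sumr_ge0 => j _; rewrite divr_ge0// exprn_ge0.
Qed.

(** Factor x^(N+1) out of the remaining series and use (j + N + 1)! >= j!. *)
Lemma exp_tail_le N x : 0 <= x -> exp_tail N x <= x ^+ N.+1 * expR x.
Proof.
move=> x0; rewrite lerBlDl.
have : limn (series (exp_coeff x)) <= \sum_(j < N.+1) x ^+ j / j`!%:R + x ^+ N.+1 * expR x.
  apply: limr_le; first exact: is_cvg_series_exp_coeff.
  near=> m; have /subnKC <- : (N.+1 <= m)%N by near: m; exact: nbhs_infty_ge.
  rewrite /series/= big_mkord big_split_ord/=; apply: lerD => //.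
  apply: le_trans (ler_wpM2l (exprn_ge0 _ x0) (exp_sum_le (m - N.+1) x0)).
  rewrite mulr_sumr; apply: ler_sum => j _; rewrite /exp_coeff/= exprD -mulrA.
  rewrite ler_wpM2l ?exprn_ge0// ler_wpM2l ?exprn_ge0//.
  rewrite lef_pV2 ?posrE ?ltr0n ?fact_gt0// ler_nat leq_fact// leq_addl//.
by [].
Unshelve. all: by end_near. Qed.

Lemma measurable_exp_tail N : measurable_fun setT (@exp_tail R N).
Proof.
apply: measurable_funB; first exact: measurable_expR.
apply: measurable_sum => j; apply: measurable_funM => //; exact: exprn_measurable.
Qed.

End exp_tail.

Section growth.
Context (R : realType) (n : nat).
Local Notation H := (heis R n).
Local Notation Q := (@hdim n).
Local Notation mu := (@haar R n).
Local Notation q := (qexp R n).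
Local Notation g := (gexp R n).
Lemma gexp_gt0 : 0 < g. Proof. by rewrite invr_gt0 Q1_gt0. Qed.

Lemma qexp_gexp : q = 1 + g.
Proof. by rewrite /qexp /gexp; field; rewrite gt_eqF// Q1_gt0. Qed.

(** From n >= 1 comes Q >= 4; the elementary inequalities in [wlev_eta] rely on this range of g. *)
Lemma gexp_le3 : (0 < n)%N -> g <= 3^-1.
Proof.
move=> n0; rewrite lef_pV2 ?posrE ?Q1_gt0// lerBrDr (_ : 3 + 1 = 4%:R)// ?ler_nat; [rewrite /hdim; lia|lra].
Qed.

Let q0 : 0 < q. Proof. by rewrite qexp_gexp ltr_pwDl// ltW// gexp_gt0. Qed.

Variable p : R.
Hypothesis p1 : 1 <= p.

Definition growth (a v : R) : R :=
  exp_tail `|Num.ceil (p * ((Q%:R - 1) / Q%:R) - 1)| (a * v `^ (Q%:R / (Q%:R - 1)))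
    / (1 + v `^ (p / (Q%:R - 1))).

Lemma growth_ge0 a v : 0 <= a -> 0 <= growth a v.
Proof.
by move=> a0; rewrite divr_ge0 ?exp_tail_ge0 ?mulr_ge0 ?powR_ge0// addr_ge0// powR_ge0.
Qed.

Lemma measurable_growth a : measurable_fun setT (growth a).
Proof.
apply: measurable_funM.
  apply: (measurableT_comp (measurable_exp_tail _)).
  by apply: measurable_funM => //; exact: measurable_powR.
apply: (measurable_fun_inv_ge0); first by move=> v; rewrite addr_ge0 ?powR_ge0.
by apply: measurable_funD => //; exact: measurable_powR.
Qed.

(** Between two consecutive levels the exponential stays below e^(j+2) and the denominator above the
    power of the lower level; the steps together dominate the integrand at large values. *)
Definition growth_level A j v : R :=
  expR j.+2%:R * lev A g j.+1 `^ (- (g * p)) * indb (lev A g j.+1 <= v).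

Lemma growth_level_ge0 A j v : 0 <= growth_level A j v.
Proof. by rewrite !mulr_ge0 ?expR_ge0// powR_ge0. Qed.

(** With x = v^q / A: for x < 1 the subtracted Taylor terms leave a multiple of x^(N+1), and the
    ceiling ensures N + 1 >= p/q, which turns this into v^p. For x >= 1 a single step suffices. *)
Lemma growth_bound A v : 0 < A -> 0 <= v ->
  ((growth A^-1 v)%:E <= (expR 1 * A `^ (- (p / q)) * v `^ p)%:E +
   \sum_(0 <= j <oo) (growth_level A j v)%:E)%E.
Proof.
move=> A0 v0; pose F j := (growth_level A j v)%:E.
have F0 j : (0 <= F j)%E by rewrite lee_fin growth_level_ge0.
pose x := A^-1 * v `^ q.
have x0 : 0 <= x by rewrite mulr_ge0 ?powR_ge0// invr_ge0 ltW.
have vx : v `^ q = A * x by rewrite /x mulrA mulfV ?mul1r// gt_eqF.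
have den : 1 <= 1 + v `^ (p / (Q%:R - 1)) by rewrite lerDl powR_ge0.
have den0 : 0 < 1 + v `^ (p / (Q%:R - 1)) by exact: lt_le_trans den.
have [x1|x1] := ltP x 1.
  apply: (@le_trans _ _ (expR 1 * A `^ (- (p / q)) * v `^ p)%:E); last first.
    by rewrite leeDl//; apply: nneseries_ge0 => j _ _; exact: F0.
  rewrite lee_fin /growth ler_pdivrMr//.
  set N := `|_|%N; apply: (@le_trans _ _ (x ^+ N.+1 * expR 1)).
    apply: (le_trans (exp_tail_le N x0)); rewrite ler_wpM2l ?exprn_ge0// ler_expR ltW//.
  apply: (@le_trans _ _ (expR 1 * A `^ (- (p / q)) * v `^ p)); last first.
    by rewrite ler_peMr// !mulr_ge0 ?expR_ge0 ?powR_ge0.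
  rewrite mulrC -mulrA ler_wpM2l ?expR_ge0//.
  have E : A `^ (- (p / q)) * v `^ p = x `^ (p / q).
    rewrite /x powRM ?invr_ge0 ?powR_ge0 ?(ltW A0)//; congr (_ * _).
      by rewrite powRN /powR invr_eq0 gt_eqF// lnV ?posrE// mulrN expRN.
    by rewrite -powRrM mulrCA mulfV ?mulr1// gt_eqF.
  rewrite E -powR_mulrn//; have [->|xn0] := eqVneq x 0.
    by rewrite powR0// powR_ge0.
  rewrite ler_wiXn2l || idtac.
  have lx : x = expR (ln x) by rewrite lnK// posrE lt_neqAle eq_sym xn0.
  have l0 : ln x <= 0 by rewrite ln_le0// ltW.
  rewrite /powR (negbTE xn0) ler_expR; apply: ler_wnM2r => //.
  have := ceil_ge (p * ((Q%:R - 1) / Q%:R) - 1); rewrite -/N => h.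
  have : (Num.ceil (p * ((Q%:R - 1) / Q%:R) - 1))%:~R <= N%:R :> R.
    rewrite /N; case: (Num.ceil _) => k; first by rewrite absz_nat.
    by apply: (@le_trans _ _ 0) => //; rewrite NegzE mulrNz oppr_le0.
  rewrite -natr1 /qexp invf_div; move: h; move: (p * _) (_%:~R) (N%:R) => a b c; lra.
(* Level j + 1 is the last one not above v, since x lies in [j + 1, j + 2). *)
pose j := (Num.truncn x).-1.
have tx : (0 < Num.truncn x)%N by rewrite truncn_gt0.
have jE : j.+1 = Num.truncn x by rewrite /j prednK.
have /andP[jx xj] : j.+1%:R <= x < j.+2%:R by rewrite jE truncn_itv.
have lv : lev A g j.+1 <= v.
  have -> : v = (v `^ q) `^ q^-1 by rewrite -powRrM mulfV ?gt_eqF// powRr1.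
  rewrite /lev -qexp_gexp; apply: ge0_ler_powR; rewrite ?nnegrE ?powR_ge0 ?mulr_ge0 ?(ltW A0)// ?invr_ge0 ?(ltW q0)//.
  by rewrite vx ler_wpM2l// ltW.
apply: (@le_trans _ _ (F j)).
  rewrite lee_fin /growth_level lv indbE mulr1 /growth ler_pdivrMr//.
  apply: (le_trans (exp_tail_le_expR _ x0)); apply: (@le_trans _ _ (expR j.+2%:R)).
    by rewrite ler_expR ltW.
  rewrite -mulrA ler_peMr ?expR_ge0//.
  have l0 : 0 < lev A g j.+1 by rewrite lev_gt0.
  have P0 := powR_gt0 (g * p) l0.
  rewrite powRN -(ler_pM2l P0) mulr1 mulrA mulfV ?mul1r ?(gt_eqF P0)//.
  rewrite (_ : p / (Q%:R - 1) = g * p); last by rewrite mulrC.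
  apply: (@le_trans _ _ (v `^ (g * p))); last by rewrite lerDr.
  have gp : 0 <= g * p by rewrite mulr_ge0 ?(ltW gexp_gt0)// (le_trans _ p1).
  by apply: ge0_ler_powR => //; rewrite nnegrE ltW.
apply: (@le_trans _ _ (\sum_(0 <= i < j.+1) F i)%E).
  by rewrite big_nat_recr//= leeDr// sume_ge0.
apply: (@le_trans _ _ (\sum_(0 <= i <oo) F i)%E); first by apply: nneseries_lim_ge.
by rewrite leeDr// lee_fin !mulr_ge0 ?expR_ge0 ?powR_ge0.
Qed.

End growth.

Section exact_growth_upper_gradient.
Context (R : realType) (n : nat).
Local Notation H := (heis R n).
Local Notation Q := (@hdim n).
Local Notation mu := (@haar R n).
Local Notation q := (qexp R n).
Local Notation g := (gexp R n).
Variable sigma : {measure set H -> \bar R}.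
Hypothesis hsigma : sphere_measure sigma.
Hypothesis n0 : (0 < n)%N.
Variable p : R.
Hypothesis p1 : 1 <= p.
Local Notation A := (A_const sigma).

Lemma A_const_gt0 : 0 < A.
Proof.
rewrite A_const_csphere mulr_gt0 ?invr_gt0 ?ltr0n ?(ltn_trans _ (hdim_gt1 n))//.
exact: powR_gt0 (csphere_gt0 hsigma n0).
Qed.

Section function.
Variables (u D : H -> R) (M : R).
Hypothesis hu : upper_gradient u D.
Hypothesis hD : (\int[mu]_x (D x `^ Q%:R)%:E <= 1)%E.
Hypothesis hM : (\int[mu]_x (`|u x| `^ p)%:E <= M%:E)%E.

Let distr (t : R) : R := fine (\int[mu]_x (indb (t <= `|u x|)%R)%:E).
Let energy (t : R) : R := fine (\int[mu]_x ((indb (t <= `|u x|)%R * D x) `^ Q%:R)%:E).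

Let mabs : measurable_fun setT (fun x => `|u x|).
Proof. by apply: measurableT_comp => //; exact: ug_measurable hu. Qed.
Let mD := ug_gradient_measurable hu.
Let D0 := ug_ge0 hu.
Let Q0 : 0 < Q%:R :> R. Proof. by rewrite ltr0n (ltn_trans _ (hdim_gt1 n)). Qed.
Let p0 : 0 < p. Proof. exact: lt_le_trans p1. Qed.

Let mind (t : R) : measurable_fun setT (fun x : H => (indb (t <= `|u x|) : R)%:E).
Proof. by apply/measurable_EFinP; exact: measurable_fun_leR. Qed.

Lemma distr_cheb (t : R) : 0 < t ->
  ((t `^ p)%:E * \int[mu]_x (indb (t <= `|u x|)%R)%:E <= M%:E)%E.
Proof.
move=> t0; rewrite -intZ; last 3 first.
- exact: powR_ge0.
- by move=> x; rewrite lee_fin.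
- exact: mind.
apply: le_trans hM; apply: int_le.
- by move=> x; rewrite mule_ge0 ?lee_fin ?powR_ge0.
- by apply: emeasurable_funM => //; exact: mind.
- by apply/measurable_EFinP; exact: measurable_fun_powR.
- move=> x; rewrite -EFinM lee_fin; case: (leP t `|u x|) => h; rewrite indbE ?mulr0 ?powR_ge0// mulr1.
  by apply: ge0_ler_powR; rewrite ?nnegrE ?(ltW p0) ?(ltW t0).
Qed.

Let distrE (t : R) : 0 < t -> (\int[mu]_x (indb (t <= `|u x|)%R)%:E = (distr t)%:E)%E.
Proof.
move=> t0; rewrite fineK// ge0_fin_numE; last by apply: int_ge0 => x; rewrite lee_fin.
rewrite ltNge leye_eq; apply/negP => /eqP E; have := distr_cheb t0.
by rewrite E gt0_muley ?lte_fin ?powR_gt0.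
Qed.

Let distr0 t : 0 <= distr t.
Proof. by apply: fine_ge0; apply: int_ge0 => x; rewrite lee_fin. Qed.

Let distr_mono s t : 0 < s -> s <= t -> distr t <= distr s.
Proof.
move=> s0 st; have t0 := lt_le_trans s0 st.
rewrite -lee_fin -(distrE s0) -(distrE t0); apply: int_le => [x|||x]; rewrite ?lee_fin//.
by case: (leP t `|u x|) => h; [rewrite (le_trans st h) !indbE|rewrite indbE].
Qed.

Let mE (f : H -> R) : measurable_fun setT f ->
  measurable_fun setT (fun x => ((f x * D x) `^ Q%:R)%:E).
Proof. by move=> mf; apply/measurable_EFinP; apply: measurable_fun_powR; exact: measurable_funM. Qed.

Let energy_le (t : R) : (\int[mu]_x ((indb (t <= `|u x|)%R * D x) `^ Q%:R)%:E <= 1)%E.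
Proof.
apply: le_trans hD; apply: int_le => [x|||x]; rewrite ?lee_fin ?powR_ge0//.
- by apply: mE; exact: measurable_fun_leR.
- by apply/measurable_EFinP; exact: measurable_fun_powR.
- apply: ge0_ler_powR; rewrite ?nnegrE ?(ltW Q0) ?D0 ?mulr_ge0 ?D0//.
  by case: (leP t `|u x|) => h; rewrite indbE ?mul1r ?mul0r ?D0.
Qed.

Let energyE (t : R) : (\int[mu]_x ((indb (t <= `|u x|)%R * D x) `^ Q%:R)%:E = (energy t)%:E)%E.
Proof.
rewrite fineK// ge0_fin_numE; last by apply: int_ge0 => x; rewrite lee_fin powR_ge0.
by apply: le_lt_trans (energy_le t) _; rewrite ltry.
Qed.

Let energy01 t : 0 <= energy t <= 1.
Proof.
rewrite -!lee_fin -energyE energy_le andbT.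
by apply: int_ge0 => x; rewrite lee_fin powR_ge0.
Qed.

(** The isocapacitary inequality measures the points strictly above s; passing to the larger set of
    points at least at s only weakens it. *)
Let iso (s t e : R) : 0 < s -> s < t -> 0 < distr t -> 0 <= e ->
  (\int[mu]_x ((indb (s < `|u x|)%R * indb (`|u x| < t)%R * D x) `^ Q%:R)%:E <= e%:E)%E ->
  (t - s) `^ (1 + g) <= e `^ g * (A * ln (distr s / distr t) + isoC sigma).
Proof.
move=> s0 st dt0 e0 he; have t0 := lt_trans s0 st.
pose ms := fine (\int[mu]_x (indb (s < `|u x|)%R)%:E).
have mlt : measurable_fun setT (fun x : H => (indb (s < `|u x|) : R)%:E).
  by apply/measurable_EFinP; exact: measurable_fun_ltR.
have le_s : (\int[mu]_x (indb (s < `|u x|)%R)%:E <= (distr s)%:E)%E.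
  rewrite -distrE//; apply: int_le => [x|||x]; rewrite ?lee_fin//.
  by case: (ltP s `|u x|) => h; [rewrite (ltW h) !indbE|rewrite indbE].
have msE : (\int[mu]_x (indb (s < `|u x|)%R)%:E = ms%:E)%E.
  rewrite fineK// ge0_fin_numE; last by apply: int_ge0 => x; rewrite lee_fin.
  by apply: le_lt_trans le_s _; rewrite ltry.
have le_t : distr t <= ms.
  rewrite -lee_fin -msE -distrE//; apply: int_le => [x|||x]; rewrite ?lee_fin//.
  by case: (leP t `|u x|) => h; [rewrite (lt_le_trans st h) !indbE|rewrite indbE].
rewrite msE lee_fin in le_s; have ms0 := lt_le_trans dt0 le_t.
have := isocapacity hsigma n0 hu (ltW s0) st dt0 e0 (distrE t0) msE he.
rewrite -qexp_gexp => h; apply: (le_trans h); apply: ler_wpM2l; first exact: powR_ge0.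
rewrite lerD2r; apply: ler_wpM2l; first exact: ltW A_const_gt0.
have ds0 := lt_le_trans ms0 le_s.
rewrite ler_ln ?posrE ?(divr_gt0 ms0 dt0) ?(divr_gt0 ds0 dt0)//.
by apply: ler_wpM2r => //; rewrite invr_ge0 ltW.
Qed.

(** The open layer below t and the set at or above t are disjoint, and the total energy is at most
    1. *)
Let iso1 (s t : R) : 0 < s -> s < t -> 0 < distr t ->
  (t - s) `^ (1 + g) <= (1 - energy t) `^ g * (A * ln (distr s / distr t) + isoC sigma).
Proof.
move=> s0 st dt; have /andP[e0 e1] := energy01 t; apply: iso => //; first by rewrite subr_ge0.
have mm : measurable_fun setT (fun x : H => indb (s < `|u x|) * indb (`|u x| < t) : R).
  by apply: measurable_funM; exact: measurable_fun_ltR.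
rewrite EFinB leeBrDr// -energyE -intD; last 4 first.
- by move=> x; rewrite lee_fin powR_ge0.
- exact: mE.
- by move=> x; rewrite lee_fin powR_ge0.
- by apply: mE; exact: measurable_fun_leR.
apply: le_trans hD; apply: int_le => [x|||x].
- by rewrite adde_ge0// lee_fin powR_ge0.
- by apply: emeasurable_funD; [exact: mE|apply: mE; exact: measurable_fun_leR].
- by apply/measurable_EFinP; exact: measurable_fun_powR.
- rewrite -EFinD lee_fin; case: (leP t `|u x|) => h; rewrite !indbE.
    by rewrite mulr0 mul0r mul1r powR0 ?add0r// gt_eqF.
  rewrite mulr1 mul0r (@powR0 _ Q%:R) ?gt_eqF// addr0.
  by case: (ltP s `|u x|) => h'; rewrite indbE ?mul1r// mul0r powR0 ?gt_eqF// powR_ge0.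
Qed.

Let iso2 (s t : R) : 0 < s -> s < t -> 0 < distr t ->
  (t - s) `^ (1 + g) <= energy s `^ g * (A * ln (distr s / distr t) + isoC sigma).
Proof.
move=> s0 st dt; have /andP[e0 e1] := energy01 s; apply: iso => //.
have mm : measurable_fun setT (fun x : H => indb (s < `|u x|) * indb (`|u x| < t) : R).
  by apply: measurable_funM; exact: measurable_fun_ltR.
rewrite -energyE; apply: int_le => [x|||x]; rewrite ?lee_fin ?powR_ge0//.
- exact: mE.
- by apply: mE; exact: measurable_fun_leR.
- apply: ge0_ler_powR; rewrite ?nnegrE ?(ltW Q0) ?mulr_ge0 ?D0//.
  rewrite ler_wpM2r ?D0//; case: (ltP s `|u x|) => h; rewrite indbE ?mul0r//.
  by rewrite (ltW h) mul1r; case: (ltP `|u x| t) => h'; rewrite !indbE.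
Qed.

Let isoC0 : 0 <= isoC sigma.
Proof.
rewrite /isoC mulr_ge0 ?powR_ge0// addr_ge0// mulr_ge0 ?powR_ge0// mulr_ge0 ?fine_ge0//.
by rewrite qexp_gexp addr_ge0// ltW// gexp_gt0.
Qed.

(** The first summand accounts for small values of |u|, the second for the levels; its factor e is
    the ratio of e^(j+2) in [growth_level] to e^(j+1) in [wlev]. *)
Definition growthC : R :=
  expR 1 * A `^ (- (p / q)) + expR 1 * (expR (levC A (isoC sigma) g p) *
    (4 * (2 * (Num.truncn (levK A (isoC sigma) g)).+1 + 2)%:R + 1)).

(** Integration turns the indicator in a step into the distribution function, so the series of steps
    becomes e times the series of the [wlev], whose partial sums are uniformly bounded. The constant
    depends neither on [u] nor on [D], as the later limit requires. *)
Lemma int_growth_le : (\int[mu]_x (growth n p A^-1 `|u x|)%:E <= (growthC * M)%:E)%E.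
Proof.
have Ai : 0 <= A^-1 by rewrite invr_ge0 ltW// A_const_gt0.
have mlevel j : measurable_fun setT (fun x => (growth_level n p A j `|u x|)%:E).
  by apply/measurable_EFinP; apply: measurable_funM => //; exact: measurable_fun_leR.
have level0 j x : (0 <= (growth_level n p A j `|u x|)%:E)%E by rewrite lee_fin growth_level_ge0.
have c0 : 0 <= expR 1 * A `^ (- (p / q)) by rewrite mulr_ge0 ?expR_ge0 ?powR_ge0.
have mpow : measurable_fun setT (fun x => (`|u x| `^ p)%:E).
  by apply/measurable_EFinP; exact: measurable_fun_powR.
apply: (@le_trans _ _ (\int[mu]_x ((expR 1 * A `^ (- (p / q)))%:E * (`|u x| `^ p)%:E +
   \sum_(0 <= j <oo) (growth_level n p A j `|u x|)%:E))%E).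
  apply: int_le.
  - by move=> x; rewrite lee_fin growth_ge0.
  - by apply/measurable_EFinP; exact: (measurableT_comp (measurable_growth _ _ _) mabs).
  - apply: emeasurable_funD; first exact: emeasurable_funM.
    by apply: ge0_emeasurable_sum => // j x _ _; exact: level0.
  - by move=> x; rewrite -EFinM; apply: growth_bound => //; exact: A_const_gt0.
rewrite intD; last 4 first.
- by move=> x; rewrite mule_ge0// lee_fin ?powR_ge0.
- exact: emeasurable_funM.
- by move=> x; apply: nneseries_ge0 => j _ _; exact: level0.
- by apply: ge0_emeasurable_sum => // j x _ _; exact: level0.
rewrite [X in (X + _)%E]intZ; last 3 first.
- exact: c0.
- by move=> x; rewrite lee_fin powR_ge0.
- exact: mpow.
rewrite /growthC mulrDl EFinD; apply: leeD.
  by rewrite [leRHS]EFinM; apply: lee_wpmul2l; rewrite ?lee_fin.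
rewrite integral_nneseries//.
apply: lime_le; first by apply: is_cvg_nneseries => j _ _; apply: int_ge0 => x; exact: level0.
apply: nearW => J; rewrite big_mkord.
have E j : (\int[mu]_x (growth_level n p A j `|u x|)%:E = (expR 1 * wlev A g p distr j.+1)%:E)%E.
  have l0 : 0 < lev A g j.+1 by apply: lev_gt0 => //; [exact: A_const_gt0].
  under eq_integral => x _ do rewrite /growth_level EFinM.
  rewrite intZ ?mulr_ge0 ?expR_ge0 ?powR_ge0//; last by move=> x; rewrite lee_fin.
  rewrite distrE// -EFinM /wlev; congr EFin.
  by rewrite -(natr1 j.+1) expRD; ring.
rewrite (eq_bigr _ (fun (j : 'I_J) _ => E j)) sumEFin lee_fin -mulr_sumr -mulrA ler_wpM2l ?expR_ge0//.
have cheb t : 0 < t -> t `^ p * distr t <= M by move=> t0; rewrite -lee_fin EFinM -distrE// distr_cheb.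
have := @sum_wlev R A (isoC sigma) g p A_const_gt0 isoC0 (gexp_gt0 R n) (gexp_le3 R n0) (ltW p0)
  distr energy M distr_mono energy01 cheb iso1 iso2 J distr0.
by move=> h; apply: (le_trans h); rewrite /levB -mulrA mulrC.
Qed.

End function.

End exact_growth_upper_gradient.

(** * Mollification *)

Section bexp.
Variable R : realType.
Implicit Types (s : R) (m : nat).

(** For m = 0 this is the classical flat function; the powers of 1/s are what its derivatives bring
    in. *)
Definition bexp m s : R := indb (0 < s) * (expR (- s^-1) * s^-1 ^+ m).

Lemma bexp_le0 m s : s <= 0 -> bexp m s = 0.
Proof. by move=> s0; rewrite /bexp ltNge s0 indbE mul0r. Qed.

Lemma bexp_gt0E m s : 0 < s -> bexp m s = expR (- s^-1) * s^-1 ^+ m.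
Proof. by move=> s0; rewrite /bexp s0 indbE mul1r. Qed.

Lemma bexp_ge0 m s : 0 <= bexp m s.
Proof.
have [s0|s0] := leP s 0; first by rewrite bexp_le0.
by rewrite bexp_gt0E// mulr_ge0 ?expR_ge0// exprn_ge0// invr_ge0 ltW.
Qed.

(** From x^(m+1) / (m+1)! <= e^x at x = 1/s. Continuity and the derivative at 0 rest on this
    vanishing for every m. *)
Lemma bexp_le m s : bexp m s <= m.+1`!%:R * `|s|.
Proof.
have [s0|s0] := leP s 0; first by rewrite bexp_le0// mulr_ge0.
have x0 : 0 < s^-1 by rewrite invr_gt0.
rewrite bexp_gt0E// gtr0_norm// -[s in leRHS]invrK; move: s^-1 x0 => x x0.
have h : x ^+ m.+1 / m.+1`!%:R <= expR x.
  apply: le_trans (exp_sum_le m.+2 (ltW x0)); rewrite big_ord_recr/= lerDr.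
  by apply: sumr_ge0 => j _; rewrite divr_ge0// exprn_ge0// ltW.
have f0 : 0 < m.+1`!%:R :> R by rewrite ltr0n fact_gt0.
rewrite expRN mulrC ler_pdivrMr ?expR_gt0// mulrAC ler_pdivlMr// -exprSr.
by rewrite mulrC -ler_pdivrMr.
Qed.

Lemma continuous_bexp0 m : bexp m s @[s --> (0 : R)] --> (0 : R).
Proof.
apply: (@squeeze_cvgr _ _ _ _ (fun=> 0) (fun s : R => m.+1`!%:R * `|s|)).
- by near=> s; rewrite bexp_ge0 bexp_le.
- exact: cvg_cst.
- rewrite -[X in _ --> X](mulr0 (m.+1`!%:R)) -[X in _ * X](@normr0 _ R).
  by apply: cvgMr; apply: cvg_norm; exact: cvg_id.
Unshelve. all: by end_near. Qed.

Lemma is_derive_bexp m s : is_derive s 1 (bexp m) (bexp m.+2 s - m%:R * bexp m.+1 s).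
Proof.
have [s0|s0|->] := ltgtP s 0.
- rewrite !bexp_le0 ?(ltW s0)// mulr0 subrr.
  apply: (near_eq_is_derive _ (is_derive_cst (0 : R) s (1 : R))).
  by near=> x; rewrite bexp_le0// ltW//; near: x; exact: lt_nbhsl.
- have dV : is_derive s 1 (fun x : R => x^-1) (- s^-1 ^+ 2).
    have := @is_deriveV _ (fun y : R => y) s 1 1 (lt0r_neq0 s0) (dv_id s); rewrite exprVn /GRing.scale/= mulr1.
    by move=> h; exact: h.
  have dE := dv_expR (dvN dV); rewrite !bexp_gt0E//.
  have nE : \forall x \near s, expR (- x^-1) * x^-1 ^+ m = bexp m x.
    by near=> x; rewrite bexp_gt0E//; near: x; exact: lt_nbhsr.
  apply: (near_eq_is_derive nE); case: m {nE} => [|m].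
    apply: (dv_eq (dv_fun dE _)); first by move=> x; rewrite expr0 mulr1.
    by rewrite mul0r subr0 opprK.
  apply: (dv_eq (dvM dE (dvX m dV))); rewrite opprK !exprS; ring.
- rewrite !bexp_le0// mulr0 subrr.
  (* For h > 0 the difference quotient at 0 is [bexp m.+1 h], and for h < 0 it is 0. *)
  have H : h^-1 *: ((bexp m \o shift 0) (h *: 1) - bexp m 0) @[h --> (0 : R)^'] --> (0 : R).
    apply: (@cvg_trans _ (bexp m.+1 h @[h --> (0 : R)^'])); last first.
      by apply: (cvg_trans _ (continuous_bexp0 m.+1)); apply: cvg_app; exact: nbhs_dnbhs.
    apply: near_eq_cvg; near=> h.
    rewrite /= /shift/= addr0 /GRing.scale/= mulr1 (bexp_le0 m (lexx 0)) subr0.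
    have [h0|h0] := leP h 0; first by rewrite !bexp_le0// mulr0.
    by rewrite !bexp_gt0E// mulrCA -exprS.
  by split; [exact: cvgP H|exact: cvg_lim H].
Unshelve. all: by end_near. Qed.

Lemma continuous_bexp m : continuous (bexp m).
Proof. by move=> s; exact: dv_continuous (is_derive_bexp m s). Qed.

Lemma measurable_bexp m : measurable_fun setT (bexp m).
Proof. by apply: continuous_measurable_fun; exact: continuous_bexp. Qed.

End bexp.

Section smooth.
Context (R : realType) (V : normedModType R).
Implicit Types (f g l : V -> R).

(* A class of functions closed under directional derivatives, because
   [bexp m] has derivative [bexp m.+2 - m bexp m.+1]. *)
Inductive smooth : (V -> R) -> Prop :=
| smooth_lin l (a : V -> R) : continuous l ->
    (forall x v, is_derive x v l (a v)) -> smooth l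
| smooth_cst (c : R) : smooth (fun=> c)
| smoothD f g : smooth f -> smooth g -> smooth (fun x => f x + g x)
| smoothM f g : smooth f -> smooth g -> smooth (fun x => f x * g x)
| smooth_bexp m f : smooth f -> smooth (fun x => bexp m (f x)).

Lemma smooth_continuous f : smooth f -> continuous f.
Proof.
elim=> [l a cl _|c|{}f g _ cf _ cg|{}f g _ cf _ cg|m {}f _ cf] x //.
- exact: cst_continuous.
- by apply: continuousD; [exact: cf|exact: cg].
- by apply: continuousM; [exact: cf|exact: cg].
- by apply: (@continuous_comp _ _ _ f (bexp m)); [exact: cf|exact: continuous_bexp].
Qed.

Lemma smooth_derive f v : smooth f ->
  exists2 g, smooth g & forall x, is_derive x v f (g x).
Proof.
elim=> [l a cl dl|c|{}f g _ [f' sf' df] _ [g' sg' dg]|{}f g sf [f' sf' df] sg [g' sg' dg]|m {}f sf [f' sf' df]].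
- by exists (fun=> a v); [exact: smooth_cst|move=> x; exact: dl].
- by exists (fun=> 0); [exact: smooth_cst|move=> x; exact: dv_cst].
- exists (fun x => f' x + g' x); first exact: smoothD.
  by move=> x; exact: dvD.
- exists (fun x => f x * g' x + g x * f' x); first by apply: smoothD; apply: smoothM.
  by move=> x; exact: dvM.
- exists (fun x => (bexp m.+2 (f x) + (- m%:R) * bexp m.+1 (f x)) * f' x).
    apply: smoothM => //; apply: smoothD; first exact: smooth_bexp.
    by apply: smoothM; [exact: smooth_cst|exact: smooth_bexp].
  move=> x; apply: (dv_eq (dv_comp (df x) (is_derive_bexp m (f x)))).
  by rewrite mulNr.
Qed.

End smooth.

Section smooth_heis.
Context (R : realType) (n : nat).
Local Notation C := (Cn R n).
Local Notation H := (heis R n).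

Lemma smooth_Ck k (f : H -> R) : smooth f -> Ck k f.
Proof.
elim: k f => [|k IH] f sf /=; first exact: smooth_continuous.
split; first exact: smooth_continuous.
move=> v; have [g sg dg] := smooth_derive v sf.
split; first by move=> x; have [] := dg x.
rewrite (_ : 'D_v f = g); first exact: IH.
by apply/funext => x; have [_] := dg x.
Qed.

Definition cdot (z w : C) : R :=
  \sum_(j < n) (z.1 ord0 j * w.1 ord0 j + z.2 ord0 j * w.2 ord0 j).

Section curve.
Context (V : normedModType R).

(** Derivatives of maps into the group are recorded by coordinates, so that only real functions are
    differentiated. *)
Definition coord_derive (P : V -> H) (x v : V) (T : H) : Prop :=
  [/\ forall j, is_derive x v (fun y => (P y).1.1 ord0 j) (T.1.1 ord0 j),
      forall j, is_derive x v (fun y => (P y).1.2 ord0 j) (T.1.2 ord0 j) &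
      is_derive x v (fun y => (P y).2) T.2].

Lemma coord_derive_cst p x v : coord_derive (fun=> p) x v 0.
Proof. by split => [j|j|]; apply: (dv_eq (dv_cst _ _ _)); rewrite ?mxE. Qed.

Lemma coord_deriveN P x v T : coord_derive P x v T -> coord_derive (fun y => - P y) x v (- T).
Proof.
move=> [h1 h2 h3]; split => [j|j|].
- by apply: (dv_eq (dv_fun (dvN (h1 j)) _)) => [y|]; rewrite !mxE.
- by apply: (dv_eq (dv_fun (dvN (h2 j)) _)) => [y|]; rewrite !mxE.
- exact: (dvN h3).
Qed.

Lemma dv_omega (f g : V -> C) x v (a b : C) :
  (forall j, is_derive x v (fun y => (f y).1 ord0 j) (a.1 ord0 j)) ->
  (forall j, is_derive x v (fun y => (f y).2 ord0 j) (a.2 ord0 j)) ->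
  (forall j, is_derive x v (fun y => (g y).1 ord0 j) (b.1 ord0 j)) ->
  (forall j, is_derive x v (fun y => (g y).2 ord0 j) (b.2 ord0 j)) ->
  is_derive x v (fun y => omega (f y) (g y)) (omega a (g x) + omega (f x) b).
Proof.
move=> f1 f2 g1 g2.
have h j := dvB (dvM (f2 j) (g1 j)) (dvM (f1 j) (g2 j)).
apply: (dv_eq (dv_sum h)); rewrite -big_split/=; apply: eq_bigr => j _; ring.
Qed.

Lemma coord_derive_hmul P P' x v T T' : coord_derive P x v T -> coord_derive P' x v T' ->
  coord_derive (fun y => hmul (P y) (P' y)) x v
    (T.1 + T'.1, T.2 + T'.2 + 2 * (omega T.1 (P' x).1 + omega (P x).1 T'.1)).
Proof.
move=> [h1 h2 h3] [k1 k2 k3]; split => [j|j|].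
- by apply: (dv_eq (dv_fun (dvD (h1 j) (k1 j)) _)) => [y|]; rewrite !mxE.
- by apply: (dv_eq (dv_fun (dvD (h2 j) (k2 j)) _)) => [y|]; rewrite !mxE.
- exact: (dvD (dvD h3 k3) (dvZ 2 (dv_omega h1 h2 k1 k2))).
Qed.

Lemma coord_derive_hN4 P x v T : coord_derive P x v T ->
  is_derive x v (fun y => hN4 (P y)) (4 * sqn (P x).1 * cdot (P x).1 T.1 + 2 * (P x).2 * T.2).
Proof.
move=> [h1 h2 h3]; have h j := dvD (dvX 1 (h1 j)) (dvX 1 (h2 j)).
apply: (dv_eq (dvD (dvX 1 (dv_sum h)) (dvX 1 h3))); rewrite /= !expr1; congr (_ + _).
rewrite -/(sqn _) -mulrA -[RHS]mulrA -[4]/(2 * 2)%:R natrM -mulrA; congr (_ * _).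
rewrite mulrCA; congr (_ * _); rewrite mulr_sumr; apply: eq_bigr => j _; rewrite !expr1; ring.
Qed.

End curve.

Lemma coord_derive_id (x v : H) : coord_derive id x v v.
Proof.
have L (l : H -> R) : (forall (a : R) p q, l (a *: p + q) = a * l p + l q) -> is_derive x v l (l v).
  move=> hl.
  have E : h^-1 *: ((l \o shift x) (h *: v) - l x) @[h --> (0 : R)^'] --> l v.
    apply: (@cvg_trans _ ((fun=> l v) @ (0 : R)^')); last exact: cvg_cst.
    apply: near_eq_cvg; near=> h; rewrite /= /shift/= hl addrK /GRing.scale/= mulrA mulVf ?mul1r//.
    by near: h; exact: nbhs_dnbhs_neq.
  by split; [exact: cvgP E|exact: cvg_lim E].
by split => [j|j|]; [apply: (L (fun p : H => p.1.1 ord0 j))|apply: (L (fun p : H => p.1.2 ord0 j))|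
  apply: (L (fun p : H => p.2))] => a p q; rewrite /= ?mxE.
Unshelve. all: by end_near. Qed.

Lemma smooth_coord : [/\ forall j, smooth (fun p : H => p.1.1 ord0 j),
  forall j, smooth (fun p : H => p.1.2 ord0 j) & smooth (fun p : H => p.2)].
Proof.
split => [j|j|].
- apply: (@smooth_lin _ _ _ (fun v : H => v.1.1 ord0 j)); last by move=> x v; have [] := coord_derive_id x v.
  move=> p; apply: (@continuous_comp _ _ _ (fun p : H => p.1.1) (fun w : 'rV[R]_n => w ord0 j)).
    by apply: continuous_comp; exact: cvg_fst.
  exact: coord_continuous.
- apply: (@smooth_lin _ _ _ (fun v : H => v.1.2 ord0 j)); last by move=> x v; have [] := coord_derive_id x v.
  move=> p; apply: (@continuous_comp _ _ _ (fun p : H => p.1.2) (fun w : 'rV[R]_n => w ord0 j)).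
    by apply: continuous_comp; [exact: cvg_fst|exact: cvg_snd].
  exact: coord_continuous.
- apply: (@smooth_lin _ _ _ (fun v : H => v.2)); last by move=> x v; have [] := coord_derive_id x v.
  by move=> p; exact: cvg_snd.
Qed.

Lemma smoothN (V : normedModType R) (f : V -> R) : @smooth R V f -> smooth (fun x => - f x).
Proof.
move=> sf; rewrite (_ : (fun x => - f x) = (fun x => -1 * f x)).
  by apply: smoothM => //; exact: smooth_cst.
by apply/funext => x; rewrite mulN1r.
Qed.

Lemma smooth_sum (V : normedModType R) m (f : 'I_m -> V -> R) :
  (forall j, smooth (f j)) -> smooth (fun x => \sum_(j < m) f j x).
Proof.
move=> sf; elim: m f sf => [|m IH] f sf.
  by rewrite (_ : (fun _ => _) = (fun=> 0)); [exact: smooth_cst|apply/funext => x; rewrite big_ord0].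
rewrite (_ : (fun _ => _) = (fun x => \sum_(j < m) f (widen_ord (leqnSn m) j) x + f ord_max x)).
  by apply: smoothD => //; apply: IH.
by apply/funext => x; rewrite big_ord_recr.
Qed.

Lemma smooth_hN4_quotient (w : H) : smooth (fun y : H => hN4 (hmul w (- y))).
Proof.
have [s1 s2 s3] := smooth_coord; have sc c := @smooth_cst R H c.
have c1 j : smooth (fun y : H => (w.1 - y.1).1 ord0 j).
  rewrite (_ : (fun _ => _) = (fun y : H => w.1.1 ord0 j + (- y.1.1 ord0 j))).
    by apply: smoothD => //; exact: smoothN.
  by apply/funext => y; rewrite !mxE.
have c2 j : smooth (fun y : H => (w.1 - y.1).2 ord0 j).
  rewrite (_ : (fun _ => _) = (fun y : H => w.1.2 ord0 j + (- y.1.2 ord0 j))).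
    by apply: smoothD => //; exact: smoothN.
  by apply/funext => y; rewrite !mxE.
have sX (f : H -> R) : smooth f -> smooth (fun y => f y ^+ 2).
  by move=> sf; under eq_fun do rewrite expr2; exact: smoothM.
apply: smoothD; apply: (sX _).
  by apply: smooth_sum => j; apply: smoothD; apply: (sX _).
apply: smoothD; first by apply: smoothD => //; exact: smoothN.
apply: smoothM => //; apply: smooth_sum => j; apply: smoothD.
  by rewrite /=; under eq_fun do rewrite mxE; apply: smoothM => //; exact: smoothN.
by apply: smoothN; rewrite /=; under eq_fun do rewrite mxE; apply: smoothM => //; exact: smoothN.
Qed.

End smooth_heis.

(** * Balls of the homogeneous norm and bumps *)

Section quasi_ball.
Context (R : realType) (n : nat).
Local Notation C := (Cn R n).
Local Notation H := (heis R n).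
Implicit Types (z w : C) (p q : H).

Lemma cdotZl (a : R) z w : cdot (a *: z) w = a * cdot z w.
Proof. by rewrite mulr_sumr; apply: eq_bigr => j _; rewrite !mxE; ring. Qed.

Lemma cdotNr z w : cdot z (- w) = - cdot z w.
Proof. by rewrite -sumrN; apply: eq_bigr => j _; rewrite !mxE; ring. Qed.

Lemma cdot_le z w (s : R) : 0 < s -> 2 * `|cdot z w| <= s * sqn z + s^-1 * sqn w.
Proof.
move=> s0; have term (a b : R) : 2 * `|a * b| <= s * a ^+ 2 + s^-1 * b ^+ 2.
  have : 0 <= s^-1 * (s * `|a| - `|b|) ^+ 2 by rewrite mulr_ge0 ?invr_ge0 ?sqr_ge0// ltW.
  rewrite sqrrB exprMn !real_normK ?num_real// mulrDr mulrBr normrM.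
  have -> : s^-1 * (s ^+ 2 * a ^+ 2) = s * a ^+ 2 by field; rewrite gt_eqF.
  have -> : s^-1 * (s * `|a| * `|b| *+ 2) = 2 * (`|a| * `|b|) by field; rewrite gt_eqF.
  lra.
apply: (@le_trans _ _ (\sum_(j < n) 2 * (`|z.1 ord0 j * w.1 ord0 j| + `|z.2 ord0 j * w.2 ord0 j|))).
  rewrite -mulr_sumr ler_wpM2l//; apply: (le_trans (ler_norm_sum _ _ _)).
  by apply: ler_sum => j _; exact: ler_normD.
rewrite /sqn !mulr_sumr -big_split/=; apply: ler_sum => j _.
have := term (z.1 ord0 j) (w.1 ord0 j); have := term (z.2 ord0 j) (w.2 ord0 j); lra.
Qed.

(** Take the weight |w|/|z| in [cdot_le]; both norms are first raised by e, so that the weight makes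
    sense when one of them is 0. *)
Lemma cdot_le_enorm z w : `|cdot z w| <= enorm z * enorm w.
Proof.
have key e : 0 < e -> `|cdot z w| <= (enorm z + e) * (enorm w + e).
  move=> e0; have z0 : 0 < enorm z + e by rewrite ltr_wpDl// enorm_ge0.
  have w0 : 0 < enorm w + e by rewrite ltr_wpDl// enorm_ge0.
  have := cdot_le z w (divr_gt0 w0 z0).
  have zz : sqn z <= (enorm z + e) ^+ 2.
    by rewrite -enorm_sqr lerXn2r ?nnegrE ?enorm_ge0 ?(ltW z0)// lerDl ltW.
  have ww : sqn w <= (enorm w + e) ^+ 2.
    by rewrite -enorm_sqr lerXn2r ?nnegrE ?enorm_ge0 ?(ltW w0)// lerDl ltW.
  move: (enorm z + e) (enorm w + e) z0 w0 zz ww => a b a0 b0 zz ww.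
  have : b / a * sqn z <= b / a * a ^+ 2 by rewrite ler_wpM2l// divr_ge0 ?ltW.
  have : (b / a)^-1 * sqn w <= (b / a)^-1 * b ^+ 2 by rewrite ler_wpM2l// invr_ge0 divr_ge0 ?ltW.
  have -> : b / a * a ^+ 2 = a * b by field; rewrite gt_eqF.
  have -> : (b / a)^-1 * b ^+ 2 = a * b by field; rewrite !gt_eqF.
  lra.
rewrite leNgt; apply/negP => lt; pose d := `|cdot z w| - enorm z * enorm w.
have d0 : 0 < d by rewrite subr_gt0.
pose M := enorm z + enorm w + 1.
have M0 : 0 < M by rewrite ltr_wpDl// addr_ge0 ?enorm_ge0.
pose e := Num.min 1 (d / (2 * M)).
have e0 : 0 < e by rewrite lt_min ltr01 divr_gt0// mulr_gt0.
have e1 : e <= 1 by rewrite ge_min lexx.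
have e2 : e * (2 * M) <= d by rewrite -ler_pdivlMr ?mulr_gt0// ge_min lexx orbT.
have := key e e0; have : e * e <= e * 1 by rewrite ler_pM2l.
have := enorm_ge0 z; have := enorm_ge0 w; move: d0 e2; rewrite /d /M.
move: (enorm z) (enorm w) (`|_|) => a b t; nra.
Qed.

Lemma omega_le z w : 2 * `|omega z w| <= sqn z + sqn w.
Proof.
have -> : omega z w = cdot (z.2, z.1) (w.1, - w.2).
  by apply: eq_bigr => j _; rewrite !mxE mulrN.
have := cdot_le (z.2, z.1) (w.1, - w.2) ltr01; rewrite invr1 !mul1r.
have -> : sqn (z.2, z.1) = sqn z by apply: eq_bigr => j _; rewrite addrC.
by have -> : sqn (w.1, - w.2) = sqn w by apply: eq_bigr => j _; rewrite !mxE sqrrN.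
Qed.

Lemma sqnD_le z w : sqn (z + w) <= 2 * (sqn z + sqn w).
Proof.
rewrite /sqn -big_split mulr_sumr; apply: ler_sum => j _; rewrite !mxE.
have t (a b : R) : (a + b) ^+ 2 <= 2 * (a ^+ 2 + b ^+ 2) by have := sqr_ge0 (a - b); nra.
have := t (z.1 ord0 j) (w.1 ord0 j); have := t (z.2 ord0 j) (w.2 ord0 j); rewrite /=; lra.
Qed.

(** A quasi-triangle inequality: of the factor 14, 8 comes from the fourth power of the norm of a
    sum and 6 from the square of the symplectic term. *)
Lemma hN4M_le p q : hN4 (hmul p q) <= 14 * (hN4 p + hN4 q).
Proof.
have := sqnD_le p.1 q.1; have := omega_le p.1 q.1; rewrite /hN4 /hmul/=.
have := sqn_ge0 p.1; have := sqn_ge0 q.1; have := sqn_ge0 (p.1 + q.1).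
move: (sqn p.1) (sqn q.1) (sqn (p.1 + q.1)) (p.2) (q.2) (omega p.1 q.1) => a b c s t o c0 b0 a0 ho hc.
have h1 : c ^+ 2 <= 8 * (a ^+ 2 + b ^+ 2).
  have : c ^+ 2 <= (2 * (a + b)) ^+ 2 by rewrite lerXn2r ?nnegrE// mulr_ge0 ?addr_ge0.
  have := sqr_ge0 (a - b); nra.
have h2 : (2 * o) ^+ 2 <= 2 * (a ^+ 2 + b ^+ 2).
  have : (2 * `|o|) ^+ 2 <= (a + b) ^+ 2 by rewrite lerXn2r ?nnegrE ?mulr_ge0 ?addr_ge0.
  rewrite !exprMn real_normK ?num_real//; have := sqr_ge0 (a - b); nra.
have h3 : (s + t + 2 * o) ^+ 2 <= 3 * (s ^+ 2 + t ^+ 2 + (2 * o) ^+ 2).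
  have := sqr_ge0 (s - t); have := sqr_ge0 (s - 2 * o); have := sqr_ge0 (t - 2 * o); nra.
have := sqr_ge0 s; have := sqr_ge0 t; lra.
Qed.

Lemma hN4_quotient_le p q : hN4 q <= 14 * (hN4 (hmul p (- q)) + hN4 p).
Proof.
have {1}-> : q = hmul (- hmul p (- q)) p by rewrite hinvM opprK hmulVKr.
by apply: (le_trans (hN4M_le _ _)); rewrite hN4N.
Qed.

Lemma sqn_le1 p : sqn p.1 <= 1 + hN4 p.
Proof. by have := sqn_le_hN4 p; have := sqr_ge0 (sqn p.1 - 1); nra. Qed.

Lemma abs2_le p : `|p.2| <= 1 + hN4 p.
Proof.
have : p.2 ^+ 2 <= hN4 p by rewrite lerDr sqr_ge0.
rewrite -real_normK ?num_real//; have := sqr_ge0 (`|p.2| - 1); nra.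
Qed.

Lemma smooth_hN4 : smooth (@hN4 R n).
Proof.
have := smooth_hN4_quotient (0 : H); congr smooth.
by apply/funext => y; rewrite hmul0p hN4N.
Qed.

Definition qball (M : R) : set H := [set p | hN4 p <= M].

Lemma closed_qball M : closed (qball M).
Proof.
have /continuous_closedP h := smooth_continuous smooth_hN4.
exact: (h [set x | x <= M] (@closed_le R M)).
Qed.

Lemma compact_qball M : compact (qball M).
Proof.
pose b := 1 + (1 + M); pose I := `[- b, b]%classic : set R.
pose B := ([set v : 'rV[R]_n | forall j, I (v ord0 j)] `*`
  [set v : 'rV[R]_n | forall j, I (v ord0 j)]) `*` I.
have cI : compact I by exact: segment_compact.
apply: (@subclosed_compact _ (qball M) B (@closed_qball M)).
  have cv : compact [set v : 'rV[R]_n | forall j, I (v ord0 j)] by exact: (@rV_compact R n (fun=> I) (fun=> cI)).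
  by apply: compact_setX => //; apply: compact_setX.
move=> p; rewrite /qball/= => hp.
have Ib (x : R) : `|x| <= b -> I x by rewrite /I/= in_itv/= ler_norml.
have sq (x : R) : x ^+ 2 <= 1 + M -> I x.
  move=> hx; apply: Ib; have := sqr_ge0 (`|x| - 1); have := sqr_ge0 x.
  by rewrite -[x ^+ 2](real_normK (num_real x)) in hx *; rewrite /b; nra.
have sM : sqn p.1 <= 1 + M by apply: (le_trans (sqn_le1 p)); rewrite lerD2l.
have sj j : p.1.1 ord0 j ^+ 2 + p.1.2 ord0 j ^+ 2 <= 1 + M.
  apply: le_trans sM; rewrite /sqn (bigD1 j)//= lerDl.
  by apply: sumr_ge0 => i _; rewrite addr_ge0 ?sqr_ge0.
split=> /=; [split=> /= j; apply: sq; apply: (le_trans _ (sj j))|].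
- by rewrite lerDl sqr_ge0.
- by rewrite lerDr sqr_ge0.
- by apply: Ib; apply: (le_trans (abs2_le p)); rewrite /b; lra.
Qed.

Lemma measurable_qball M : measurable (qball M).
Proof.
have := @measurable_fun_hN4 R n _ _ id (@measurable_id _ _ _) measurableT _ (@measurable_itv R `]-oo, M]).
rewrite setTI; congr (measurable _); apply/seteqP; split => p; rewrite /qball/= in_itv//=.
Qed.

End quasi_ball.

Section bump.
Context (R : realType) (n : nat).
Local Notation C := (Cn R n).
Local Notation H := (heis R n).
Variable k : R.
Hypothesis k0 : 0 < k.

(** Supported where N^4 <= 1/k, so that large k concentrates it at the origin. *)
Definition bump (p : H) : R := bexp 0 (1 - k * hN4 p).

Lemma bump_ge0 p : 0 <= bump p. Proof. exact: bexp_ge0. Qed.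

Lemma measurable_bump : measurable_fun setT bump.
Proof.
apply: (measurableT_comp (@measurable_bexp R 0)); apply: measurable_funB => //.
by apply: measurable_funM => //; exact: measurable_fun_hN4.
Qed.

Lemma bexp_qball m (p : H) : bexp m (1 - k * hN4 p) != 0 -> qball k^-1 p.
Proof.
apply: contra_neqP; rewrite /qball/= => /negP; rewrite -ltNge => h; apply: bexp_le0.
by rewrite subr_le0 -ler_pdivrMl// mulr1 ltW.
Qed.

Lemma bexp_bump_le m (p : H) : bexp m (1 - k * hN4 p) <= m.+1`!%:R.
Proof.
have [s0|s0] := leP (1 - k * hN4 p) 0; first by rewrite bexp_le0.
apply: (le_trans (bexp_le _ _)); rewrite ler_piMr// gtr0_norm// gerBl.
by rewrite mulr_ge0 ?hN4_ge0// ltW.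
Qed.

Lemma bump_le1 p : bump p <= 1. Proof. exact: bexp_bump_le. Qed.

Lemma smooth_bump_quotient (w : H) : smooth (fun y : H => bump (hmul w (- y))).
Proof.
apply: (smooth_bexp 0 (f := fun y : H => 1 - k * hN4 (hmul w (- y)))).
apply: (smoothD (smooth_cst _ 1)); apply: smoothN; apply: (smoothM (smooth_cst _ k)).
exact: smooth_hN4_quotient.
Qed.

Lemma test_bump_quotient (w : H) : test_function (fun y : H => bump (hmul w (- y))).
Proof.
split; first by move=> m; apply: smooth_Ck; exact: smooth_bump_quotient.
apply: (@subclosed_compact _ _ (qball (14 * (k^-1 + hN4 w)))).
- exact: closed_closure.
- exact: compact_qball.
- rewrite [X in _ `<=` X](closure_id _).1; last exact: closed_qball.
  apply: closureS => y /= /bexp_qball; rewrite /qball/= => h.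
  by apply: (le_trans (hN4_quotient_le w y)); rewrite ler_wpM2l// lerD2r.
Qed.

(** The horizontal gradient in y of the bump of w y^(-1), as one vector; its two summands stem from
    |z|^4 and from t^2. *)
Definition bump_grad (w y : H) : C :=
  let p := hmul w (- y) in
  (4 * k * bexp 2 (1 - k * hN4 p)) *:
    (sqn p.1 *: p.1 + p.2 *: ((w.1 + y.1).2, - (w.1 + y.1).1)).

Lemma dv_bump (V : normedModType R) (P : V -> H) x v T : coord_derive P x v T ->
  is_derive x v (fun y => bump (P y))
    (- (k * bexp 2 (1 - k * hN4 (P x)) * (4 * sqn (P x).1 * cdot (P x).1 T.1 + 2 * (P x).2 * T.2))).
Proof.
move=> /coord_derive_hN4 h.
apply: (dv_eq (dv_comp (dvB (dv_cst 1 x v) (dvZ k h)) (is_derive_bexp 0 _))).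
by rewrite mul0r subr0 sub0r; ring.
Qed.

Lemma derive_bump_quotient (w y v : H) :
  'D_v (fun y : H => bump (hmul w (- y))) y = let p := hmul w (- y) in
    k * bexp 2 (1 - k * hN4 p) *
    (4 * sqn p.1 * cdot p.1 v.1 + 2 * p.2 * (v.2 + 2 * omega w.1 v.1)).
Proof.
have h := coord_derive_hmul (coord_derive_cst w y v) (coord_deriveN (coord_derive_id y v)).
have [_ ->] := dv_bump h; rewrite /= !add0r cdotNr.
have -> : omega 0 (- y.1) = 0 by rewrite -(scale0r y.1) omegaZl mul0r.
rewrite (omegaNr w.1 v.1) add0r; ring.
Qed.

Lemma cdot_delta (z : C) j : (cdot z (dx j : H).1 = z.1 ord0 j) * (cdot z (dy j : H).1 = z.2 ord0 j) *
  (omega z (dx j : H).1 = z.2 ord0 j) * (omega z (dy j : H).1 = - z.1 ord0 j).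
Proof.
have d (f : 'I_n -> R) : \sum_(i < n) f i * (delta_mx ord0 j : 'rV[R]_n) ord0 i = f j.
  rewrite (bigD1 j)//= mxE !eqxx mulr1 big1 ?addr0// => i ij.
  by rewrite mxE (negbTE ij) mulr0.
rewrite /cdot /omega /=; do !split.
- by rewrite -[RHS]d; apply: eq_bigr => i _; rewrite !mxE; ring.
- by rewrite -[RHS]d; apply: eq_bigr => i _; rewrite !mxE; ring.
- by rewrite -[RHS]d; apply: eq_bigr => i _; rewrite !mxE; ring.
- by rewrite -[in RHS]d -sumrN; apply: eq_bigr => i _; rewrite !mxE; ring.
Qed.

Lemma cdot_dt (z : C) : (cdot z (dt : H).1 = 0) * (omega z (dt : H).1 = 0).
Proof. by split; apply: big1 => i _; rewrite !mxE; ring. Qed.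

Lemma Xfield_bump (w y : H) j :
  Xfield j (fun y : H => bump (hmul w (- y))) y = (bump_grad w y).1 ord0 j.
Proof. by rewrite /Xfield !derive_bump_quotient /= !cdot_delta !cdot_dt !mxE /=; ring. Qed.

Lemma Yfield_bump (w y : H) j :
  Yfield j (fun y : H => bump (hmul w (- y))) y = (bump_grad w y).2 ord0 j.
Proof. by rewrite /Yfield !derive_bump_quotient /= !cdot_delta !cdot_dt !mxE /=; ring. Qed.

Lemma cdotDr (z w w' : C) : cdot z (w + w') = cdot z w + cdot z w'.
Proof. by rewrite -big_split/=; apply: eq_bigr => j _; rewrite !mxE; ring. Qed.

Lemma cdotC (z w : C) : cdot z w = cdot w z.
Proof. by apply: eq_bigr => j _; ring. Qed.

Lemma cdotZr (a : R) (z w : C) : cdot z (a *: w) = a * cdot z w.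
Proof. by rewrite cdotC cdotZl cdotC. Qed.

(** Moving w along a horizontal direction changes w y^(-1) in the same way as moving y backwards
    along it. Hence the derivative in w is minus the pairing with the gradient in y, on which the
    weak gradient of u can be tested. *)
Lemma dv_bump_curve (c : R -> H) (r : R) (a : C) (y : H) :
  coord_derive c r 1 (a, 2 * omega (c r).1 a) ->
  is_derive r 1 (fun r : R => bump (hmul (c r) (- y))) (- cdot a (bump_grad (c r) y)).
Proof.
move=> hc; apply: (dv_eq (dv_bump (coord_derive_hmul hc (coord_derive_cst (- y) r 1)))).
congr (- _); rewrite /bump_grad /= addr0 addr0.
have o0 : omega (c r).1 0 = 0 by rewrite -(scale0r y.1) omegaZr mul0r.
have -> : 2 * omega (c r).1 a + 2 * (omega a (- y.1) + omega (c r).1 0) = 2 * omega ((c r).1 + y.1) a.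
  by rewrite o0 omegaNr (omegaC a) opprK addr0 omegaDl; ring.
rewrite cdotZr cdotDr !cdotZr (cdotC a).
have -> : cdot a (((c r).1 + y.1).2, - ((c r).1 + y.1).1) = omega ((c r).1 + y.1) a.
  by apply: eq_bigr => j _; rewrite !mxE; ring.
ring.
Qed.

End bump.

Section spiral_curve.
Context (R : realType) (n : nat).
Local Notation C := (Cn R n).
Local Notation H := (heis R n).
Variable p : H.
Hypotheses (Sp : unit_sphere p) (p0 : 0 < sqn p.1).
Let tau : R := p.2 / sqn p.1.

(** The z-component of the velocity, that is, the derivative of r e^(-i tau ln r) z0. *)
Definition spiral_dir (r : R) : C :=
  crot (cos (tau * ln r)) (sin (tau * ln r)) p.1 +
  tau *: crot (- sin (tau * ln r)) (cos (tau * ln r)) p.1.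

Lemma spiralE (r : R) : 0 < r ->
  spiral p r = (r *: crot (cos (tau * ln r)) (sin (tau * ln r)) p.1, r ^+ 2 * p.2).
Proof.
move=> r0; have -> : tau * ln r = twist_angle (hdil r p).
  rewrite /twist_angle hnorm_hdil// (_ : hnorm p = 1)// mulr1 sqnZ /tau; congr (_ * _).
  by rewrite /hdil/=; field; rewrite !gt_eqF.
rewrite /spiral /twist; congr pair; move: (cos _) (sin _) => c s.
transitivity ((r *: (c *: p.1.1 + s *: p.1.2), r *: (c *: p.1.2 - s *: p.1.1)) : C) => //.
by rewrite /crot/= scalerDr scalerBr !scalerA ![r * _]mulrC.
Qed.

Let hor (r : R) : 0 < r ->
  coord_derive (spiral p) r 1 (spiral_dir r, 2 * r * p.2).
Proof.
move=> r0; have nE : \forall s \near r, spiral p s =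
    (s *: crot (cos (tau * ln s)) (sin (tau * ln s)) p.1, s ^+ 2 * p.2).
  by near=> s; rewrite spiralE//; near: s; exact: lt_nbhsr.
have dth : is_derive r 1 (fun s : R => tau * ln s) (tau * r^-1).
  by apply: dvZ; exact: is_derive1_ln.
have dc := dv_comp dth (is_derive_cos (tau * ln r)).
have ds := dv_comp dth (is_derive_sin (tau * ln r)).
split => [j|j|].
- apply: (near_eq_is_derive (f := fun s : R => s * (cos (tau * ln s) * p.1.1 ord0 j + sin (tau * ln s) * p.1.2 ord0 j))).
    by near=> s; rewrite (near nE s)//= !mxE.
  apply: (dv_eq (dvM (dv_id r) (dvD (dvM dc (dv_cst (p.1.1 ord0 j) r 1)) (dvM ds (dv_cst (p.1.2 ord0 j) r 1))))).
  rewrite /spiral_dir /= !mxE; move: (cos _) (sin _) (p.1.1 _ _) (p.1.2 _ _) => c s a b.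
  by field; rewrite gt_eqF.
- apply: (near_eq_is_derive (f := fun s : R => s * (cos (tau * ln s) * p.1.2 ord0 j - sin (tau * ln s) * p.1.1 ord0 j))).
    by near=> s; rewrite (near nE s)//= !mxE.
  apply: (dv_eq (dvM (dv_id r) (dvB (dvM dc (dv_cst (p.1.2 ord0 j) r 1)) (dvM ds (dv_cst (p.1.1 ord0 j) r 1))))).
  rewrite /spiral_dir /= !mxE; move: (cos _) (sin _) (p.1.1 _ _) (p.1.2 _ _) => c s a b.
  by field; rewrite gt_eqF.
- apply: (near_eq_is_derive (f := fun s : R => s ^+ 2 * p.2)).
    by near=> s; rewrite (near nE s).
  by apply: (dv_eq (dvM (dv_pow 1 r) (dv_cst p.2 r 1))); rewrite /= expr1; ring.
Unshelve. all: by end_near. Qed.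

(** Along the spiral t grows at the rate 2 r t0, whereas horizontality asks for 2 r tau |z0|^2; this
    is the origin of tau = t0/|z0|^2. Left translations preserve horizontality. *)
Lemma spiral_horizontal (x : H) (r : R) : 0 < r ->
  coord_derive (fun r : R => hmul x (spiral p r)) r 1
    (spiral_dir r, 2 * omega (hmul x (spiral p r)).1 (spiral_dir r)).
Proof.
move=> r0; have := coord_derive_hmul (coord_derive_cst x r (1 : R)) (hor r0).
congr coord_derive; rewrite (spiralE r0) !add0r; congr pair.
have -> : omega (0 : H).1 (r *: crot (cos (tau * ln r)) (sin (tau * ln r)) p.1, r ^+ 2 * p.2).1 = 0.
  have o0 w : omega (0 : C) w = 0 by rewrite -(scale0r p.1) omegaZl mul0r.
  exact: o0.
rewrite [LHS]/= [RHS]/= omegaDl add0r mulrDr [RHS]addrC; congr (_ + _).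
rewrite omegaZl -mulrA; congr (_ * _).
set c := cos _; set s := sin _.
have cs : c ^+ 2 + s ^+ 2 = 1 by exact: cos2Dsin2.
have -> : omega (crot c s p.1) (spiral_dir r) = tau * sqn p.1.
  rewrite /spiral_dir -/c -/s omegaDr omegaxx add0r omegaZr; congr (_ * _).
  rewrite -(sqn_crot p.1 cs); apply: eq_bigr => j _; rewrite /= !mxE; ring.
by rewrite /tau divfK ?gt_eqF.
Qed.

(** The radial and the rotational part of the velocity are orthogonal, and (1 + tau^2)|z0|^2 =
    (|z0|^4 + t0^2)/|z0|^2, with numerator 1 on the sphere. *)
Lemma sqn_spiral_dir r : sqn (spiral_dir r) = (sqn p.1)^-1.
Proof.
set c := cos (tau * ln r); set s := sin (tau * ln r).
have cs : c ^+ 2 + s ^+ 2 = 1 by exact: cos2Dsin2.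
have E : sqn (spiral_dir r) = (1 + tau ^+ 2) * sqn p.1.
  rewrite mulr_sumr; apply: eq_bigr => j _; rewrite /spiral_dir -/c -/s /= !mxE.
  have e1 (x : R) : x = (c ^+ 2 + s ^+ 2) * x by rewrite cs mul1r.
  by rewrite [RHS]e1; ring.
have h1 : sqn p.1 ^+ 2 + p.2 ^+ 2 = 1 by have := hN4_unit Sp.
have : (sqn p.1)^-1 * (sqn p.1 ^+ 2 + p.2 ^+ 2) = (sqn p.1)^-1 by rewrite h1 mulr1.
by rewrite E => <-; rewrite /tau; field; rewrite gt_eqF.
Qed.

End spiral_curve.

Section coord_cvg.
Context (R : realType) (n : nat) (T : Type) (F : set_system T) {FF : Filter F}.
Local Notation C := (Cn R n).
Local Notation H := (heis R n).

(** Convergence by coordinates along a filter, used for sequences as well as for neighbourhoods on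
    the line. *)
Definition coord_cvg (P : T -> H) (p : H) : Prop :=
  [/\ forall j, (P t).1.1 ord0 j @[t --> F] --> p.1.1 ord0 j,
      forall j, (P t).1.2 ord0 j @[t --> F] --> p.1.2 ord0 j &
      (P t).2 @[t --> F] --> p.2].

Lemma cvg_sum_ord m (f : 'I_m -> T -> R) (a : 'I_m -> R) :
  (forall j, f j t @[t --> F] --> a j) ->
  \sum_(j < m) f j t @[t --> F] --> \sum_(j < m) a j.
Proof.
elim: m f a => [|m IH] f a h.
  by under eq_fun do rewrite big_ord0; rewrite big_ord0; exact: cvg_cst.
under eq_fun do rewrite big_ord_recr; rewrite big_ord_recr/=.
by apply: cvgD; [exact: IH|exact: h].
Qed.

Lemma coord_cvg_cst p : coord_cvg (fun=> p) p.
Proof. by split => [j|j|]; exact: cvg_cst. Qed.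

Lemma coord_cvgN P p : coord_cvg P p -> coord_cvg (fun t => - P t) (- p).
Proof.
move=> [h1 h2 h3]; split => [j|j|]; last exact: cvgN.
- by under eq_fun do rewrite mxE; rewrite mxE; exact: cvgN.
- by under eq_fun do rewrite mxE; rewrite mxE; exact: cvgN.
Qed.

Lemma coord_cvg_hmul P P' p p' : coord_cvg P p -> coord_cvg P' p' ->
  coord_cvg (fun t => hmul (P t) (P' t)) (hmul p p').
Proof.
move=> [h1 h2 h3] [k1 k2 k3]; split => [j|j|].
- by under eq_fun do rewrite mxE; rewrite mxE; exact: cvgD.
- by under eq_fun do rewrite mxE; rewrite mxE; exact: cvgD.
- apply: cvgD; first exact: cvgD.
  apply: cvgMr; apply: cvg_sum_ord => j.
  by apply: cvgB; exact: cvgM.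
Qed.

Lemma coord_cvg_hN4 P p : coord_cvg P p -> hN4 (P t) @[t --> F] --> hN4 p.
Proof.
have sq (f : T -> R) (a : R) : f t @[t --> F] --> a -> f t ^+ 2 @[t --> F] --> a ^+ 2.
  by move=> h; under eq_fun do rewrite expr2; rewrite expr2; exact: cvgM.
move=> [h1 h2 h3]; apply: cvgD; apply: (sq _ _) => //.
by apply: cvg_sum_ord => j; apply: cvgD; apply: (sq _ _).
Qed.

Lemma coord_cvg0 P : hN4 (P t) @[t --> F] --> (0 : R) -> coord_cvg P 0.
Proof.
move=> /cvgr0Pnorm_lt h.
have key (f : T -> R) : (forall t, f t ^+ 4 <= hN4 (P t)) -> f t @[t --> F] --> (0 : R).
  move=> fh; apply/cvgr0Pnorm_lt => e e0.
  apply: filterS (h (e ^+ 4) (exprn_gt0 _ e0)) => t.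
  rewrite ger0_norm ?hN4_ge0// => /(le_lt_trans (fh t)).
  move=> hh; rewrite -(@ltr_pXn2r _ 4) ?nnegrE ?(ltW e0)//.
  by rewrite -normrX ger0_norm// (exprM _ 2 2) sqr_ge0.
have key2 (f : T -> R) : (forall t, f t ^+ 2 <= hN4 (P t)) -> f t @[t --> F] --> (0 : R).
  move=> fh; apply/cvgr0Pnorm_lt => e e0.
  apply: filterS (h (e ^+ 2) (exprn_gt0 _ e0)) => t.
  rewrite ger0_norm ?hN4_ge0// => /(le_lt_trans (fh t)).
  move=> hh; rewrite -(@ltr_pXn2r _ 2) ?nnegrE ?(ltW e0)//.
  by rewrite -normrX ger0_norm// sqr_ge0.
have le4 (a b : R) : 0 <= a -> a <= b -> a ^+ 2 <= b ^+ 2.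
  by move=> a0 ab; rewrite lerXn2r ?nnegrE// (le_trans a0).
have sj j t : (P t).1.1 ord0 j ^+ 2 + (P t).1.2 ord0 j ^+ 2 <= sqn (P t).1.
  rewrite /sqn (bigD1 j)//= lerDl.
  by apply: sumr_ge0 => i _; rewrite addr_ge0 ?sqr_ge0.
split => [j|j|]; rewrite ?mxE.
- apply: key => t; apply: le_trans (sqn_le_hN4 (P t)); rewrite (exprM _ 2 2).
  by apply: le4; [exact: sqr_ge0|apply: le_trans (sj j t); rewrite lerDl sqr_ge0].
- apply: key => t; apply: le_trans (sqn_le_hN4 (P t)); rewrite (exprM _ 2 2).
  by apply: le4; [exact: sqr_ge0|apply: le_trans (sj j t); rewrite lerDr sqr_ge0].
- by apply: key2 => t; rewrite lerDr sqr_ge0.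
Qed.

Lemma coord_cvg_bump k P p : coord_cvg P p -> bump k (P t) @[t --> F] --> bump k p.
Proof.
move=> /coord_cvg_hN4 h.
have h1 : 1 - k * hN4 (P t) @[t --> F] --> 1 - k * hN4 p by apply: cvgB; [exact: cvg_cst|exact: cvgMr].
exact: (cvg_comp _ _ h1 (@continuous_bexp R 0 (1 - k * hN4 p))).
Qed.

End coord_cvg.

Section ball_integrable.
Context (R : realType) (n : nat).
Local Notation C := (Cn R n).
Local Notation H := (heis R n).
Local Notation Q := (@hdim n).
Local Notation mu := (@haar R n).

Lemma scales_hdil (r : R) : 0 < r -> scales mu (hdil r) (r ^- Q).
Proof.
move=> r0; have r2 : 0 <= (r ^+ 2)^-1 by rewrite invr_ge0 exprn_ge0// ltW.
have h := @scales_skew _ _ _ _ _ (lebesgue_C R n) (@lebesgue_line R) _ (fun _ t => r ^+ 2 * t + 0) _ _ r2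
  (scales_C 0 (lt0r_neq0 r0)) (fun _ => scales_line_pos 0 (exprn_gt0 2 r0)) _.
apply: (eq_scales _ _ (h _)) => [p||]; first by rewrite /hdil !addr0.
  by rewrite gtr0_norm// -invfM -exprD hdim_double doubleS addn2.
by apply: measurable_funD => //; apply: measurable_funM => //; exact: measurable_snd.
Qed.

Lemma int_hmul_inv (h : H -> \bar R) (w : H) : measurable_fun setT h -> (forall x, (0 <= h x)%E) ->
  (\int[mu]_y h (hmul w (- y)%R) = \int[mu]_y h y)%E.
Proof.
move=> mh h0; have [mw hw] := scales_hmull w; have [_ hn] := @scales_hN R n.
have := hn (fun y => h (hmul w y)); rewrite mul1e => ->//.
- by rewrite hw// mul1e.
- exact: (measurableT_comp mh mw).
Qed.

Lemma haar_qball_lt (M : R) : 0 < M ->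
  (\int[mu]_p (indb (hN4 p < M)%R)%:E =
   (M `^ (Q%:R / 4))%:E * \int[mu]_p (indb (hN4 p < 1)%R)%:E)%E.
Proof.
move=> M0; pose r := M `^ 4^-1; have r0 : 0 < r by exact: powR_gt0.
have r4 : r ^+ 4 = M by rewrite -powR_mulrn ?(ltW r0)// -powRrM mulVf// powRr1// ltW.
have mh : measurable_fun setT (fun p : H => (indb (hN4 p < M) : R)%:E).
  by apply/measurable_EFinP; apply: measurable_fun_ltR => //; exact: measurable_fun_hN4.
have [_ /(_ _ mh (fun p => _))] := scales_hdil r0.
have -> : M `^ (Q%:R / 4) = r ^+ Q by rewrite -powR_mulrn ?(ltW r0)// -powRrM mulrC.
under eq_integral => p _ do rewrite hN4_hdil r4 gtr_pMr//.
move=> -> ; first by rewrite muleA -EFinM mulfV ?mul1e// gt_eqF// exprn_gt0.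
by move=> p; rewrite lee_fin.
Qed.

Lemma haar_qball_fin (M : R) : (mu (qball M) < +oo)%E.
Proof.
rewrite -(int_indic mu (measurable_qball M)).
have M1 : 0 < Num.max M 0 + 1 by rewrite ltr_wpDl// le_max lexx orbT.
apply: (@le_lt_trans _ _ (\int[mu]_p (indb (hN4 p < Num.max M 0 + 1)%R)%:E)%E).
  apply: int_le => [x|||x]; rewrite ?lee_fin//.
  - by apply/measurable_EFinP; exact: measurable_indic (measurable_qball M).
  - by apply/measurable_EFinP; apply: measurable_fun_ltR => //; exact: measurable_fun_hN4.
  - rewrite indicE; case: (boolP (x \in qball M)) => //; rewrite inE /qball/= => h.
    by rewrite (_ : hN4 x < _) ?indbE//; apply: (le_lt_trans h); rewrite ltr_pwDr// le_max lexx.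
rewrite haar_qball_lt//; have := @haar_ball_fin R n.
have : (0 <= \int[mu]_p (indb (hN4 p < 1)%R)%:E)%E by apply: int_ge0 => p; rewrite lee_fin.
by case: (\int[mu]_p _)%E => // x _ _; rewrite -EFinM ltry.
Qed.

Definition ball_integrable (f : H -> R) : Prop :=
  measurable_fun setT f /\ forall M, mu.-integrable (qball M) (EFin \o f).

Lemma loc_integrable_ball (f : H -> R) : loc_integrable f -> ball_integrable f.
Proof. by move=> [mf lf]; split => // M; apply: lf; exact: compact_qball. Qed.

Lemma ball_integrableM (f g : H -> R) (M c : R) : ball_integrable f -> measurable_fun setT g ->
  (forall y, `|g y| <= c * \1_(qball M) y) -> mu.-integrable setT (EFin \o (fun y => g y * f y)).
Proof.
move=> [mf lf] mg gb; have mq := measurable_qball (R := R) (n := n) M.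
have /integrable_mkcond - /(_ mq) i1 := lf M.
apply: (le_integrable measurableT _ _ (integrableZl measurableT c i1)).
  by apply/measurable_EFinP; exact: measurable_funM.
move=> y _; rewrite /= patchE; have := gb y; rewrite indicE.
case: (y \in qball M) => /= h.
  rewrite lee_fin !normrM ler_wpM2r//; apply: (le_trans h); rewrite mulr1 ler_norm//.
rewrite lee_fin mulr0 normr0 normrM.
by rewrite (_ : `|g y| = 0) ?mul0r//; apply/eqP; rewrite eq_le normr_ge0 andbT (le_trans h)// mulr0.
Qed.

Lemma ball_integrable_abs (f : H -> R) : ball_integrable f -> ball_integrable (fun y => `|f y|).
Proof.
move=> [mf lf]; split; first by apply: measurableT_comp.
by move=> M; have := integrable_abse (lf M).
Qed.

Lemma integrable_normr (f : H -> R) : measurable_fun setT f ->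
  mu.-integrable setT (EFin \o f) -> (\int[mu]_y (`|f y|)%:E < +oo)%E.
Proof. by move=> mf /integrableP[_]. Qed.

Lemma Rintegral_sum m (f : 'I_m -> H -> R) : (forall j, mu.-integrable setT (EFin \o f j)) ->
  \int[mu]_y (\sum_(j < m) f j y) = \sum_(j < m) \int[mu]_y f j y.
Proof.
elim: m f => [|m IH] f hf.
  by under eq_Rintegral do rewrite big_ord0; rewrite big_ord0 /Rintegral integral0.
under eq_Rintegral do rewrite big_ord_recr.
rewrite RintegralD//; first by rewrite IH// big_ord_recr.
have := @integrable_sum _ _ _ mu setT measurableT _ (index_enum 'I_m) xpredT
  (fun j y => (f (widen_ord (leqnSn m) j) y)%:E) (fun j _ => hf _).
by congr (integrable _ _ _); apply/funext => y; rewrite sumEFin.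
Qed.

End ball_integrable.

(** * Mollifications and their upper gradients *)

Section mollification.
Context (R : realType) (n : nat).
Local Notation C := (Cn R n).
Local Notation H := (heis R n).
Local Notation Q := (@hdim n).
Local Notation mu := (@haar R n).
Variable k : R.
Hypothesis k0 : 0 < k.

(** The argument w y^(-1) makes this an average of left translates of f; such averages commute with
    left-invariant fields. *)
Definition moll (f : H -> R) (w : H) : R := \int[mu]_y (bump k (hmul w (- y)) * f y).

Definition bump_mass : R := \int[mu]_y (bump k y).

Let mquot (w : H) : measurable_fun setT (fun y : H => bump k (hmul w (- y))).
Proof.
apply: (measurableT_comp (@measurable_bump R n k)); apply: measurable_fun_hmul => //.
exact: measurable_fun_hN.
Qed.

Lemma bump_quotient_le (w y : H) W : hN4 w <= W ->
  `|bump k (hmul w (- y))| <= 1 * \1_(qball (14 * (k^-1 + W))) y.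
Proof.
move=> wW; rewrite mul1r ger0_norm ?bump_ge0// indicE.
have [->|h] := eqVneq (bump k (hmul w (- y))) 0; first by [].
rewrite mem_set ?bump_le1// /qball/=; apply: (le_trans (hN4_quotient_le w y)).
by rewrite ler_wpM2l// lerD//; exact: (bexp_qball k0 h).
Qed.

Lemma moll_integrable f (w : H) : ball_integrable f ->
  mu.-integrable setT (EFin \o (fun y => bump k (hmul w (- y)) * f y)).
Proof.
move=> hf; apply: (ball_integrableM hf (mquot w)) => y.
exact: (bump_quotient_le y (lexx (hN4 w))).
Qed.

Lemma measurable_moll f : measurable_fun setT f -> measurable_fun setT (moll f).
Proof.
move=> mf; apply: measurableT_comp => //.
pose F (z : H * H) := (bump k (hmul z.1 (- z.2)) * f z.2)%:E.
have mF : measurable_fun setT F.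
  apply/measurable_EFinP; apply: measurable_funM; last exact: (measurableT_comp mf measurable_snd).
  apply: (measurableT_comp (@measurable_bump R n k)); apply: measurable_fun_hmul; first exact: measurable_fst.
  by apply: measurable_fun_hN; exact: measurable_snd.
have mp : measurable_fun setT (F ^\+)%E by exact: measurable_funepos.
have mn : measurable_fun setT (F ^\-)%E by exact: measurable_funeneg.
rewrite (_ : (fun _ => _) = (fun w : H => (\int[mu]_y (F ^\+) (w, y) - \int[mu]_y (F ^\-) (w, y))%E)).
  apply: emeasurable_funB; first exact: (measurable_int2 mu mp (funepos_ge0 F)).
  exact: (measurable_int2 mu mn (funeneg_ge0 F)).
apply/funext => w; rewrite integralE; congr (_ - _)%E; apply: eq_integral => y _.
  by rewrite !funeposE.
by rewrite !funenegE.
Qed.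

Lemma moll_ge0 f w : (forall y, 0 <= f y) -> 0 <= moll f w.
Proof. by move=> f0; apply: Rintegral_ge0 => y _; rewrite mulr_ge0 ?bump_ge0. Qed.

Lemma mollE f w : ball_integrable f ->
  (\int[mu]_y (bump k (hmul w (- y)%R) * f y)%:E = (moll f w)%:E)%E.
Proof. by move=> hf; rewrite fineK//; apply: integrable_fin_num => //; exact: moll_integrable. Qed.

(** Dominated convergence: as long as w stays in a ball, the bumps have a common ball as support. *)
Lemma moll_cvg f (w : nat -> H) (w0 : H) (W : R) : ball_integrable f ->
  (forall i, hN4 (w i) <= W) -> coord_cvg \oo w w0 -> moll f (w i) @[i --> \oo] --> moll f w0.
Proof.
move=> hf wW cw; have [mf _] := hf.
pose B := qball (R := R) (n := n) (14 * (k^-1 + W)).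
have mB : measurable B by exact: measurable_qball.
have iB : mu.-integrable setT (EFin \o (fun y => \1_B y * `|f y|)).
  apply: (ball_integrableM (c := 1) (M := 14 * (k^-1 + W)) (ball_integrable_abs hf)); first exact: measurable_indic.
  by move=> y; rewrite mul1r ger0_norm.
have := @dominated_cvg _ _ _ mu setT measurableT (fun i y => (bump k (hmul (w i) (- y)) * f y)%:E)
  (fun y => (bump k (hmul w0 (- y)) * f y)%:E) (EFin \o (fun y => \1_B y * `|f y|)).
move=> /(_ _ _ _ iB _) D; apply: fine_cvg; rewrite fineK.
  apply: D => //.
  - by move=> i; apply/measurable_EFinP; exact: measurable_funM.
  - move=> y _; apply: cvg_EFin; first by near=> i.
    apply: cvgMl; apply: coord_cvg_bump; apply: coord_cvg_hmul => //; exact: coord_cvg_cst.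
  - move=> i y _; rewrite /= lee_fin normrM ler_wpM2r//.
    by have := bump_quotient_le y (wW i); rewrite mul1r.
by apply: integrable_fin_num => //; exact: moll_integrable.
Unshelve. all: by end_near. Qed.

End mollification.

Section mollification_norm.
Context (R : realType) (n : nat).
Local Notation C := (Cn R n).
Local Notation H := (heis R n).
Local Notation Q := (@hdim n).
Local Notation mu := (@haar R n).
Local Notation Sg := (@unit_sphere R n).
Variable sigma : {measure set H -> \bar R}.
Hypothesis hsigma : sphere_measure sigma.
Hypothesis n0 : (0 < n)%N.
Variable k : R.
Hypothesis k0 : 0 < k.
Local Notation mass := (@bump_mass R n k).

Lemma bump_massE : (\int[mu]_y (bump k y)%:E = mass%:E)%E.
Proof.
rewrite fineK// ge0_fin_numE; last by apply: int_ge0 => y; rewrite lee_fin bump_ge0.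
apply: le_lt_trans (haar_qball_fin n k^-1); rewrite -(int_indic mu (measurable_qball _)).
apply: int_le => [y|||y]; rewrite ?lee_fin ?bump_ge0//.
- by apply/measurable_EFinP; exact: measurable_bump.
- by apply/measurable_EFinP; exact: measurable_indic (measurable_qball _).
- rewrite indicE; have [->|h] := eqVneq (bump k y) 0; first by [].
  by rewrite mem_set ?bump_le1//; exact: (bexp_qball k0 h).
Qed.

(** A null unit ball would make the sphere null, contrary to the positivity of [csphere sigma]. *)
Lemma haar_ball_gt0 : (0 < \int[mu]_p (indb (hN4 p < 1)%R)%:E)%E.
Proof.
rewrite lt_neqAle eq_sym int_ge0 ?andbT; last by move=> p; rewrite lee_fin.
apply/eqP => E; have := haar_ball_sphere hsigma; rewrite E mul0e => S0.
have := csphere_gt0 hsigma n0; rewrite -lte_fin -csphereE//; apply/negP; rewrite -leNgt /csphere_e.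
have mS := @measurable_unit_sphere R n.
apply: (@le_trans _ _ (\int[sigma]_(p in Sg) 1%:E)%E); last by rewrite integral_cst// mul1e -S0.
apply: ge0_le_integral => //.
- by move=> p _; rewrite lee_fin exprn_ge0// enorm_ge0.
- apply/measurable_EFinP; apply: measurable_funTS; apply: measurable_funX.
  by apply: measurable_fun_enorm; exact: measurable_fst.
- by move=> p Sp; rewrite lee_fin exprn_ile1 ?enorm_ge0// (enorm_unit Sp).
Qed.

Lemma bump_mass_gt0 : 0 < mass.
Proof.
have e2 : 0 < (2 * k)^-1 by rewrite invr_gt0 mulr_gt0.
rewrite -lte_fin -bump_massE.
(* Where N^4 < 1/(2k), the argument of the flat function is at least 1/2 and the bump at least
   e^(-2). *)
apply: (@lt_le_trans _ _ (\int[mu]_p ((expR (- 2))%:E * (indb (hN4 p < (2 * k)^-1)%R)%:E))%E).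
  rewrite intZ ?expR_ge0//; last 2 first.
  - by move=> p; rewrite lee_fin.
  - by apply/measurable_EFinP; apply: measurable_fun_ltR => //; exact: measurable_fun_hN4.
  rewrite haar_qball_lt// mule_gt0 ?lte_fin ?expR_gt0//.
  by rewrite mule_gt0 ?lte_fin ?powR_gt0// haar_ball_gt0.
apply: int_le => [p|||p].
- by rewrite mule_ge0 ?lee_fin ?expR_ge0.
- apply: emeasurable_funM => //; apply/measurable_EFinP.
  by apply: measurable_fun_ltR => //; exact: measurable_fun_hN4.
- by apply/measurable_EFinP; exact: measurable_bump.
- rewrite -EFinM lee_fin; case: (ltP (hN4 p) (2 * k)^-1) => h; rewrite indbE ?mulr0 ?bump_ge0// mulr1.
  have s2 : 2^-1 <= 1 - k * hN4 p.
    have : k * hN4 p <= k * (2 * k)^-1 by rewrite ler_pM2l// ltW.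
    have -> : k * (2 * k)^-1 = 2^-1 by field; rewrite gt_eqF.
    lra.
  have s0 : 0 < 1 - k * hN4 p by apply: lt_le_trans s2.
  rewrite /bump bexp_gt0E// expr0 mulr1 ler_expR lerN2.
  by rewrite -[leRHS]invrK lef_pV2 ?posrE.
Qed.

Let phi (y : H) : R := bump k y / mass.

Let mphi : measurable_fun setT phi.
Proof. by apply: measurable_funM => //; exact: measurable_bump. Qed.

Let phi0 y : 0 <= phi y.
Proof. by rewrite divr_ge0 ?bump_ge0// ltW// bump_mass_gt0. Qed.

Let phi1 : (\int[mu]_y (phi y)%:E = 1)%E.
Proof.
under eq_integral => y _ do rewrite EFinM.
rewrite intZr ?invr_ge0 ?(ltW bump_mass_gt0)//.
- by rewrite bump_massE -EFinM mulfV// gt_eqF// bump_mass_gt0.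
- by move=> y; rewrite lee_fin bump_ge0.
- by apply/measurable_EFinP; exact: measurable_bump.
Qed.

(** The substitution x = w y^(-1) preserves the measure and turns the mollification into an average
    of left translates, to which Jensen's inequality applies. *)
Let havg_moll f w : ball_integrable f -> (forall y, 0 <= f y) ->
  havg phi f w = (moll k f w / mass)%:E.
Proof.
move=> hf f0; have [mf _] := hf; rewrite /havg.
have mh : measurable_fun setT (fun x : H => (phi x * f (hmul (- x) w))%:E).
  apply/measurable_EFinP; apply: measurable_funM => //; apply: (measurableT_comp mf).
  by apply: measurable_fun_hmul => //; exact: measurable_fun_hN.
rewrite -(int_hmul_inv w mh); last by move=> x; rewrite lee_fin mulr_ge0.
under eq_integral => y _ do rewrite hinvM opprK hmulVKr /phi mulrAC EFinM.
have mq : measurable_fun setT (fun y : H => bump k (hmul w (- y))).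
  apply: (measurableT_comp (@measurable_bump R n k)); apply: measurable_fun_hmul => //.
  exact: measurable_fun_hN.
rewrite intZr ?invr_ge0 ?(ltW bump_mass_gt0)//.
- by rewrite (mollE k0 w hf) EFinM.
- by move=> y; rewrite lee_fin mulr_ge0 ?bump_ge0.
- by apply/measurable_EFinP; exact: measurable_funM.
Qed.

(** Jensen's inequality at each w, then left invariance of the measure. It is applied to |u| and to
    the norm of the gradient, with different exponents. *)
Lemma int_moll_powR f (p a : R) : 1 <= p -> ball_integrable f -> (forall y, 0 <= f y) -> 0 <= a ->
  (\int[mu]_y (f y `^ p)%:E <= a%:E)%E ->
  (\int[mu]_w ((moll k f w / mass) `^ p)%:E <= a%:E)%E.
Proof.
move=> p1 hf f0 a0 ha; have [mf _] := hf.
have mfp : measurable_fun setT (fun y => f y `^ p) by exact: measurable_fun_powR.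
apply: (@le_trans _ _ (\int[mu]_w (1%:E * havg phi (fun y => (f y `^ p)%R) w))%E).
  apply: int_le => [w|||w].
  - by rewrite lee_fin powR_ge0.
  - apply/measurable_EFinP; apply: measurable_fun_powR; apply: measurable_funM => //.
    exact: measurable_moll.
  - apply: emeasurable_funM => //; apply: measurable_havg => // y; exact: powR_ge0.
  - by rewrite mul1e; apply: havg_jensen => //; exact: havg_moll.
apply: (int_havg_le mphi phi0 phi1 a0) => //.
  by move=> y; exact: powR_ge0.
move=> x; under eq_integral => y _ do rewrite mul1r.
by rewrite (int_hmull (- x) mfp)// => y; exact: powR_ge0.
Qed.

Lemma moll_norm (f : H -> R) (w : H) : ball_integrable f -> `|moll k f w| <= moll k (fun y => `|f y|) w.
Proof.
move=> hf; apply: (le_trans (le_normr_Rintegral _ (moll_integrable k0 w hf))) => //.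
rewrite le_eqVlt; apply/orP; left; apply/eqP; apply: eq_Rintegral => y _.
by rewrite normrM ger0_norm// bump_ge0.
Qed.

End mollification_norm.

Section bump_gradient.
Context (R : realType) (n : nat).
Local Notation C := (Cn R n).
Local Notation H := (heis R n).
Local Notation mu := (@haar R n).
Variable k : R.
Hypothesis k0 : 0 < k.

Lemma measurable_fun_cdot d (T : measurableType d) (f g : T -> C) :
  measurable_fun setT f -> measurable_fun setT g -> measurable_fun setT (fun x => cdot (f x) (g x)).
Proof.
move=> mf mg; apply: measurable_sum => j.
by apply: measurable_funD; apply: measurable_funM; apply: measurable_fun_coord;
  first [exact: measurable_fun_fst|exact: measurable_fun_snd].
Qed.

Lemma measurable_fun_bump_grad d (T : measurableType d) (f g : T -> H) :
  measurable_fun setT f -> measurable_fun setT g -> measurable_fun setT (fun x => bump_grad k (f x) (g x)).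
Proof.
move=> mf mg; have mP : measurable_fun setT (fun x => hmul (f x) (- g x)).
  by apply: measurable_fun_hmul => //; exact: measurable_fun_hN.
have mP1 := measurable_fun_fst mP; have mP2 := measurable_fun_snd mP.
have ms : measurable_fun setT (fun x => (f x).1 + (g x).1).
  by apply: measurable_fun_CD; exact: measurable_fun_fst.
apply: measurable_fun_CZ.
  apply: measurable_funM => //; apply: (measurableT_comp (@measurable_bexp R 2)).
  by apply: measurable_funB => //; apply: measurable_funM => //; exact: measurable_fun_hN4.
apply: measurable_fun_CD; apply: measurable_fun_CZ => //; first exact: measurable_fun_sqn.
apply: measurable_fun_pair; first exact: measurable_fun_snd.
by apply: measurable_fun_rowN; exact: measurable_fun_fst.
Qed.

(** A crude bound, uniform for N(w)^4 at most [W]: 24 is 4 times 3!, the bound of [bexp 2], and the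
    squared norm plus 1 stands for the norm. *)
Definition bump_grad_bound (W : R) : R :=
  1 + (24 * k) ^+ 2 * (2 * ((1 + k^-1) ^+ 3 + k^-1 * (2 * (1 + W + (1 + 14 * (k^-1 + W)))))).

Lemma bump_grad_le (w y : H) W : hN4 w <= W ->
  enorm (bump_grad k w y) <= bump_grad_bound W * \1_(qball (14 * (k^-1 + W))) y.
Proof.
move=> wW; rewrite indicE; have [E|h] := eqVneq (bexp 2 (1 - k * hN4 (hmul w (- y)))) 0.
  have -> : bump_grad k w y = 0 by rewrite /bump_grad E mulr0 scale0r.
  rewrite /enorm -/(sqn _) sqn0 sqrtr0 mulr_ge0//.
  have W0 : 0 <= W := le_trans (hN4_ge0 w) wW.
  have ki : 0 <= k^-1 by rewrite invr_ge0 ltW.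
  by rewrite addr_ge0// mulr_ge0 ?sqr_ge0// mulr_ge0// addr_ge0 ?exprn_ge0 ?mulr_ge0 ?addr_ge0 ?mulr_ge0 ?addr_ge0.
have hP : hN4 (hmul w (- y)) <= k^-1 := bexp_qball k0 h.
have hy : hN4 y <= 14 * (k^-1 + W).
  by apply: (le_trans (hN4_quotient_le w y)); rewrite ler_wpM2l// lerD.
rewrite mem_set// mulr1 /bump_grad_bound; set K := _ * (2 * _).
have : sqn (bump_grad k w y) <= K.
  rewrite /bump_grad sqnZ /K; apply: ler_pM; rewrite ?sqr_ge0 ?sqn_ge0//.
    have b0 := bexp_ge0 2 (1 - k * hN4 (hmul w (- y))).
    have b6 := bexp_bump_le k0 2 (hmul w (- y)).
    have b1 : 0 <= 4 * k * bexp 2 (1 - k * hN4 (hmul w (- y))).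
      by apply: mulr_ge0 => //; apply: mulr_ge0 => //; exact: ltW.
    rewrite lerXn2r ?nnegrE// ?mulr_ge0 ?(ltW k0)//.
    have -> : 24 * k = 4 * k * (3`!)%:R by rewrite -[3`!]/6%N; ring.
    by rewrite ler_wpM2l// mulr_ge0// ltW.
  apply: (le_trans (sqnD_le _ _)); rewrite ler_wpM2l//; apply: lerD; rewrite sqnZ.
    have s1 : sqn (hmul w (- y)).1 <= 1 + k^-1 by apply: (le_trans (sqn_le1 _)); rewrite lerD2l.
    by rewrite -exprSr lerXn2r ?nnegrE ?sqn_ge0// (le_trans (sqn_ge0 _) s1).
  apply: ler_pM; rewrite ?sqr_ge0 ?sqn_ge0//.
    by apply: le_trans hP; rewrite lerDr sqr_ge0.
  have -> : sqn (((w.1 + y.1).2, - (w.1 + y.1).1) : C) = sqn (w.1 + y.1).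
    by apply: eq_bigr => j _; rewrite [RHS]addrC /= !mxE sqrrN.
  apply: (le_trans (sqnD_le _ _)); rewrite ler_wpM2l//; apply: lerD.
    by apply: (le_trans (sqn_le1 _)); rewrite lerD2l.
  by apply: (le_trans (sqn_le1 _)); rewrite lerD2l.
rewrite -enorm_sqr; have := enorm_ge0 (bump_grad k w y); move: (enorm _) => e e0 eK.
by have := sqr_ge0 (e - 1); nra.
Qed.

Lemma coord_le_enorm (z : C) j : (`|z.1 ord0 j| <= enorm z) * (`|z.2 ord0 j| <= enorm z).
Proof.
have E (x : R) : x ^+ 2 <= sqn z -> `|x| <= enorm z.
  by move=> h; rewrite -(@ler_pXn2r _ 2) ?nnegrE ?enorm_ge0// enorm_sqr real_normK ?num_real.
have h : z.1 ord0 j ^+ 2 + z.2 ord0 j ^+ 2 <= sqn z.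
  by rewrite /sqn (bigD1 j)//= lerDl; apply: sumr_ge0 => i _; rewrite addr_ge0 ?sqr_ge0.
by split; apply: E; apply: le_trans h; rewrite ?lerDl ?lerDr sqr_ge0.
Qed.

Variables (u : H -> R) (G : H -> C).
Hypothesis hG : weak_hgrad u G.

Let hu : ball_integrable u. Proof. by apply: loc_integrable_ball; case: hG. Qed.
Let hG1 j : ball_integrable (fun p => (G p).1 ord0 j). Proof. by apply: loc_integrable_ball; have [_ /(_ j)[]] := hG. Qed.
Let hG2 j : ball_integrable (fun p => (G p).2 ord0 j). Proof. by apply: loc_integrable_ball; have [_ /(_ j)[]] := hG. Qed.

Lemma measurable_weak_hgrad : measurable_fun setT G.
Proof.
rewrite (_ : G = fun y => ((G y).1, (G y).2)); last by apply/funext => y; case: (G y).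
apply: measurable_fun_pair; apply: measurable_fun_row => j; [exact: (hG1 j).1|exact: (hG2 j).1].
Qed.

Lemma ball_integrable_enorm : ball_integrable (fun y => enorm (G y)).
Proof.
have mG : measurable_fun setT (fun y => enorm (G y)) by apply: measurable_fun_enorm; exact: measurable_weak_hgrad.
split=> // M; have mq := measurable_qball (R := R) (n := n) M.
have i1 j := integrable_abse ((hG1 j).2 M); have i2 j := integrable_abse ((hG2 j).2 M).
have iS := @integrable_sum _ _ _ mu _ mq _ (index_enum 'I_n) xpredT _
  (fun j _ => integrableD mq (i1 j) (i2 j)).
apply: (le_integrable mq _ _ iS); first by apply/measurable_EFinP; exact: measurable_funTS.
move=> y _; rewrite /= sumEFin lee_fin; apply: le_trans (ler_norm _).
rewrite ger0_norm ?enorm_ge0//; move: (G y) => z {iS i1 i2}.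
pose b j := `|z.1 ord0 j| + `|z.2 ord0 j|; have b0 j : 0 <= b j by rewrite addr_ge0.
have S0 : 0 <= \sum_(j < n) b j by apply: sumr_ge0.
rewrite -(@ler_pXn2r _ 2) ?nnegrE ?enorm_ge0// enorm_sqr expr2 mulr_suml; apply: ler_sum => j _.
apply: (@le_trans _ _ (b j * b j)).
  rewrite -(real_normK (num_real (z.1 ord0 j))) -(real_normK (num_real (z.2 ord0 j))) /b.
  by have := normr_ge0 (z.1 ord0 j); have := normr_ge0 (z.2 ord0 j); nra.
by rewrite ler_wpM2l// (bigD1 j)//= lerDl; apply: sumr_ge0.
Qed.

(** For fixed w the bump is a test function of y whose derivatives along X_j and Y_j are the
    components of [bump_grad], so the definition of the weak gradient applies term by term. *)
Lemma weak_moll (w : H) (a : C) :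
  \int[mu]_y (u y * - cdot a (bump_grad k w y)) =
  \int[mu]_y (bump k (hmul w (- y)) * cdot a (G y)).
Proof.
pose gX j y := (bump_grad k w y).1 ord0 j; pose gY j y := (bump_grad k w y).2 ord0 j.
have mg : measurable_fun setT (fun y : H => bump_grad k w y) by exact: measurable_fun_bump_grad.
have mX j : measurable_fun setT (gX j) by apply: measurable_fun_coord; exact: measurable_fun_fst.
have mY j : measurable_fun setT (gY j) by apply: measurable_fun_coord; exact: measurable_fun_snd.
have iX j : mu.-integrable setT (EFin \o (fun y => gX j y * u y)).
  apply: (ball_integrableM hu (mX j)) => y; apply: le_trans (bump_grad_le y (lexx (hN4 w))).
  by rewrite (coord_le_enorm _ _).1.
have iY j : mu.-integrable setT (EFin \o (fun y => gY j y * u y)).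
  apply: (ball_integrableM hu (mY j)) => y; apply: le_trans (bump_grad_le y (lexx (hN4 w))).
  by rewrite (coord_le_enorm _ _).2.
have iB f : ball_integrable f -> mu.-integrable setT (EFin \o (fun y => bump k (hmul w (- y)) * f y)).
  exact: moll_integrable.
have iZ f c : mu.-integrable setT (EFin \o f) -> mu.-integrable setT (EFin \o (fun y => c * f y)).
  by move=> h; exact: (integrableZl measurableT c h).
have iD f g : mu.-integrable setT (EFin \o f) -> mu.-integrable setT (EFin \o g) ->
    mu.-integrable setT (EFin \o (fun y => f y + g y)).
  by move=> hf hg; exact: (integrableD measurableT hf hg).
have test := test_bump_quotient k0 w.
transitivity (\sum_(j < n) \int[mu]_y (- a.1 ord0 j * (gX j y * u y) + - a.2 ord0 j * (gY j y * u y))).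
  rewrite -Rintegral_sum; last by move=> j; apply: iD; apply: iZ.
  apply: eq_Rintegral => y _; rewrite /cdot mulrN mulr_sumr -sumrN; apply: eq_bigr => j _.
  by rewrite /gX /gY; ring.
transitivity (\sum_(j < n) \int[mu]_y (a.1 ord0 j * (bump k (hmul w (- y)) * (G y).1 ord0 j) +
    a.2 ord0 j * (bump k (hmul w (- y)) * (G y).2 ord0 j))); last first.
  rewrite -Rintegral_sum; last by move=> j; apply: iD; apply: iZ; exact: iB.
  apply: eq_Rintegral => y _; rewrite /cdot mulr_sumr; apply: eq_bigr => j _; ring.
apply: eq_bigr => j _; rewrite !RintegralD//; try by apply: iZ => //; exact: iB.
rewrite !RintegralZl//; try exact: iB.
have [_ /(_ j)[_ _ hX hY]] := hG; congr (_ + _); rewrite mulNr -mulrN; congr (_ * _).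
  have := hX _ test; under eq_Rintegral do rewrite Xfield_bump mulrC.
  by move=> ->; rewrite opprK; apply: eq_Rintegral => y _; rewrite mulrC.
have := hY _ test; under eq_Rintegral do rewrite Yfield_bump mulrC.
by move=> ->; rewrite opprK; apply: eq_Rintegral => y _; rewrite mulrC.
Qed.

Lemma weak_moll_le (w : H) (a : C) :
  `|\int[mu]_y (u y * - cdot a (bump_grad k w y))| <= enorm a * moll k (fun y => enorm (G y)) w.
Proof.
have hE := ball_integrable_enorm; have iE := moll_integrable k0 w hE.
have mc : measurable_fun setT (fun y => cdot a (G y)).
  by apply: measurable_fun_cdot => //; exact: measurable_weak_hgrad.
have mq : measurable_fun setT (fun y : H => bump k (hmul w (- y))).
  apply: (measurableT_comp (@measurable_bump R n k)); apply: measurable_fun_hmul => //.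
  exact: measurable_fun_hN.
have b (y : H) : `|bump k (hmul w (- y)) * cdot a (G y)| <= enorm a * (bump k (hmul w (- y)) * enorm (G y)).
  rewrite normrM ger0_norm ?bump_ge0// mulrCA ler_wpM2l ?bump_ge0//; exact: cdot_le_enorm.
have iZ := integrableZl measurableT (enorm a) iE.
have ic : mu.-integrable setT (EFin \o (fun y => bump k (hmul w (- y)) * cdot a (G y))).
  apply: (le_integrable measurableT _ _ iZ); first by apply/measurable_EFinP; exact: measurable_funM.
  move=> y _; rewrite /= lee_fin; apply: (le_trans (b y)); exact: ler_norm.
rewrite weak_moll; apply: (le_trans (le_normr_Rintegral _ ic)) => //.
rewrite /moll -RintegralZl//; apply: le_Rintegral => //.
exact: (integrable_abse ic).
Qed.

End bump_gradient.

Lemma integral_line (R : realType) (D : set R) (f : R -> \bar R) :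
  measurable D -> measurable_fun D f ->
  (\int[lebesgue_measure]_(x in D) f x = \int[@lebesgue_line R]_(x in D) f x)%E.
Proof.
move=> mD mf; rewrite integralE [RHS]integralE; congr (_ - _)%E.
  by apply: ge0_integral_line => //; exact: measurable_funepos.
by apply: ge0_integral_line => //; exact: measurable_funeneg.
Qed.

Section cvg_bump_grad.
Context (R : realType) (n : nat) (T : Type) (F : set_system T) {FF : Filter F}.
Local Notation C := (Cn R n).
Local Notation H := (heis R n).

Lemma coord_cvg_bump_grad (k : R) (P : T -> H) (p y : H) : coord_cvg F P p ->
  (forall j, (bump_grad k (P t) y).1 ord0 j @[t --> F] --> (bump_grad k p y).1 ord0 j) /\
  (forall j, (bump_grad k (P t) y).2 ord0 j @[t --> F] --> (bump_grad k p y).2 ord0 j).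
Proof.
move=> hP; have [P1 P2 P3] := hP.
have hq := coord_cvg_hmul hP (coord_cvg_cst (- y)); have [q1 q2 q3] := hq.
have hs : sqn (hmul (P t) (- y)).1 @[t --> F] --> sqn (hmul p (- y)).1.
  apply: cvg_sum_ord => j; apply: cvgD.
    by under eq_fun do rewrite expr2; rewrite expr2; apply: cvgM; exact: q1.
  by under eq_fun do rewrite expr2; rewrite expr2; apply: cvgM; exact: q2.
have hb : 4 * k * bexp 2 (1 - k * hN4 (hmul (P t) (- y))) @[t --> F] -->
    4 * k * bexp 2 (1 - k * hN4 (hmul p (- y))).
  apply: cvgMr; have h1 : 1 - k * hN4 (hmul (P t) (- y)) @[t --> F] --> 1 - k * hN4 (hmul p (- y)).
    by apply: cvgB; [exact: cvg_cst|apply: cvgMr; exact: coord_cvg_hN4].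
  exact: (cvg_comp _ _ h1 (@continuous_bexp R 2 _)).
split => j; under eq_fun => t do rewrite !mxE; rewrite !mxE; apply: cvgM => //; apply: cvgD.
- by apply: cvgM => //; have := q1 j; under eq_fun => t do rewrite !mxE; rewrite !mxE.
- by apply: cvgM => //; apply: cvgD => //; exact: cvg_cst.
- by apply: cvgM => //; have := q2 j; under eq_fun => t do rewrite !mxE; rewrite !mxE.
- by apply: cvgM => //; apply: cvgN; apply: cvgD => //; exact: cvg_cst.
Qed.

End cvg_bump_grad.

Section moll_upper_gradient.
Context (R : realType) (n : nat).
Local Notation C := (Cn R n).
Local Notation H := (heis R n).
Local Notation mu := (@haar R n).
Local Notation lam := (@lebesgue_line R).
Variables (k : R) (u : H -> R) (G : H -> C).
Hypotheses (k0 : 0 < k) (mass0 : 0 < @bump_mass R n k) (hG : weak_hgrad u G).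
Local Notation mass := (@bump_mass R n k).

Let hu : ball_integrable u. Proof. by apply: loc_integrable_ball; case: hG. Qed.

Lemma hN4_spiral (p : H) r : unit_sphere p -> hN4 (spiral p r) = r ^+ 4.
Proof.
move=> Sp; rewrite /spiral twistE {1}/hN4 sqn_hrot -/(hN4 (hdil r p)) hN4_hdil.
by rewrite (hN4_unit Sp) mulr1.
Qed.

Let ccurve (x p : H) (w : nat -> R) (r : R) : unit_sphere p -> 0 < sqn p.1 -> 0 < r ->
  w i @[i --> \oo] --> r ->
  coord_cvg \oo (fun i => hmul x (spiral p (w i))) (hmul x (spiral p r)).
Proof.
move=> Sp p0 r0 wr; have [h1 h2 h3] := spiral_horizontal Sp p0 x r0.
split => [j|j|].
- exact: (cvg_comp _ _ wr (dv_continuous (h1 j))).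
- exact: (cvg_comp _ _ wr (dv_continuous (h2 j))).
- exact: (cvg_comp _ _ wr (dv_continuous h3)).
Qed.

Let bcurve (x p : H) (w : nat -> R) (r : R) : unit_sphere p -> w i @[i --> \oo] --> r ->
  exists W, forall i, hN4 (hmul x (spiral p (w i))) <= W.
Proof.
move=> Sp wr; have [M0 [_ hM0]] := cvg_seq_bounded (cvgP _ wr).
have wM := hM0 (M0 + 1) (ltr_pwDr ltr01 (lexx M0)); set M := M0 + 1 in wM.
exists (14 * (hN4 x + M ^+ 4)) => i; apply: (le_trans (hN4M_le _ _)).
rewrite ler_wpM2l// lerD2l hN4_spiral//.
have := wM i I => h; rewrite -[w i ^+ 4]ger0_norm; last by rewrite (exprM _ 2 2) sqr_ge0.
by rewrite normrX lerXn2r ?nnegrE// (le_trans (normr_ge0 _) h).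
Qed.

Section curve.
Variables (x p : H) (a b : R).
Hypotheses (Sp : unit_sphere p) (p0 : 0 < sqn p.1) (a0 : 0 < a) (ab : a <= b).

Let eta (r : R) : H := hmul x (spiral p r).
Let dir (r : R) : C := spiral_dir p r.
Let W : R := 14 * (hN4 x + b ^+ 4).
Let s : R := (enorm p.1)^-1.
Let ind (r : R) : R := indb (a <= r) * indb (r <= b).
Let dens (r : R) (y : H) : R := - cdot (dir r) (bump_grad k (eta r) y).

Let meta : measurable_fun setT eta.
Proof. by apply: measurable_fun_hmul => //; exact: measurable_fun_spiral. Qed.

Let mdir : measurable_fun setT dir.
Proof.
have mt : measurable_fun setT (fun r : R => p.2 / sqn p.1 * ln r).
  by apply: measurable_funM => //; exact: measurable_ln.
have mc := measurableT_comp (@measurable_cosR R) mt.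
have ms := measurableT_comp (@measurable_sinR R) mt.
apply: measurable_fun_CD; first exact: measurable_fun_crot.
apply: measurable_fun_CZ => //; apply: measurable_fun_crot => //.
exact: measurableT_comp.
Qed.

Let mind : measurable_fun setT ind.
Proof. by apply: measurable_funM; exact: measurable_fun_leR. Qed.

Let ind0 r : 0 <= ind r. Proof. by rewrite mulr_ge0. Qed.

Let ind1 r : ind r != 0 -> a <= r <= b.
Proof.
by rewrite /ind; case: (leP a r); case: (leP r b); rewrite !indbE ?(mulr0, mul0r) ?eqxx.
Qed.

Let enorm_dir r : enorm (dir r) = s.
Proof. by rewrite /enorm -/(sqn _) sqn_spiral_dir// sqrtrV ?sqn_ge0. Qed.

Let etaW r : a <= r <= b -> hN4 (eta r) <= W.
Proof.
move=> /andP[ar rb]; apply: (le_trans (hN4M_le _ _)); rewrite ler_wpM2l// lerD2l hN4_spiral//.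
by rewrite lerXn2r ?nnegrE// ltW// (lt_le_trans a0)// (le_trans ar).
Qed.

Let f (z : R * H) : R := ind z.1 * (u z.2 * dens z.1 z.2).

Let mf : measurable_fun setT f.
Proof.
apply: measurable_funM; first exact: (measurableT_comp mind measurable_fst).
apply: measurable_funM; first exact: (measurableT_comp hu.1 measurable_snd).
apply: measurableT_comp => //; apply: measurable_fun_cdot.
  exact: (measurableT_comp mdir measurable_fst).
apply: measurable_fun_bump_grad; last exact: measurable_snd.
exact: (measurableT_comp meta measurable_fst).
Qed.

Let B := qball (R := R) (n := n) (14 * (k^-1 + W)).
Let K : R := s * bump_grad_bound k W.

Let densK r y : a <= r <= b -> `|dens r y| <= K * \1_B y.
Proof.
move=> /etaW h; rewrite normrN; apply: (le_trans (cdot_le_enorm _ _)).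
rewrite enorm_dir -mulrA ler_wpM2l ?invr_ge0 ?enorm_ge0//; exact: bump_grad_le.
Qed.

Let mdens r : measurable_fun setT (dens r).
Proof. by apply: measurableT_comp => //; apply: measurable_fun_cdot => //; exact: measurable_fun_bump_grad. Qed.

Let idens r : a <= r <= b -> mu.-integrable setT (EFin \o (fun y => u y * dens r y)).
Proof.
move=> rab; have h := ball_integrableM hu (mdens r) (fun y => densK y rab).
by move: h; congr (integrable _ _ _); apply/funext => y /=; rewrite mulrC.
Qed.

Let int_ind (g : R -> \bar R) :
  (\int[lam]_r ((ind r)%:E * g r) = \int[lam]_(r in `[a, b]) g r)%E.
Proof.
rewrite [RHS]int_setE; apply: eq_int => r; rewrite muleC indicE /ind; congr (_ * _%:E)%E.
have -> : (r \in `[a, b]%classic) = (a <= r <= b) by apply/idP/idP; rewrite inE/= in_itv.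
by rewrite /indb -natrM mulnb.
Qed.

Let int_ind1 : (\int[lam]_r (ind r)%:E = (b - a)%:E)%E.
Proof.
transitivity (\int[lam]_r ((ind r)%:E * 1%:E))%E; first by apply: eq_int => r; rewrite mule1.
rewrite int_ind; apply: (etrans (@FTC2_line R (fun y : R => y) (fun=> 1) _ _ ab _ _ _)) => // r _.
exact: cst_continuous.
Qed.

(** Between the parameters a and b the curve stays in a fixed ball, so the integrand is dominated by
    a multiple of |u| on one larger ball. *)
Let ifubini : (lam \x mu)%E.-integrable setT (EFin \o f).
Proof.
have mB : measurable B by exact: measurable_qball.
pose v y := (K * \1_B y) * u y.
have iB : mu.-integrable setT (EFin \o v).
  apply: (ball_integrableM (c := `|K|) (M := 14 * (k^-1 + W)) hu).
    by apply: measurable_funM => //; exact: measurable_indic.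
  by move=> y; rewrite normrM (ger0_norm (_ : 0 <= \1_B y)).
have mv : measurable_fun setT v.
  by apply: measurable_funM; [apply: measurable_funM => //; exact: measurable_indic|exact: hu.1].
have J := integrable_normr mv iB; set I := (integral _ _ _) in J.
have I0 : (0 <= I)%E by apply: int_ge0 => y; rewrite lee_fin.
have IE : I = (fine I)%:E by rewrite fineK// ge0_fin_numE.
have mfa : measurable_fun setT (fun z => `|(EFin \o f) z|)%E.
  by apply/measurable_EFinP; apply: measurableT_comp.
have mva : measurable_fun setT (fun y => (`|v y|)%:E) by apply/measurable_EFinP; apply: measurableT_comp.
apply/integrable12ltyP; first exact/measurable_EFinP.
apply: (@le_lt_trans _ _ (\int[lam]_r ((ind r)%:E * I))%E).
  apply: int_le => [r|||r].
  - by apply: int_ge0 => y; rewrite lee_fin.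
  - by apply: (measurable_int2 mu mfa) => z; rewrite lee_fin.
  - by rewrite IE; apply: emeasurable_funM => //; exact/measurable_EFinP.
  - rewrite /I -intZ//.
    apply: int_le => [y|||y].
    + by rewrite lee_fin.
    + by apply: (measurableT_comp mfa); exact: measurable_pair1.
    + exact: emeasurable_funM.
    + rewrite -EFinM lee_fin /f/= normrM ger0_norm//.
      have [->|/ind1 rab] := eqVneq (ind r) 0; first by rewrite !mul0r.
      rewrite ler_wpM2l// /v [u y * _]mulrC !(normrM _ (u y)) ler_wpM2r//.
      exact: (le_trans (densK y rab) (ler_norm _)).
rewrite IE [X in (X < _)%E]intZr ?fine_ge0//; last exact/measurable_EFinP.
by rewrite int_ind1 -EFinM ltry.
Qed.

Let dv_eta r : a <= r <= b -> coord_derive eta r 1 (dir r, 2 * omega (eta r).1 (dir r)).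
Proof. by move=> /andP[ar _]; apply: spiral_horizontal => //; exact: lt_le_trans ar. Qed.

Let cdens y r : a <= r <= b -> {for r, continuous (dens ^~ y)}.
Proof.
move=> rab; have [h1 h2 h3] := dv_eta rab.
have ce : coord_cvg (nbhs r) eta (eta r).
  by split => [j|j|]; [exact: (dv_continuous (h1 j))|exact: (dv_continuous (h2 j))|exact: (dv_continuous h3)].
have [g1 g2] := coord_cvg_bump_grad k y ce.
have r0 : 0 < r by move: rab => /andP[ar _]; exact: lt_le_trans ar.
have ct : p.2 / sqn p.1 * ln t @[t --> r] --> p.2 / sqn p.1 * ln r.
  by apply: cvgMr; exact: continuous_ln.
have cc : cos (p.2 / sqn p.1 * ln t) @[t --> r] --> cos (p.2 / sqn p.1 * ln r).
  exact: (cvg_comp _ _ ct (@continuous_cos R _)).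
have cs : sin (p.2 / sqn p.1 * ln t) @[t --> r] --> sin (p.2 / sqn p.1 * ln r).
  exact: (cvg_comp _ _ ct (@continuous_sin R _)).
have d1 j : (dir t).1 ord0 j @[t --> r] --> (dir r).1 ord0 j.
  rewrite /dir /spiral_dir; under eq_fun => t do rewrite !mxE; rewrite !mxE.
  by apply: cvgD; [|apply: cvgMr]; apply: cvgD; apply: cvgMl => //; exact: cvgN.
have d2 j : (dir t).2 ord0 j @[t --> r] --> (dir r).2 ord0 j.
  rewrite /dir /spiral_dir; under eq_fun => t do rewrite !mxE; rewrite !mxE.
  by apply: cvgD; [|apply: cvgMr]; apply: cvgB; apply: cvgMl => //; exact: cvgN.
apply: cvgN; apply: cvg_sum_ord => j.
by apply: cvgD; apply: cvgM; [exact: d1|exact: g1|exact: d2|exact: g2].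
Qed.

(* Along a horizontal curve the bump changes at the rate [- cdot dir (bump_grad k)],
   which is what Fubini's theorem pairs with the weak gradient. *)
Let int_dens y : (\int[lam]_r (f (r, y))%:E =
  (u y * (bump k (hmul (eta b) (- y)%R) - bump k (hmul (eta a) (- y)%R)))%:E)%E.
Proof.
transitivity (\int[lam]_r ((ind r)%:E * (u y * dens r y)%:E))%E.
  by apply: eq_int => r; rewrite -EFinM.
have cd r : a <= r <= b -> {for r, continuous (fun r : R => u y * dens r y)}.
  by move=> rab; apply: cvgMr; exact: cdens.
rewrite int_ind -integral_line//.
  apply: (etrans (@FTC2_lebesgue R (fun r => u y * bump k (hmul (eta r) (- y))) _ _ _ ab _ cd)).
    by move=> r rab; apply: dvZ; apply: dv_bump_curve; exact: dv_eta.
  by rewrite mulrBr.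
apply/measurable_EFinP; apply: measurable_funTS; apply: measurable_funM => //.
apply: measurableT_comp => //; apply: measurable_fun_cdot => //.
exact: measurable_fun_bump_grad.
Qed.

(** The mollification is not differentiated under the integral: for each y the bump is integrated
    along the curve, Fubini's theorem exchanges the integrals, and for each r the weak gradient
    bounds the integral in y. *)
Lemma moll_curve_le :
  (`|moll k u (eta b) - moll k u (eta a)|%:E <=
   \int[lam]_(r in `[a, b]) (moll k (fun y => enorm (G y)) (eta r) / enorm p.1)%:E)%E.
Proof.
pose g r := \int[mu]_y (u y * dens r y).
have hE := ball_integrable_enorm hG.
have fE r : (\int[mu]_y (f (r, y))%:E = (ind r * g r)%:E)%E.
  rewrite /f /=; have [->|/ind1 rab] := eqVneq (ind r) 0.
    by under eq_integral do rewrite mul0r; rewrite integral0 mul0r.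
  under eq_integral do rewrite EFinM.
  rewrite integralZl//; last exact: idens.
  rewrite [RHS]EFinM; congr (_ * _)%E; rewrite /g /Rintegral fineK//; apply: integrable_fin_num => //; exact: idens.
have h := Fubini ifubini.
have diff : (\int[mu]_y \int[lam]_r (f (r, y))%:E = (moll k u (eta b) - moll k u (eta a))%:E)%E.
  have E (c v w : R) : c * (v - w) = v * c - w * c by ring.
  under eq_integral => y _ do rewrite int_dens E.
  rewrite /moll -RintegralB//; try exact: moll_integrable.
  rewrite fineK; last first.
    apply: integrable_fin_num => //.
    have := integrableB measurableT (moll_integrable k0 (eta b) hu) (moll_integrable k0 (eta a) hu).
    by congr (integrable _ _ _); apply/funext => y.
  by [].
have mg : measurable_fun setT (fun r => (ind r * g r)%:E).
  have := measurable_fubini_F ifubini; congr (measurable_fun _ _); apply/funext => r.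
  exact: fE.
rewrite -abse_EFin -diff -[X in `|X|%E]h.
apply: (le_trans (le_abse_integral _ _ _)) => //.
  by under eq_fun do rewrite [X in (X _)]/=; move: mg; congr (measurable_fun _ _); apply/funext => r; rewrite -fE.
rewrite -int_ind; apply: int_le => [r|||r].
- exact: abse_ge0.
- apply: measurableT_comp => //; move: mg; congr (measurable_fun _ _); apply/funext => r.
  by rewrite -fE.
- apply/measurable_EFinP; apply: measurable_funM => //; apply: measurable_funM => //.
  by apply: (measurableT_comp (measurable_moll k hE.1) meta).
- rewrite [X in `|X|%E]fE abse_EFin normrM ger0_norm// -EFinM lee_fin.
  rewrite ler_wpM2l//; apply: (le_trans (weak_moll_le k0 hG (eta r) (dir r))).
  by rewrite enorm_dir mulrC.
Qed.

End curve.

Lemma moll_upper_gradient :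
  upper_gradient (fun w => moll k u w / mass) (fun w => moll k (fun y => enorm (G y)) w / mass).
Proof.
have hE := ball_integrable_enorm hG.
split.
- by apply: measurable_funM => //; apply: measurable_moll; exact: hu.1.
- by apply: measurable_funM => //; apply: measurable_moll; exact: hE.1.
- by move=> w; rewrite divr_ge0 ?(ltW mass0)// moll_ge0// => y; exact: enorm_ge0.
- move=> x p r Sp p0 r0; have h w : w i @[i --> \oo] --> r ->
      moll k u (hmul x (spiral p (w i))) / mass @[i --> \oo] --> moll k u (hmul x (spiral p r)) / mass.
    move=> wr; have [W hW] := bcurve x Sp wr; apply: cvgMl.
    by apply: (moll_cvg k0 hu hW); exact: ccurve.
  apply/left_right_continuousP; split.
    by apply/cvg_at_leftP => w [_ wr]; exact: h.
  by apply/cvg_at_rightP => w [_ wr]; exact: h.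
(* On the spiral N^4 equals r^4, so the spiral tends to the origin with r. *)
- move=> x p Sp p0; apply/cvg_at_rightP => w [w0 wr].
  have [W hW] := bcurve x Sp wr; apply: cvgMl; rewrite -[X in _ --> moll k u X]hmulp0.
  apply: (moll_cvg k0 hu hW); apply: coord_cvg_hmul; first exact: coord_cvg_cst.
  apply: coord_cvg0; under eq_fun do rewrite hN4_spiral//.
  have := cvg_comp _ _ wr (@exprn_continuous R 4 0); by rewrite expr0n.
- move=> x p a b Sp p0 a0 ab; rewrite -mulrBl normrM [X in _ * X]gtr0_norm ?invr_gt0//.
  have h := moll_curve_le x Sp p0 a0 ab.
  rewrite mulrC EFinM.
  apply: (le_trans (lee_wpmul2l _ h)); first by rewrite lee_fin invr_ge0 ltW.
  have mg : measurable_fun setT (fun r => moll k (fun y => enorm (G y)) (hmul x (spiral p r)) / enorm p.1).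
    apply: measurable_funM => //; apply: (measurableT_comp (measurable_moll k hE.1)).
    by apply: measurable_fun_hmul => //; exact: measurable_fun_spiral.
  rewrite -ge0_integralZl//; last 3 first.
  - by apply/measurable_EFinP; exact: measurable_funTS.
  - by move=> r _; rewrite lee_fin divr_ge0 ?enorm_ge0// moll_ge0// => y; exact: enorm_ge0.
  - by rewrite lee_fin invr_ge0 ltW.
  by apply: eqW; apply: eq_integral => r _; rewrite -EFinM; congr _%:E; ring.
Qed.

End moll_upper_gradient.

Lemma cvge_lt (R : realType) (u : nat -> \bar R) (l e : \bar R) :
  u i @[i --> \oo] --> l -> (l < e)%E -> \forall i \near \oo, (u i < e)%E.
Proof.
move=> h le; apply: (h [set x | x < e]%E); apply: open_nbhs_nbhs; split => //.
exact: open_ereal_lt_ereal.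
Qed.

(** The identity behind Scheffe's argument: up to a - b, the absolute difference is twice a
    one-sided one, and the one-sided one has an integrable majorant. *)
Lemma distr_max (R : realType) (a b : R) : `|a - b| + b = 2 * Order.max 0 (b - a) + a.
Proof.
case: (leP 0 (b - a)) => h; first by rewrite distrC ger0_norm//; ring.
by rewrite ger0_norm; [ring|lra].
Qed.

Section int_real.
Context d (T : measurableType d) (R : realType) (m : {measure set T -> \bar R}).
Variables f g : T -> R.
Hypotheses (f0 : forall x, 0 <= f x) (mf : measurable_fun setT f).
Hypotheses (g0 : forall x, 0 <= g x) (mg : measurable_fun setT g).

Lemma int_realD : (\int[m]_x (f x)%:E + \int[m]_x (g x)%:E = \int[m]_x (f x + g x)%:E)%E.
Proof.
rewrite -intD//; try (by move=> x; rewrite lee_fin); exact/measurable_EFinP.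
Qed.

Lemma int_realZ (k : R) : 0 <= k -> (k%:E * \int[m]_x (f x)%:E = \int[m]_x (k * f x)%:E)%E.
Proof.
move=> k0; rewrite -intZ//; try (by move=> x; rewrite lee_fin); exact/measurable_EFinP.
Qed.

End int_real.

Import HBSimple.

(** * Convergence of the mollifications almost everywhere *)

Section open_sets.
Context (R : realType) (n : nat).
Local Notation H := (heis R n).

(** Openness is tested on coordinatewise convergent sequences, the mode of convergence for which
    continuity of the group operations is at hand. *)
Definition seq_open (O : set H) : Prop := forall w x, O x -> coord_cvg \oo w x ->
  \forall i \near \oo, O (w i).

Lemma seq_open_gt (g : H -> R) (a : R) :
  (forall w x, coord_cvg \oo w x -> g (w i) @[i --> \oo] --> g x) -> seq_open [set x | a < g x].
Proof. by move=> cg w x ax /cg h; exact: (cvgr_gt _ h a ax). Qed.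

Lemma seq_openI A B : seq_open A -> seq_open B -> seq_open (A `&` B).
Proof.
by move=> oA oB w x [Ax Bx] cw; near=> i; split; near: i; [exact: oA cw|exact: oB cw].
Unshelve. all: by end_near. Qed.

Let G := [set O : set H | measurable O /\ seq_open O].

(** Half-spaces of single coordinates are sequentially open and generate the product structure. This
    generating family is stable under intersection, which prepares a Dynkin argument. *)
Lemma measurable_seq_open : @measurable _ H = <<s G >>.
Proof.
apply/seteqP; split; last by apply: smallest_sub; [exact: sigma_algebra_measurable|move=> O []].
pose T := g_sigma_algebraType G.
have key (g : H -> R) : measurable_fun setT g ->
    (forall w x, coord_cvg \oo w x -> g (w i) @[i --> \oo] --> g x) ->
    measurable_fun (setT : set T) (g : T -> R).
  move=> mg cg; apply: (measurability _ (RGenOInfty.measurableE R)) => _ [_ [a ->] <-].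
  apply: sub_sigma_algebra; rewrite setTI; split; last first.
    have := seq_open_gt (a := a) cg; congr seq_open; apply/seteqP.
    by split => x /=; rewrite in_itv/= andbT.
  by rewrite -[X in measurable X]setTI; exact: mg.
have h : measurable_fun (setT : set T) (fun x : T => (x : H)).
  have mf : measurable_fun setT (fun x : H => x.1) by exact: measurable_fst.
  rewrite (_ : (fun x : T => (x : H)) = (fun x : T => (((x : H).1.1, (x : H).1.2), (x : H).2))); last first.
    by apply/funext => -[[? ?] ?].
  apply: measurable_fun_pair; last by apply: key => // w x [].
  apply: measurable_fun_pair; apply: measurable_fun_row => j.
    apply: (key (fun x => x.1.1 ord0 j)); last by move=> w x [].
    by apply: measurable_fun_coord; exact: (measurableT_comp measurable_fst mf).
  apply: (key (fun x => x.1.2 ord0 j)); last by move=> w x [].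
  by apply: measurable_fun_coord; exact: (measurableT_comp measurable_snd mf).
move=> O mO; have := h measurableT O mO; rewrite setTI; exact.
Qed.

(** Otherwise there are y_i outside O with x y_i^(-1) tending to 0, and then y_i = (x y_i^(-1))^(-1)
    x tends to x. *)
Lemma seq_open_nbhs (O : set H) (x : H) : seq_open O -> O x ->
  exists N, forall i, (N <= i)%N -> forall y, hN4 (hmul x (- y)) <= (i.+1%:R)^-1 -> O y.
Proof.
move=> oO Ox; apply: contrapT => /forallNP h.
have {}h N : exists y : H, hN4 (hmul x (- y)) <= (N.+1%:R)^-1 /\ ~ O y.
  have /existsNP[i /not_implyP[Ni /existsNP[y /not_implyP[hy nO]]]] := h N.
  exists y; split => //; apply: (le_trans hy).
  by rewrite lef_pV2 ?posrE// ler_nat.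
have [y hy] := choice h.
have c0 : coord_cvg \oo (fun i => hmul x (- y i)) 0.
  apply: coord_cvg0; apply: (squeeze_cvgr (f := fun=> 0) (h := fun i => (i.+1%:R)^-1)).
  - by near=> i; rewrite hN4_ge0 (hy i).1.
  - exact: cvg_cst.
  - exact: cvg_harmonic.
have : coord_cvg \oo y x.
  have h1 : coord_cvg \oo (fun i => hmul (- hmul x (- y i)) x) (hmul (- 0) x).
    by apply: coord_cvg_hmul; [exact: coord_cvgN|exact: coord_cvg_cst].
  move: h1; rewrite oppr0 hmul0p; have -> // : (fun i => hmul (- hmul x (- y i)) x) = y.
  by apply/funext => i; rewrite hinvM opprK hmulVKr.
move=> /(oO _ _ Ox)[N _ /(_ N)] /(_ (leqnn _)); exact: (hy N).2.
Unshelve. all: by end_near. Qed.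

End open_sets.

Section approximate_identity.
Context (R : realType) (n : nat).
Local Notation C := (Cn R n).
Local Notation H := (heis R n).
Local Notation mu := (@haar R n).
Variable sigma : {measure set H -> \bar R}.
Hypothesis hsigma : sphere_measure sigma.
Hypothesis n0 : (0 < n)%N.

Definition mollify i (f : H -> R) (w : H) : R := moll i.+1%:R f w / bump_mass n i.+1%:R.
Definition l1norm (f : H -> R) : \bar R := (\int[mu]_x (`|f x|)%:E)%E.

Let k0 i : 0 < i.+1%:R :> R. Proof. by []. Qed.
Let mass0 i : 0 < @bump_mass R n i.+1%:R. Proof. exact: (bump_mass_gt0 hsigma n0). Qed.

Lemma integrable_ball f : measurable_fun setT f -> mu.-integrable setT (EFin \o f) -> ball_integrable f.
Proof.
by move=> mf hf; split => // M; apply: (integrableS _ _ _ hf) => //; exact: measurable_qball.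
Qed.

Lemma measurable_mollify i f : measurable_fun setT f -> measurable_fun setT (mollify i f).
Proof. by move=> mf; apply: measurable_funM => //; exact: measurable_moll. Qed.

Lemma mollifyD i f g w : ball_integrable f -> ball_integrable g ->
  mollify i (fun x => f x + g x) w = mollify i f w + mollify i g w.
Proof.
move=> hf hg; rewrite /mollify -mulrDl; congr (_ / _); rewrite /moll.
rewrite -RintegralD//; try exact: moll_integrable.
by apply: eq_Rintegral => y _; rewrite mulrDr.
Qed.

Lemma mollifyZ i (a : R) f w : ball_integrable f ->
  mollify i (fun x => a * f x) w = a * mollify i f w.
Proof.
move=> hf; rewrite /mollify mulrA; congr (_ / _); rewrite /moll.
rewrite -RintegralZl//; last exact: moll_integrable.
by apply: eq_Rintegral => y _; rewrite mulrCA.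
Qed.

Lemma l1norm_ge0 f : (0 <= l1norm f)%E.
Proof. by apply: int_ge0 => x; rewrite lee_fin. Qed.

Lemma l1norm_fin f : measurable_fun setT f -> mu.-integrable setT (EFin \o f) ->
  l1norm f = (fine (l1norm f))%:E.
Proof. by move=> mf hf; rewrite fineK// ge0_fin_numE ?l1norm_ge0//; exact: integrable_normr. Qed.

Lemma l1norm_integrable f : measurable_fun setT f -> (l1norm f < +oo)%E -> mu.-integrable setT (EFin \o f).
Proof. by move=> mf hf; apply/integrableP; split => //; exact/measurable_EFinP. Qed.

Lemma l1normD (f g : H -> R) : measurable_fun setT f -> measurable_fun setT g ->
  (l1norm (fun x => (f x + g x)%R) <= l1norm f + l1norm g)%E.
Proof.
move=> mf mg; have mf' : measurable_fun setT (fun x => (`|f x|)%:E).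
  by apply/measurable_EFinP; exact: measurableT_comp.
have mg' : measurable_fun setT (fun x => (`|g x|)%:E).
  by apply/measurable_EFinP; exact: measurableT_comp.
rewrite /l1norm -intD//; try by move=> x; rewrite lee_fin.
apply: int_le => [x|||x]; rewrite ?lee_fin//.
- by apply/measurable_EFinP; apply: measurableT_comp => //; exact: measurable_funD.
- exact: emeasurable_funD.
- exact: ler_normD.
Qed.

Lemma l1normZ (a : R) f : measurable_fun setT f ->
  l1norm (fun x => a * f x) = (`|a|%:E * l1norm f)%E.
Proof.
move=> mf; rewrite /l1norm -intZ//; first by apply: eq_int => x; rewrite normrM.
by apply/measurable_EFinP; exact: measurableT_comp.
Qed.

Lemma l1norm_mollify i f : measurable_fun setT f -> mu.-integrable setT (EFin \o f) ->
  (l1norm (mollify i f) <= l1norm f)%E.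
Proof.
move=> mf hf; have bf := integrable_ball mf hf; have E := l1norm_fin mf hf.
have mn : measurable_fun setT (fun x => `|f x|) by exact: measurableT_comp.
rewrite E; apply: (le_trans _ (int_moll_powR hsigma n0 (k0 i) (lexx 1) (ball_integrable_abs bf) _ _ _)).
- apply: int_le => [x|||x].
  + by rewrite lee_fin.
  + by apply/measurable_EFinP; apply: measurableT_comp => //; exact: measurable_mollify.
  + apply/measurable_EFinP; apply: measurable_fun_powR; apply: measurable_funM => //.
    exact: measurable_moll.
  + rewrite lee_fin powRr1; last by rewrite divr_ge0 ?moll_ge0// ltW.
    by rewrite normrM [X in _ * X]gtr0_norm ?invr_gt0// ler_wpM2r ?invr_ge0 ?(ltW (mass0 _))// moll_norm.
- by move=> y.
- by apply: fine_ge0; exact: l1norm_ge0.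
- by rewrite -E; apply: eqW; apply: eq_int => x; rewrite powRr1.
Qed.

Definition l1_cvg (f : H -> R) : Prop :=
  [/\ measurable_fun setT f, mu.-integrable setT (EFin \o f) &
    forall e : R, 0 < e -> exists N, forall i, (N <= i)%N ->
      (l1norm (fun w => (mollify i f w - f w)%R) <= e%:E)%E].

Let mdiff i f : measurable_fun setT f -> measurable_fun setT (fun w => mollify i f w - f w).
Proof. by move=> mf; apply: measurable_funB => //; exact: measurable_mollify. Qed.

Lemma l1_cvgD f g : l1_cvg f -> l1_cvg g -> l1_cvg (fun x => f x + g x).
Proof.
move=> [mf hf cf] [mg hg cg]; split.
- exact: measurable_funD.
- exact: (integrableD measurableT hf hg).
move=> e e0; have e2 : 0 < e / 2 by rewrite divr_gt0.
have [N1 h1] := cf _ e2; have [N2 h2] := cg _ e2.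
exists (maxn N1 N2) => i; rewrite geq_max => /andP[i1 i2].
rewrite (splitr e) EFinD; apply: le_trans (leeD (h1 _ i1) (h2 _ i2)).
apply: le_trans (l1normD (mdiff i mf) (mdiff i mg)).
apply: eqW; congr l1norm; apply/funext => w.
by rewrite mollifyD; [ring|exact: integrable_ball|exact: integrable_ball].
Qed.

Lemma l1_cvgZ (a : R) f : l1_cvg f -> l1_cvg (fun x => a * f x).
Proof.
move=> [mf hf cf]; split.
- exact: measurable_funM.
- exact: (integrableZl measurableT a hf).
move=> e e0; have a1 : 0 < `|a| + 1 by rewrite ltr_wpDl.
have [N h] := cf _ (divr_gt0 e0 a1); exists N => i /h {}h.
rewrite (_ : (fun _ => _) = (fun w => a * (mollify i f w - f w))); last first.
  by apply/funext => w; rewrite mollifyZ ?mulrBr//; exact: integrable_ball.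
rewrite l1normZ; last exact: mdiff.
apply: (le_trans (lee_wpmul2l _ h)); rewrite ?lee_fin// mulrA ler_pdivrMr// [leLHS]mulrC ler_wpM2l ?(ltW e0)//.
by rewrite lerDl.
Qed.

Lemma l1_cvg0 : l1_cvg (fun=> 0).
Proof.
have i0 : mu.-integrable setT (EFin \o (fun _ : H => 0 : R)) by exact: integrable0.
have m0 : measurable_fun setT (fun _ : H => 0 : R) by [].
split => // e e0; exists 0%N => i _.
rewrite (_ : (fun _ => _) = (fun w => 0 * (mollify i (fun=> 0) w - 0))); last first.
  apply/funext => w; rewrite -{1}(_ : (fun w : H => 0 * 0) = (fun=> 0)); last by apply/funext => y; rewrite mul0r.
  by rewrite mollifyZ ?mul0r ?subr0//; exact: integrable_ball.
rewrite l1normZ ?normr0 ?mul0e ?lee_fin ?(ltW e0)//.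
exact: (mdiff i m0).
Qed.

Lemma l1_cvg_sum (I : Type) (s : seq I) (F : I -> H -> R) :
  (forall y, l1_cvg (F y)) -> l1_cvg (fun x => \sum_(y <- s) F y x).
Proof.
move=> hF; elim: s => [|y s IH]; first by under eq_fun do rewrite big_nil; exact: l1_cvg0.
by under eq_fun do rewrite big_cons; apply: l1_cvgD.
Qed.

(** Mollifications are contractions of L^1, so the three-epsilon argument applies. *)
Lemma l1_cvg_closure f : measurable_fun setT f -> mu.-integrable setT (EFin \o f) ->
  (forall e : R, 0 < e -> exists g, l1_cvg g /\ (l1norm (fun x => (f x - g x)%R) <= e%:E)%E) -> l1_cvg f.
Proof.
move=> mf hf h; split => // e e0; have e3 : 0 < e / 3 by rewrite divr_gt0.
have [g [[mg hg cg] fg]] := h _ e3; have [N hN] := cg _ e3; exists N => i /hN {}hN.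
pose d x := f x - g x.
have md : measurable_fun setT d by exact: measurable_funB.
have hd : mu.-integrable setT (EFin \o d) by exact: (integrableB measurableT hf hg).
have -> : e = e / 3 + (e / 3 + e / 3) by field.
rewrite 2!EFinD; apply: le_trans (leeD (le_trans (l1norm_mollify i md hd) fg) (leeD hN fg)).
have m1 := measurable_mollify i md; have m2 := mdiff i mg.
have m4 : measurable_fun setT (fun x => -1 * d x) by exact: measurable_funM.
have E4 : l1norm (fun x => -1 * d x) = l1norm d by rewrite l1normZ// normrN1 mul1e.
have m3 : measurable_fun setT (fun w => (mollify i g w - g w) + -1 * d w) by exact: measurable_funD.
have h1 := l1normD m2 m4; rewrite E4 in h1.
apply: le_trans (leeD (lexx _) h1); apply: le_trans (l1normD m1 m3).
apply: eqW; congr l1norm; apply/funext => w.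
have -> : mollify i f w = mollify i (fun x => d x + g x) w by congr mollify; apply/funext => x; rewrite subrK.
by rewrite mollifyD /d; [ring|exact: integrable_ball|exact: integrable_ball].
Qed.

(** Once the bump around x is supported inside O, the normalised average of the constant 1 is
    exactly 1. *)
Lemma mollify_indic_open (O : set H) x : measurable O -> seq_open O -> mu.-integrable setT (EFin \o \1_O) -> O x ->
  exists N, forall i, (N <= i)%N -> mollify i \1_O x = 1.
Proof.
move=> mO oO iO Ox; have [N hN] := seq_open_nbhs oO Ox; exists N => i /hN {}hN.
rewrite /mollify /moll; under eq_Rintegral => y _.
  rewrite (_ : _ * _ = bump i.+1%:R (hmul x (- y))); last first.
    have [->|h] := eqVneq (bump i.+1%:R (hmul x (- y))) 0; first by rewrite mul0r.
    by rewrite indicE mem_set ?mulr1//; apply: hN; exact: (bexp_qball (k0 i) h).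
  over.
rewrite /Rintegral (int_hmul_inv (h := fun y => (bump i.+1%:R y)%:E)).
- exact: (divff (lt0r_neq0 (mass0 i))).
- by apply/measurable_EFinP; exact: measurable_bump.
- by move=> y; rewrite lee_fin bump_ge0.
Qed.

(* Scheffe's argument: [mollify i \1_O] tends to 1 on [O] and its integral is at
   most the measure of [O]. *)
Lemma l1_cvg_indic_open (O : set H) : measurable O -> seq_open O -> (mu O < +oo)%E -> l1_cvg \1_O.
Proof.
move=> mO oO fO; have mf : measurable_fun setT (\1_O : H -> R) by exact: measurable_indic.
have LO : l1norm \1_O = mu O.
  by rewrite -(int_indic mu mO); apply: eq_int => x; rewrite ger0_norm.
have hf : mu.-integrable setT (EFin \o \1_O) by apply: l1norm_integrable => //; rewrite LO.
split => // e e0.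
pose d i x := Order.max 0 (\1_O x - mollify i \1_O x).
have M0 i x : 0 <= mollify i \1_O x by rewrite divr_ge0 ?moll_ge0// ltW.
have d0 i x : 0 <= d i x by rewrite le_max lexx.
have d1 i x : d i x <= \1_O x by rewrite ge_max; apply/andP; split => //; rewrite lerBlDr lerDl.
have md i : measurable_fun setT (d i).
  by apply: measurable_maxr => //; apply: measurable_funB => //; exact: measurable_mollify.
have cd : (\int[mu]_x (d i x)%:E @[i --> \oo] --> \int[mu]_x (cst 0 x))%E.
  apply: (dominated_cvg measurableT _ _ _ hf) => //.
  - by move=> i; apply/measurable_EFinP.
  - move=> x _; apply: cvg_EFin; first by near=> i.
    have [Ox|nOx] := pselect (O x).
      have [N hN] := mollify_indic_open mO oO hf Ox.
      apply: cvg_near_cst; near=> i; rewrite /= /d indicE mem_set// hN; first by rewrite subrr maxxx.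
      by near: i; exists N.
    apply: cvg_near_cst; near=> i; rewrite /= /d indicE memNset// sub0r.
    by apply/max_idPl; rewrite oppr_le0.
  - by move=> i x _; rewrite gee0_abs ?lee_fin.
rewrite integral0 in cd.
have [N _ hN] : \forall i \near \oo, (\int[mu]_x (d i x)%:E < (e / 2)%:E)%E.
  by apply: (cvge_lt cd); rewrite lte_fin divr_gt0.
exists N => i /hN {}hN.
have mE := measurable_mollify i mf.
have mD : measurable_fun setT (fun w => `|mollify i \1_O w - \1_O w|).
  by apply: measurableT_comp => //; exact: mdiff.
have EQ : (l1norm (fun w => (mollify i \1_O w - \1_O w)%R) + mu O =
    2%:E * \int[mu]_x (d i x)%:E + l1norm (mollify i \1_O))%E.
  rewrite -LO /l1norm int_realZ// int_realD//; last exact: measurableT_comp.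
  rewrite int_realD//; last 3 first.
  - by move=> x; rewrite mulr_ge0.
  - exact: measurable_funM.
  - exact: measurableT_comp.
  apply: eq_int => x; rewrite [X in _ + X]ger0_norm// [X in (_ = (_ + X)%:E)%E]ger0_norm//.
  by congr _%:E; exact: distr_max.
have fO' : mu O \is a fin_num by rewrite ge0_fin_numE.
rewrite -(leeD2rE _ _ fO') EQ; apply: leeD; last by rewrite -LO; exact: l1norm_mollify.
apply: (le_trans (lee_wpmul2l _ (ltW hN))) => //.
by rewrite -EFinM lee_fin mulrC divfK.
Unshelve. all: by end_near. Qed.

(** The sets E with this property contain the sequentially open ones and form a Dynkin system.
    Intersecting with a ball keeps all measures finite. *)
Lemma l1_cvg_indic (M : R) (E : set H) : measurable E -> l1_cvg \1_(E `&` [set x | hN4 x < M]).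
Proof.
set B := [set x : H | hN4 x < M].
have oB : seq_open B.
  have -> : B = [set x | - M < - hN4 x] by apply/seteqP; split => x; rewrite /B/= ltrN2.
  by apply: seq_open_gt => w x cw; apply: cvgN; exact: coord_cvg_hN4.
have mB : measurable B.
  have := @measurable_fun_hN4 R n _ _ id (@measurable_id _ _ _) measurableT _ (@measurable_itv R `]-oo, M[).
  by rewrite setTI; congr (measurable _); apply/seteqP; split => p; rewrite /B/= in_itv.
have fB : (mu B < +oo)%E.
  apply: le_lt_trans (haar_qball_fin n M); apply: le_measure; rewrite ?inE//; first exact: measurable_qball.
  by move=> x; exact: ltW.
have fI F : measurable F -> (mu (F `&` B) < +oo)%E.
  by move=> mF; apply: le_lt_trans fB; apply: le_measure; rewrite ?inE//; exact: measurableI.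
have LI F : measurable F -> l1norm \1_(F `&` B) = mu (F `&` B).
  by move=> mF; rewrite -(int_indic mu (measurableI _ _ mF mB)); apply: eq_int => x; rewrite ger0_norm.
have iI F : measurable F -> mu.-integrable setT (EFin \o \1_(F `&` B)).
  move=> mF; apply: l1norm_integrable; last by rewrite LI// fI.
  by apply: measurable_indic; exact: measurableI.
have mI F : measurable F -> measurable_fun setT (\1_(F `&` B) : H -> R).
  by move=> mF; apply: measurable_indic; exact: measurableI.
rewrite (@measurable_seq_open R n); move: E; apply: dynkin_induction.
- exact: measurable_seq_open.
- move=> U V [mU oU] [mV oV]; split; [exact: measurableI|exact: seq_openI].
- by rewrite setTI; exact: l1_cvg_indic_open.
- move=> O [mO oO]; apply: l1_cvg_indic_open; [exact: measurableI|exact: seq_openI|exact: fI].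
- move=> S mS cS; have -> : (\1_(~` S `&` B) : H -> R) = (fun x => \1_B x + -1 * \1_(S `&` B) x).
    apply/funext => x; rewrite !indicE !in_setI in_setC; case: (x \in S); case: (x \in B) => /=; ring.
  by apply: l1_cvgD; [exact: l1_cvg_indic_open|exact: l1_cvgZ].
- move=> F mF tF cF; have mU : measurable (\bigcup_k F k) by exact: bigcup_measurable.
  apply: l1_cvg_closure; [exact: mI|exact: iI|] => e e0.
  pose P N := \bigcup_(k in `I_N) F k.
  have mP N : measurable (P N) by exact: bigcup_measurable.
  have cP N : l1_cvg \1_(P N `&` B).
    elim: N => [|N IH].
      rewrite (_ : (\1_(P 0%N `&` B) : H -> R) = fun=> 0); first exact: l1_cvg0.
      by apply/funext => x; rewrite indicE memNset// => -[[k]].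
    rewrite (_ : (\1_(P N.+1 `&` B) : H -> R) = fun x => \1_(P N `&` B) x + \1_(F N `&` B) x); first exact: l1_cvgD.
    apply/funext => x; rewrite !indicE !in_setI.
    have -> : (x \in P N.+1) = (x \in P N) || (x \in F N).
      apply/idP/orP; rewrite !inE.
        move=> [k /=]; rewrite ltnS leq_eqVlt => /orP[/eqP->|kN] Fx; [by right|by left; exists k].
      by move=> [[k /= kN Fx]|Fx]; [exists k => //=; rewrite ltnS ltnW|exists N => //=].
    have : ~ ((x \in P N) /\ (x \in F N)).
      rewrite !inE => -[[k /= kN Fkx] FNx].
      have E : k = N := tF k N I I (ex_intro _ x (conj Fkx FNx)).
      by rewrite E ltnn in kN.
    by case: (x \in P N); case: (x \in F N); case: (x \in B) => //= h; rewrite ?addr0 ?add0r//; case: h.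
  (* The finite parts of the disjoint union approximate it in L^1, since the measure of what is left
     decreases to 0. *)
  have c0 : (mu (((\bigcup_k F k) `\` P N) `&` B) @[N --> \oo] --> (0%R : R)%:E)%E.
    have I0 : \bigcap_N (((\bigcup_k F k) `\` P N) `&` B) = set0.
      rewrite -subset0 => x hx; have [[[k _ Fkx] _] _] := hx 0%N I.
      have [[_ +] _] := hx k.+1 I; apply; exists k => //=.
    rewrite -[X in _ --> X](measure0 mu) -I0; apply: (nonincreasing_cvg_mu (F := fun N => ((\bigcup_k F k) `\` P N) `&` B)).
    - by apply: fI; exact: measurableD.
    - by move=> N; apply: measurableI => //; exact: measurableD.
    - by rewrite I0.
    - move=> i j ij; apply/subsetPset => x [[Ux nP] Bx]; split => //; split => // -[k /= ki Fx].
      by apply: nP; exists k => //=; exact: leq_trans ij.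
  have [N _ /(_ N (leqnn _))/= hN] : \forall N \near \oo, (mu (((\bigcup_k F k) `\` P N) `&` B) < e%:E)%E.
    by apply: (cvge_lt c0); rewrite lte_fin.
  exists \1_(P N `&` B); split => //.
  apply: le_trans (ltW hN); rewrite -LI; last exact: measurableD.
  apply: eqW; apply: eq_int => x; congr (`|_|%R)%:E; rewrite !indicE setDE !in_setI in_setC.
  have : x \in P N -> x \in \bigcup_k F k by rewrite !inE => -[k _ Fx]; exists k.
  by case: (x \in P N) => [->//|_]; case: (x \in \bigcup_k F k); case: (x \in B) => /=; ring.
Qed.

Lemma ball_integrable_trunc (M : R) u : ball_integrable u ->
  let f x := \1_[set x | hN4 x < M] x * u x in
  measurable_fun setT f /\ mu.-integrable setT (EFin \o f).
Proof.
move=> hu f; have mB : measurable [set x : H | hN4 x < M].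
  have := @measurable_fun_hN4 R n _ _ id (@measurable_id _ _ _) measurableT _ (@measurable_itv R `]-oo, M[).
  by rewrite setTI; congr (measurable _); apply/seteqP; split => p; rewrite /= in_itv.
have m1 : measurable_fun setT (\1_[set x : H | hN4 x < M] : H -> R) by exact: measurable_indic.
split; first by apply: measurable_funM => //; exact: hu.1.
apply: (ball_integrableM (c := 1) (M := M) hu m1) => y.
rewrite mul1r ger0_norm// !indicE; case: (boolP (y \in _)) => //.
by rewrite inE/= => /ltW yM; rewrite mem_set.
Qed.

(** Simple functions are finite combinations of indicators and dense in L^1; truncating them to the
    ball brings in the sets already treated. *)
Lemma l1_cvg_trunc (M : R) u : ball_integrable u -> l1_cvg (fun x => \1_[set x | hN4 x < M] x * u x).
Proof.
move=> hu; have [mf hf] := ball_integrable_trunc M hu; set f := (fun x => _) in mf hf *.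
set B := [set x : H | hN4 x < M] in f mf hf *.
have mB : measurable B.
  have := @measurable_fun_hN4 R n _ _ id (@measurable_id _ _ _) measurableT _ (@measurable_itv R `]-oo, M[).
  by rewrite setTI; congr (measurable _); apply/seteqP; split => p; rewrite /B/= in_itv.
apply: l1_cvg_closure => // e e0.
have [g [ig _ cg]] := approximation_sfun_integrable measurableT hf.
have e0' : (0 < e%:E)%E by rewrite lte_fin.
have [N _ /(_ N (leqnn _))/= hN] := cvge_lt cg e0'.
exists (fun x => \1_B x * g N x); split.
  have -> : (fun x => \1_B x * g N x) = (fun x : H =>
      \sum_(y <- finmap.enum_fset (fset_set (range (g N)))) (y * \1_(g N @^-1` [set y] `&` B) x)).
    apply/funext => x; rewrite (fimfunE (g N) x) fsbig_finite/=; last exact: fimfunP.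
    rewrite mulr_sumr; apply: eq_bigr => y _; rewrite mulrCA; congr (_ * _).
    by rewrite !indicE in_setI mulrC -natrM mulnb.
  apply: l1_cvg_sum => y; apply: l1_cvgZ; apply: l1_cvg_indic.
  have mg : measurable_fun setT (g N) by [].
  by rewrite -[X in measurable X]setTI; exact: mg.
apply: le_trans (ltW hN); apply: int_le => [x|||x].
- by rewrite lee_fin.
- apply/measurable_EFinP; apply: measurableT_comp => //; apply: measurable_funB => //.
  by apply: measurable_funM => //; apply: measurable_indic.
- by apply/measurable_EFinP; apply: measurableT_comp => //; apply: measurable_funB.
- rewrite lee_fin /f indicE; case: (x \in B); first by rewrite !mul1r.
  by rewrite !mul0r subrr normr0.
Qed.

(** A mollification at x sees only a bounded neighbourhood of x, since its bump is supported in N^4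
    <= 1; a truncation far out is invisible there. *)
Lemma mollify_trunc (M W : R) u i x : 14 * (1 + W) < M -> hN4 x <= W ->
  mollify i (fun x => \1_[set x | hN4 x < M] x * u x) x = mollify i u x.
Proof.
move=> WM xW; congr (_ / _); apply: eq_Rintegral => y _.
have [->|h] := eqVneq (bump i.+1%:R (hmul x (- y))) 0; first by rewrite !mul0r.
rewrite indicE mem_set ?mul1r//=; apply: le_lt_trans WM; apply: (le_trans (hN4_quotient_le x y)).
rewrite ler_wpM2l// lerD//; apply: (le_trans (bexp_qball (k0 i) h)).
by rewrite invf_le1// ler1n.
Qed.

Lemma mollify_cvg_ball (W e : R) u : ball_integrable u -> 0 < e -> exists N, forall i, (N <= i)%N ->
  (\int[mu]_x (\1_(qball W) x * `|mollify i u x - u x|)%:E <= e%:E)%E.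
Proof.
move=> hu e0; pose M := 14 * (1 + Num.max 0 W) + 1.
have W0 : 0 <= Num.max 0 W :> R by rewrite le_max lexx.
have WW : W <= Num.max 0 W by rewrite le_max lexx orbT.
have [mf hf cf] := l1_cvg_trunc M hu; have [N hN] := cf _ e0; exists N => i /hN {}hN.
have mu' := hu.1; have mW := measurable_qball (R := R) (n := n) W.
apply: le_trans hN; apply: int_le => [x|||x].
- by rewrite lee_fin mulr_ge0.
- apply/measurable_EFinP; apply: measurable_funM; first exact: measurable_indic.
  by apply: measurableT_comp => //; exact: mdiff.
- by apply/measurable_EFinP; apply: measurableT_comp => //; exact: mdiff.
- rewrite lee_fin indicE; have [xW|] := boolP (x \in qball W); last by rewrite mul0r.
  rewrite inE /qball/= in xW; have xW' := le_trans xW WW.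
  rewrite mul1r (mollify_trunc (W := Num.max 0 W))//; last by rewrite ltrDl.
  rewrite indicE mem_set ?mul1r//=; apply: (le_lt_trans xW'); rewrite /M; lra.
Qed.

(** The indices are chosen so that the error on the ball N^4 <= j has integral at most 2^(-j-1). The
    errors are then summable almost everywhere, hence tend to 0, and every point lies in all
    sufficiently large balls. *)
Lemma mollify_ae u : ball_integrable u ->
  exists k : nat -> nat, {ae mu, forall x, mollify (k j) u x @[j --> \oo] --> u x}.
Proof.
move=> hu; have e0 j : 0 < 1 / (2 ^ j.+1)%:R :> R by rewrite divr_gt0// ltr0n expn_gt0.
have [k hk] := choice (fun j => mollify_cvg_ball j%:R hu (e0 j)).
exists k; pose h j x := \1_(qball j%:R) x * `|mollify (k j) u x - u x|.
have h0 j x : (0 <= (h j x)%:E)%E by rewrite lee_fin mulr_ge0.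
have mh j : measurable_fun setT (fun x => (h j x)%:E).
  apply/measurable_EFinP; apply: measurable_funM.
    by apply: measurable_indic; exact: measurable_qball.
  by apply: measurableT_comp => //; apply: mdiff; exact: hu.1.
have iF : mu.-integrable setT (fun x => \sum_(0 <= j <oo) (h j x)%:E)%E.
  apply/integrableP; split.
    by apply: ge0_emeasurable_sum.
  rewrite (eq_integral (fun x => \sum_(0 <= j <oo) (h j x)%:E))%E; last first.
    by move=> x _; rewrite gee0_abs//; exact: nneseries_ge0.
  rewrite integral_nneseries//; apply: le_lt_trans (ltry 1).
  apply: le_trans (epsilon_trick0 xpredT (@ler01 R)); apply: lee_nneseries => [j _|j _].
    by move=> _; exact: int_ge0.
  exact: (hk j _ (leqnn _)).
have := integrable_ae measurableT iF; apply: filterS => x /(_ I) Fx.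
have hx0 j : 0 <= h j x by rewrite mulr_ge0.
have cs : cvgn (series (h^~ x)).
  apply: nondecreasing_is_cvgn.
    by apply: nondecreasing_series => j _ _; rewrite -lee_fin.
  exists (fine (\sum_(0 <= j <oo) (h j x)%:E)%E) => _ [N _ <-].
  rewrite -lee_fin fineK// /series/= -sumEFin; exact: nneseries_lim_ge.
have c0 := cvg_series_cvg_0 cs.
have [j0 hj0] : exists j0, hN4 x <= j0%:R by exists (Num.truncn (hN4 x)).+1; rewrite ltW// truncnS_gt.
apply/cvgrPdist_le => e ee; have /cvgr0Pnorm_le/(_ e ee) c1 := c0.
near=> j; rewrite distrC; have jj : (j0 <= j)%N by near: j; exists j0.
have : `|h j x| <= e by near: j.
rewrite ger0_norm// /h indicE mem_set ?mul1r// /qball/=.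
by apply: (le_trans hj0); rewrite ler_nat.
Unshelve. all: by end_near. Qed.

End approximate_identity.

(** * Passage to the limit *)

Lemma cvg_powR (R : realType) (u : nat -> R) (a r : R) : 0 < r -> (forall i, 0 <= u i) ->
  u i @[i --> \oo] --> a -> u i `^ r @[i --> \oo] --> a `^ r.
Proof.
move=> r0 u0 ua; have a0 : 0 <= a by rewrite -(cvg_lim _ ua)//; apply: limr_ge; [exact: cvgP ua|exact: nearW].
move: a0; rewrite le_eqVlt => /predU1P[a0|a0]; last first.
  exact: (cvg_comp _ _ ua (dv_continuous (is_derive1_powR r a0))).
subst a; rewrite powR0 ?gt_eqF//; apply/cvgr0Pnorm_lt => e e0.
have /cvgr0Pnorm_lt/(_ (e `^ r^-1) (powR_gt0 _ e0)) := ua; apply: filterS => i.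
rewrite !ger0_norm ?powR_ge0// => h.
have -> : e = (e `^ r^-1) `^ r by rewrite -powRrM mulVf ?gt_eqF// powRr1// ltW.
by rewrite gt0_ltr_powR// nnegrE ?powR_ge0.
Qed.

Section continuous_growth.
Context (R : realType).

Lemma continuous_exp_tail N : continuous (@exp_tail R N).
Proof.
move=> x; apply: cvgB; first exact: continuous_expR.
apply: cvg_sum_ord => j; apply: cvgMl; exact: exprn_continuous.
Qed.

Lemma cvg_growth (n : nat) (p a : R) (u : nat -> R) (v : R) : 1 <= p -> (forall i, 0 <= u i) ->
  u i @[i --> \oo] --> v -> growth n p a (u i) @[i --> \oo] --> growth n p a v.
Proof.
move=> p1 u0 uv; have Q1 := Q1_gt0 R n.
have q0 : 0 < (@hdim n)%:R / ((@hdim n)%:R - 1) :> R.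
  by rewrite divr_gt0// ltr0n (ltn_trans _ (hdim_gt1 n)).
have g0 : 0 < p / ((@hdim n)%:R - 1) :> R by rewrite divr_gt0// (lt_le_trans ltr01).
apply: cvgM.
  have h : a * u i `^ ((@hdim n)%:R / ((@hdim n)%:R - 1)) @[i --> \oo] --> a * v `^ ((@hdim n)%:R / ((@hdim n)%:R - 1)).
    by apply: cvgMr; exact: cvg_powR.
  exact: (cvg_comp _ _ h (@continuous_exp_tail _ _)).
apply: cvgV; first by rewrite gt_eqF// ltr_pwDl// powR_ge0.
by apply: cvgD; [exact: cvg_cst|exact: cvg_powR].
Qed.

End continuous_growth.

Section fatou.
Context d (T : measurableType d) (R : realType) (m : {measure set T -> \bar R}).

Lemma fatou_ae (f : nat -> T -> R) (g : T -> R) (c : \bar R) :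
  (forall j, measurable_fun setT (f j)) -> measurable_fun setT g ->
  (forall j x, 0 <= f j x) -> (forall x, 0 <= g x) ->
  {ae m, forall x, f j x @[j --> \oo] --> g x} ->
  (forall j, (\int[m]_x (f j x)%:E <= c)%E) -> (\int[m]_x (g x)%:E <= c)%E.
Proof.
move=> mf mg f0 g0 fg fc.
have mF j : measurable_fun setT (EFin \o f j) by exact/measurable_EFinP.
have F0 j x : setT x -> (0 <= (EFin \o f j) x)%E by rewrite lee_fin.
have L0 x : (0 <= limn_einf (fun j => (EFin \o f j) x))%E.
  rewrite limn_einf_lim; apply: lime_ge; first exact: is_cvg_einfs.
  by apply: nearW => j; apply: le_ereal_inf_tmp => _ [k _ <-]; rewrite lee_fin.
apply: (@le_trans _ _ (\int[m]_x limn_einf (fun j => (EFin \o f j) x))%E).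
  apply: eqW; apply: ge0_ae_eq_integral => //.
  - exact/measurable_EFinP.
  - apply: (emeasurable_fun_cvg (fun j x => einfs (fun j => (EFin \o f j) x) j)).
      by move=> j; exact: measurable_fun_einfs.
    by move=> x _; rewrite limn_einf_lim; exact: is_cvg_einfs.
  - by move=> x _; rewrite lee_fin.
  apply: filterS fg => x fx _; have h : (EFin \o f j) x @[j --> \oo] --> (g x)%:E.
    by apply: cvg_EFin; first by near=> j.
  by rewrite (cvg_limn_einf_sup h).1.
apply: (le_trans (fatou m measurableT mF F0)).
rewrite limn_einf_lim; apply: lime_le; first exact: is_cvg_einfs.
by apply: nearW => j; apply: le_trans (fc j); apply: ereal_inf_lbound; exists j => /=.
Unshelve. all: by end_near. Qed.

Lemma Lnorm_powR (f : T -> R) (r : R) : 0 < r ->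
  ('N[m]_(r%:E)[EFin \o f] `^ r = \int[m]_x (`|f x| `^ r)%:E)%E.
Proof. by move=> r0; rewrite poweR_Lnorm ?gt_eqF//; apply: eq_int => x; rewrite /= poweR_EFin. Qed.

Lemma Lnorm_le1 (f : T -> R) (r : R) : 0 < r ->
  ('N[m]_(r%:E)[EFin \o f] <= 1)%E -> (\int[m]_x (`|f x| `^ r)%:E <= 1)%E.
Proof.
move=> r0 f1; rewrite -Lnorm_powR// -(poweR1r r); apply: gt0_ler_poweR f1; first exact: ltW.
  by rewrite in_itv/= leey andbT Lnorm_ge0.
by rewrite in_itv/= leey andbT.
Qed.

End fatou.

Section exact_growth.
Context (R : realType) (n : nat).
Local Notation C := (Cn R n).
Local Notation H := (heis R n).
Local Notation mu := (@haar R n).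
Variable sigma : {measure set H -> \bar R}.
Hypothesis hsigma : sphere_measure sigma.
Hypothesis n0 : (0 < n)%N.

(** One constant serves all mollifications because mollifying increases neither the energy nor the
    L^p norm; the integrand is continuous in |u|, so convergence almost everywhere is inherited by
    it. *)
Lemma exact_growth (p : R) : 1 <= p -> exists K : R, exact_growth_inequality (n := n) (A_const sigma)^-1 p K.
Proof.
move=> p1; have p0 : 0 < p by exact: lt_le_trans p1.
exists (growthC sigma p) => u G [uL _] hG G1.
have [hu _] := hG; have bu := loc_integrable_ball hu; have mu' := bu.1.
have bE := ball_integrable_enorm hG.
have Q0 : (0 : R) < (@hdim n)%:R by rewrite ltr0n (ltn_trans _ (hdim_gt1 n)).
have A0 := A_const_gt0 hsigma n0; have Ai : 0 <= (A_const sigma)^-1 by rewrite invr_ge0 ltW.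
have k0 i : 0 < i.+1%:R :> R by [].
have mass0 i := bump_mass_gt0 hsigma n0 (k0 i).
have LE : ('N[mu]_(p%:E)[EFin \o u] `^ p = \int[mu]_x (`|u x| `^ p)%:E)%E.
  exact: Lnorm_powR.
have GE : (\int[mu]_x (enorm (G x) `^ (@hdim n)%:R)%:E <= 1%:E)%E.
  have := Lnorm_le1 Q0 G1; congr (_ <= _)%E; apply: eq_int => x.
  by rewrite ger0_norm//; exact: enorm_ge0.
have uf : (\int[mu]_x (`|u x| `^ p)%:E < +oo)%E.
  rewrite -LE; apply: poweR_lty; case/andP: uL => _; rewrite inE; exact.
set I := (integral _ _ _) in uf; have I0 : (0 <= I)%E by apply: int_ge0 => x; rewrite lee_fin powR_ge0.
have IE : I = (fine I)%:E by rewrite fineK// ge0_fin_numE.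
rewrite LE -/I IE -EFinM.
have [k kc] := mollify_ae hsigma n0 bu.
apply: (fatou_ae (f := fun j x => growth n p (A_const sigma)^-1 `|mollify (k j) u x|)
                 (g := fun x => growth n p (A_const sigma)^-1 `|u x|)).
- move=> j; apply: (measurableT_comp (measurable_growth _ _ _)); apply: measurableT_comp => //.
  exact: measurable_mollify.
- by apply: (measurableT_comp (measurable_growth _ _ _)); apply: measurableT_comp.
- by move=> j x; apply: growth_ge0.
- by move=> x; apply: growth_ge0.
- apply: filterS kc => x xc; apply: cvg_growth => //; exact: cvg_norm.
move=> j; have ug := moll_upper_gradient (k0 (k j)) (mass0 (k j)) hG.
apply: (int_growth_le hsigma n0 p1 ug).
- apply: (int_moll_powR hsigma n0 (k0 (k j)) _ bE _ ler01 GE); last by move=> y; exact: enorm_ge0.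
  by rewrite ler1n (ltn_trans _ (hdim_gt1 n)).
- rewrite -IE; apply: (@le_trans _ _ (\int[mu]_x ((moll (k j).+1%:R (fun y => `|u y|) x / bump_mass n (k j).+1%:R) `^ p)%:E)%E).
    apply: int_le => [x|||x].
    + by rewrite lee_fin powR_ge0.
    + apply/measurable_EFinP; apply: measurable_fun_powR; apply: measurableT_comp => //.
      exact: measurable_mollify.
    + apply/measurable_EFinP; apply: measurable_fun_powR; apply: measurable_funM => //.
      by apply: measurable_moll; exact: measurableT_comp.
    + rewrite lee_fin ge0_ler_powR ?nnegrE ?(ltW p0)//.
        by rewrite divr_ge0 ?moll_ge0// ltW.
      rewrite normrM [X in _ * X]gtr0_norm ?invr_gt0// ler_wpM2r ?invr_ge0 ?(ltW (mass0 _))//.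
      exact: moll_norm.
  rewrite IE; apply: (int_moll_powR hsigma n0 (k0 (k j)) p1 (ball_integrable_abs bu)) => //.
  + exact: fine_ge0.
  + by rewrite -IE.
Qed.

End exact_growth.

(** * Sharpness of the constant *)

Section open_measurable.
Context (R : realType) (n : nat).
Local Notation H := (heis R n).
Local Notation mu := (@haar R n).

(* Boxes with rational centre and radius: a countable base. *)
Let rbox (i : ('rV[rat]_n * 'rV[rat]_n * rat) * rat) : set H :=
  [set p : H | [/\ forall j, `|p.1.1 ord0 j - ratr (i.1.1.1 ord0 j)| < ratr i.2,
    forall j, `|p.1.2 ord0 j - ratr (i.1.1.2 ord0 j)| < ratr i.2 &
    `|p.2 - ratr i.1.2| < ratr i.2]].

Let measurable_rbox i : measurable (rbox i).
Proof.
have key (g : H -> R) (a : R) : measurable_fun setT g -> measurable [set p : H | `|g p - a| < ratr i.2].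
  move=> mg; have mf : measurable_fun setT (fun p => `|g p - a|).
    by apply: measurableT_comp => //; exact: measurable_funB.
  have := mf measurableT _ (@measurable_itv R `]-oo, ratr i.2[).
  by rewrite setTI; congr (measurable _); apply/seteqP; split => p; rewrite /= in_itv.
have m1 : measurable_fun setT (fun p : H => p.1.1).
  exact: (measurableT_comp measurable_fst measurable_fst).
have m2 : measurable_fun setT (fun p : H => p.1.2).
  exact: (measurableT_comp measurable_snd measurable_fst).
have -> : rbox i = (\bigcap_j [set p : H | `|p.1.1 ord0 j - ratr (i.1.1.1 ord0 j)| < ratr i.2] `&`
    \bigcap_j [set p : H | `|p.1.2 ord0 j - ratr (i.1.1.2 ord0 j)| < ratr i.2]) `&`
    [set p | `|p.2 - ratr i.1.2| < ratr i.2].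
  apply/seteqP; split => [p [h1 h2 h3]|p [[h1 h2] h3]].
    by split => //; split => j _; [exact: h1|exact: h2].
  by split => // j; [exact: h1|exact: h2].
apply: measurableI; last by apply: key; exact: measurable_snd.
apply: measurableI; apply: fin_bigcap_measurable => [|j _]; try exact: finite_finset.
  by apply: key; exact: measurable_fun_coord.
by apply: key; exact: measurable_fun_coord.
Qed.

Let rbox_nbhs (O : set H) p : open O -> O p -> exists i, rbox i p /\ rbox i `<=` O.
Proof.
move=> oO Op; have /nbhs_ballP[e /= e0 pO] : nbhs p O by exact: open_nbhs_nbhs.
have [r] := rat_in_itvoo (divr_gt0 e0 (ltr0n _ 2)); rewrite in_itv/= => /andP[r0 re].
have q (x : R) : {q : rat | `|x - ratr q| < ratr r}.
  have xr : x - ratr r < x + ratr r by rewrite ltrBlDr -addrA ltrDl addr_gt0.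
  have [q] := cid (rat_in_itvoo xr).
  by rewrite in_itv/= => hq; exists q; rewrite ltr_distlC.
exists ((\row_j sval (q (p.1.1 ord0 j)), \row_j sval (q (p.1.2 ord0 j)), sval (q p.2)), r).
split.
  by split => [j|j|]; rewrite /= ?mxE; case: (q _).
have tri (a b c : R) : `|a - c| < ratr r -> `|b - c| < ratr r -> `|a - b| < e.
  move=> ac bc; rewrite -(subrKA c a (- b)) (le_lt_trans (ler_normD _ _))//.
  rewrite [e]splitr; apply: ltrD; first exact: lt_trans re.
  by rewrite distrC; exact: lt_trans re.
move=> x [h1 h2 h3]; apply: pO; split; [split|].
- split=> // i j; rewrite (ord1 i); apply: tri (h1 j); rewrite mxE; by case: (q _).
- split=> // i j; rewrite (ord1 i); apply: tri (h2 j); rewrite mxE; by case: (q _).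
- apply: tri h3; by case: (q _).
Qed.

Lemma open_measurable_heis (O : set H) : open O -> measurable O.
Proof.
move=> oO; pose F k := if unpickle k is Some i then (if `[< rbox i `<=` O >] then rbox i else set0) else set0.
have -> : O = \bigcup_k F k.
  apply/seteqP; split => [p Op|p [k _]].
    have [i [ip iO]] := rbox_nbhs oO Op; exists (pickle i); first exact: I.
    by rewrite /F (@pickleK _ i) asboolT.
  by rewrite /F; case: (unpickle k) => // i; case: asboolP => // iO /iO.
apply: bigcup_measurable => k _; rewrite /F; case: (unpickle k) => // i.
by case: asboolP.
Qed.

Lemma continuous_measurable_heis (f : H -> R) : continuous f -> measurable_fun setT f.
Proof.
move=> /continuousP cf; apply: (measurability _ (RGenOInfty.measurableE R)) => _ [_ [a ->] <-].
by rewrite setTI; apply: open_measurable_heis; apply: cf; exact: interval_open.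
Qed.

Lemma compact_measurable_heis (K : set H) : compact K -> measurable K.
Proof.
move=> cK; rewrite -[K]setCK; apply: measurableC; apply: open_measurable_heis.
by rewrite openC; apply: compact_closed => //; exact: norm_hausdorff.
Qed.

Lemma haar_compact (K : set H) : compact K -> (mu K < +oo)%E.
Proof.
move=> cK; have ch : {within K, continuous (@hN4 R n)}.
  by apply: continuous_subspaceT; exact: smooth_continuous (smooth_hN4 R n).
have [M [_ hM]] := compact_bounded (continuous_compact ch cK).
have KM : K `<=` qball (M + 1).
  move=> x Kx; have := hM (M + 1) (ltr_pwDr ltr01 (lexx _)) (hN4 x) (ex_intro2 _ _ x Kx erefl).
  by rewrite /= ger0_norm ?hN4_ge0.
apply: (le_lt_trans _ (haar_qball_fin n (M + 1))).
by apply: le_measure => //; rewrite inE; [exact: compact_measurable_heis|exact: measurable_qball].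
Qed.

Lemma continuous_integrable_heis (f : H -> R) (K : set H) : continuous f -> compact K ->
  mu.-integrable K (EFin \o f).
Proof.
move=> cf cK; apply: measurable_bounded_integrable.
- exact: compact_measurable_heis.
- exact: haar_compact.
- by apply: measurable_funTS; exact: continuous_measurable_heis.
have cfK : {within K, continuous f} by exact: continuous_subspaceT.
have [M [Mr hM]] := compact_bounded (continuous_compact cfK cK).
by exists M; split => // x Mx y Ky; apply: hM => //; exists y.
Qed.

Lemma continuous_loc_integrable (f : H -> R) : continuous f -> loc_integrable f.
Proof.
move=> cf; split; first exact: continuous_measurable_heis.
by move=> K cK; exact: continuous_integrable_heis.
Qed.

Lemma continuous_integrable_support (f : H -> R) (K : set H) : continuous f -> compact K ->
  (forall x, ~ K x -> f x = 0) -> mu.-integrable setT (EFin \o f).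
Proof.
move=> cf cK f0; have := continuous_integrable_heis cf cK.
move/integrable_mkcond => /(_ (compact_measurable_heis cK)).
congr (integrable _ _ _); apply/funext => x; rewrite patchE /=.
by case: (boolP (x \in K)) => //; rewrite notin_setE => /f0 ->.
Qed.

End open_measurable.

Section line_derivative.
Context (R : realType) (n : nat).
Local Notation H := (heis R n).
Local Notation mu := (@haar R n).
Local Notation lam := (@lebesgue_line R).

Lemma scales1_integral (f : H -> R) (T : H -> H) : scales mu T 1 -> measurable_fun setT f ->
  (\int[mu]_x (f (T x))%:E = \int[mu]_x (f x)%:E)%E.
Proof.
move=> [mT hT] mf; have mF : measurable_fun setT (EFin \o f) by exact/measurable_EFinP.
rewrite integralE [RHS]integralE; congr (_ - _)%E.
  have := hT _ (measurable_funepos mF) (funepos_ge0 _); rewrite mul1e => <-.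
  by apply: eq_integral => x _; rewrite !funeposE.
have := hT _ (measurable_funeneg mF) (funeneg_ge0 _); rewrite mul1e => <-.
by apply: eq_integral => x _; rewrite !funenegE.
Qed.

Lemma scales1_integrable (f : H -> R) (T : H -> H) : scales mu T 1 -> measurable_fun setT f ->
  mu.-integrable setT (EFin \o f) -> mu.-integrable setT (EFin \o (f \o T)).
Proof.
move=> [mT hT] mf hf; apply/integrableP; split.
  by apply/measurable_EFinP; exact: measurableT_comp.
have mn : measurable_fun setT (fun x => (`|f x|)%:E) by apply/measurable_EFinP; exact: measurableT_comp.
have := hT _ mn (fun x => _); rewrite mul1e => h.
apply: le_lt_trans (integrable_normr mf hf); apply: eqW.
by rewrite -h// => x; rewrite lee_fin.
Qed.

Variables (psi h : H -> R) (v : H).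
Hypotheses (dpsi : forall q, is_derive q v psi (h q)) (ch : continuous h).
Hypotheses (mpsi : measurable_fun setT psi).
Hypotheses (ipsi : mu.-integrable setT (EFin \o psi)) (ih : mu.-integrable setT (EFin \o h)).

Let mh : measurable_fun setT h. Proof. exact: continuous_measurable_heis. Qed.
Let ind (s : R) : R := indb (0 <= s) * indb (s <= 1).
Let f (z : R * H) : R := ind z.1 * h (z.1 *: v + z.2).

Let mind : measurable_fun setT ind.
Proof. by apply: measurable_funM; exact: measurable_fun_leR. Qed.

Let ind0 s : 0 <= ind s. Proof. by rewrite mulr_ge0. Qed.

Let mshift : measurable_fun setT (fun z : R * H => z.1 *: v + z.2).
Proof.
have [m1 m2] := (@measurable_fst _ _ R H, @measurable_snd _ _ R H).
apply: measurable_fun_pair.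
  apply: measurable_fun_CD; last exact: (measurableT_comp measurable_fst m2).
  exact: (measurable_fun_CZ m1).
by apply: measurable_funD; [exact: measurable_funM|exact: (measurableT_comp measurable_snd m2)].
Qed.

Let mf : measurable_fun setT f.
Proof.
by apply: measurable_funM; [exact: (measurableT_comp mind measurable_fst)|exact: (measurableT_comp mh mshift)].
Qed.

Let shiftE s : scales mu (fun q : H => s *: v + q) 1.
Proof.
have := scales_hshift (s *: v); congr (scales _ _ _); apply/funext => q; exact: addrC.
Qed.

Let int_ind (g : R -> \bar R) :
  (\int[lam]_s ((ind s)%:E * g s) = \int[lam]_(s in `[0%R, 1%R]) g s)%E.
Proof.
rewrite [RHS]int_setE; apply: eq_int => s; rewrite muleC indicE /ind; congr (_ * _%:E)%E.
have -> : (s \in `[0, 1]%classic) = (0 <= s <= 1) by apply/idP/idP; rewrite inE/= in_itv.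
by rewrite /indb -natrM mulnb.
Qed.

Let ind_int : (\int[lam]_s (ind s)%:E = 1)%E.
Proof.
transitivity (\int[lam]_s ((ind s)%:E * 1%:E))%E; first by apply: eq_int => s; rewrite mule1.
rewrite int_ind.
apply: (etrans (@FTC2_line R (fun y : R => y) (fun=> 1) _ _ ler01 _ _ _)) => [s _|s _|].
- exact: cst_continuous.
- by [].
- by rewrite subr0.
Qed.

Let ifubini : (lam \x mu)%E.-integrable setT (EFin \o f).
Proof.
have J := integrable_normr mh ih; set I := (integral _ _ _) in J.
have I0 : (0 <= I)%E by apply: int_ge0 => y; rewrite lee_fin.
have IE : I = (fine I)%:E by rewrite fineK// ge0_fin_numE.
apply/integrable12ltyP; first exact/measurable_EFinP.
rewrite (eq_integral (fun s => (ind s)%:E * I))%E; last first.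
  move=> s _; transitivity (\int[mu]_y ((ind s)%:E * (`|h (s *: v + y)|)%:E))%E.
    by apply: eq_int => y; rewrite /f/= normrM ger0_norm// EFinM.
  have mhs : measurable_fun setT (fun y => (`|h (s *: v + y)|)%:E).
    apply/measurable_EFinP; apply: measurableT_comp => //.
    exact: (measurableT_comp mh (shiftE s).1).
  rewrite intZ//; congr (_ * _)%E.
  have [_ hs] := shiftE s; rewrite (hs (fun y => (`|h y|)%:E)) ?mul1e//.
  by apply/measurable_EFinP; apply: measurableT_comp.
rewrite IE intZr ?fine_ge0//; last exact/measurable_EFinP.
by rewrite ind_int mul1e ltry.
Qed.

(** The integral of psi(v + y) - psi(y) vanishes by translation invariance. By Fubini's theorem it
    is also the integral of h, averaged over the shifts by s v with s in [0, 1]. *)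
Lemma int_line_derivative : \int[mu]_x h x = 0.
Proof.
have E1 : (\int[lam]_s \int[mu]_y (f (s, y))%:E = (\int[mu]_x h x)%:E)%E.
  have IE : (\int[mu]_x (h x)%:E = (\int[mu]_x h x)%:E)%E.
    by rewrite fineK//; exact: integrable_fin_num.
  have fE s : (\int[mu]_y (f (s, y))%:E = (ind s * \int[mu]_x h x)%:E)%E.
    rewrite /f /= EFinM -IE -(scales1_integral (shiftE s) mh).
    under eq_integral do rewrite EFinM.
    by rewrite integralZl//; exact: (scales1_integrable (shiftE s) mh ih).
  under eq_integral => s _ do rewrite fE EFinM.
  rewrite integralZr//; first by rewrite ind_int mul1e.
  apply/integrableP; split; first exact/measurable_EFinP.
  by rewrite (eq_integral (fun s => (ind s)%:E)) ?ind_int ?ltry// => s _; rewrite gee0_abs ?lee_fin.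
have E2 : (\int[mu]_y \int[lam]_s (f (s, y))%:E = 0)%E.
  have fE y : (\int[lam]_s (f (s, y))%:E = (psi (1 *: v + y) - psi (0 *: v + y))%:E)%E.
    transitivity (\int[lam]_s ((ind s)%:E * (h (s *: v + y))%:E))%E.
      by apply: eq_int => s; rewrite -EFinM.
    have cd s : 0 <= s <= 1 -> {for s, continuous (fun s : R => h (s *: v + y))}.
      move=> _; apply: (@continuous_comp _ _ _ (fun s : R => s *: v + y) h); last exact: ch.
      by apply: cvgD; [apply: cvgZl; exact: cvg_id|exact: cvg_cst].
    rewrite int_ind -integral_line//.
      apply: (etrans (@FTC2_lebesgue R (fun s => psi (s *: v + y)) _ _ _ ler01 _ cd)) => [s _|//].
      exact: (dv_line psi y v (h (s *: v + y)) s).1 (dpsi _).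
    apply/measurable_EFinP; apply: measurable_funTS; apply: (measurableT_comp mh).
    exact: (measurableT_comp mshift (measurable_pair2 _)).
  under eq_integral => y _ do rewrite fE EFinB.
  have i1 s := scales1_integrable (shiftE s) mpsi ipsi.
  rewrite integralB//; [|exact: (i1 1)|exact: (i1 0)].
  rewrite (scales1_integral (shiftE 1) mpsi) (scales1_integral (shiftE 0) mpsi).
  by rewrite subee//; exact: integrable_fin_num.
have := Fubini ifubini; by rewrite E1 E2 => -[].
Qed.

End line_derivative.

Section continuous_algebra.
Context (R : realType) (n : nat).
Local Notation H := (heis R n).
Implicit Types f g : H -> R.

Lemma continuous_funM f g : continuous f -> continuous g -> continuous (fun p => f p * g p).
Proof. by move=> cf cg p; exact: continuousM (cf p) (cg p). Qed.

Lemma continuous_funD f g : continuous f -> continuous g -> continuous (fun p => f p + g p).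
Proof. by move=> cf cg p; exact: continuousD (cf p) (cg p). Qed.

Lemma continuous_funZ (c : R) f : continuous f -> continuous (fun p => c * f p).
Proof. by move=> cf; apply: continuous_funM => // p; exact: cst_continuous. Qed.

End continuous_algebra.

Section weak_gradient.
Context (R : realType) (n : nat).
Local Notation C := (Cn R n).
Local Notation H := (heis R n).
Local Notation mu := (@haar R n).
Variable phi : H -> R.
Hypothesis tphi : test_function phi.
Let K : set H := closure [set p | phi p != 0].

Let cK : compact K. Proof. exact: tphi.2. Qed.

Let phiC1 (v : H) : (forall p, is_derive p v phi ('D_v phi p)) * continuous ('D_v phi) * continuous phi.
Proof.
have [cphi /(_ v)[dphi cdphi]] := tphi.1 1%N.
by split => //; split => // p; apply: DeriveDef.
Qed.

Let phi0 p : ~ K p -> phi p = 0.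
Proof. by move=> nK; apply: contra_notP nK => /eqP h; exact: subset_closure. Qed.

Let dphi0 (v p : H) : ~ K p -> 'D_v phi p = 0.
Proof.
move=> nK; have E : \forall q \near p, 0 = phi q.
  have : nbhs p (~` K) by apply: open_nbhs_nbhs; split => //; rewrite openC; exact: closed_closure.
  by apply: filterS => q /phi0.
by have [_ ->] := near_eq_is_derive E (dv_cst 0 p v).
Qed.

Lemma continuous_test_integrable (w : H -> R) (v : H) : continuous w ->
  mu.-integrable setT (EFin \o (fun p => w p * phi p)) *
  mu.-integrable setT (EFin \o (fun p => w p * 'D_v phi p)).
Proof.
move=> cw; split; apply: (continuous_integrable_support _ cK).
- exact: (continuous_funM cw (phiC1 v).2).
- by move=> p /phi0 ->; rewrite mulr0.
- exact: (continuous_funM cw (phiC1 v).1.2).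
- by move=> p /dphi0 ->; rewrite mulr0.
Qed.

(** The product of w with the test function has compact support, so the integral of its derivative
    vanishes. *)
Lemma int_by_parts (w w' : H -> R) (v : H) : continuous w -> continuous w' ->
  (forall p, is_derive p v w (w' p)) ->
  \int[mu]_p (w p * 'D_v phi p) = - \int[mu]_p (w' p * phi p).
Proof.
move=> cw cw' dw; apply/eqP; rewrite -addr_eq0; apply/eqP.
have [i1 _] := continuous_test_integrable v cw.
have [_ i2] := continuous_test_integrable v cw.
have [i3 _] := continuous_test_integrable v cw'.
rewrite -RintegralD//.
have i4 : mu.-integrable setT (EFin \o (fun p => w p * 'D_v phi p + w' p * phi p)).
  exact: (integrableD measurableT i2 i3).
apply: (int_line_derivative (psi := fun p => w p * phi p) (v := v)) i4 => //.
- move=> p; apply: (dv_eq (dvM (dw p) ((phiC1 v).1.1 p))); ring.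
- exact: (continuous_funD (continuous_funM cw (phiC1 v).1.2) (continuous_funM cw' (phiC1 v).2)).
- exact: (continuous_measurable_heis (continuous_funM cw (phiC1 v).2)).
Qed.

(* The coefficient [b] of the field is constant along [dt], so that [b u] has the
   derivative [b u'] in that direction. *)
Lemma int_by_parts_field (u : H -> R) (u' : H -> H -> R) (b : H -> R) (v : H) (c : R) : continuous u ->
  (forall v, continuous (u' v)) -> (forall p v, is_derive p v u (u' v p)) ->
  continuous b -> (forall p, is_derive p dt b 0) ->
  \int[mu]_p (u p * ('D_v phi p + c * b p * 'D_dt phi p)) =
  - \int[mu]_p ((u' v p + c * b p * u' dt p) * phi p).
Proof.
move=> cu cu' du cb db.
have cbu : continuous (fun p => c * b p * u p) := continuous_funM (continuous_funZ (c := c) cb) cu.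
have cbu' : continuous (fun p => c * b p * u' dt p) := continuous_funM (continuous_funZ (c := c) cb) (cu' dt).
have dbu p : is_derive p dt (fun p => c * b p * u p) (c * b p * u' dt p).
  by apply: (dv_eq (dvM (dvZ c (db p)) (du p dt))); ring.
have [i1 i2] := continuous_test_integrable v cu; have [i3 i4] := continuous_test_integrable dt cbu.
have [i5 _] := continuous_test_integrable v (cu' v); have [i6 _] := continuous_test_integrable v cbu'.
transitivity (\int[mu]_p (u p * 'D_v phi p) + \int[mu]_p (c * b p * u p * 'D_dt phi p)).
  by rewrite -RintegralD//; apply: eq_Rintegral => p _; ring.
rewrite (int_by_parts cu (cu' v) (fun p => du p v)).
rewrite (int_by_parts cbu cbu' dbu) -opprD; congr (- _); rewrite -RintegralD//.
by apply: eq_Rintegral => p _; ring.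
Qed.

End weak_gradient.

Section classical_gradient.
Context (R : realType) (n : nat).
Local Notation C := (Cn R n).
Local Notation H := (heis R n).
Local Notation mu := (@haar R n).
Variables (u : H -> R) (u' : H -> H -> R).
Hypotheses (cu : continuous u) (cu' : forall v, continuous (u' v)).
Hypothesis du : forall p v, is_derive p v u (u' v p).

Definition hgrad (p : H) : C :=
  (\row_j (u' (dx j) p + 2 * p.1.2 ord0 j * u' dt p), \row_j (u' (dy j) p - 2 * p.1.1 ord0 j * u' dt p)).

Lemma weak_hgrad_C1 : weak_hgrad u hgrad.
Proof.
have [s1 s2 _] := @smooth_coord R n.
have d1 j p : is_derive p (dt : H) (fun p : H => p.1.1 ord0 j) 0.
  by have [h _ _] := coord_derive_id p (dt : H); apply: (dv_eq (h j)); rewrite mxE.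
have d2 j p : is_derive p (dt : H) (fun p : H => p.1.2 ord0 j) 0.
  by have [_ h _] := coord_derive_id p (dt : H); apply: (dv_eq (h j)); rewrite mxE.
split; first exact: continuous_loc_integrable.
move=> j; have c1 := smooth_continuous (s1 j); have c2 := smooth_continuous (s2 j); split.
- under eq_fun do rewrite mxE; apply: continuous_loc_integrable.
  apply: continuous_funD; first exact: cu'.
  by apply: (continuous_funM (f := fun p => 2 * p.1.2 ord0 j)); [exact: continuous_funZ c2|exact: cu'].
- under eq_fun do rewrite mxE -!mulNr; apply: continuous_loc_integrable.
  apply: continuous_funD; first exact: cu'.
  by apply: (continuous_funM (f := fun p => - 2 * p.1.1 ord0 j)); [exact: continuous_funZ c1|exact: cu'].
- move=> phi tphi; rewrite (int_by_parts_field tphi (dx j) 2 cu cu' du c2 (d2 j)); congr (- _).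
  by apply: eq_Rintegral => p _; rewrite mxE.
- move=> phi tphi; have := int_by_parts_field tphi (dy j) (- 2) cu cu' du c1 (d1 j).
  under eq_Rintegral do rewrite !mulNr; move=> ->; congr (- _).
  by apply: eq_Rintegral => p _; rewrite mxE !mulNr.
Qed.

End classical_gradient.

(** * The extremal functions and their energy *)

Section profile.
Context (R : realType).
Variable eps : R.
Hypothesis eps0 : 0 < eps.

(** For small s this is close to -ln (eps + s), a logarithm levelled off at s = eps, while e^(-s)
    provides the decay. As it is regular for s >= 0, it gives functions of N^4 that are C^1 without
    any cutoff. *)
Definition profile (s : R) : R := ln (1 + expR (- s) / (eps + s)).

Definition profile_slope (s : R) : R :=
  expR (- s) * (eps + s + 1) / ((eps + s) * (eps + s + expR (- s))).

Let E0 (s : R) : 0 < expR (- s). Proof. exact: expR_gt0. Qed.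
Let x0 (s : R) : 0 <= s -> 0 < eps + s. Proof. by move=> s0; rewrite ltr_wpDr. Qed.
Let xE0 (s : R) : 0 <= s -> 0 < eps + s + expR (- s).
Proof. by move=> s0; rewrite addr_gt0// x0. Qed.

Lemma profile_slope_ge0 (s : R) : 0 <= s -> 0 <= profile_slope s.
Proof.
move=> s0; have h1 := x0 s0; have h2 := xE0 s0; have h3 := E0 s.
by rewrite /profile_slope !mulr_ge0 ?invr_ge0 ?mulr_ge0 ?ltW// addr_gt0.
Qed.

(** Put x = eps + s and y = e^(-s): after clearing denominators the difference of the two sides is
    (1 - y) x^2 + eps y (x + 1). *)
Lemma profile_slope_le (s : R) : 0 <= s -> s * profile_slope s <= 1.
Proof.
move=> s0; have h1 := x0 s0; have h2 := xE0 s0; have h3 := E0 s.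
have E1 : expR (- s) <= 1 by rewrite -expR0 ler_expR oppr_le0.
rewrite mulrA ler_pdivrMr ?mulr_gt0// mul1r.
have e1 : 0 <= 1 - expR (- s) by rewrite subr_ge0.
have := mulr_ge0 (mulr_ge0 e1 (ltW h1)) (ltW h1).
have := mulr_ge0 (ltW eps0) (mulr_ge0 (ltW h3) (ltW (addr_gt0 h1 ltr01))).
lra.
Qed.

Lemma is_derive_profile (s : R) : 0 <= s -> is_derive s 1 profile (- profile_slope s).
Proof.
move=> s0; have h1 := x0 s0; have h2 := xE0 s0; have h3 := E0 s.
have dx : is_derive s 1 (fun s : R => eps + s) 1.
  by apply: (dv_eq (dvD (dv_cst eps s 1) (dv_id s))); rewrite add0r.
have dV : is_derive s 1 (fun s : R => (eps + s)^-1) (- (eps + s) ^- 2).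
  have := @is_deriveV _ (fun y : R => eps + y) s 1 1 (lt0r_neq0 h1) dx; rewrite /GRing.scale/= mulr1.
  by move=> h; exact: h.
have dE := dv_expR (dvN (dv_id s)).
have p1 : 0 < 1 + expR (- s) / (eps + s) by rewrite addr_gt0// divr_gt0.
apply: (dv_eq (dv_comp (dvD (dv_cst 1 s 1) (dvM dE dV)) (is_derive1_ln p1))).
rewrite /profile_slope -exprVn; move: (expR (- s)) (eps + s) h1 h2 h3 p1 => e x h1 h2 h3 p1.
by field; rewrite !gt_eqF.
Qed.

Lemma continuous_profile_slope (s : R) : 0 <= s -> {for s, continuous profile_slope}.
Proof.
move=> s0; have h1 := x0 s0; have h2 := xE0 s0.
have cE : expR (- t) @[t --> s] --> expR (- s).
  exact: (dv_continuous (dv_expR (dvN (dv_id s)))).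
have cx : eps + t @[t --> s] --> eps + s by apply: cvgD; [exact: cvg_cst|exact: cvg_id].
apply: cvgM.
  by apply: cvgM => //; apply: cvgD => //; exact: cvg_cst.
apply: cvgV; first by rewrite gt_eqF// mulr_gt0.
by apply: cvgM => //; exact: cvgD.
Qed.

Lemma profile_ge0 (s : R) : 0 <= s -> 0 <= profile s.
Proof. by move=> s0; rewrite ln_ge0// lerDl divr_ge0 ?expR_ge0// ltW// x0. Qed.

Lemma profile_le (s : R) : 0 <= s -> profile s <= expR (- s) / (eps + s).
Proof. by move=> s0; apply: le_ln1Dx; rewrite (lt_le_trans (ltrN10 R))// divr_ge0 ?expR_ge0// ltW// x0. Qed.

Lemma profile_le0 (s : R) : 0 <= s -> profile s <= profile 0.
Proof.
move=> s0; have h1 := x0 s0; rewrite ler_ln ?posrE ?addr_gt0 ?divr_gt0 ?expR_gt0 ?addr0//.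
rewrite lerD2l oppr0 expR0; apply: ler_pM; rewrite ?expR_ge0 ?invr_ge0 ?(ltW h1)//.
  by rewrite -[leRHS]expR0 ler_expR oppr_le0.
by rewrite lef_pV2 ?posrE// lerDl.
Qed.

Lemma profile_cvg0 : profile s @[s --> +oo] --> (0 : R).
Proof.
apply: (squeeze_cvgr (f := fun=> 0) (h := fun s => expR (- s) / eps)).
- near=> s; have s0 : 0 <= s by near: s; exact: nbhs_pinfty_ge.
  rewrite profile_ge0// (le_trans (profile_le s0))// ler_wpM2l ?expR_ge0//.
  by rewrite lef_pV2 ?posrE ?x0// lerDl.
- exact: cvg_cst.
- rewrite -[X in _ --> X](mul0r eps^-1); apply: cvgMl; exact: cvgr_expR.
Unshelve. all: by end_near. Qed.

Lemma int_profile_slope :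
  (\int[@lebesgue_line R]_r (indb (0 < r)%R * (r ^+ 3 * profile_slope (r ^+ 4)))%:E = (profile 0 / 4)%:E)%E.
Proof.
have r4 (r : R) : 0 <= r ^+ 4 by rewrite (exprM _ 2 2) sqr_ge0.
have mX k : measurable_fun setT (fun r : R => r ^+ k) by exact: measurable_funX.
have mE : measurable_fun setT (fun r : R => expR (- r ^+ 4)) by exact: measurable_expN.
have mf : measurable_fun setT (fun r : R => r ^+ 3 * profile_slope (r ^+ 4)).
  apply: measurable_funM => //; apply: measurable_funM.
    by apply: measurable_funM => //; do 2 apply: measurable_funD => //.
  apply: measurable_fun_inv_ge0; first by move=> r; rewrite mulr_ge0 ?ltW ?x0 ?xE0.
  by apply: measurable_funM; [apply: measurable_funD|apply: measurable_funD => //; apply: measurable_funD].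
apply: (etrans (@tail_line R (fun r => - 4^-1 * profile (r ^+ 4)) _ 0 0 mf _ _ _ _)); last by rewrite expr0n/= sub0r mulNr opprK mulrC.
- move=> r _; apply: (dv_eq (dvZ (- 4^-1) (dv_comp (dv_pow 3 r) (is_derive_profile (r4 r))))).
  by field.
- move=> r _; apply: cvgM; first exact: exprn_continuous.
  apply: (@continuous_comp _ _ _ (fun r : R => r ^+ 4) profile_slope); first exact: exprn_continuous.
  exact: continuous_profile_slope.
- by move=> r r0; rewrite mulr_ge0 ?exprn_ge0// profile_slope_ge0.
- rewrite -[X in _ --> X](mulr0 (- 4^-1 : R)); apply: cvgMr.
  apply: (cvg_comp _ _ _ profile_cvg0); apply/cvgryPge => A.
  near=> r; have r1 : 1 <= r by near: r; exact: nbhs_pinfty_ge.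
  by apply: (@le_trans _ _ r); [near: r; apply: nbhs_pinfty_ge; exact: num_real|rewrite -[leLHS]expr1 ler_weXn2l].
Unshelve. all: by end_near. Qed.

Lemma profile0 : profile 0 = ln (1 + eps^-1).
Proof. by rewrite /profile oppr0 expR0 addr0 mul1r. Qed.

Lemma profile_exp_le (s : R) : 0 <= s -> profile s <= (profile 0 + 1) * expR 1 * expR (- s).
Proof.
move=> s0; have l0 := profile_ge0 (lexx 0); have [s1|s1] := leP s 1.
  apply: (le_trans (profile_le0 s0)); rewrite -mulrA -expRD.
  have : 1 <= expR (1 - s) :> R by rewrite -[leLHS]expR0 ler_expR subr_ge0.
  move: (expR _) => e e1; nra.
apply: (le_trans (profile_le s0)); apply: (@le_trans _ _ (expR (- s))).
  apply: ler_piMr; first exact: expR_ge0.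
  by rewrite invf_le1 ?x0//; apply: (le_trans (ltW s1)); rewrite lerDr ltW.
rewrite -[leLHS]mul1r ler_wpM2r ?expR_ge0// mulr_ege1//; first lra.
by rewrite -[leLHS]expR0 ler_expR.
Qed.

(** For s <= eps <= 1 the quotient e^(-s)/(eps + s) loses at most a factor e in the numerator and a
    factor 2 < e^2 in the denominator. *)
Lemma profile_ge (s : R) : eps <= 1 -> 0 <= s -> s <= eps -> profile 0 - 3 <= profile s.
Proof.
move=> e1 s0 se; have h1 := x0 s0.
have p1 : 0 < 1 + expR (- s) / (eps + s) by rewrite addr_gt0 ?divr_gt0 ?expR_gt0.
rewrite -ler_expR /profile [leRHS]lnK ?posrE// -/(profile 0) profile0 expRD lnK ?posrE ?addr_gt0 ?invr_gt0//.
rewrite mulrDl mul1r; apply: lerD; first by rewrite -[leRHS]expR0 ler_expR; lra.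
rewrite mulrC ler_pdivrMr// -mulrA [_^-1 * _]mulrC.
have -> : expR (- 3) = expR (- 1) * expR (- 2) :> R by rewrite -expRD; congr expR; lra.
apply: (@le_trans _ _ (expR (- s) * 2^-1)); last first.
  rewrite ler_wpM2l ?expR_ge0// ler_pdivlMr//; lra.
apply: ler_pM; rewrite ?expR_ge0//; first by rewrite ler_expR; lra.
rewrite expRN lef_pV2 ?posrE ?expR_gt0//; apply: le_trans (expR_ge1Dx 2); lra.
Qed.

End profile.

Section exp_tail_lower.
Context (R : realType).

(* [x^j / j! <= 2^N (x/2)^j / j!] for [j <= N], so the omitted terms sum to at most
   [2^N e^{x/2}]. *)
Lemma exp_tail_ge N (x : R) : (2 * N.+1)%:R <= x -> expR x / 2 <= exp_tail N x.
Proof.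
move=> Nx; have x0 : 0 <= x by apply: le_trans Nx.
have h : \sum_(j < N.+1) x ^+ j / j`!%:R <= 2 ^+ N * expR (x / 2).
  apply: (@le_trans _ _ (2 ^+ N * \sum_(j < N.+1) (x / 2) ^+ j / j`!%:R)).
    rewrite mulr_sumr; apply: ler_sum => j _; rewrite mulrA ler_wpM2r ?invr_ge0//.
    rewrite expr_div_n mulrCA ler_peMr ?exprn_ge0// ler_pdivlMr ?exprn_gt0// mul1r.
    by rewrite ler_weXn2l ?ler1n// -ltnS.
  by rewrite ler_wpM2l ?exprn_ge0// exp_sum_le// divr_ge0.
have e2 : 2 ^+ N.+1 <= expR (x / 2) :> R.
  apply: (@le_trans _ _ (expR N.+1%:R)); last first.
    by rewrite ler_expR ler_pdivlMr// -natrM mulnC.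
  rewrite -[N.+1%:R]mulr1 expRM_natl lerXn2r ?nnegrE ?expR_ge0//.
  by apply: le_trans (expR_ge1Dx 1).
rewrite /exp_tail lerBrDr -lerBrDl; apply: (le_trans h).
have -> : expR x = expR (x / 2) * expR (x / 2) :> R by rewrite -expRD; congr expR; field.
move: e2; rewrite exprS; move: (expR (x / 2)) (expR_ge0 (x / 2)) => e e0 e2.
nra.
Qed.

Lemma expR_not_le_powR (t K m : R) : 0 < t ->
  exists2 y0 : R, 1 <= y0 & forall L, y0 <= L -> K * (L + 1) `^ m < expR (t * L).
Proof.
move=> t0; pose k := (Num.truncn `|m|).+1; have mk : m <= k%:R.
  by apply: (le_trans (ler_norm m)); rewrite ltW// truncnS_gt.
(* Chosen so that the term of order k + 1 of the exponential series wins as soon as L + 1 exceeds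
   it. *)
pose K' := `|K| * (k.+1)`!%:R * expR t / t ^+ k.+1.
have tk : 0 < t ^+ k.+1 by exact: exprn_gt0.
have f0 : 0 < (k.+1)`!%:R :> R by rewrite ltr0n fact_gt0.
have et : 0 < expR t by exact: expR_gt0.
have K'0 : 0 <= K' := divr_ge0 (mulr_ge0 (mulr_ge0 (normr_ge0 K) (ltW f0)) (ltW et)) (ltW tk).
exists (1 + K') => [|L hL]; first by rewrite lerDl.
have L1 : 1 <= L + 1 by lra.
have L0 : 0 < L + 1 by lra.
have LK : K' < L + 1 by lra.
apply: (@le_lt_trans _ _ (`|K| * (L + 1) ^+ k)).
  apply: (@le_trans _ _ (`|K| * (L + 1) `^ m)); first by rewrite ler_wpM2r ?powR_ge0 ?ler_norm.
  by rewrite ler_wpM2l// -powR_mulrn ?(ltW L0)// ler_powR.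
have -> : `|K| = K' * (t ^+ k.+1 / ((k.+1)`!%:R * expR t)).
  by rewrite /K'; move: (k.+1)`!%:R (expR t) (t ^+ k.+1) f0 et tk => a b c a0 b0 c0; field; rewrite !gt_eqF.
have -> : t * L = t * (L + 1) - t by ring.
rewrite expRD expRN.
apply: (@lt_le_trans _ _ ((L + 1) * (t ^+ k.+1 / ((k.+1)`!%:R * expR t)) * (L + 1) ^+ k)).
  by rewrite ltr_pM2r ?exprn_gt0// ltr_pM2r// divr_gt0// mulr_gt0.
have h : (t * (L + 1)) ^+ k.+1 / (k.+1)`!%:R <= expR (t * (L + 1)).
  have tL0 : 0 <= t * (L + 1) by rewrite mulr_ge0 ?ltW.
  apply: le_trans (exp_sum_le k.+2 tL0); rewrite big_ord_recr/= lerDr.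
  by apply: sumr_ge0 => j _; rewrite divr_ge0// exprn_ge0.
apply: le_trans (ler_wpM2r (ltW (_ : 0 < (expR t)^-1)) h); last by rewrite invr_gt0.
rewrite exprMn [(L + 1) ^+ k.+1]exprS.
move: (k.+1)`!%:R (expR t) (t ^+ k.+1) ((L + 1) ^+ k) f0 et tk => a b c d a0 b0 c0.
rewrite le_eqVlt; apply/orP; left; apply/eqP; field; rewrite !gt_eqF//.
Qed.

End exp_tail_lower.

Section extremal.
Context (R : realType) (n : nat).
Local Notation C := (Cn R n).
Local Notation H := (heis R n).
Local Notation Q := (@hdim n).
Local Notation mu := (@haar R n).
Local Notation muC := (@lebesgue_C R n).
Local Notation lam := (@lebesgue_line R).

Lemma int_exp_hN4_fin : (\int[mu]_p (expR (- hN4 p))%:E < +oo)%E.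
Proof.
have gl := int_gauss_line R.
have mf : measurable_fun setT (fun z : C => expR (- sqn z)).
  by apply: measurable_expN; exact: measurable_fun_sqn.
have mg : measurable_fun setT (fun t : R => expR (- t ^+ 2)).
  by apply: measurable_expN; exact: measurable_funX.
apply: (@le_lt_trans _ _ (\int[mu]_p ((expR 1)%:E * (expR (- sqn p.1) * expR (- p.2 ^+ 2))%:E))%E).
  apply: int_le => [p|||p].
  - by rewrite lee_fin expR_ge0.
  - by apply/measurable_EFinP; apply: measurable_expN; exact: measurable_fun_hN4.
  - apply: emeasurable_funM => //; apply/measurable_EFinP; apply: measurable_funM.
      exact: (measurableT_comp mf measurable_fst).
    exact: (measurableT_comp mg measurable_snd).
  - rewrite -EFinM lee_fin -!expRD ler_expR /hN4; have := sqr_ge0 (sqn p.1 - 1); nra.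
rewrite intZ ?expR_ge0//; last first.
- apply/measurable_EFinP; apply: measurable_funM.
    exact: (measurableT_comp mf measurable_fst).
  exact: (measurableT_comp mg measurable_snd).
rewrite (@int_haar_prod R n (fun z => expR (- sqn z)) (fun t => expR (- t ^+ 2)) mf mg).
- by rewrite gl int_gauss_C -!EFinM ltry.
- by move=> z; exact: expR_ge0.
- by move=> t; exact: expR_ge0.
- by rewrite gl.
Qed.

Lemma hdim_even : Q = (2 * n.+1)%N.
Proof. by rewrite hdim_double mul2n. Qed.

(** With b the slope and s = N^4, this isolates one factor b in the power Q of the gradient and
    pairs the others with s. *)
Lemma power_split (a b z s : R) (j : nat) : s != 0 ->
  ((a * b) ^+ 2 * s * z) ^+ j.+1 =
  a ^+ (2 * j.+1) * (z ^+ j.+1 * (b * s^-1 ^+ j)) * (s * b) ^+ (2 * j).+1.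
Proof.
move=> s0; rewrite (exprMn _ ((a * b) ^+ 2 * s) z) (exprMn _ ((a * b) ^+ 2) s) -exprM exprMn (exprMn _ s b).
have -> : b ^+ (2 * j.+1) = b * b ^+ (2 * j).+1 by rewrite -exprS mulnS.
have -> : s ^+ (2 * j).+1 = s ^+ j * s ^+ j.+1 by rewrite -exprD; congr (_ ^+ _); lia.
rewrite exprVn; move: (s ^+ j) (expf_neq0 j s0) => t t0; by field.
Qed.

Variable sigma : {measure set H -> \bar R}.
Hypothesis hsigma : sphere_measure sigma.
Hypothesis n0 : (0 < n)%N.
Local Notation c := (csphere sigma).

Variables (eps k : R).
Hypotheses (eps0 : 0 < eps) (k0 : 0 <= k).
Local Notation l := (profile eps).
Local Notation m := (profile_slope eps).

Definition extremal (p : H) : R := k * l (hN4 p).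

Let u' (v p : H) : R := - (k * m (hN4 p)) * (4 * sqn p.1 * cdot p.1 v.1 + 2 * p.2 * v.2).

Let s0 (p : H) : 0 <= hN4 p. Proof. exact: hN4_ge0. Qed.

Let chN4 : continuous (@hN4 R n). Proof. exact: smooth_continuous (smooth_hN4 R n). Qed.

Let du p v : is_derive p v extremal (u' v p).
Proof.
have h := coord_derive_hN4 (coord_derive_id p v).
by apply: (dv_eq (dvZ k (dv_comp h (is_derive_profile eps0 (s0 p))))); rewrite /u'; ring.
Qed.

Let cu : continuous extremal.
Proof.
apply: continuous_funZ => p; apply: (@continuous_comp _ _ _ (@hN4 R n) l); first exact: chN4.
exact: (dv_continuous (is_derive_profile eps0 (s0 p))).
Qed.

Let cu' v : continuous (u' v).
Proof.
have [s1 s2 s3] := @smooth_coord R n.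
have ssq (f : H -> R) : smooth f -> smooth (fun y => f y ^+ 2).
  by move=> sf; under eq_fun do rewrite expr2; exact: smoothM.
have sS : smooth (fun p : H => sqn p.1).
  by apply: smooth_sum => j; apply: smoothD; exact: ssq.
have sD : smooth (fun p : H => cdot p.1 v.1).
  by apply: smooth_sum => j; apply: smoothD; apply: smoothM => //; exact: smooth_cst.
apply: continuous_funM.
  rewrite (_ : (fun _ => _) = (fun p => (- k) * m (hN4 p))); last by apply/funext => p; rewrite mulNr.
  apply: continuous_funZ => p; apply: (@continuous_comp _ _ _ (@hN4 R n) m); first exact: chN4.
  exact: continuous_profile_slope.
apply: smooth_continuous; apply: smoothD; apply: smoothM; try exact: smooth_cst => //.
- by apply: smoothM => //; exact: smooth_cst.
- by [].
- by apply: smoothM => //; exact: smooth_cst.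
Qed.

Definition extremal_grad : H -> C := hgrad u'.

Lemma weak_hgrad_extremal : weak_hgrad extremal extremal_grad.
Proof. exact: weak_hgrad_C1 cu cu' du. Qed.

(** The horizontal gradient of N^4 has square 16 N^4 |z|^2: the mixed terms of X_j and Y_j
    cancel. *)
Lemma sqn_extremal_grad (p : H) :
  sqn (extremal_grad p) = (4 * k * m (hN4 p)) ^+ 2 * hN4 p * sqn p.1.
Proof.
transitivity (\sum_(j < n) (4 * k * m (hN4 p)) ^+ 2 * hN4 p * (p.1.1 ord0 j ^+ 2 + p.1.2 ord0 j ^+ 2)).
  apply: eq_bigr => j _; rewrite !mxE /u' !cdot_delta !cdot_dt /=.
  by move: (m (hN4 p)) => b; rewrite /hN4; ring.
by rewrite -mulr_sumr.
Qed.

(* [(s m)^(Q-1) <= 1], for [m] the slope of the profile at [s = N^4], leaves one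
   factor [m], whose integral is [profile 0 / 4]. *)
Lemma int_extremal_grad : (\int[mu]_p (enorm (extremal_grad p) ^+ Q)%:E <=
  ((4 * k) ^+ Q * (l 0 / 4 * c))%:E)%E.
Proof.
(* The slope is controlled for s >= 0 only, so the argument is cut off at 0 to obtain a nonnegative
   function on the whole line. *)
pose g (s : R) : R := m (Num.max s 0) * (Num.max s 0)^-1 ^+ n.
have mx0 s : 0 <= Num.max s 0 :> R by rewrite le_max lexx orbT.
have gE s : 0 <= s -> g s = m s * s^-1 ^+ n by move=> h; rewrite /g max_l.
have g0 s : 0 <= g s.
  by rewrite mulr_ge0 ?profile_slope_ge0// exprn_ge0// invr_ge0.
have mg : measurable_fun setT g.
  have mm : measurable_fun setT (fun s : R => Num.max s 0) by exact: measurable_maxr.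
  have mE : measurable_fun setT (fun s : R => expR (- Num.max s 0)) by exact: measurable_expN.
  apply: measurable_funM; last by apply: measurable_funX; exact: measurable_fun_inv_ge0.
  apply: measurable_funM.
    by apply: measurable_funM => //; do 2 apply: measurable_funD => //.
  apply: measurable_fun_inv_ge0.
    by move=> s; rewrite mulr_ge0 ?addr_ge0 ?expR_ge0 ?(ltW eps0).
  by apply: measurable_funM; [apply: measurable_funD|apply: measurable_funD => //; apply: measurable_funD].
have me : measurable_fun setT (fun p : H => enorm p.1 ^+ Q).
  by apply: measurable_funX; apply: measurable_fun_enorm; exact: measurable_fst.
have e0 (p : H) : 0 <= enorm p.1 ^+ Q by rewrite exprn_ge0// enorm_ge0.
have mG := measurable_weak_hgrad weak_hgrad_extremal.
apply: (@le_trans _ _ (\int[mu]_p (((4 * k) ^+ Q)%:E * (enorm p.1 ^+ Q * g (hN4 p))%:E))%E).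
  apply: int_le => [p|||p].
  - by rewrite lee_fin exprn_ge0// enorm_ge0.
  - by apply/measurable_EFinP; apply: measurable_funX; exact: measurable_fun_enorm.
  - apply: emeasurable_funM => //; apply/measurable_EFinP; apply: measurable_funM => //.
    by apply: (measurableT_comp mg); exact: measurable_fun_hN4.
  - rewrite -EFinM lee_fin !enorm_hdim sqn_extremal_grad gE//.
    have m0 := profile_slope_ge0 eps0 (s0 p); have m1 := profile_slope_le eps0 (s0 p).
    have [->|z0] := eqVneq (sqn p.1) 0; first by rewrite !(mulr0, mul0r) expr0n/= mul0r mulr0.
    have sp : 0 < hN4 p.
      by apply: lt_le_trans (sqn_le_hN4 p); rewrite exprn_gt0// lt0r z0 sqn_ge0.
    have E1 := power_split (4 * k) (m (hN4 p)) (sqn p.1) n (lt0r_neq0 sp); rewrite -hdim_even in E1.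
    rewrite E1; move: (m (hN4 p)) m0 m1 {E1} => b m0 m1.
    apply: ler_piMr; last by rewrite exprn_ile1// mulr_ge0.
    by rewrite !mulr_ge0 ?exprn_ge0 ?mulr_ge0 ?invr_ge0 ?sqn_ge0.
rewrite intZ; last 3 first.
- by rewrite exprn_ge0// mulr_ge0.
- by move=> p; rewrite lee_fin mulr_ge0.
- apply/measurable_EFinP; apply: measurable_funM => //.
  by apply: (measurableT_comp mg); exact: measurable_fun_hN4.
rewrite (polar_product' hsigma me mg e0 g0 (k := Q)); last first.
  by move=> r p r0; rewrite enorm_hdil// exprMn.
rewrite EFinM; apply: lee_wpmul2l; first by rewrite lee_fin exprn_ge0// mulr_ge0.
rewrite -/(csphere_e sigma) csphereE// EFinM; apply: lee_wpmul2r.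
  by rewrite lee_fin ltW// csphere_gt0.
rewrite -int_profile_slope//; apply: eqW; apply: eq_int => r; congr _%:E.
case: (ltP 0 r) => r0; rewrite indbE ?mul0r// !mul1r.
rewrite gE ?exprn_ge0 ?(ltW r0)// mulrCA [RHS]mulrC; congr (_ * _).
have -> : (Q + Q.-1 = 3 + 4 * n)%N by rewrite /hdim; lia.
by rewrite exprD exprVn -exprM mulfK// expf_neq0// gt_eqF.
Qed.

End extremal.

Section Lnorm_finite.
Context d (T : measurableType d) (R : realType) (m : {measure set T -> \bar R}).
Variables (f : T -> R) (r : R).
Hypotheses (r0 : 0 < r) (mf : measurable_fun setT f).

Lemma Lfun_int_powR : (\int[m]_x (`|f x| `^ r)%:E < +oo)%E -> f \in Lfun m r%:E.
Proof.
move=> h; apply/andP; split; rewrite inE//=.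
by rewrite /finite_norm; apply: (@lty_poweRy _ _ r); rewrite ?gt_eqF// Lnorm_powR.
Qed.

Lemma Lnorm_int_le1 : (\int[m]_x (`|f x| `^ r)%:E <= 1)%E -> ('N[m]_(r%:E)[EFin \o f] <= 1)%E.
Proof.
move=> h; have I0 : (0 <= \int[m]_x (`|f x| `^ r)%:E)%E by apply: int_ge0 => x; rewrite lee_fin powR_ge0.
have -> : ('N[m]_(r%:E)[EFin \o f] = (\int[m]_x (`|f x| `^ r)%:E) `^ r^-1)%E.
  by rewrite -Lnorm_powR// -poweRrM mulfV ?gt_eqF// poweRe1// Lnorm_ge0.
have hh : ((\int[m]_x (`|f x| `^ r)%:E) `^ r^-1 <= 1 `^ r^-1)%E.
  apply: gt0_ler_poweR h; first by rewrite invr_ge0 ltW.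
    by rewrite in_itv/= leey andbT.
  by rewrite in_itv/= leey andbT.
by move: hh; rewrite poweR1r.
Qed.

End Lnorm_finite.

(** * Failure of the inequality for larger exponential constants *)

Section sharpness.
Context (R : realType) (n : nat).
Local Notation C := (Cn R n).
Local Notation H := (heis R n).
Local Notation Q := (@hdim n).
Local Notation g := (gexp R n).
Local Notation q := (qexp R n).
Local Notation mu := (@haar R n).
Variable sigma : {measure set H -> \bar R}.
Hypothesis hsigma : sphere_measure sigma.
Hypothesis n0 : (0 < n)%N.
Local Notation c := (csphere sigma).
Variables (p a : R).
Hypotheses (p1 : (1 : R) <= p) (a0 : (0 : R) < a).
(** The number [b] is the exponential rate in L that the constant a produces on the extremal of
    height L. As 1/A = Q c^g, it exceeds Q/4 exactly when a exceeds 1/A. *)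
Variables (b : R) (N : nat).
Hypotheses (bE : b = a * c `^ (- g) / 4) (NE : N = `|Num.ceil (p * ((Q%:R - 1) / Q%:R) - 1)|%N).

Let c0 : 0 < c. Proof. exact: csphere_gt0. Qed.
Let Q0 : 0 < Q%:R :> R. Proof. by rewrite ltr0n (ltn_trans _ (hdim_gt1 n)). Qed.
Let g0 : 0 < g. Proof. exact: gexp_gt0. Qed.
Let g1 : g <= 1. Proof. by apply: (le_trans (gexp_le3 R n0)); lra. Qed.
Let b0 : 0 < b. Proof. by rewrite bE divr_gt0// mulr_gt0// powR_gt0. Qed.
Let q0 : 0 < q. Proof. by rewrite qexp_gexp addr_gt0. Qed.

Section fixed_scale.
(** The choice of [eps] gives the profile the maximum L, and that of [k] makes the energy bound
    (4k)^Q (L/4) c equal to 1. The plateau N^4 < eps then has measure of order e^(-QL/4), against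
    which [b] competes. *)
Variables (L k eps : R).
Hypotheses (kE : k = (4 / (c * L)) `^ Q%:R^-1 / 4) (epsE : eps = (expR L - 1)^-1).
Hypotheses (L7 : (7 : R) <= L) (Lc : (4 : R) <= c * L) (LN : (2 * N.+1)%:R <= b * (L - 6)).

Let L0 : 0 < L. Proof. by apply: lt_le_trans L7. Qed.

Let k0 : 0 < k. Proof. by rewrite kE divr_gt0// powR_gt0// divr_gt0// mulr_gt0. Qed.

Let k1 : k <= 1.
Proof.
have h : (4 / (c * L)) `^ Q%:R^-1 <= 1.
  have x1 : 4 / (c * L) <= 1 by rewrite ler_pdivrMr ?mul1r// mulr_gt0.
  have x0 : 0 <= 4 / (c * L) by rewrite divr_ge0// mulr_ge0 ?ltW.
  have h1 : 1 `^ Q%:R^-1 = 1 :> R by rewrite powR1.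
  by rewrite -[leRHS]h1 ge0_ler_powR ?nnegrE ?invr_ge0// ltW.
rewrite kE; lra.
Qed.

Let k_powR : k `^ q = c `^ (- g) * L `^ (- g) / 4.
Proof.
have cL0 : 0 < c * L by rewrite mulr_gt0.
have E1 : q = 1 + g := qexp_gexp R n.
have E2 : Q%:R^-1 * q = g.
  by rewrite /qexp /gexp mulrA mulVf ?mul1r// gt_eqF.
rewrite kE powRM ?powR_ge0// -powRrM E2 powRM ?invr_ge0 ?(ltW cL0)//.
rewrite -(powRN_inv g (ltW cL0)) (powRM (- g) (ltW c0) (ltW L0)).
rewrite E1 powRD; last by rewrite -E1 gt_eqF.
rewrite powRr1// -[4^-1 `^ g]powRN_inv// (powRN 4 g).
have : 0 < 4 `^ g :> R by exact: powR_gt0.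
move: (4 `^ g) (c `^ _) (L `^ _) => x y z x0; by field; rewrite gt_eqF.
Qed.

(** Since k^q = c^(-g) L^(-g) / 4, only lower order terms are lost: (L - 3)^(1+g) L^(-g) >= (L -
    3)^2 / L >= L - 6. *)
Lemma extremal_exponent (v : R) : k * (L - 3) <= v -> b * (L - 6) <= a * v `^ q.
Proof.
have l7 : 7 <= L := L7; have hp : 1 <= p := p1.
move=> kv; have L3 : 0 < L - 3 by lra.
have kL0 : 0 <= k * (L - 3) by rewrite mulr_ge0 ?(ltW k0)// ltW.
apply: (@le_trans _ _ (a * (k * (L - 3)) `^ q)); last first.
  rewrite ler_wpM2l ?(ltW a0)// ge0_ler_powR ?nnegrE ?(ltW q0)//; exact: le_trans kv.
rewrite powRM ?(ltW k0) ?(ltW L3)// k_powR qexp_gexp powRD; last by rewrite -qexp_gexp gt_eqF.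
rewrite powRr1 ?(ltW L3)//.
have E : L `^ (- g) * (L - 3) `^ g = ((L - 3) / L) `^ g.
  by rewrite powRM ?invr_ge0 ?(ltW L3) ?(ltW L0)// -(powRN_inv g (ltW L0)) mulrC.
have h : (L - 3) / L <= ((L - 3) / L) `^ g.
  have x0 : 0 < (L - 3) / L by rewrite divr_gt0.
  have x1 : (L - 3) / L <= 1 by rewrite ler_pdivrMr// mul1r; lra.
  by rewrite -[leLHS]powRr1 ?(ltW x0)// ger_powR// x0.
have -> : a * (c `^ (- g) * L `^ (- g) / 4 * ((L - 3) * (L - 3) `^ g)) =
    b * ((L - 3) * (L `^ (- g) * (L - 3) `^ g)) by rewrite bE; ring.
rewrite E ler_wpM2l ?(ltW b0)//; apply: le_trans (ler_wpM2l (ltW L3) h).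
rewrite mulrA ler_pdivlMr//; lra.
Qed.

(** At these heights the exponential tail is at least half of the exponential, and the denominator
    is at most twice (L + 1)^p. *)
Lemma growth_extremal (v : R) : k * (L - 3) <= v -> v <= L ->
  expR (b * (L - 6)) / (4 * (L + 1) `^ p) <= growth n p a v.
Proof.
have l7 : 7 <= L := L7; have hp : 1 <= p := p1.
move=> kv vL; have L3 : 0 < L - 3 by lra.
have v0 : 0 <= v by apply: le_trans kv; rewrite mulr_ge0 ?(ltW k0)// ltW.
have h1 := extremal_exponent kv.
have pL : 1 <= (L + 1) `^ p.
  have h0 : (L + 1) `^ 0 = 1 := powRr0 _.
  by rewrite -[leLHS]h0 ler_powR; lra.
have den : 1 + v `^ (p / (Q%:R - 1)) <= 2 * (L + 1) `^ p.
  have : v `^ (p / (Q%:R - 1)) <= (L + 1) `^ p.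
    apply: (@le_trans _ _ ((L + 1) `^ (p / (Q%:R - 1)))).
      rewrite ge0_ler_powR ?nnegrE//; try lra.
      by rewrite divr_ge0// ?(ltW (Q1_gt0 R n)); lra.
    rewrite ler_powR//; first lra.
    by rewrite -/g ler_piMr//; lra.
  lra.
have d0 : 0 < 1 + v `^ (p / (Q%:R - 1)) by rewrite ltr_pwDl// powR_ge0.
apply: (@le_trans _ _ (expR (b * (L - 6)) / 2 / (1 + v `^ (p / (Q%:R - 1))))).
  rewrite ler_pdivlMr// mulrAC ler_pdivrMr ?mulr_gt0 ?powR_gt0//; last lra.
  have := expR_gt0 (b * (L - 6)); move: (expR _) ((L + 1) `^ p) (v `^ _) den => e x y den e0; nra.
rewrite /growth -NE ler_wpM2r ?invr_ge0 ?(ltW d0)//.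
apply: le_trans (exp_tail_ge (le_trans LN h1)).
by rewrite ler_wpM2r// ler_expR.
Qed.

Let eL : 1 < expR L - 1.
Proof. have l7 : 7 <= L := L7; have := expR_ge1Dx L; lra. Qed.
Let eps0 : 0 < eps. Proof. by have h := eL; rewrite epsE invr_gt0; lra. Qed.
Let eps1 : eps <= 1. Proof. by have h := eL; rewrite epsE invf_le1; lra. Qed.
Let epsL : expR (- L) <= eps.
Proof. by have h := eL; rewrite epsE expRN lef_pV2 ?posrE ?expR_gt0//; lra. Qed.
Let profL : profile eps 0 = L.
Proof. by rewrite profile0 epsE invrK addrC subrK expRK. Qed.

Local Notation u := (extremal eps k : H -> R).
Local Notation G := (@extremal_grad R n eps k).
Let wg : weak_hgrad u G. Proof. by apply: weak_hgrad_extremal. Qed.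
Let measurable_u : measurable_fun setT u. Proof. by have [[]] := wg. Qed.
Let s0 (x : H) : 0 <= hN4 x. Proof. exact: hN4_ge0. Qed.
Let u0 x : 0 <= u x. Proof. by rewrite /extremal mulr_ge0 ?(ltW k0)// profile_ge0. Qed.

Let uL x : u x <= (L + 1) * expR 1 * expR (- hN4 x).
Proof.
have h := profile_exp_le eps0 (s0 x); rewrite profL in h.
apply: le_trans h; rewrite /extremal; apply: ler_piMl => //; exact: (profile_ge0 eps0 (s0 x)).
Qed.

Let int_u : (\int[mu]_x (`|u x| `^ p)%:E <=
  (((L + 1) * expR 1) `^ p * fine (\int[mu]_x (expR (- hN4 x))%:E))%:E)%E.
Proof.
have l7 : 7 <= L := L7; have hp : 1 <= p := p1.
have K0 : 0 <= (L + 1) * expR 1 by rewrite mulr_ge0 ?expR_ge0//; lra.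
have I0 : (0 <= \int[mu]_x (expR (- hN4 x))%:E)%E by apply: int_ge0 => x; rewrite lee_fin expR_ge0.
rewrite EFinM fineK; last by rewrite ge0_fin_numE// int_exp_hN4_fin.
have mE : measurable_fun setT (fun x : H => (expR (- hN4 x))%:E).
  by apply/measurable_EFinP; apply: measurable_expN; exact: measurable_fun_hN4.
rewrite -intZ ?powR_ge0//.
apply: int_le => [x|||x].
- by rewrite lee_fin powR_ge0.
- by apply/measurable_EFinP; apply: measurable_fun_powR; exact: measurableT_comp.
- exact: emeasurable_funM.
- rewrite -EFinM lee_fin ger0_norm//.
  apply: (@le_trans _ _ (((L + 1) * expR 1 * expR (- hN4 x)) `^ p)).
    apply: ge0_ler_powR; rewrite ?nnegrE//; first lra.
    by rewrite mulr_ge0 ?expR_ge0.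
  rewrite powRM ?expR_ge0// ler_wpM2l ?powR_ge0// -expRM ler_expR.
  have := s0 x; nra.
Qed.

Let int_G : (\int[mu]_x (`|enorm (G x)| `^ Q%:R)%:E <= 1)%E.
Proof.
apply: (@le_trans _ _ (((4 * k) ^+ Q * (profile eps 0 / 4 * c))%:E)%E).
  apply: le_trans (int_extremal_grad hsigma n0 eps0 (ltW k0)).
  apply: eqW; apply: eq_int => x; rewrite ger0_norm ?enorm_ge0// powR_mulrn//; exact: enorm_ge0.
rewrite lee_fin profL.
have -> : (4 * k) ^+ Q = 4 / (c * L).
  have x0 : 0 <= 4 / (c * L) by rewrite divr_ge0// mulr_ge0 ?ltW.
  rewrite kE mulrC divfK// -powR_mulrn ?powR_ge0// -powRrM mulVf ?powRr1// gt_eqF//.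
by rewrite le_eqVlt; apply/orP; left; apply/eqP; field; rewrite !gt_eqF.
Qed.

Local Notation v0 := (fine (\int[mu]_x (indb (hN4 x < 1)%R)%:E)%E).

(** The left side bounds the growth on the ball N^4 < eps, where the profile is within 3 of its
    maximum, times the measure of that ball, since eps >= e^(-L). *)
Lemma growth_extremal_bound (K : R) : 0 <= K -> @exact_growth_inequality R n a p K ->
  v0 * expR (- (Q%:R / 4) * L) * (expR (b * (L - 6)) / (4 * (L + 1) `^ p)) <=
  K * (((L + 1) * expR 1) `^ p * fine (\int[mu]_x (expR (- hN4 x))%:E)).
Proof.
have l7 : 7 <= L := L7; have hp : 1 <= p := p1.
move=> K0 hK; have p0 : 0 < p by lra.
have mG : measurable_fun setT (fun x => enorm (G x)).
  by apply: measurable_fun_enorm; exact: (measurable_weak_hgrad wg).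
have su : sobolev Q%:R p u.
  split; first by apply: Lfun_int_powR => //; apply: (le_lt_trans int_u); rewrite ltry.
  by exists G => //; apply: Lfun_int_powR => //; apply: (le_lt_trans int_G); rewrite ltry.
have := hK u G su wg (Lnorm_int_le1 Q0 int_G); rewrite Lnorm_powR// => h.
rewrite -lee_fin [X in (_ <= X)%E]EFinM.
apply: le_trans (lee_wpmul2l _ int_u); last by rewrite lee_fin.
apply: le_trans h; have vE : (\int[mu]_x (indb (hN4 x < 1)%R)%:E = v0%:E)%E.
  rewrite fineK// ge0_fin_numE; last by apply: int_ge0 => x; rewrite lee_fin.
  exact: haar_ball_fin.
set V := fine (\int[mu]_x (indb (hN4 x < 1)%R)%:E) in vE *.
have V0 : 0 <= V by apply: fine_ge0; apply: int_ge0 => x; rewrite lee_fin.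
set kap := expR _ / _; have kap0 : 0 <= kap by rewrite divr_ge0 ?expR_ge0// mulr_ge0// powR_ge0.
have mi : measurable_fun setT (fun x : H => (indb (hN4 x < eps) : R)%:E).
  by apply/measurable_EFinP; apply: measurable_fun_ltR => //; exact: measurable_fun_hN4.
apply: (@le_trans _ _ (\int[mu]_x (kap%:E * (indb (hN4 x < eps)%R)%:E))%E).
  rewrite intZ//; last by move=> x; rewrite lee_fin.
  rewrite (haar_qball_lt n eps0) vE -!EFinM lee_fin mulrC ler_wpM2l//.
  rewrite mulrC ler_wpM2r//.
  apply: (@le_trans _ _ (expR (- L) `^ (Q%:R / 4))).
    by rewrite -expRM ler_expR; lra.
  by rewrite ge0_ler_powR ?nnegrE ?expR_ge0 ?(ltW eps0)// divr_ge0// ltW.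
apply: int_le => [x|||x].
- by rewrite mule_ge0// lee_fin.
- exact: emeasurable_funM.
- apply/measurable_EFinP; apply: (measurableT_comp (measurable_growth n p a)).
  exact: measurableT_comp.
- rewrite -EFinM lee_fin -/(growth n p a _); case: (ltP (hN4 x) eps) => xe; rewrite indbE ?mulr1 ?mulr0; last first.
    by apply: growth_ge0; exact: ltW.
  rewrite ger0_norm//; apply: growth_extremal.
    have := profile_ge eps0 eps1 (s0 x) (ltW xe); rewrite profL => h1.
    by rewrite /extremal ler_wpM2l// ltW.
  have := profile_le0 eps0 (s0 x); rewrite profL; apply: le_trans.
  by rewrite /extremal; apply: ler_piMl => //; exact: (profile_ge0 eps0 (s0 x)).
Qed.

End fixed_scale.

(** As b > Q/4, the left side of [growth_extremal_bound] grows exponentially in L but for a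
    denominator of order (L + 1)^p, while the right side grows like (L + 1)^p. *)
Lemma exact_growth_sharp : (A_const sigma)^-1 < a -> ~ exists K : R, @exact_growth_inequality R n a p K.
Proof.
move=> aA [K0 hK0]; have A0 := A_const_gt0 hsigma n0.
(* Enlarging the constant weakens the inequality, so it may be taken nonnegative. *)
pose K := Num.max K0 0; have K_ge0 : 0 <= K by rewrite le_max lexx orbT.
have hK : @exact_growth_inequality R n a p K.
  move=> u G su wg G1; apply: (le_trans (hK0 u G su wg G1)).
  by apply: lee_wpmul2r; rewrite ?poweR_ge0// lee_fin le_max lexx.
have t0 : 0 < b - Q%:R / 4.
  rewrite subr_gt0 bE; move: aA; rewrite A_const_csphere invfM invrK -/(gexp R n) => aA.
  have d0 : 0 < c `^ (- g) by exact: powR_gt0.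
  by rewrite ltr_pM2r// -ltr_pdivrMr.
pose v0 : R := fine (\int[mu]_x (indb (hN4 x < 1)%R)%:E).
have v0_gt0 : 0 < v0.
  rewrite fine_gt0// (haar_ball_gt0 hsigma n0)/=; exact: haar_ball_fin.
pose I0 : R := fine (\int[mu]_x (expR (- hN4 x))%:E).
have I0_ge0 : 0 <= I0 by apply: fine_ge0; apply: int_ge0 => x; rewrite lee_fin expR_ge0.
pose M := 4 * expR (6 * b) * K * (expR 1 `^ p) * I0 / v0.
have [y0 _ hy] := expR_not_le_powR M (2 * p) t0.
pose L := Num.max (Num.max y0 7) (Num.max (4 / c) (6 + (2 * N.+1)%:R / b)).
have [L1 L2 L3 L4] : [/\ y0 <= L, 7 <= L, 4 / c <= L & 6 + (2 * N.+1)%:R / b <= L].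
  by split; rewrite /L !le_max lexx ?orbT.
have cL : 4 <= c * L by rewrite mulrC -ler_pdivrMr.
have LN : (2 * N.+1)%:R <= b * (L - 6) by rewrite mulrC -ler_pdivrMr// lerBrDl.
have := growth_extremal_bound (erefl _) (erefl _) L2 cL LN K_ge0 hK; rewrite -/v0 -/I0.
have := hy L L1; rewrite ltNge => /negP hn hb; apply: hn; move: hb.
have L0 : 0 < L + 1 by lra.
have -> : (L + 1) `^ (2 * p) = (L + 1) `^ p * (L + 1) `^ p.
  by rewrite -powRD ?mulr2n ?mulrDl ?mul1r//; apply/implyP => _; rewrite gt_eqF.
have -> : (b - Q%:R / 4) * L = 6 * b + (- (Q%:R / 4) * L + b * (L - 6)) by ring.
rewrite 2!expRD powRM ?expR_ge0 ?(ltW L0)//.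
have x0 : 0 < (L + 1) `^ p by exact: powR_gt0.
have e0 := expR_gt0 (6 * b); rewrite /M.
move: ((L + 1) `^ p) x0 (expR (6 * b)) e0 (expR (- (Q%:R / 4) * L)) (expR (b * (L - 6))) (expR 1 `^ p) => x x0 e e0 y z w h.
have x1 : 0 < 4 * x by rewrite mulr_gt0.
have h' : v0 * y * z <= K * (x * w * I0) * (4 * x).
  by rewrite -ler_pdivrMr//; apply: le_trans h; rewrite -!mulrA.
have -> : 4 * e * K * w * I0 / v0 * (x * x) = e * (K * (x * w * I0) * (4 * x)) / v0 by ring.
rewrite ler_pdivlMr//; have -> : e * (y * z) * v0 = e * (v0 * y * z) by ring.
by rewrite ler_wpM2l// ltW.
Qed.

End sharpness.

Theorem theorem6 (R : realType) (n : nat) (hn : (0 < n)%N)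
    (sigma : {measure set (heis R n) -> \bar R})
    (hsigma : sphere_measure sigma) (p : R) (hp : 1 <= p) :
  let Q : R := (@hdim n)%:R in
  let A := A_const sigma in
  [/\ A = Q^-1 * (Gamma_fun (Q / 2) * Gamma_fun n%:R
                   / (2 * pi `^ (n%:R + 1 / 2) * Gamma_fun ((Q - 1) / 2)))
                  `^ (Q - 1)^-1,
      exists C : R, @exact_growth_inequality R n A^-1 p C
    & forall a : R, A^-1 < a ->
        ~ exists C : R, @exact_growth_inequality R n a p C].
Proof.
move=> Q A; split.
- exact: A_const_Gamma.
- exact: exact_growth.
- move=> a aA; have a0 : 0 < a.
    by apply: lt_trans aA; rewrite invr_gt0; exact: A_const_gt0.
  exact: (exact_growth_sharp hsigma hn hp a0 (erefl _) (erefl _) aA).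
Qed.
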